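(* Let $P$ be a rank-1 Hermitian projector-valued function on $\overline{\mathbb{C}}$, with components differentiable at least $N+2$ times, which is a solution of the Euler-Lagrange equations $[\partial_+\partial_-P,P]=0$ with finite action $S(P)<\infty$. Let $e\in\mathbb{C}^N$ be a constant unit vector with $Pe\neq 0$, and let $$H=\mathrm{span}\{(D_-^kP)e : k\ge 0\},\qquad H^\perp=\mathrm{span}\{(D_+^kP)e: k\ge 1\}.$$ Let $n+1$ be the dimension of $H$ and $m$ the dimension of $H^\perp$. Then the projectors $\Pi_-^kP$, $k\ge 0$, project into $H$ and the projectors $\Pi_+^kP$, $k\ge 1$, project into $H^\perp$. Furthermore, the images of $\Pi_-^kP$, $0\le k\le n$, form a basis for $H$, and the images of $\Pi_+^kP$, $1\le k\le m$, form a basis for $H^\perp$ (i.e. choosing a non-zero vector in each of these one-dimensional images gives a basis).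
   Context: Coordinates: $(\xi_1,\xi_2)\in\mathbb{R}^2$, $\xi_\pm=\xi_1\pm i\xi_2$, $\partial_\pm=\partial/\partial\xi_\pm=\frac12\left(\frac{\partial}{\partial \xi_1}\mp i\frac{\partial}{\partial\xi_2}\right)$. $\overline{\mathbb{C}}=\mathbb{C}\cup\{\infty\}$, with differentiability at $\infty$ meant in the coordinate $w_\pm=\xi_\pm^{-1}$. A rank-1 Hermitian projector (function) is an $N\times N$ complex matrix function $P$ of $(\xi_1,\xi_2)$ (not assumed holomorphic) with $P^2=P$, $P^\dagger=P$, $\mathrm{tr}(P)=1$ pointwise. The action is $S(P)=\int_{\mathbb{R}^2}\mathrm{tr}(\partial_+P\,\partial_-P)\,d\xi_1d\xi_2$. Solutions are real analytic by elliptic regularity, so iterated derivatives of all orders make sense. Sesquilinear product on $N\times N$ matrix functions (where $Pe\ne0$): $\langle X,Y\rangle=\dfrac{e^\dagger X^\dagger Y e}{e^\dagger P e}$. Covariant derivatives: $D_\pm X=\partial_\pm X-\langle P,\partial_\pm P\rangle X$; iterates $D_\pm^0X=X$, $D_\pm^kX=D_\pm(D_\pm^{k-1}X)$, always with the fixed $P$ and $e$. The notation $H^\perp$ does not presuppose that it is the orthogonal complement of $H$. The spaces are spans with scalar functions of $(\xi_+,\xi_-)$ as coefficients; dimensions and bases are generic ones, i.e. the dimensions are the maximal pointwise ranks and the assertions are understood at generic points (on a dense open set of points). Raising and lowering operators: for a Hermitian projector function $X$, $$\Pi_\pm(X)=\frac{\partial_\pm X\,X\,\partial_\mp X}{\mathrm{tr}(\partial_\pm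 X\,X\,\partial_\mp X)}\ \text{ if } \partial_\pm X\,X\,\partial_\mp X\neq 0,\qquad \Pi_\pm(X)=0\ \text{ if }\partial_\pm X\,X\,\partial_\mp X= 0,$$ where ''$=0$'' means identically zero as a matrix function, and in the first case the quotient is extended by continuity across the zeros of its denominator. Set $\Pi_\pm^0(X)=X$ and $\Pi_\pm^k(X)=\Pi_\pm(\Pi_\pm^{k-1}(X))$. *)

(* Defs.v *)
From HB Require Import structures.
From mathcomp Require Import all_boot all_order all_algebra.
From mathcomp Require Import spectral complex.
From mathcomp Require Import all_classical all_reals all_analysis.
Set Implicit Arguments.
Unset Strict Implicit.
Unset Printing Implicit Defensive.
Import Order.TTheory GRing.Theory Num.Theory.
Import numFieldNormedType.Exports.
Local Open Scope classical_set_scope.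
Local Open Scope ring_scope.
Local Open Scope complex_scope.
Local Open Scope sesquilinear_scope.

(* The point (x, y) of the plane stands for xi_+ = x + i y. *)
Definition plane (R : realType) : normedModType R := (R * R)%type.

Section Calculus.
Variable R : realType.
Local Notation C := R[i].

Fixpoint ndifferentiable (k : nat) (f : plane R -> R) : Prop :=
  if k is l.+1 then
    [/\ forall z : plane R, differentiable f z,
        ndifferentiable l ('D_((1, 0) : plane R) f) &
        ndifferentiable l ('D_((0, 1) : plane R) f)]
  else True.

Definition cderive (v : plane R) (f : plane R -> C) (z : plane R) : C :=
  'D_v (fun x => complex.Re (f x)) z +i* 'D_v (fun x => complex.Im (f x)) z.

(* A sign is encoded by the boolean exponent s of (-1) ^+ s: false is +,      *)
(* true is -.                                                                 *)
Definition wirtinger (s : bool) (f : plane R -> C) (z : plane R) : C :=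
  2^-1 * (cderive (1, 0) f z - (-1) ^+ s * 'i * cderive (0, 1) f z).

Definition clim (F : set_system (plane R)) (f : plane R -> C) : C :=
  lim (complex.Re (f x) @[x --> F]) +i* lim (complex.Im (f x) @[x --> F]).

(* The chart w_+ = xi_+^-1 at infinity, as a map from the w-plane.            *)
Definition chart_infty (w : plane R) : one_point_compactification (plane R) :=
  if w == 0 then None
  else let u := (w.1 +i* w.2)^-1 in Some (complex.Re u, complex.Im u).

End Calculus.

Notation sphere R := (one_point_compactification (plane R)).

Section MatrixFunctions.
Variables (R : realType) (N : nat).
Local Notation C := R[i].
Implicit Types (X Y P : plane R -> 'M[C]_N) (z : plane R).

Definition mxndifferentiable (k : nat) X : Prop :=
  forall i j, ndifferentiable k (fun z => complex.Re (X z i j)) /\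
              ndifferentiable k (fun z => complex.Im (X z i j)).

Definition sphere_ndifferentiable (k : nat) (P : sphere R -> 'M[C]_N) : Prop :=
  mxndifferentiable k (fun z => P (Some z)) /\
  mxndifferentiable k (fun w => P (chart_infty w)).

Definition rank1_projector (A : 'M[C]_N) : Prop :=
  [/\ A *m A = A, A ^t* = A & \tr A = 1].

Definition mxpartial (s : bool) X (z : plane R) : 'M[C]_N :=
  \matrix_(i, j) wirtinger s (fun x => X x i j) z.

Local Notation dp := (mxpartial false).
Local Notation dm := (mxpartial true).

Definition euler_lagrange P : Prop :=
  forall z, dp (dm P) z *m P z - P z *m dp (dm P) z = 0.

(* The trace is real and nonnegative when P is Hermitian-valued, whence the   *)
(* real part and the absence of an integrability condition.                   *)
Definition action P : \bar R :=
  (\int[lebesgue_measure \x lebesgue_measure]_z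
     (complex.Re (\tr (dp P z *m dm P z)))%:E)%E.

Definition bracket P (e : 'cV[C]_N) X Y z : C :=
  (e ^t* *m (X z) ^t* *m Y z *m e) 0 0 / (e ^t* *m P z *m e) 0 0.

Definition covder (s : bool) P (e : 'cV[C]_N) X z : 'M[C]_N :=
  mxpartial s X z - bracket P e P (mxpartial s P) z *: X z.

Definition ladder_num (s : bool) X z : 'M[C]_N :=
  mxpartial s X z *m X z *m mxpartial (~~ s) X z.

Definition ladder_quot (s : bool) X z : 'M[C]_N :=
  (\tr (ladder_num s X z))^-1 *: ladder_num s X z.

(* The zero test is for the whole matrix function; at a zero of the trace the *)
(* value is the limit of the quotient along the points where it is defined.   *)
Definition ladder (s : bool) X z : 'M[C]_N :=
  if `[< forall x, ladder_num s X x = 0 >] then 0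
  else if \tr (ladder_num s X z) != 0 then ladder_quot s X z
  else \matrix_(i, j)
    clim (within [set x | \tr (ladder_num s X x) != 0] (nbhs z))
         (fun x => ladder_quot s X x i j).

End MatrixFunctions.

Section Spans.
Variables (K : fieldType) (V : vectType K).

(* The subspace spanned by an infinite sequence of vectors, see span_seqP.    *)
Definition span_seq (v : nat -> V) : {vspace V} :=
  xget 0%VS
    [set U : {vspace V} | forall u : V, u \in U <-> exists k, u \in <<mkseq v k>>%VS].

Lemma span_seqP (v : nat -> V) (u : V) :
  u \in span_seq v <-> exists k, u \in <<mkseq v k>>%VS.
Proof.
rewrite /span_seq; case: xgetP => [U _ -> // | noU]; exfalso.
have mono k l : (k <= l)%N -> (<<mkseq v k>> <= <<mkseq v l>>)%VS.
  rewrite /mkseq => kl; apply: sub_span => x /mapP[j].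
  rewrite mem_iota /= add0n => jk ->.
  by apply: map_f; rewrite mem_iota /= add0n (leq_trans jk).
pose p d := `[< exists k, \dim <<mkseq v k>>%VS = d >].
have exp : exists d, p d by exists (\dim <<mkseq v 0>>%VS); apply/asboolP; exists 0%N.
have ubp d : p d -> (d <= \dim {:V})%N.
  by move=> /asboolP[k <-]; rewrite dimvS ?subvf.
case: (ex_maxnP exp ubp) => d /asboolP[k kd] dmax.
apply: (noU <<mkseq v k>>%VS) => w; split=> [wk|[l wl]]; first by exists k.
have /eqP -> : <<mkseq v k>>%VS == <<mkseq v (maxn k l)>>%VS.
  rewrite eqEdim mono ?leq_maxl //= kd.
  by apply: dmax; apply/asboolP; exists (maxn k l).
by apply: subvP wl; rewrite mono ?leq_maxr.
Qed.

(* The largest dimension of the subspaces W z over the z in D.                *)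
Definition generic_dim (T : Type) (D : set T) (W : T -> {vspace V}) : nat :=
  \max_(d < (\dim {:V}).+1 | `[< exists2 z, D z & \dim (W z) = d >]) d.

End Spans.

Section Lines.
Variables (R : realType) (N : nat).
Local Notation C := R[i].

(* The images of the matrices A k, for k in ks, are lines, and any choice of  *)
(* a nonzero vector in each of them is a basis of W.                          *)
Definition images_basis (W : {vspace 'cV[C]_N}) (A : nat -> 'M[C]_N)
    (ks : seq nat) : Prop :=
  (forall k, k \in ks -> \rank (A k) = 1%N) /\
  forall u : nat -> 'cV[C]_N,
    (forall k, k \in ks -> u k != 0 /\ exists v, u k = A k *m v) ->
    basis_of W [seq u k | k <- ks].

Definition projects_into (A : 'M[C]_N) (W : {vspace 'cV[C]_N}) : Prop :=
  forall v : 'cV[C]_N, A *m v \in W.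

Implicit Types (P : plane R -> 'M[C]_N) (e : 'cV[C]_N).

(* The set where the denominator of bracket does not vanish; P z *m e = 0     *)
(* makes covder meaningless at z.                                             *)
Definition nonvanishing P e : set (plane R) := [set z | P z *m e != 0].

Definition spaceH P e (z : plane R) : {vspace 'cV[C]_N} :=
  span_seq (fun k => iter k (covder true P e) P z *m e).

Definition spaceHperp P e (z : plane R) : {vspace 'cV[C]_N} :=
  span_seq (fun k => iter k.+1 (covder false P e) P z *m e).

End Lines.

(* Main.v *)
From HB Require Import structures.
Require Import Defs.
From mathcomp Require Import all_boot all_order all_algebra.
From mathcomp Require Import spectral complex.
From mathcomp Require Import all_classical all_reals all_analysis.
From mathcomp Require Import ring lra zify.
Import Order.TTheory GRing.Theory Num.Theory.
Import numFieldNormedType.Exports.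
Local Open Scope classical_set_scope.
Local Open Scope ring_scope.
Local Open Scope complex_scope.
Local Open Scope sesquilinear_scope.
Set Implicit Arguments.
Unset Strict Implicit.
Unset Printing Implicit Defensive.

(** The mechanism is the classical one behind the Din-Zakrzewski solutions of
    the sigma models: a harmonic map from the sphere to a projective
    space is isotropic, and the lines produced by the two ladders
    are an orthogonal frame in which the covariant derivatives of P e are
    triangular.

    Isotropy. Let X_0 = P and X_(k+1) = (d_s X_k) P, in each of the two
    directions s. The Euler-Lagrange equation makes d_(-s) lower the level
    (tower_lower), so that the traces of the products of the two opposite
    towers are, by induction on the level, holomorphic. In the coordinate at
    infinity each derivative carries a factor w^2, so these traces vanish at
    infinity, and by the Liouville theorem they vanish (tower_orthogonal).
    Hence P X_k = 0 for 0 < k <= N (tower_PX): this is where the sphere and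
    the number of derivatives of P enter.

    The potential. Near a suitable point the sum of the images of the X_k with k > 0
    has an orthogonal projector T with T P = 0 and d_s T = - (d_s P) P
    (local_potential). The matrix form with components -B and -B^t*, where
    B = (d_s P) P, is closed by the Euler-Lagrange equation, so the local T
    extends to a primitive on the whole plane, and unique continuation
    propagates its algebraic identities (global_potential). The record
    potential collects them; the complement 1 - T - P is a potential for the
    opposite direction (pot_dual). A potential makes T and T + P orthogonal
    projectors on holomorphic subbundles, whence P is smooth
    (smooth_projector).

    The ladder. The function B is covariantly holomorphic, so its zeros are
    isolated unless B = 0, and B is locally a power of the coordinate times a
    nonvanishing smooth matrix (pot_factor). The lowering or raising operator
    sends P to the orthogonal projector P_1 on the image of B, which is
    therefore smooth, and T - P_1 is a potential for P_1 (ladder_potential).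
    Since the rank of T drops, the ladder P_0, ..., P_r stops (ladder_chain).
    The P_k are mutually orthogonal.

    The spaces. The k-th covariant derivative of P e lies in the sum of the
    images of P_0, ..., P_k, and its component along P_k is obtained by
    applying the B of all levels to P e (y_partial, y_diag). So, where P e and
    all these B are nonzero, the images of the P_k are a basis of the span
    (covspan_basis), and these points are dense by unique continuation
    (pot_uc, pot_kill). The dimension of the span never exceeds the number of
    steps, so the generic dimension is the length of the ladder.

    The analysis rests on real variables and on finitely many derivatives:
    smoothness of harmonic functions from gradient estimates on squares
    (harmonic_nsm), and unique continuation from the maximum principle
    for u exp (M / |z|^(2p)) (log_subharmonic_uc), which applies to squared
    norms of solutions of first-order systems (system_uc). *)

(** * Differentiability classes on open subsets of the plane *)

Definition axis (R : realType) (b : bool) : plane R :=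
  if b then (0, 1) else (1, 0).

(** Locked, since unfolding limits makes unification diverge. *)
HB.lock Definition pd (R : realType) (b : bool) (f : plane R -> R) :
  plane R -> R := 'D_(axis R b) f.

Section RealCalculus.
Variable R : realType.
Implicit Types (f g : plane R -> R) (z h : plane R) (D : set (plane R)).

Lemma pdE b f : pd b f = 'D_(axis R b) f.
Proof. by rewrite pd.unlock. Qed.

Definition linform (a b : R) (h : plane R) : R := a * h.1 + b * h.2.

Lemma linform_is_linear a b : linear (linform a b).
Proof. by move=> k u v; rewrite /linform /= /GRing.scale /=; ring. Qed.

HB.instance Definition _ a b :=
  GRing.isLinear.Build R (plane R) R _ (linform a b) (@linform_is_linear a b).

Lemma linform_continuous a b : continuous (linform a b).
Proof.
move=> z; apply: cvgD; apply: cvgM; (try exact: cvg_cst).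
- exact: cvg_fst.
- exact: cvg_snd.
Qed.

Lemma differentiable_eps f z a b :
  (forall e : R, 0 < e -> \forall h \near (0 : plane R),
     `|f (h + z) - f z - linform a b h| <= e * `|h|) ->
  differentiable f z /\ forall c, pd c f z = if c then b else a.
Proof.
move=> fe.
have E : f \o shift z = cst (f z) + linform a b +o_ 0 id.
  apply/eqaddoP => e e0; near=> h.
  rewrite [X in `|X|](_ : _ = f (h + z) - f z - linform a b h); last first.
    by rewrite -[LHS]/(f (h + z) - (f z + linform a b h)); ring.
  by near: h; apply: fe.
have Ed := diff_unique (@linform_continuous a b) E.
have df : differentiable f z.
  apply/diff_locallyP; rewrite Ed; split => //.
  exact: linform_continuous.
split=> // c; rewrite pdE deriveE // Ed /= /linform /axis.
by case: c => /=; rewrite !(mulr0, mulr1, add0r, addr0).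
Unshelve. all: by end_near.
Qed.

Lemma differentiable_epsE f z : differentiable f z ->
  forall e : R, 0 < e -> \forall h \near (0 : plane R),
    `|f (h + z) - f z - linform (pd false f z) (pd true f z) h| <= e * `|h|.
Proof.
move=> df e e0; have /diff_locally := df.
have -> : 'd f z = linform (pd false f z) (pd true f z) :> (plane R -> R).
  apply/funext => h; rewrite !pdE /= !deriveE // /linform /axis.
  have {1}-> : h = h.1 *: ((1, 0) : plane R) + h.2 *: ((0, 1) : plane R).
    by case: h => x y; congr (_, _); rewrite /= /GRing.scale /=; ring.
  by rewrite linearD !linearZ /= /GRing.scale /=; ring.
move=> /eqaddoP /(_ e e0) H; near=> h.
rewrite [X in `|X|](_ : _ =
  (f \o shift z - (cst (f z) + linform (pd false f z) (pd true f z))) h).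
  by near: h; exact: H.
by rewrite -[RHS]/(f (h + z) - (f z + linform _ _ h)); ring.
Unshelve. all: by end_near.
Qed.

Lemma near_differentiable f g z : (\forall x \near z, f x = g x) ->
  differentiable f z -> differentiable g z.
Proof.
move=> fg df; apply: (proj1 (differentiable_eps (a := pd false f z)
  (b := pd true f z) _)) => e e0.
have := differentiable_epsE df e0; have fgz := nbhs_singleton fg.
move=> H; near=> h; rewrite -fgz.
have -> : g (h + z) = f (h + z).
  by apply/esym; near: h; move: fg; rewrite (near_shift 0 z) /= subr0.
by near: h.
Unshelve. all: by end_near.
Qed.

Lemma near_pd b f g z : (\forall x \near z, f x = g x) -> pd b f z = pd b g z.
Proof. by rewrite !pdE; exact: near_eq_derive. Qed.

Lemma pd_cst b (c : R) z : pd b (fun=> c) z = 0.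
Proof. by rewrite pdE; exact: derive_cst. Qed.

Lemma pdD b f g z : differentiable f z -> differentiable g z ->
  pd b (fun x => f x + g x) z = pd b f z + pd b g z.
Proof. by move=> df dg; rewrite !pdE -deriveD //; apply: diff_derivable. Qed.

Lemma pdN b f z : differentiable f z -> pd b (fun x => - f x) z = - pd b f z.
Proof. by move=> df; rewrite !pdE -deriveN //; apply: diff_derivable. Qed.

Lemma pdM b f g z : differentiable f z -> differentiable g z ->
  pd b (fun x => f x * g x) z = f z * pd b g z + g z * pd b f z.
Proof. by move=> df dg; rewrite !pdE -deriveM //; apply: diff_derivable. Qed.

Lemma pdV b f z : differentiable f z -> f z != 0 ->
  pd b (fun x => (f x)^-1) z = - (f z)^-1 * (f z)^-1 * pd b f z.
Proof.
move=> df f0; rewrite !pdE deriveV //; last exact: diff_derivable.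
by rewrite expr2 invfM mulNr.
Qed.

Fixpoint nsm D (k : nat) f : Prop :=
  if k is l.+1 then
    (forall z, D z -> differentiable f z) /\ forall b, nsm D l (pd b f)
  else True.

Lemma nsm_eq D k f g : open D -> (forall z, D z -> f z = g z) ->
  nsm D k f -> nsm D k g.
Proof.
move=> oD; elim: k f g => //= k IH f g fg [df pf].
have nfg z : D z -> \forall x \near z, f x = g x.
  by move=> Dz; apply: filterS (open_nbhs_nbhs (conj oD Dz)) => x /fg.
split=> [z Dz|b]; first exact: near_differentiable (nfg z Dz) (df z Dz).
by apply: IH (pf b) => z Dz; apply: near_pd; exact: nfg.
Qed.

Lemma nsm_sub D D' k f : D' `<=` D -> nsm D k f -> nsm D' k f.
Proof.
move=> sD; elim: k f => //= k IH f [df pf].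
by split=> [z /sD/df|b] //; apply: IH.
Qed.

Lemma nsmW D k f : nsm D k.+1 f -> nsm D k f.
Proof. by elim: k f => //= k IH f [df pf]; split=> // b; apply: IH. Qed.

Lemma nsm_le D j k f : (j <= k)%N -> nsm D k f -> nsm D j f.
Proof.
move=> /subnK <-; elim: (k - j)%N => [//|i IH H].
exact/IH/nsmW.
Qed.

Lemma nsm_cst D k (c : R) : nsm D k (fun=> c).
Proof.
elim: k c => //= k IH c; split=> [z _|b]; first exact: differentiable_cst.
suff -> : pd b (fun=> c) = fun=> 0 by apply: IH.
by apply/funext => z; exact: pd_cst.
Qed.

Lemma nsmD D k f g : open D -> nsm D k f -> nsm D k g ->
  nsm D k (fun x => f x + g x).
Proof.
move=> oD; elim: k f g => //= k IH f g [df pf] [dg pg].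
split=> [z Dz|b]; first exact: differentiableD (df z Dz) (dg z Dz).
apply: (nsm_eq (f := fun x => pd b f x + pd b g x)) => // [z Dz|].
  by rewrite pdD //; [exact: df|exact: dg].
exact: IH.
Qed.

Lemma nsmN D k f : open D -> nsm D k f -> nsm D k (fun x => - f x).
Proof.
move=> oD; elim: k f => //= k IH f [df pf].
split=> [z Dz|b]; first exact: differentiableN (df z Dz).
apply: (nsm_eq (f := fun x => - pd b f x)) => // [z Dz|]; last exact: IH.
by rewrite pdN //; exact: df.
Qed.

Lemma nsmB D k f g : open D -> nsm D k f -> nsm D k g ->
  nsm D k (fun x => f x - g x).
Proof. by move=> oD nf ng; apply: nsmD => //; apply: nsmN. Qed.

Lemma nsmM D k f g : open D -> nsm D k f -> nsm D k g ->
  nsm D k (fun x => f x * g x).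
Proof.
move=> oD; elim: k f g => //= k IH f g [df pf] [dg pg].
have nf : nsm D k f by apply: nsmW.
have ng : nsm D k g by apply: nsmW.
split=> [z Dz|b]; first exact: differentiableM (df z Dz) (dg z Dz).
apply: (nsm_eq (f := fun x => f x * pd b g x + g x * pd b f x)) => // [z Dz|].
  by rewrite pdM //; [exact: df|exact: dg].
by apply: nsmD => //; apply: IH.
Qed.

Lemma nsmV D k f : open D -> (forall z, D z -> f z != 0) -> nsm D k f ->
  nsm D k (fun x => (f x)^-1).
Proof.
move=> oD f0; elim: k => //= k IH [df pf].
have ni := IH (nsmW (conj df pf : nsm D k.+1 f)).
split=> [z Dz|b]; first by apply: differentiableV; [exact: df|exact: f0].
apply: (nsm_eq (f := fun x => - ((f x)^-1 * (f x)^-1 * pd b f x))) => //.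
  by move=> z Dz; rewrite pdV ?mulNr //; [exact: df|exact: f0].
by apply: nsmN => //; apply: nsmM => //; apply: nsmM.
Qed.

Lemma nsm_continuous D k f z : nsm D k.+1 f -> D z -> {for z, continuous f}.
Proof. by case=> df _ /df /differentiable_continuous. Qed.

Lemma nsm_diff D k f z : nsm D k.+1 f -> D z -> differentiable f z.
Proof. by case=> df _ /df. Qed.

Lemma nsm_pd D k f b : nsm D k.+1 f -> nsm D k (pd b f).
Proof. by move=> [_ /(_ b)]. Qed.

Lemma ndifferentiableE k f : ndifferentiable k f <-> nsm setT k f.
Proof.
elim: k f => //= k IH f; rewrite -[(1, 0)]/(axis R false) -[(0, 1)]/(axis R true) -!pdE.
split=> [[df0 /IH pf /IH qf]|[df0 pf]].
  by split=> [z _|[]].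
by split=> [z||]; [exact: df0|exact/IH/(pf false)|exact/IH/(pf true)].
Qed.
End RealCalculus.

(** * Mean values over squares *)

Section MeanValue.
Variable R : realType.
Implicit Types (f g : plane R -> R) (z w h : plane R) (D K : set (plane R)).

Lemma is_derive_line f (v z : plane R) (t : R) : derivable f (t *: v + z) v ->
  is_derive t 1 (fun s : R => f (s *: v + z)) ('D_v f (t *: v + z)).
Proof.
move=> df; have E : (fun h : R => h^-1 *: (f ((h *: 1 + t) *: v + z) - f (t *: v + z)))
    = (fun h : R => h^-1 *: (f (h *: v + (t *: v + z)) - f (t *: v + z))).
  apply/funext => h; rewrite addrA -scalerDl.
  by rewrite (_ : h *: 1 = h) // /GRing.scale /= mulr1.
split; last by rewrite /derive /= E.
by move: df; rewrite /derivable /= E.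
Qed.

(** The sign of t is arbitrary, which is why the point is parametrized by th. *)
Lemma mvt_axis b f z (t : R) :
  (forall th : R, 0 <= th <= 1 -> differentiable f ((th * t) *: axis R b + z)) ->
  exists2 th : R, 0 < th < 1 &
    f (t *: axis R b + z) - f z = t * pd b f ((th * t) *: axis R b + z).
Proof.
move=> df; pose g (th : R) := f ((th * t) *: axis R b + z).
have dg (th : R) : 0 <= th <= 1 ->
    is_derive th (1 : R) g (t * pd b f ((th * t) *: axis R b + z)).
  move=> th01; have /= := @is_derive_line f (t *: axis R b) z th.
  rewrite scalerA => /(_ (diff_derivable (df _ th01))) H.
  rewrite /g; apply: is_derive_eq.
    by under eq_fun do rewrite -scalerA; exact: H.
  by rewrite !pdE !(deriveE _ (df _ th01)) linearZ.
have [//|||th] := @MVT R g (fun th => t * pd b f ((th * t) *: axis R b + z)) 0 1.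
- by move=> x; rewrite in_itv /= => /andP[x0 x1]; apply: dg; rewrite !ltW.
- apply: derivable_within_continuous => x; rewrite in_itv /= => x01.
  by have [] := dg x x01.
rewrite in_itv /= => th01; rewrite /g mul1r mul0r scale0r add0r subr0 mulr1 => E.
by exists th.
Qed.

Definition sq z (r : R) : set (plane R) :=
  [set w | `|w.1 - z.1| < r /\ `|w.2 - z.2| < r].

Definition csq z (r : R) : set (plane R) :=
  [set w | `|w.1 - z.1| <= r /\ `|w.2 - z.2| <= r].

Lemma sqE z r : sq z r = ball z r.
Proof.
apply/seteqP; split=> w /=; rewrite /sq /ball /= /prod_ball /ball /=.
  by rewrite ![`|_ - w.1|]distrC ![`|_ - w.2|]distrC.
by rewrite ![`|z.1 - _|]distrC ![`|z.2 - _|]distrC.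
Qed.

Lemma sq_open z r : open (sq z r).
Proof.
rewrite sqE; have [r0|r0] := ltP 0 r; first exact: ball_open.
rewrite (_ : ball z r = set0); first exact: open0.
apply/seteqP; split=> // w; rewrite -sqE => -[/(le_lt_trans (normr_ge0 _))].
by rewrite ltNge r0.
Qed.

Lemma sq_center z r : 0 < r -> sq z r z.
Proof. by move=> r0; split; rewrite subrr normr0. Qed.

Lemma nbhs_sqP z D : nbhs z D <-> exists2 r : R, 0 < r & sq z r `<=` D.
Proof.
by split=> [/nbhs_ballP[r /= r0 H]|[r r0 H]]; [|apply/nbhs_ballP]; exists r;
  rewrite ?sqE // -sqE.
Qed.

Lemma open_sqP D z : open D -> D z -> exists2 r : R, 0 < r & sq z r `<=` D.
Proof. by move=> oD Dz; apply/nbhs_sqP; apply: open_nbhs_nbhs. Qed.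

Lemma sq_csq z r s : r < s -> csq z r `<=` sq z s.
Proof. by move=> rs w [? ?]; split; apply: le_lt_trans rs. Qed.

Lemma csq_sq z r : sq z r `<=` csq z r.
Proof. by move=> w [? ?]; split; apply: ltW. Qed.

Lemma sq_sub z r s : r <= s -> sq z r `<=` sq z s.
Proof. by move=> rs w [? ?]; split; apply: lt_le_trans rs. Qed.

Lemma csq_compact z r : compact (csq z r).
Proof.
have -> : csq z r = `[z.1 - r, z.1 + r] `*` `[z.2 - r, z.2 + r].
  apply/seteqP; split=> [w [w1 w2]|w [/= w1 w2]].
    by split=> /=; rewrite in_itv /= -ler_distl.
  by split; move: w1 w2; rewrite !in_itv /= -!ler_distl.
by apply: compact_setX; apply: segment_compact.
Qed.

Lemma norm_planeE h : `|h| = Num.max `|h.1| `|h.2|.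
Proof. by []. Qed.

Lemma norm_plane_le h e : (`|h| <= e) = (`|h.1| <= e) && (`|h.2| <= e).
Proof. by rewrite norm_planeE ge_max. Qed.

Lemma norm_fst_le h : `|h.1| <= `|h|.
Proof. by rewrite norm_planeE le_max lexx. Qed.

Lemma norm_snd_le h : `|h.2| <= `|h|.
Proof. by rewrite norm_planeE le_max lexx orbT. Qed.

Lemma norm_axis b (t : R) : `|t *: axis R b| = `|t|.
Proof.
rewrite norm_planeE /axis; case: b; rewrite /= /GRing.scale /= ?mulr1 ?mulr0 normr0.
  by apply/max_idPr.
by apply/max_idPl.
Qed.

Lemma lipschitz_sq f z r (C : R) :
  (forall w, sq z r w -> differentiable f w) ->
  (forall b w, sq z r w -> `|pd b f w| <= C) ->
  forall v w, sq z r v -> sq z r w ->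
    `|f v - f w| <= C * (`|v.1 - w.1| + `|v.2 - w.2|).
Proof.
move=> df bf v w [v1 v2] [w1 w2].
have conv (a c d : R) (th : R) : 0 <= th <= 1 -> `|a - c| < r -> `|d - c| < r ->
    `|th * (a - d) + d - c| < r.
  move=> /andP[t0 t1] ar dr; pose M := Num.max `|a - c| `|d - c|.
  have aM : `|a - c| <= M by rewrite le_max lexx.
  have dM : `|d - c| <= M by rewrite le_max lexx orbT.
  apply: (@le_lt_trans _ _ M); last by rewrite gt_max ar dr.
  move: aM dM; rewrite !ler_norml => /andP[a1 a2] /andP[d1 d2].
  by apply/andP; split; nra.
pose u : plane R := (v.1, w.2).
have Eu : u = (v.1 - w.1) *: axis R false + w.
  case: (w) @u => w1' w2' /=; congr (_, _); rewrite /= /GRing.scale /=; ring.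
have Ev : v = (v.2 - w.2) *: axis R true + u.
  by rewrite /u; case: (v) => v1' v2'; congr (_, _); rewrite /= /GRing.scale /=; ring.
have [th /andP[/ltW t0 /ltW t1]] :
    exists2 th, 0 < th < 1 & f u - f w =
      (v.1 - w.1) * pd false f ((th * (v.1 - w.1)) *: axis R false + w).
  rewrite [in f u]Eu; apply: mvt_axis => th th01; apply: df; split=> /=.
    by rewrite /GRing.scale /= mulr1; apply: conv.
  by rewrite /GRing.scale /= mulr0 add0r.
have [et /andP[/ltW e0 /ltW e1]] :
    exists2 th, 0 < th < 1 & f v - f u =
      (v.2 - w.2) * pd true f ((th * (v.2 - w.2)) *: axis R true + u).
  rewrite [in f v]Ev; apply: mvt_axis => et et01; apply: df; split=> /=.
    by rewrite /GRing.scale /= mulr0 add0r.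
  by rewrite /GRing.scale /= mulr1; apply: conv.
move=> Efv Efu.
have A : `|f u - f w| <= C * `|v.1 - w.1|.
  rewrite Efu normrM mulrC; apply: ler_wpM2r => //; apply: bf.
  by split=> /=; rewrite /GRing.scale /= ?mulr1 ?mulr0 ?add0r //; apply: conv;
    rewrite ?t0.
have B : `|f v - f u| <= C * `|v.2 - w.2|.
  rewrite Efv normrM mulrC; apply: ler_wpM2r => //; apply: bf.
  by split=> /=; rewrite /GRing.scale /= ?mulr1 ?mulr0 ?add0r //; apply: conv;
    rewrite ?e0.
rewrite (_ : f v - f w = (f v - f u) + (f u - f w)); last by ring.
by rewrite mulrDr addrC; apply: le_trans (ler_normD _ _) _; apply: lerD.
Qed.

Lemma gradient0_sq f z r : (forall w, sq z r w -> differentiable f w) ->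
  (forall b w, sq z r w -> pd b f w = 0) ->
  forall v w, sq z r v -> sq z r w -> f v = f w.
Proof.
move=> df pf v w zv zw; apply/subr0_eq/eqP; rewrite -normr_le0.
apply: le_trans (lipschitz_sq df (C := 0) _ zv zw) _; last by rewrite mul0r.
by move=> b x zx; rewrite pf // normr0.
Qed.

End MeanValue.

(** * Second derivatives and the maximum principle *)

Section SecondOrder.
Variable R : realType.
Implicit Types (f g : plane R -> R) (z w h : plane R) (D K : set (plane R)).

Lemma nsm_on_line D b f z : open D -> D z -> nsm D 1 f ->
  exists2 r : R, 0 < r &
    (forall t : R, `|t| < r -> D (t *: axis R b + z)) /\
    forall h, `|h| < r -> D (h + z).
Proof.
move=> oD Dz nf; have [r r0 rD] := open_sqP oD Dz; exists r => //.
have H h : `|h| < r -> D (h + z).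
  move=> hr; apply: rD; split; rewrite /= addrK.
    exact: le_lt_trans (norm_fst_le _) hr.
  exact: le_lt_trans (norm_snd_le _) hr.
by split=> // t tr; apply: H; rewrite norm_axis.
Qed.

Lemma linform_axis (x y t : R) b :
  linform x y (t *: axis R b) = t * if b then y else x.
Proof. by case: b; rewrite /linform /axis /= /GRing.scale /=; ring. Qed.

Lemma differentiable_shift f v z :
  differentiable f (z + v) -> differentiable (fun x => f (x + v)) z.
Proof.
move=> df; apply: (proj1 (differentiable_eps (a := pd false f (z + v))
  (b := pd true f (z + v)) _)) => e e0.
have := differentiable_epsE df e0; apply: filterS => h.
by rewrite addrA.
Qed.

Lemma pd_shift b f v z : pd b (fun x => f (x + v)) z = pd b f (z + v).
Proof.
by rewrite !pdE /derive /=; under eq_fun do rewrite -addrA.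
Qed.

Lemma nsm_shift D k f v :
  nsm D k f -> nsm [set x | D (x + v)] k (fun x => f (x + v)).
Proof.
elim: k f => //= k IH f [df pf]; split=> [z Dz|b].
  by apply: differentiable_shift; apply: df.
have -> : pd b (fun x => f (x + v)) = fun x => pd b f (x + v).
  by apply/funext => z; rewrite pd_shift.
exact: IH.
Qed.

(** The mean value theorem in one direction, then differentiability of the
    first derivative in the other. The second difference is symmetric in the
    two directions. *)
Lemma mixed_difference D b f z : open D -> D z -> nsm D 2 f ->
  forall e : R, 0 < e -> \forall t \near (0:R)^'+,
   `|f (t *: axis R b + (t *: axis R (~~ b) + z)) - f (t *: axis R b + z)
     - f (t *: axis R (~~ b) + z) + f z - t * t * pd (~~ b) (pd b f) z|
    <= e * (t * t).
Proof.
move=> oD Dz nf e e0; have [r r0 [_ rD]] := nsm_on_line b oD Dz (nsmW nf).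
have dp : differentiable (pd b f) z by case: nf => _ /(_ b) [/(_ _ Dz)].
have e2 : 0 < e / 2 by rewrite divr_gt0.
have := differentiable_epsE dp e2.
move=> /nbhs_sqP [s s0 sH].
near=> t; have t0 : 0 < t by near: t; exact: nbhs_right_gt.
have tr : t < r by near: t; exact: nbhs_right_lt.
have ts : t < s by near: t; exact: nbhs_right_lt.
pose a := axis R b; pose a' := axis R (~~ b).
have aD (x y : R) : 0 <= x <= t -> 0 <= y <= t ->
    `|x *: a + y *: a'| <= t.
  move=> /andP[x0 xt] /andP[y0 yt]; rewrite norm_plane_le /a /a' /axis.
  by case: (b) => /=; rewrite /GRing.scale /= !(mulr0, mulr1, addr0, add0r) !ger0_norm ?xt ?yt.
have tt : 0 <= t <= t by rewrite lexx ltW.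
have t00 : 0 <= (0 : R) <= t by rewrite lexx ltW.
have dfz (x y : R) : 0 <= x <= t -> 0 <= y <= t ->
    differentiable f (x *: a + y *: a' + z).
  move=> xt yt; case: nf => df _; apply/df/rD.
  exact: le_lt_trans (aD _ _ xt yt) tr.
pose g x := f (x + t *: a') - f x.
have dg (th : R) : 0 <= th <= 1 -> differentiable g ((th * t) *: a + z) /\
    pd b g ((th * t) *: a + z) =
      pd b f ((th * t) *: a + z + t *: a') - pd b f ((th * t) *: a + z).
  move=> /andP[th0 th1].
  have tht : 0 <= th * t <= t by apply/andP; split; nra.
  have df1 : differentiable f ((th * t) *: a + z).
    by have := dfz _ _ tht t00; rewrite scale0r addr0.
  have df2 : differentiable (fun x => f (x + t *: a')) ((th * t) *: a + z).
    by apply: differentiable_shift; rewrite addrAC; apply: dfz.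
  split; first exact: differentiableB df2 df1.
  rewrite -[in RHS]pd_shift -(pdN b df1); apply: pdD => //.
  exact: differentiableN.
have [th /andP[/ltW th0 /ltW th1] E] :=
  mvt_axis (fun th (H : 0 <= th <= 1) => (dg th H).1).
have tht : 0 <= th * t <= t by apply/andP; split; nra.
have th01 : 0 <= th <= 1 by rewrite th0.
move: E; rewrite (dg th th01).2 /g; set w := (th * t) *: a + z => E.
have SH k : `|k| <= t -> `|pd b f (k + z) - pd b f z -
    linform (pd false (pd b f) z) (pd true (pd b f) z) k| <= e / 2 * t.
  move=> kt; apply: le_trans (sH k _) _.
    by split; rewrite subr0; [apply: le_lt_trans (norm_fst_le _) _|
       apply: le_lt_trans (norm_snd_le _) _]; apply: le_lt_trans kt _.
  by apply: ler_wpM2l => //; apply: ltW.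
have n1 : `|t *: a' + (th * t) *: a| <= t by rewrite addrC; exact: aD.
have n2 : `|(th * t) *: a| <= t.
  by rewrite -[_ *: a]addr0 -(scale0r a'); exact: aD.
have B2 := SH _ n2; rewrite -/w in B2.
have Ew : t *: a' + (th * t) *: a + z = w + t *: a' by rewrite -addrA addrC.
have B1 := SH _ n1; rewrite Ew in B1.
have L : linform (pd false (pd b f) z) (pd true (pd b f) z) (t *: a' + (th * t) *: a)
   - linform (pd false (pd b f) z) (pd true (pd b f) z) ((th * t) *: a) =
   t * pd (~~ b) (pd b f) z.
  rewrite linearD /= addrK linform_axis.
  by case: (b).
have -> : f (t *: a + (t *: a' + z)) - f (t *: a + z) - f (t *: a' + z) + f z =
    t * (pd b f (w + t *: a') - pd b f w).
  rewrite -E (_ : t *: a + z + t *: a' = t *: a + (t *: a' + z)).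
    by rewrite [z + _]addrC; ring.
  by rewrite -addrA [z + _]addrC.
rewrite -mulrA -mulrBr normrM gtr0_norm // mulrCA ler_pM2l // -L.
rewrite [X in `|X|](_ : _ = 
  (pd b f (w + t *: a') - pd b f z -
   linform (pd false (pd b f) z) (pd true (pd b f) z) (t *: a' + (th * t) *: a))
  - (pd b f w - pd b f z -
   linform (pd false (pd b f) z) (pd true (pd b f) z) ((th * t) *: a))); last by ring.
apply: le_trans (ler_normB _ _) _.
by rewrite [e in leRHS]splitr mulrDl; apply: lerD.
Unshelve. all: by end_near.
Qed.

(** Both mixed derivatives are the limit of the same symmetric second
    difference. *)
Lemma pdC D f z b : open D -> D z -> nsm D 2 f ->
  pd b (pd (~~ b) f) z = pd (~~ b) (pd b f) z.
Proof.
move=> oD Dz nf; apply/subr0_eq/eqP; rewrite -normr_le0.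
apply/ler_addgt0Pr => e e0; rewrite add0r.
have e2 : 0 < e / 2 by rewrite divr_gt0.
have := mixed_difference b oD Dz nf e2.
have := mixed_difference (~~ b) oD Dz nf e2; rewrite negbK => H1 H2.
have H3 : \forall t \near (0:R)^'+, 0 < t by exact: nbhs_right_gt.
have [t [[A1 A2] t0]] := filter_ex (filterI (filterI H1 H2) H3).
have tt0 : 0 < t * t by rewrite mulr_gt0.
move: A1 A2; rewrite [t *: axis R (~~ b) + (_ + z)]addrCA.
move: (f (t *: axis R b + (t *: axis R (~~ b) + z))) (f (t *: axis R b + z))
  (f (t *: axis R (~~ b) + z)) (f z) (pd b (pd (~~ b) f) z)
  (pd (~~ b) (pd b f) z) => A B C F X Y A1 A2.
rewrite -(ler_pM2l tt0) -[X in X * _](gtr0_norm tt0) -normrM.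
rewrite [X in `|X|](_ : _ = (A - B - C + F - t * t * Y) -
  (A - C - B + F - t * t * X)); last by ring.
apply: le_trans (ler_normB _ _) _.
rewrite (_ : t * t * e = e / 2 * (t * t) + e / 2 * (t * t)); last by field.
exact: lerD.
Unshelve. all: by end_near.
Qed.

(** The second-derivative test on the two coordinate lines; it feeds the
    maximum principle below. *)
Lemma local_max_pd D f z b : open D -> D z -> nsm D 2 f ->
  (forall w, D w -> f w <= f z) -> pd b f z = 0 /\ pd b (pd b f) z <= 0.
Proof.
move=> oD Dz nf fz; have [r r0 [rD _]] := nsm_on_line b oD Dz (nsmW nf).
pose g (t : R) := f (t *: axis R b + z).
have dg (t : R) : t \in `]-r, r[ -> is_derive t (1 : R) g (pd b f (t *: axis R b + z)).
  rewrite in_itv /= => tr; rewrite pdE; apply: is_derive_line; apply: diff_derivable.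
  by case: nf => df _; apply/df/rD; rewrite ltr_norml.
have z0 : (0 : R) \in `]-r, r[ by rewrite in_itv /= oppr_lt0 r0.
have Ez : 0 *: axis R b + z = z by rewrite scale0r add0r.
have p0 : pd b f z = 0.
  have [_ <-] : is_derive (0 : R) (1 : R) g 0; last first.
    by have [_ ->] := dg 0 z0; rewrite Ez.
  apply: (@derive1_at_max R g (-r) r 0) => //; first by lra.
  - by move=> t tr; have [] := dg t tr.
  - move=> t; rewrite in_itv /= => tr; rewrite /g Ez; apply/fz/rD.
    by rewrite ltr_norml.
split=> //; rewrite leNgt; apply/negP; set c := pd b (pd b f) z => c0.
have dp : differentiable (pd b f) z by case: nf => _ /(_ b) [/(_ _ Dz)].
have c2 : 0 < c / 2 by rewrite divr_gt0.
have := differentiable_epsE dp c2.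
move=> /nbhs_sqP [s s0 sH].
pose t := Num.min r s / 2.
have m0 : 0 < Num.min r s by rewrite lt_min r0.
have t0 : 0 < t by rewrite divr_gt0.
have tm : t < Num.min r s by rewrite /t; lra.
have [tr ts] : t < r /\ t < s by move: tm; rewrite lt_min => /andP.
have [|th /andP[th0 th1] E] := @mvt_axis R b f z t.
  move=> th /andP[h0 h1]; case: nf => df _; apply/df/rD.
  by rewrite normrM ger0_norm // gtr0_norm // (le_lt_trans _ tr) // ler_piMl // ltW.
have tp : 0 < th * t by rewrite mulr_gt0.
have := sH ((th * t) *: axis R b) _; rewrite p0 subr0 norm_axis (gtr0_norm tp) => {}sH.
have : f (t *: axis R b + z) <= f z by apply/fz/rD; rewrite gtr0_norm.
apply/negP; rewrite -ltNge -subr_gt0 E mulr_gt0 //.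
have lt1 : th * t < s by apply: le_lt_trans ts; rewrite ler_piMl // ltW.
have {}sH := sH _.
have Q : `|pd b f (th * t *: axis R b + z) - th * t * c| <= c / 2 * (th * t).
  rewrite (_ : th * t * c = linform (pd false (pd b f) z) (pd true (pd b f) z)
      ((th * t) *: axis R b)); first apply: sH.
    split; rewrite subr0; [apply: le_lt_trans (norm_fst_le _) _|
       apply: le_lt_trans (norm_snd_le _) _]; by rewrite norm_axis gtr0_norm.
  by rewrite linform_axis /c; case: (b).
move: Q; rewrite ler_norml => /andP[Q _].
have tc : 0 < th * t * c by rewrite mulr_gt0.
by lra.
Qed.

Definition lap f : plane R -> R :=
  fun z => pd false (pd false f) z + pd true (pd true f) z.

(** A maximum outside B would contradict local_max_pd. The positivity of the
    Laplacian is asked only at critical points, which is what the weighted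
    functions of the unique continuation argument offer. *)
Lemma max_principle K (B : set (plane R)) f : K !=set0 -> compact K ->
  (forall z, K z -> {for z, continuous f}) ->
  (forall z, K z -> ~ B z -> (forall w, K w -> f w <= f z) ->
     exists D, [/\ open D, D z, D `<=` K, nsm D 2 f &
       (forall b, pd b f z = 0) -> 0 < lap f z]) ->
  exists z, [/\ K z, B z & forall w, K w -> f w <= f z].
Proof.
move=> K0 cK cf H.
have [|c /set_mem Kc cmax] := compact_EVT_max K0 cK (f := f).
  apply/continuous_in_subspaceT => z /set_mem; exact: cf.
have {}cmax w : K w -> f w <= f c by move=> Kw; apply: cmax; rewrite inE.
have [Bc|nBc] := pselect (B c); first by exists c.
have [D [oD Dc DK nf pos]] := H c Kc nBc cmax.
have M b := local_max_pd b oD Dc nf (fun w Dw => cmax w (DK w Dw)).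
have := pos (fun b => (M b).1); rewrite /lap ltNge => /negP; case.
by rewrite -(addr0 0); apply: lerD; [exact: (M false).2|exact: (M true).2].
Qed.

End SecondOrder.

(** * Harmonic functions and the Liouville theorem *)

Section Harmonic.
Variable R : realType.
Implicit Types (f g u : plane R -> R) (z w h : plane R) (D K O : set (plane R)).

Definition coord (b : bool) (w : plane R) : R := if b then w.2 else w.1.

Lemma coordD b v w : coord b (v + w) = coord b v + coord b w.
Proof. by case: b. Qed.

Lemma coord_axis b c (t : R) : coord b (t *: axis R c) = t * (b == c)%:R.
Proof. by case: b; case: c => /=; rewrite /GRing.scale /= ?mulr1 ?mulr0. Qed.

Lemma coord_le b h : `|coord b h| <= `|h|.
Proof. by case: b; [exact: norm_snd_le|exact: norm_fst_le]. Qed.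

Lemma coord_diff b z : differentiable (coord b) z /\
  forall c, pd c (coord b) z = (c == b)%:R.
Proof.
have [|df dp] := @differentiable_eps R (coord b) z (b == false)%:R (b == true)%:R.
  move=> e e0; near=> h; rewrite coordD /linform; case: b => /=;
  by rewrite ?(mul0r, mul1r) addrK ?(add0r, addr0) subrr normr0 mulr_ge0 // ltW.
by split=> // c; rewrite dp; case: (b); case: c.
Unshelve. all: by end_near.
Qed.

Lemma nsm_coord D k b : open D -> nsm D k (coord b).
Proof.
move=> oD; case: k => //= k; split=> [z _|c]; first exact: (coord_diff b z).1.
apply: (nsm_eq (f := fun=> (c == b)%:R)) => // [z Dz|]; last exact: nsm_cst.
by rewrite (coord_diff b z).2.
Qed.

Lemma pd2D D f g z b c : open D -> D z -> nsm D 2 f -> nsm D 2 g ->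
  pd b (pd c (fun x => f x + g x)) z = pd b (pd c f) z + pd b (pd c g) z.
Proof.
move=> oD Dz [df pf] [dg pg].
rewrite (near_pd b (g := fun x => pd c f x + pd c g x)); last first.
  by apply: filterS (open_nbhs_nbhs (conj oD Dz)) => x Dx; rewrite pdD //;
    [exact: df|exact: dg].
by rewrite pdD //; [have [H _] := pf c|have [H _] := pg c]; apply: H.
Qed.

Lemma pd2N D f z b c : open D -> D z -> nsm D 2 f ->
  pd b (pd c (fun x => - f x)) z = - pd b (pd c f) z.
Proof.
move=> oD Dz [df pf].
rewrite (near_pd b (g := fun x => - pd c f x)); last first.
  by apply: filterS (open_nbhs_nbhs (conj oD Dz)) => x Dx; rewrite pdN //; exact: df.
by rewrite pdN //; have [H _] := pf c; apply: H.
Qed.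

Lemma lapD D f g z : open D -> D z -> nsm D 2 f -> nsm D 2 g ->
  lap (fun x => f x + g x) z = lap f z + lap g z.
Proof.
move=> oD Dz nf ng; rewrite /lap (pd2D false false oD Dz nf ng).
by rewrite (pd2D true true oD Dz nf ng) addrACA.
Qed.

Lemma lapN D f z : open D -> D z -> nsm D 2 f -> lap (fun x => - f x) z = - lap f z.
Proof. move=> oD Dz nf; rewrite /lap (pd2N false false oD Dz nf).
by rewrite (pd2N true true oD Dz nf) opprD. Qed.

Lemma lapB D f g z : open D -> D z -> nsm D 2 f -> nsm D 2 g ->
  lap (fun x => f x - g x) z = lap f z - lap g z.
Proof.
by move=> oD Dz nf ng; rewrite (lapD (g := fun x => - g x) oD Dz) //
  ?(lapN oD Dz) //; exact: nsmN.
Qed.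

Definition quad (b : bool) (p q a : R) : plane R -> R :=
  fun w => p * ((coord b w - a) * (coord b w - a)) + q * (coord b w - a).

Lemma nsm_quad D k b p q a : open D -> nsm D k (quad b p q a).
Proof.
move=> oD; have nc := nsm_coord k b oD.
have nb : nsm D k (fun w => coord b w - a) by apply: nsmB => //; exact: nsm_cst.
by apply: nsmD => //; apply: nsmM => //; [exact: nsm_cst|exact: nsmM|exact: nsm_cst].
Qed.

Lemma pd_quad b p q a c z :
  pd c (quad b p q a) z = (c == b)%:R * (2 * p * (coord b z - a) + q).
Proof.
have oT : open [set: plane R] by exact: openT.
have [dc pc] := coord_diff b z.
have db : differentiable (fun w => coord b w - a) z.
  exact: differentiableB dc (differentiable_cst _ _).
have pb : pd c (fun w => coord b w - a) z = (c == b)%:R.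
  by rewrite (pdD c (g := fun=> - a)) // pd_cst addr0 pc.
have dbb := differentiableM db db.
rewrite /quad pdD; first last.
- by apply: differentiableM => //; exact: differentiable_cst.
- by apply: differentiableM => //; exact: differentiable_cst.
rewrite !pdM // ?pb ?pd_cst; try exact: differentiable_cst.
by ring.
Qed.

Lemma lap_quad b p q a z : lap (quad b p q a) z = 2 * p.
Proof.
have oT : open [set: plane R] by exact: openT.
have E c d : pd d (pd c (quad b p q a)) z = (c == b)%:R * (d == b)%:R * (2 * p).
  have -> : pd c (quad b p q a) =
     quad b 0 ((c == b)%:R * (2 * p)) a \+ (fun=> (c == b)%:R * q).
    by apply/funext => w; rewrite pd_quad /quad /=; ring.
  rewrite pdD ?pd_quad ?pd_cst; first by ring.
    by apply: (nsm_diff (D := setT) (k := 0)) => //; exact: nsm_quad.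
  exact: differentiable_cst.
by rewrite /lap !E; case: (b) => /=; ring.
Qed.

(** Adding a small quadratic term makes the Laplacian strictly positive, which
    excludes interior maxima. *)
Lemma subharmonic_le K O u z r (M : R) : compact K -> open O -> O `<=` K ->
  K `<=` csq z r -> (forall w, K w -> {for w, continuous u}) -> nsm O 2 u ->
  (forall w, O w -> 0 <= lap u w) ->
  (forall w, K w -> ~ O w -> u w <= M) -> forall w, K w -> u w <= M.
Proof.
move=> cK oO OK Kr cu nu lu uM w Kw; apply/ler_addgt0Pr => e e0.
pose p := e / (r * r + 1).
have r1 : 0 < r * r + 1 by rewrite ltr_wpDl // -expr2 sqr_ge0.
have p0 : 0 < p by rewrite divr_gt0.
pose q := quad false p 0 z.1.
have q0 v : 0 <= q v.
  by rewrite /q /quad mul0r addr0; apply: mulr_ge0; [exact: ltW|rewrite -expr2 sqr_ge0].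
have qe v : K v -> q v <= e.
  move=> /Kr [v1 _]; rewrite /q /quad mul0r addr0 /= -expr2 -real_normK ?num_real //.
  rewrite -[leRHS](divfK (lt0r_neq0 r1)) -/p; apply: ler_wpM2l; first exact: ltW.
  have := normr_ge0 (v.1 - z.1); move: (`|v.1 - z.1|) v1 => n nr n0.
  by rewrite expr2; nra.
have [|//|v Kv|v Kv nOv _|v [Kv nOv vmax]] := @max_principle R K (~` O) (u \+ q).
- by exists w.
- apply: cvgD; first exact: cu.
  apply: differentiable_continuous; apply: (nsm_diff (D := setT) (k := 0)) => //.
  by apply: nsm_quad; exact: openT.
- have {}nOv : O v by apply: contrapT.
  exists O; split=> //; first by apply: nsmD => //; exact: nsm_quad.
  move=> _; rewrite (lapD oO nOv nu); last exact: nsm_quad.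
  by rewrite lap_quad ltr_wpDl ?lu // mulr_gt0.
apply: (@le_trans _ _ (u w + q w)); first by rewrite lerDl.
by apply: le_trans (vmax w Kw) _; apply: lerD; [exact: uM|exact: qe].
Qed.

(** The maximum principle on large squares, for u and - u. *)
Lemma harmonic_Liouville u : nsm setT 2 u -> (forall w, lap u w = 0) ->
  (forall e : R, 0 < e -> exists r : R, forall w, ~ sq 0 r w -> `|u w| <= e) ->
  forall w, u w = 0.
Proof.
move=> nu lu inf w; apply/eqP; rewrite -normr_le0; apply/ler_addgt0Pr => e e0.
rewrite add0r; have [r ur] := inf e e0.
pose s := Num.max r (`|w| + 1).
have us v : ~ sq 0 s v -> `|u v| <= e.
  move=> nv; apply: ur; apply: contra_not nv; apply: sq_sub.
  by rewrite /s le_max lexx.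
have ws : csq 0 s w.
  have : `|w| <= s by rewrite /s le_max lerDl ler01 orbT.
  by move=> ws; split; rewrite subr0; apply: le_trans ws; [exact: norm_fst_le|exact: norm_snd_le].
have P v : nsm setT 2 v -> (forall w, 0 <= lap v w) ->
    (forall w, ~ sq 0 s w -> v w <= e) -> v w <= e.
  move=> nv lv vs.
  apply: (@subharmonic_le (csq 0 s) (sq 0 s) v 0 s e) => //.
  - exact: csq_compact.
  - exact: sq_open.
  - exact: csq_sq.
  - by move=> x _; apply: nsm_continuous nv _.
  - by apply: nsm_sub nv.
  - by move=> x _; apply: vs.
rewrite ler_norml lerNl; apply/andP; split.
  apply: (P (fun x => - u x)) => [|x|x nx].
  - by apply: nsmN => //; exact: openT.
  - by rewrite (lapN (D := setT)) ?lu ?oppr0 //; exact: openT.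
  - by have := us x nx; rewrite ler_norml => /andP[]; rewrite lerNl.
apply: P => // [x|x nx]; first by rewrite lu.
by have := us x nx; rewrite ler_norml => /andP[].
Qed.

End Harmonic.

(** * Gradient estimate for harmonic functions *)

Section Regularity.
Variable R : realType.
Implicit Types (f g u : plane R -> R) (z w h : plane R) (D K O : set (plane R)).

Definition refl b z w : plane R :=
  if b then (w.1, z.2 - (w.2 - z.2)) else (z.1 - (w.1 - z.1), w.2).

Lemma coord_refl b c z w : coord c (refl b z w) =
  if c == b then coord c z - (coord c w - coord c z) else coord c w.
Proof. by case: b; case: c. Qed.

Lemma refl_dist (p q : R) : `|p - (q - p) - p| = `|q - p|.
Proof. by rewrite -normrN; congr `|_|; ring. Qed.

Lemma plane_eq v w : (forall c, coord c v = coord c w) -> v = w.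
Proof.
by case: v w => [x y] [x' y'] H; have /= -> := H false; have /= -> := H true.
Qed.

Lemma linform_coord (x y : R) h :
  linform x y h = x * coord false h + y * coord true h.
Proof. by []. Qed.

Lemma coord_sq z r w : sq z r w <-> forall c, `|coord c w - coord c z| < r.
Proof.
split=> [[w1 w2] []|H] //.
by split; [exact: (H false)|exact: (H true)].
Qed.

Lemma coord_csq z r w : csq z r w <-> forall c, `|coord c w - coord c z| <= r.
Proof.
split=> [[w1 w2] []|H] //.
by split; [exact: (H false)|exact: (H true)].
Qed.

Lemma refl_diff b z f w : differentiable f (refl b z w) ->
  differentiable (fun x => f (refl b z x)) w /\
  forall c, pd c (fun x => f (refl b z x)) w = (-1) ^+ (c == b) * pd c f (refl b z w).
Proof.
move=> df; pose p c := (-1) ^+ (c == b) * pd c f (refl b z w).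
have [|df' dp] := @differentiable_eps R (fun x => f (refl b z x)) w (p false) (p true).
  move=> e e0; have /nbhs_sqP [s s0 sH] := differentiable_epsE df e0.
  apply/nbhs_sqP; exists s => // h hs /=.
  have /= := sH (refl b 0 h) _.
  have -> : refl b 0 h + refl b z w = refl b z (h + w).
    apply: plane_eq => c; rewrite coordD !coord_refl coordD.
    by case: (c == b) => //; rewrite (_ : coord c 0 = 0) //; [ring|case: c].
  have -> : linform (pd false f (refl b z w)) (pd true f (refl b z w)) (refl b 0 h) =
      linform (p false) (p true) h.
    rewrite !linform_coord !coord_refl /p; case: (b) => /=; ring.
  have -> : `|refl b 0 h| = `|h|.
    rewrite !norm_planeE -![_.1]/(coord false _) -![_.2]/(coord true _) !coord_refl.
    by case: (b) => /=; rewrite subr0 sub0r normrN.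
  apply; apply/coord_sq => c; move/coord_sq: hs => /(_ c); rewrite coord_refl.
  by case: (c == b) => //; rewrite (_ : coord c 0 = 0) ?subr0 ?sub0r ?normrN //; case: (c).
by split=> // c; rewrite dp /p; case: c.
Qed.

Lemma nsm_refl D k b z f (s : R) : open [set x | D (refl b z x)] -> nsm D k f ->
  nsm [set x | D (refl b z x)] k (fun x => s * f (refl b z x)).
Proof.
move=> oD; elim: k f s => //= k IH f s [df pf].
have dr x : D (refl b z x) -> differentiable (fun x => s * f (refl b z x)) x.
  move=> Dx; have [H _] := refl_diff (df _ Dx).
  by apply: differentiableM => //; exact: differentiable_cst.
split=> // c.
apply: (nsm_eq (f := fun x => s * (-1) ^+ (c == b) * pd c f (refl b z x))) => //.
  move=> x Dx; have [H E] := refl_diff (df _ Dx).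
  by rewrite pdM ?pd_cst ?mulr0 ?addr0 ?E ?mulrA //; exact: differentiable_cst.
exact: IH.
Qed.

Lemma refl_sq b z r : [set x | sq z r (refl b z x)] = sq z r.
Proof.
apply/seteqP; split=> x /=; move=> /coord_sq H; apply/coord_sq => c; move: (H c);
  by rewrite coord_refl; case: (c == b) => //; rewrite refl_dist.
Qed.

Lemma coord_continuous c : continuous (coord c : plane R -> R).
Proof.
by move=> w; apply: differentiable_continuous; exact: (coord_diff c w).1.
Qed.

Lemma refl_continuous b z : continuous (refl b z).
Proof.
have cr c a : continuous (fun w : plane R => a - (coord c w - a)).
  move=> w; apply: cvgB; first exact: cvg_cst.
  by apply: cvgB; [exact: coord_continuous|exact: cvg_cst].
move=> w; case: b.
  exact: (cvg_pair (@coord_continuous false w) (@cr true z.2 w)).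
exact: (cvg_pair (@cr false z.1 w) (@coord_continuous true w)).
Qed.

Lemma pd_le_of_increment b f z (C d : R) : 0 < d -> differentiable f z ->
  (forall t : R, 0 < t < d ->
    f (t *: axis R b + z) - f ((- t) *: axis R b + z) <= 2 * C * t) ->
  pd b f z <= C.
Proof.
move=> d0 df H; apply/ler_addgt0Pr => e e0.
have /nbhs_sqP [s s0 sH] := differentiable_epsE df e0.
pose t := Num.min d s / 2.
have m0 : 0 < Num.min d s by rewrite lt_min d0.
have t0 : 0 < t by rewrite divr_gt0.
have tm : t < Num.min d s by rewrite /t; lra.
have [td ts] : t < d /\ t < s by move: tm; rewrite lt_min => /andP.
have E (x : R) : `|x| = t ->
    `|f (x *: axis R b + z) - f z - x * pd b f z| <= e * t.
  move=> xt; have /= := sH (x *: axis R b) _; rewrite norm_axis xt linform_axis.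
  rewrite (_ : (if b then _ else _) = pd b f z); last by case: (b).
  by apply; apply/coord_sq => c; rewrite (_ : coord c 0 = 0) ?subr0;
    [rewrite coord_axis normrM xt; case: (c == b); rewrite ?normr1 ?normr0 ?mulr1 ?mulr0|
     case: (c)].
have /ler_normlP [A _] := E t (gtr0_norm t0).
have /ler_normlP [_ B] := E (- t) (etrans (normrN t) (gtr0_norm t0)).
have {}H := H t _; rewrite t0 td in H; have {}H := H isT.
rewrite -(ler_pM2l t0).
by move: (f _) (f _) (f z) (pd b f z) A B H => X Y F p A B H; nra.
Qed.

(** Comparison on a half square of the odd part of u with the explicit
    harmonic barrier 2M((y^2 - x^2)/r^2 + 2x/r). *)
Lemma gradient_estimate u z r (M : R) : 0 < r -> nsm (sq z r) 2 u ->
  (forall w, sq z r w -> lap u w = 0) ->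
  (forall w, csq z r w -> {for w, continuous u}) ->
  (forall w, csq z r w -> `|u w| <= M) ->
  forall b, `|pd b u z| <= 2 * M / r.
Proof.
have main v : 0 < r -> nsm (sq z r) 2 v ->
    (forall w, sq z r w -> lap v w = 0) ->
    (forall w, csq z r w -> {for w, continuous v}) ->
    (forall w, csq z r w -> `|v w| <= M) -> forall b, pd b v z <= 2 * M / r.
  move=> r0 nv lv cv vM b.
  have oS := @sq_open R z r; have zS := sq_center z r0.
  have oS' : open [set x | sq z r (refl b z x)] by rewrite refl_sq.
  have rr : 0 < r * r by rewrite mulr_gt0.
  have M0 : 0 <= M by apply: le_trans (vM z (csq_sq zS)).
  apply: (@pd_le_of_increment b v z _ r) => //; first exact: nsm_diff nv zS.
  move=> t /andP[t0 tr].
  pose K : set (plane R) := csq z r `&` [set w | coord b z <= coord b w].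
  pose O : set (plane R) := sq z r `&` [set w | coord b z < coord b w].
  pose B w := quad (~~ b) (2 * M / (r * r)) 0 (coord (~~ b) z) w +
              quad b (- (2 * M / (r * r))) (4 * M / r) (coord b z) w.
  pose phi w := v w - 1 * v (refl b z w) - B w.
  have cc := @coord_continuous.
  have oO : open O.
    apply: openI; first exact: sq_open.
    by apply: (@open_comp _ _ (coord b) [set x | coord b z < x]) => [w _|];
      [exact: cc|exact: open_gt].
  have nvr : nsm (sq z r) 2 (fun w => 1 * v (refl b z w)).
    by have := nsm_refl 1 oS' nv; rewrite refl_sq.
  have nB : nsm (sq z r) 2 B by apply: (nsmD oS); exact: nsm_quad.
  have nd : nsm (sq z r) 2 (fun w => v w - 1 * v (refl b z w)) by exact: nsmB.
  have nphi : nsm (sq z r) 2 phi by exact: nsmB.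
  have lB w : lap B w = 0.
    rewrite (lapD (D := setT)) ?lap_quad; first by ring.
    - exact: openT.
    - by [].
    - by apply: nsm_quad; exact: openT.
    - by apply: nsm_quad; exact: openT.
  have lr w : sq z r w -> lap (fun x => 1 * v (refl b z x)) w = 0.
    move=> Sw; have Sw' : sq z r (refl b z w) by move: Sw; rewrite -[X in X w](refl_sq b).
    have E c : pd c (pd c (fun x => 1 * v (refl b z x))) w = pd c (pd c v) (refl b z w).
      have -> : pd c (pd c (fun x => 1 * v (refl b z x))) w =
          pd c (fun x => (-1) ^+ (c == b) * pd c v (refl b z x)) w.
        apply: near_pd; apply: filterS (open_nbhs_nbhs (conj oS Sw)) => x Sx.
        have Sx' : sq z r (refl b z x) by move: Sx; rewrite -[X in X x](refl_sq b).
        have [H Ex] := refl_diff (nsm_diff nv Sx').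
        by under eq_fun do rewrite mul1r; rewrite Ex.
      have [H Ex] := refl_diff (nsm_diff (nsm_pd c nv) Sw').
      by rewrite pdM // pd_cst mulr0 addr0 Ex mulrA -expr2 sqrr_sign mul1r.
    by rewrite /lap !E -/(lap v _) lv.
  have lphi w : sq z r w -> lap phi w = 0.
    move=> Sw; rewrite (lapB oS Sw) // (lapB oS Sw) // lv // lr // lB.
    by rewrite !subr0.
  have Kc : K `<=` csq z r by move=> w [].
  have reflK w : csq z r w -> csq z r (refl b z w).
    move=> /coord_csq H; apply/coord_csq => c; move: (H c); rewrite coord_refl.
    by case: (c == b) => //; rewrite refl_dist.
  have phiK w : K w -> phi w <= 0.
    apply: (@subharmonic_le R K O phi z r 0) => //.
    - apply: (subclosed_compact _ (csq_compact (z := z) (r := r))) => //.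
      apply: closedI; first exact: (compact_closed (@norm_hausdorff _ _) (csq_compact (z:=z) (r:=r))).
      apply: (@closed_comp _ _ (coord b) [set x | coord b z <= x]) => [x _|]; first exact: cc.
      exact: closed_ge.
    - by move=> x [/csq_sq Sx /ltW].
    - move=> x [Kx _]; apply: cvgB; last first.
        apply: differentiable_continuous; apply: (nsm_diff (D := setT) (k := 0)) => //.
        by apply: nsmD; [exact: openT|apply: nsm_quad; exact: openT|
                         apply: nsm_quad; exact: openT].
      apply: cvgB; first exact: cv.
      apply: cvgM; first exact: cvg_cst.
      apply: (@continuous_comp _ _ _ (refl b z) v); last by apply: cv; exact: reflK.
      exact: refl_continuous.
    - by apply: nsm_sub nphi => x [].
    - by move=> x [Sx _]; rewrite lphi.
    - move=> x [Sx zx] nOx; rewrite /phi mul1r.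
      have vx : v x - v (refl b z x) <= 2 * M.
        have /ler_normlP [_ A1] := vM x Sx.
        have /ler_normlP [A2 _] := vM _ (reflK x Sx).
        by lra.
      move/coord_csq: (Sx) => Sc.
      have /= Sb := Sc b; have /= Sb' := Sc (~~ b).
      rewrite /B /quad; set X := coord b x - coord b z; set Y := coord (~~ b) x - coord (~~ b) z.
      have X0 : 0 <= X by rewrite subr_ge0.
      rewrite -/X ger0_norm // in Sb; rewrite -/Y in Sb'.
      have EB : 2 * M / (r * r) * (Y * Y) + 0 * Y + (- (2 * M / (r * r)) * (X * X) + 4 * M / r * X)
           = 2 * M / (r * r) * (Y * Y - X * X + 2 * r * X).
        by field; exact: lt0r_neq0.
      rewrite EB; clear EB.
      have [xz|xz] := eqVneq (coord b x) (coord b z).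
        have -> : refl b z x = x.
          apply: plane_eq => c; rewrite coord_refl; case: eqP => // ->.
          by rewrite xz subrr subr0.
        rewrite subrr sub0r oppr_le0; apply: mulr_ge0.
          by apply: mulr_ge0; [lra|rewrite invr_ge0 ltW].
        by rewrite /X xz subrr mulr0 mulr0 subr0 addr0 -expr2 sqr_ge0.
      have big : r * r <= Y * Y - X * X + 2 * r * X.
        have [Xr|Xr] := eqVneq X r; first by rewrite Xr -expr2; have := sqr_ge0 Y; rewrite expr2; nra.
        have [Yr|Yr] := eqVneq `|Y| r.
          have -> : Y * Y = r * r by rewrite -Yr -!expr2 real_normK ?num_real.
          by nra.
        exfalso; apply: nOx; split; last by rewrite /= lt_neqAle eq_sym xz.
        apply/coord_sq => c; have := Sc c.
        have [->|cb] := eqVneq c b; first by rewrite -/X ger0_norm // lt_neqAle Xr.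
        have -> : c = ~~ b by move: cb; case: (c); case: (b).
        by rewrite -/Y lt_neqAle Yr.
      rewrite subr_le0; apply: le_trans vx _.
      apply: (@le_trans _ _ (2 * M / (r * r) * (r * r))).
        by rewrite divfK ?lt0r_neq0.
      apply: ler_wpM2l => //; apply: mulr_ge0; first by lra.
      by rewrite invr_ge0 ltW.
  have Kt : K (t *: axis R b + z).
    split; last by rewrite /= coordD coord_axis eqxx mulr1; lra.
    apply/coord_csq => c; rewrite coordD addrK coord_axis normrM gtr0_norm //.
    by case: (c == b); rewrite ?normr1 ?normr0 ?mulr1 ?mulr0; exact: ltW.
  have := phiK _ Kt; rewrite /phi mul1r.
  have -> : refl b z (t *: axis R b + z) = (- t) *: axis R b + z.
    apply: plane_eq => c; rewrite coord_refl !coordD !coord_axis.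
    by case: (c == b) => /=; ring.
  rewrite /B /quad !coordD !coord_axis eqxx (_ : ~~ b == b = false); last by case: (b).
  rewrite mulr0 mulr1 add0r subrr !mulr0 !addr0 add0r addrK subr_le0 => H.
  apply: le_trans H _; rewrite -subr_ge0.
  rewrite (_ : _ - _ = 2 * M / (r * r) * (t * t)); last by field; exact: lt0r_neq0.
  apply: mulr_ge0; last by rewrite -expr2 sqr_ge0.
  by apply: mulr_ge0; [lra|rewrite invr_ge0 ltW].
move=> r0 nu lu cu uM b; rewrite ler_norml lerNl; apply/andP; split; last exact: main.
rewrite -pdN; last exact: nsm_diff nu (sq_center z r0).
apply: main => // [|w Sw|w Kw|w Kw].
- by apply: nsmN => //; exact: sq_open.
- by rewrite (lapN (@sq_open R z r) Sw) // lu // oppr0.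
- by apply: cvgN; exact: cu.
- by rewrite normrN uM.
Qed.

End Regularity.

(** * Smoothness of harmonic functions *)

Section Smoothness.
Variable R : realType.
Implicit Types (f g u : plane R -> R) (z w h : plane R) (D K O : set (plane R)).

Lemma csq_in_csq z w r s : csq z r w -> csq w s `<=` csq z (r + s).
Proof.
move=> /coord_csq zw v /coord_csq wv; apply/coord_csq => c.
rewrite (_ : _ - _ = (coord c w - coord c z) + (coord c v - coord c w)); last by ring.
by apply: le_trans (ler_normD _ _) _; apply: lerD.
Qed.

Lemma compact_bound K f : compact K -> (forall w, K w -> {for w, continuous f}) ->
  exists M : R, 0 <= M /\ forall w, K w -> `|f w| <= M.
Proof.
move=> cK cf; have [[w0 Kw0]|K0] := pselect (K !=set0); last first.
  by exists 0; split=> // w Kw; case: K0; exists w.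
have cn : {within K, continuous (fun w => `|f w|)}.
  apply: continuous_in_subspaceT => w /set_mem Kw.
  by apply: (@continuous_comp _ _ _ f Num.norm); [exact: cf|exact: norm_continuous].
have [w _ wmax] := compact_EVT_max (ex_intro _ w0 Kw0) cK cn.
by exists `|f w|; split=> // v Kv; apply: wmax; rewrite inE.
Qed.

Lemma csq_center z r : 0 <= r -> csq z r z.
Proof. by move=> r0; split; rewrite subrr normr0. Qed.

Lemma csq_axis z b (t r : R) : `|t| <= r -> csq z r (t *: axis R b + z).
Proof.
move=> tr; apply/coord_csq => c; rewrite coordD addrK coord_axis normrM.
by case: (c == b); rewrite ?normr1 ?normr0 ?mulr1 ?mulr0 // (le_trans _ tr).
Qed.

Definition dq b (t : R) f : plane R -> R :=
  fun w => t^-1 * (f (w + t *: axis R b) - f w).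

Lemma nsm_dq D D' k b t f : open D -> open D' -> D' `<=` D ->
  (forall w, D' w -> D (w + t *: axis R b)) -> nsm D k f -> nsm D' k (dq b t f).
Proof.
move=> oD oD' sD sDt nf; apply: nsmM => //; first exact: nsm_cst.
apply: nsmB => //; last exact: nsm_sub nf.
by apply: nsm_sub (nsm_shift (t *: axis R b) nf).
Qed.

Lemma pd_dq D b c t f w : open D -> D w -> D (w + t *: axis R b) -> nsm D 1 f ->
  pd c (dq b t f) w = dq b t (pd c f) w.
Proof.
move=> oD Dw Dwt nf; have df := nsm_diff nf Dw.
have dft := differentiable_shift (nsm_diff nf Dwt).
have ds : differentiable (fun x => f (x + t *: axis R b) - f x) w.
  exact: differentiableB.
rewrite /dq pdM // pd_cst mulr0 addr0.
congr (_ * _); rewrite (pdD c dft (differentiableN df)) pdN // pd_shift.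
by [].
Qed.

Lemma dq_mvt b t f w : t != 0 ->
  (forall th : R, 0 <= th <= 1 -> differentiable f ((th * t) *: axis R b + w)) ->
  exists2 th : R, 0 < th < 1 & dq b t f w = pd b f ((th * t) *: axis R b + w).
Proof.
move=> t0 df; have [th th01 E] := mvt_axis df; exists th => //.
by rewrite /dq [w + _]addrC E mulKf.
Qed.

Lemma dq_cvg b f w : differentiable f w -> forall e : R, 0 < e ->
  exists2 d : R, 0 < d & forall t : R, 0 < t < d -> `|dq b t f w - pd b f w| <= e.
Proof.
move=> df e e0; have /nbhs_sqP [s s0 sH] := differentiable_epsE df e0.
exists s => // t /andP[t0 ts]; have /= := sH (t *: axis R b) _.
rewrite norm_axis (gtr0_norm t0) linform_axis.
rewrite (_ : (if b then _ else _) = pd b f w); last by case: (b).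
move=> H; rewrite /dq [w + _]addrC -(ler_pM2l t0) -[X in X * `|_|](gtr0_norm t0) -normrM.
rewrite mulrBr mulVKf ?lt0r_neq0 // [t * e]mulrC; apply: H.
apply/coord_sq => c; rewrite (_ : coord c 0 = 0) ?subr0; last by case: (c).
rewrite coord_axis normrM gtr0_norm //.
by case: (c == b); rewrite ?normr1 ?normr0 ?mulr1 ?mulr0.
Qed.

Section Estimates.
Variables (D : set (plane R)) (u : plane R -> R).
Hypotheses (oD : open D) (nu : nsm D 2 u) (lu : forall w, D w -> lap u w = 0).

Lemma gradient_estimate_in z r (M : R) : 0 < r -> csq z r `<=` D ->
  (forall w, csq z r w -> `|u w| <= M) -> forall b, `|pd b u z| <= 2 * M / r.
Proof.
move=> r0 rD uM b; apply: gradient_estimate => // [|w Sw|w Kw].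
- by apply: nsm_sub nu => w /csq_sq /rD.
- exact/lu/rD/csq_sq.
- by apply: nsm_continuous nu _; exact: rD.
Qed.

Lemma lap_dq b t w : D w -> D (w + t *: axis R b) -> lap (dq b t u) w = 0.
Proof.
move=> Dw Dwt.
have E c : pd c (pd c (dq b t u)) w = dq b t (pd c (pd c u)) w.
  rewrite -(pd_dq (D := D)) //; last exact: nsm_pd.
  apply: near_pd; near=> x; apply: (pd_dq (D := D)) => //; last exact: nsmW.
    by near: x; exact: (open_nbhs_nbhs (conj oD Dw)).
  near: x; rewrite near_simpl.
  have oDt : open [set x | D (x + t *: axis R b)].
    apply: (@open_comp _ _ (fun x => x + t *: axis R b) D) => // x _.
    by apply: cvgD; [exact: cvg_id|exact: cvg_cst].
  exact: (open_nbhs_nbhs (conj oDt Dwt)).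
rewrite /lap !E /dq -mulrDr -[X in _ * X](_ : lap u (w + t *: axis R b) - lap u w = _).
  by rewrite !lu // subrr mulr0.
by rewrite /lap opprD addrACA.
Unshelve. all: by end_near.
Qed.

(** The second derivatives are controlled by applying the gradient estimate to
    difference quotients. *)
Lemma hessian_estimate z r (M : R) : 0 < r -> csq z r `<=` D ->
  (forall w, csq z r w -> `|u w| <= M) ->
  forall b c, `|pd b (pd c u) z| <= 32 * M / (r * r).
Proof.
move=> r0 rD uM b c.
have M0 : 0 <= M by apply: le_trans (uM z (csq_center _ (ltW r0))).
have r2 : 0 < r / 2 by lra.
have r4 : 0 < r / 4 by lra.
have G w : csq z (r / 2) w -> forall b, `|pd b u w| <= 4 * M / r.
  move=> Sw b'; rewrite (_ : 4 * M / r = 2 * M / (r / 2)); last first.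
    by field; exact: lt0r_neq0.
  have sub : csq w (r / 2) `<=` csq z r.
    by rewrite [X in csq z X](_ : r = r / 2 + r / 2); [exact: csq_in_csq|field].
  by apply: gradient_estimate_in => // [v /sub /rD|v /sub /uM].
apply/ler_addgt0Pr => e e0.
have zD : D z by apply/rD/csq_center/ltW.
have [d d0 dH] := dq_cvg b (nsm_diff (nsm_pd c nu) zD) e0.
pose t := Num.min d (r / 4) / 2.
have m0 : 0 < Num.min d (r / 4) by rewrite lt_min d0.
have t0 : 0 < t by rewrite divr_gt0.
have tm : t < Num.min d (r / 4) by rewrite /t; lra.
have [td tr] : t < d /\ t < r / 4 by move: tm; rewrite lt_min => /andP.
have {}dH := dH t _; rewrite t0 td in dH; have {}dH := dH isT.
have step w (x : R) : csq z (r / 4) w -> `|x| <= r / 4 -> csq z (r / 2) (x *: axis R b + w).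
  move=> Sw xr; rewrite [X in csq z X](_ : _ = r / 4 + r / 4); last by field.
  by apply: (csq_in_csq Sw); exact: csq_axis.
have half w : csq z (r / 2) w -> csq z r w.
  by move=> [w1 w2]; split; [apply: le_trans w1 _|apply: le_trans w2 _]; lra.
have quart w : csq z (r / 4) w -> csq z (r / 2) w.
  by move=> [w1 w2]; split; [apply: le_trans w1 _|apply: le_trans w2 _]; lra.
have tx : `|t| <= r / 4 by rewrite gtr0_norm // ltW.
pose D' := sq z (r / 4).
have oD' : open D' by exact: sq_open.
have D'D : D' `<=` D by move=> w /csq_sq /quart /half /rD.
have D't w : csq z (r / 4) w -> D (w + t *: axis R b).
  by move=> Sw; apply/rD/half; rewrite addrC; exact: step.
have A : `|pd c (dq b t u) z| <= 2 * (4 * M / r) / (r / 4).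
  apply: (@gradient_estimate R (dq b t u) z (r / 4) (4 * M / r) r4) => [|w Sw|w Sw|w Sw].
  - by apply: (nsm_dq (D := D)) => // w /csq_sq; exact: D't.
  - by apply: lap_dq; [exact: D'D|apply/D't/csq_sq].
  - apply: cvgM; first exact: cvg_cst.
    apply: cvgB; last by apply: (nsm_continuous nu); apply/rD/half/quart.
    apply: (@continuous_comp _ _ _ (fun x => x + t *: axis R b) u).
      by apply: cvgD; [exact: cvg_id|exact: cvg_cst].
    by apply: (nsm_continuous nu); exact: D't.
  - have thr (th : R) : 0 <= th <= 1 -> `|th * t| <= r / 4.
      move=> /andP[h0 h1]; rewrite normrM (ger0_norm h0); apply: le_trans tx.
      by rewrite ler_piMl.
    have [th /andP[h0 h1] ->] := @dq_mvt b t u w (lt0r_neq0 t0) (fun th th01 =>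
        nsm_diff nu (rD _ (half _ (step _ _ Sw (thr th th01))))).
    by apply: G; apply: step => //; apply: thr; rewrite !ltW.
move: A; rewrite (pd_dq (D := D)) // => [A||]; last exact: nsmW.
  rewrite (_ : 32 * M / (r * r) = 2 * (4 * M / r) / (r / 4)); last first.
    by field; exact: lt0r_neq0.
  move: A dH; move: (dq b t (pd c u) z) (pd b (pd c u) z) (_ / (r / 4)) => X Y Z.
  by rewrite !ler_norml => /andP[A1 A2] /andP[B1 B2]; apply/andP; split; lra.
by apply: D't; apply: csq_center; exact: ltW.
Qed.

End Estimates.

(** Termwise differentiation for a family of functions whose gradients are
    uniformly Cauchy, at the linear rate that difference quotients provide. *)
Lemma differentiable_limit (p : R -> plane R -> R) (P : plane R -> R) z (s d C : R) :
  0 < s -> 0 < d -> 0 <= C ->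
  (forall t, 0 < t < d -> forall w, sq z s w -> differentiable (p t) w) ->
  (forall t t', 0 < t < d -> 0 < t' < d -> forall c w, sq z s w ->
      `|pd c (p t) w - pd c (p t') w| <= C * (t + t')) ->
  (forall w, sq z s w -> forall e : R, 0 < e -> exists2 d' : R, 0 < d' &
      forall t, 0 < t < d' -> t < d -> `|p t w - P w| <= e) ->
  differentiable P z.
Proof.
move=> s0 d0 C0 dp cp lp.
have zs := sq_center z s0.
have Lip t t' : 0 < t < d -> 0 < t' < d -> forall w, sq z s w ->
    `|(p t w - p t' w) - (p t z - p t' z)| <= C * (t + t') * (2 * `|w - z|).
  move=> td td' w zw.
  have := lipschitz_sq (f := fun x => p t x - p t' x) (C := C * (t + t'))
    (z := z) (r := s) _ _ zw zs.
  move=> H; apply: le_trans (H _ _) _.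
  - by move=> x Sx; apply: differentiableB; exact: dp.
  - move=> c x Sx; rewrite pdD ?pdN; [exact: cp|exact: dp|exact: dp|].
    by apply: differentiableN; exact: dp.
  apply: ler_wpM2l.
    by apply: mulr_ge0 => //; case/andP: td => ? _; case/andP: td' => ? _; lra.
  have := norm_fst_le (w - z); have := norm_snd_le (w - z); rewrite /=.
  by move: (`|w.2 - z.2|) (`|w.1 - z.1|) (`|w - z|) => a b c'; lra.
have LipP t : 0 < t < d -> forall w, sq z s w ->
    `|(p t w - P w) - (p t z - P z)| <= 2 * C * t * `|w - z|.
  move=> td w zw; apply/ler_addgt0Pr => e e0.
  have [t0 _] := andP td.
  have e4 : 0 < e / 4 by lra.
  have [d1 d10 H1] := lp w zw _ e4; have [d2 d20 H2] := lp z zs _ e4.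
  pose q := 2 * C * (2 * `|w - z|) + 1.
  have q0 : 0 < q.
    by rewrite /q ltr_wpDl // mulr_ge0 // mulr_ge0.
  pose t' := Num.min (Num.min d1 d2) (Num.min d (e / q)) / 2.
  have m0 : 0 < Num.min (Num.min d1 d2) (Num.min d (e / q)).
    by rewrite !lt_min d10 d20 d0 divr_gt0.
  have t'0 : 0 < t' by rewrite divr_gt0.
  have : t' < Num.min (Num.min d1 d2) (Num.min d (e / q)) by rewrite /t'; lra.
  rewrite !lt_min => /andP[/andP[td1 td2] /andP[td' te]].
  have A := Lip t t' td _ w zw; rewrite t'0 td' in A; have {}A := A isT.
  have B1 := H1 t' _ td'; rewrite t'0 td1 in B1; have {}B1 := B1 isT.
  have B2 := H2 t' _ td'; rewrite t'0 td2 in B2; have {}B2 := B2 isT.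
  have E : C * t' * (2 * `|w - z|) <= e / 2.
    have : t' * q <= e by rewrite -ler_pdivlMr // ltW.
    rewrite /q; have := normr_ge0 (w - z); move: (`|w - z|) => n n0; nra.
  move: A B1 B2 E; have := normr_ge0 (w - z).
  move: (p t w) (p t z) (p t' w) (p t' z) (P w) (P z) (`|w - z|) => a b c d' e' f' n n0.
  rewrite !ler_norml => /andP[A1 A2] /andP[B1 B2] /andP[B3 B4] E.
  by apply/andP; split; lra.
(* The limit of the gradients is the supremum of their lower estimates. *)
have [Q HQ] : exists Q : bool -> R, forall c t, 0 < t < d ->
    `|pd c (p t) z - Q c| <= C * t.
  have ex c : exists q : R, forall t, 0 < t < d -> `|pd c (p t) z - q| <= C * t.
    pose S := [set x : R | exists2 t, 0 < t < d & x = pd c (p t) z - C * t].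
    have d2 : 0 < d / 2 < d by apply/andP; split; lra.
    have S0 : S !=set0 by exists (pd c (p (d / 2)) z - C * (d / 2)), (d / 2).
    have ub t : 0 < t < d -> ubound S (pd c (p t) z + C * t).
      move=> td _ [t' td' ->]; have := cp t t' td td' c z zs.
      rewrite ler_norml => /andP[A B]; lra.
    exists (sup S) => t td; rewrite ler_distl; apply/andP; split.
      by rewrite lerBlDr; apply: (ge_sup S0); exact: ub.
    rewrite -lerBlDr; apply: ub_le_sup; last by exists t.
    by exists (pd c (p (d / 2)) z + C * (d / 2)); exact: ub.
  have [q0 h0] := ex false; have [q1 h1] := ex true.
  by exists (fun c => if c then q1 else q0) => -[].
apply: (proj1 (differentiable_eps (a := Q false) (b := Q true) _)) => e e0.
pose k := 4 * C + 1.
have k0 : 0 < k by rewrite /k ltr_wpDl // mulr_ge0.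
pose t := Num.min d (e / (2 * k)) / 2.
have m0 : 0 < Num.min d (e / (2 * k)) by rewrite lt_min d0 divr_gt0 // mulr_gt0.
have t0 : 0 < t by rewrite divr_gt0.
have : t < Num.min d (e / (2 * k)) by rewrite /t; lra.
rewrite lt_min => /andP[td te].
have tt : 0 < t < d by rewrite t0.
have e2 : 0 < e / 2 by lra.
have /nbhs_sqP [s' s'0 sH] := differentiable_epsE (dp t tt z zs) e2.
apply/nbhs_sqP; exists (Num.min s s'); first by rewrite lt_min s0.
move=> h hs /=.
have hs1 : sq 0 s h by apply: sq_sub hs; rewrite ge_min lexx.
have hs2 : sq 0 s' h by apply: sq_sub hs; rewrite ge_min lexx orbT.
have zh : sq z s (h + z).
  by case: hs1; rewrite !subr0 => h1 h2; split; rewrite /= addrK.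
have A := sH h hs2; rewrite /= in A.
have := LipP t tt _ zh; rewrite addrK => B.
have C1 := HQ false t tt; have C2 := HQ true t tt.
have L : `|linform (pd false (p t) z) (pd true (p t) z) h - linform (Q false) (Q true) h|
    <= 2 * C * t * `|h|.
  rewrite /linform (_ : _ - _ = (pd false (p t) z - Q false) * h.1 +
    (pd true (p t) z - Q true) * h.2); last by ring.
  apply: le_trans (ler_normD _ _) _; rewrite !normrM.
  rewrite (_ : 2 * C * t * `|h| = C * t * `|h| + C * t * `|h|); last by ring.
  by apply: lerD; apply: ler_pM => //; [exact: norm_fst_le|exact: norm_snd_le].
have E : 4 * C * t * `|h| <= e / 2 * `|h|.
  apply: ler_wpM2r => //; move: te; rewrite ltr_pdivlMr ?mulr_gt0 // /k; nra.
move: A B L E; move: (linform _ _ h) (linform _ _ h) (p t (h + z)) (p t z) (P (h + z)) (P z)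
  (`|h|) => a b c f g x n.
rewrite !ler_norml => /andP[A1 A2] /andP[B1 B2] /andP[L1 L2] E.
by apply/andP; split; lra.
Qed.

End Smoothness.

Section HarmonicSmooth.
Variable R : realType.
Implicit Types (f g u : plane R -> R) (z w h : plane R) (D K O : set (plane R)).

Lemma lap_pd D u b w : open D -> D w -> nsm D 2 u -> (forall c, nsm D 2 (pd c u)) ->
  lap (pd b u) w = pd b (lap u) w.
Proof.
move=> oD Dw nu npu.
have E c : pd c (pd c (pd b u)) w = pd b (pd c (pd c u)) w.
  have [->//|bc] := eqVneq c b.
  have Ec : c = ~~ b by move: bc; case: (c); case: (b).
  have -> : pd c (pd c (pd b u)) w = pd c (pd b (pd c u)) w.
    apply: near_pd; apply: filterS (open_nbhs_nbhs (conj oD Dw)) => x Dx.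
    by rewrite Ec -(pdC b oD Dx nu).
  by rewrite Ec -(pdC b oD Dw).
rewrite /lap !E (pdD b (f := pd false (pd false u))) //.
  by have [/(_ _ Dw)] := npu false; case=> _ /(_ false) [H _] ; exact: H.
by case: (npu true) => _ /(_ true) [H _]; exact: H.
Qed.

(** The difference quotients of u are harmonic and converge at a linear rate
    by hessian_estimate, and so do their first and second derivatives;
    differentiable_limit then differentiates the limit. *)
Lemma harmonic_nsm_pd D u b : open D -> nsm D 2 u -> (forall w, D w -> lap u w = 0) ->
  nsm D 2 (pd b u).
Proof.
move=> oD nu lu; split=> [z Dz|c]; first exact: nsm_diff (nsm_pd b nu) Dz.
split=> // z Dz.
have [r0' r0'0 r0D] := open_sqP oD Dz.
pose r := r0' / 5.
have r0 : 0 < r by rewrite divr_gt0.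
have rD : csq z (4 * r) `<=` D by move=> w /(sq_csq (s := r0')) H; apply/r0D/H; rewrite /r; lra.
have sub (x y : R) w : x <= y -> csq z x w -> csq z y w.
  by move=> xy [? ?]; split; apply: le_trans xy.
have [M uM] : exists M : R, forall w, csq z (4 * r) w -> `|u w| <= M.
  have [|M [_ H]] := compact_bound (f := u) (csq_compact (z := z) (r := 4 * r)).
    by move=> w Kw; apply: nsm_continuous nu _; exact: rD.
  by exists M.
have M0 : 0 <= M by apply: le_trans (uM z (csq_center _ _)) => //; lra.
pose C := 32 * M / (2 * r * (2 * r)).
have C0 : 0 <= C by apply: mulr_ge0; [lra|rewrite invr_ge0 mulr_ge0 //; lra].
have H2 w : csq z (2 * r) w -> forall b c, `|pd b (pd c u) w| <= C.
  move=> Sw b' c'; have S : csq w (2 * r) `<=` csq z (4 * r).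
    by rewrite (_ : 4 * r = 2 * r + 2 * r); [exact: csq_in_csq|ring].
  by apply: (hessian_estimate oD nu lu) => [|v /S /rD|v /S /uM] //; lra.
have step w (x : R) : csq z r w -> `|x| <= r -> csq z (2 * r) (x *: axis R b + w).
  by move=> Sw xr; rewrite (_ : 2 * r = r + r); [apply: (csq_in_csq Sw); exact: csq_axis|ring].
(* Difference quotients converge to the derivative at a linear rate. *)
have rate t w : 0 < t < r -> csq z r w -> `|dq b t u w - pd b u w| <= C * t.
  move=> /andP[t0 tr] Sw.
  have thr (th : R) : 0 <= th <= 1 -> `|th * t| <= r.
    move=> /andP[h0 h1]; rewrite normrM (ger0_norm h0) (gtr0_norm t0).
    by apply: le_trans (ltW tr); rewrite ler_piMl // ltW.
  have inD (x : R) : `|x| <= r -> D (x *: axis R b + w).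
    by move=> xr; apply/rD; apply: (sub (2 * r)); [lra|exact: step].
  have [th /andP[h0 h1] ->] := @dq_mvt R b t u w (lt0r_neq0 t0) (fun th th01 =>
        nsm_diff nu (inD _ (thr th th01))).
  have tht : `|th * t| <= r by apply: thr; rewrite !ltW.
  have thr2 (et : R) : 0 <= et <= 1 -> `|et * (th * t)| <= r.
    move=> /andP[? ?]; rewrite normrM ger0_norm //; apply: le_trans tht.
    by rewrite ler_piMl.
  have [et /andP[e0 e1] ->] := @mvt_axis R b (pd b u) w (th * t) (fun et et01 =>
        nsm_diff (nsm_pd b nu) (inD _ (thr2 et et01))).
  rewrite normrM mulrC; apply: ler_pM => //.
    by apply: H2; apply: step => //; apply: thr2; rewrite !ltW.
  by rewrite normrM !gtr0_norm // ler_piMl // ltW.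
pose C' := 32 * C / (r / 2 * (r / 2)).
have C'0 : 0 <= C' by apply: mulr_ge0; [lra|rewrite invr_ge0 mulr_ge0 //; lra].
pose D' := sq z (2 * r).
have oD' : open D' by exact: sq_open.
have D'D : D' `<=` D by move=> w /csq_sq Sw; apply/rD/(sub (2 * r)) => //; lra.
have D't (t : R) : `|t| < r -> forall w, D' w -> D (w + t *: axis R b).
  move=> tr w /csq_sq Sw; apply/rD/(sub (2 * r + r)); first by lra.
  by rewrite [w + _]addrC; apply: (csq_in_csq Sw); apply: csq_axis; exact: ltW.
have ndq t : 0 < t < r -> nsm D' 2 (dq b t u).
  move=> /andP[t0 tr]; apply: (nsm_dq (D := D)) => //; apply: D't.
  by rewrite gtr0_norm.
have ldq t w : 0 < t < r -> D' w -> lap (dq b t u) w = 0.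
  move=> /andP[t0 tr] Dw; apply: (lap_dq oD nu lu); first exact: D'D.
  by apply: D't => //; rewrite gtr0_norm.
have r2 : 0 < r / 2 by lra.
suff dP : differentiable (pd b (pd c u)) z.
  have [Ebc|bc] := eqVneq c b; first by rewrite Ebc in dP *.
  have Ec : c = ~~ b by move: bc; case: (c); case: (b).
  apply: near_differentiable dP.
  apply: filterS (open_nbhs_nbhs (conj oD Dz)) => x Dx.
  by rewrite Ec -(pdC b oD Dx nu).
apply: (@differentiable_limit R (fun t => dq b t (pd c u)) _ z (r / 2) r C' r2 r0 C'0).
- move=> t tr w /csq_sq Sw; have D'w : D' w by apply: (sq_csq (r := r / 2)) => //; lra.
  apply: (@near_differentiable _ (pd c (dq b t u))); last first.
    by apply: (nsm_diff (nsm_pd c (ndq t tr))).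
  apply: filterS (open_nbhs_nbhs (conj oD' D'w)) => x D'x.
  apply: (pd_dq (D := D)) => //; [exact: D'D| |exact: nsmW].
  by apply: D't => //; case/andP: tr => ? ?; rewrite gtr0_norm.
- move=> t t' tr tr' c' w /csq_sq Sw.
  have D'w : D' w by apply: (sq_csq (r := r / 2)) => //; lra.
  have E s x : 0 < s < r -> D' x -> pd c (dq b s u) x = dq b s (pd c u) x.
    move=> sr D'x; apply: (pd_dq (D := D)) => //; [exact: D'D| |exact: nsmW].
    by apply: D't => //; case/andP: sr => ? ?; rewrite gtr0_norm.
  have E' s : 0 < s < r -> pd c' (dq b s (pd c u)) w = pd c' (pd c (dq b s u)) w.
    move=> sr; apply: near_pd.
    by apply: filterS (open_nbhs_nbhs (conj oD' D'w)) => x D'x; rewrite E.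
  rewrite !E' //.
  pose phi x := dq b t u x - dq b t' u x.
  have nphi : nsm D' 2 phi := (nsmB oD' (ndq t tr) (ndq t' tr')).
  have -> : pd c' (pd c (dq b t u)) w - pd c' (pd c (dq b t' u)) w = pd c' (pd c phi) w.
    rewrite /phi (pd2D (g := fun x => - dq b t' u x) c' c oD' D'w (ndq t tr)).
      by rewrite (pd2N c' c oD' D'w (ndq t' tr')).
    exact: (nsmN oD' (ndq t' tr')).
  rewrite (_ : C' * _ = 32 * (C * (t + t')) / (r / 2 * (r / 2))); last first.
    by rewrite /C'; ring.
  have S : csq w (r / 2) `<=` csq z r.
    by rewrite [X in csq z X](_ : r = r / 2 + r / 2); [exact: csq_in_csq|field].
  apply: (hessian_estimate oD' nphi) => // [x D'x|x /S Sx|x /S Sx].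
  - rewrite (lapB oD' D'x (ndq t tr) (ndq t' tr')) !ldq // subrr //.
  - by apply: (sq_csq (r := r)) => //; lra.
  - have A := rate t x tr Sx; have B := rate t' x tr' Sx.
    rewrite /phi (_ : _ - _ = (dq b t u x - pd b u x) - (dq b t' u x - pd b u x)); last by ring.
    by apply: le_trans (ler_normB _ _) _; rewrite mulrDr; apply: lerD.
- move=> w /csq_sq Sw e e0; have Dw : D w by apply/rD/(sub (r / 2)) => //; lra.
  have [d' d'0 H] := dq_cvg b (nsm_diff (nsm_pd c nu) Dw) e0.
  by exists d' => // t td' _; exact: H.
Qed.

(** Each derivative of a harmonic function is again harmonic and twice
    differentiable, so the number of derivatives is raised one at a time. *)
Lemma harmonic_nsm D u k : open D -> nsm D 2 u -> (forall w, D w -> lap u w = 0) ->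
  nsm D k u.
Proof.
move=> oD; elim: k u => [//|k IH] u nu lu.
have npu b : nsm D 2 (pd b u) by exact: harmonic_nsm_pd.
split=> [z Dz|b]; first exact: nsm_diff nu Dz.
apply: IH => // w Dw; rewrite (lap_pd b oD Dw nu npu).
rewrite (near_pd b (g := fun=> 0)) ?pd_cst //.
by apply: filterS (open_nbhs_nbhs (conj oD Dw)) => x; exact: lu.
Qed.

End HarmonicSmooth.

(** * Unique continuation *)

Section UniqueContinuation.
Variable R : realType.
Implicit Types (f g u : plane R -> R) (z w h : plane R) (D K O : set (plane R)).

Lemma pd_comp (phi : R -> R) (d : R) f z : differentiable f z ->
  is_derive (f z) (1 : R) phi d ->
  differentiable (fun x => phi (f x)) z /\
  forall b, pd b (fun x => phi (f x)) z = d * pd b f z.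
Proof.
move=> df [dphi Ed].
have dphi' : differentiable phi (f z) by apply/derivable1_diffP.
have dc : differentiable (phi \o f) z by apply: differentiable_comp.
split=> // b; rewrite !pdE !deriveE // (diff_comp df dphi') /=.
rewrite deriv1E // derive1E Ed.
by rewrite -[LHS]/('d f z (axis R b) * d) mulrC.
Qed.

Definition dist2 z0 : plane R -> R :=
  fun w => quad false 1 0 (coord false z0) w + quad true 1 0 (coord true z0) w.

Lemma dist2E z0 w : dist2 z0 w =
  (w.1 - z0.1) * (w.1 - z0.1) + (w.2 - z0.2) * (w.2 - z0.2).
Proof. by rewrite /dist2 /quad /=; ring. Qed.

Lemma nsm_dist2 D k z0 : open D -> nsm D k (dist2 z0).
Proof. by move=> oD; apply: (nsmD oD); exact: nsm_quad. Qed.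

Lemma dist2_diff z0 w : differentiable (dist2 z0) w.
Proof. by apply: (nsm_diff (D := setT) (k := 0) (nsm_dist2 _ _ openT)). Qed.

Lemma pd_dist2 z0 b w : pd b (dist2 z0) w = 2 * (coord b w - coord b z0).
Proof.
have dq c a : differentiable (quad c 1 0 a) w.
  by apply: (nsm_diff (D := setT) (k := 0) (nsm_quad _ _ _ _ _ openT)).
by rewrite pdD // !pd_quad; case: b => /=; ring.
Qed.

Section Weight.
Variables (z0 : plane R) (M : R) (p : nat).

(** The exponent of the weight, strictly subharmonic away from z0. *)
Definition wexp : plane R -> R := fun w => M * (dist2 z0 w)^-1 ^+ p.

Lemma pd_wexp b w : 0 < dist2 z0 w -> differentiable wexp w /\
  pd b wexp w = - (2 * M * p%:R) *
     ((dist2 z0 w)^-1 ^+ p.+1 * (coord b w - coord b z0)).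
Proof.
move=> q0; have qn0 : dist2 z0 w != 0 by rewrite gt_eqF.
have [|dc E] := @pd_comp (fun x => M * x^-1 ^+ p)
   (- (M * p%:R) * (dist2 z0 w)^-1 ^+ p.+1) (dist2 z0) w (dist2_diff _ _).
  have di : is_derive (dist2 z0 w) (1 : R) (fun x : R => x^-1) (- (dist2 z0 w)^-1 ^+ 2).
    split; first by apply: derivableV => //; exact: derivable_id.
    by rewrite deriveV // derive_id exprVn; rewrite -[RHS]mulr1.
  have dX := is_deriveX p di.
  have := is_deriveZ M dX; rewrite exprfctE => dM.
  apply: (is_derive_eq dM); rewrite /GRing.scale /=; move: (_^-1) => y; case: (p) => [|k].
    by rewrite !mul0r !mulr0 oppr0 mul0r.
  by rewrite /= !exprS expr0; ring.
split=> //; rewrite /wexp E pd_dist2; ring.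
Qed.

Lemma nsm_wexp D k : open D -> (forall w, D w -> 0 < dist2 z0 w) -> nsm D k wexp.
Proof.
move=> oD D0; rewrite /wexp.
have nv : nsm D k (fun w => (dist2 z0 w)^-1).
  by apply: nsmV => // [w /D0 /gt_eqF ->|] //; exact: nsm_dist2.
apply: nsmM => //; first exact: nsm_cst.
elim: (p) => [|q IH]; first by apply: nsm_cst.
by under eq_fun do rewrite exprS; apply: nsmM.
Qed.

End Weight.

Lemma pd2_wexp z0 M p b w : 0 < dist2 z0 w ->
  pd b (pd b (wexp z0 M p)) w =
    4 * M * p%:R * p.+1%:R * (dist2 z0 w)^-1 ^+ p.+2 *
      ((coord b w - coord b z0) * (coord b w - coord b z0))
    - 2 * M * p%:R * (dist2 z0 w)^-1 ^+ p.+1.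
Proof.
move=> q0.
have oP : open [set w | 0 < dist2 z0 w].
  apply: (@open_comp _ _ (dist2 z0) [set x | 0 < x]) => [x _|]; last exact: open_gt.
  exact: differentiable_continuous (dist2_diff z0 x).
have oT : open [set: plane R] := openT.
rewrite (near_pd b (g := fun w => wexp z0 (- (2 * M * p%:R)) p.+1 w * quad b 0 1 (coord b z0) w)); last first.
  apply: filterS (open_nbhs_nbhs (conj oP q0)) => x x0.
  by rewrite (pd_wexp M p b x0).2 /wexp /quad; ring.
rewrite pdM; first last.
- by apply: (nsm_diff (D := setT) (k := 0) (nsm_quad _ _ _ _ _ openT)).
- exact: (pd_wexp _ _ b q0).1.
rewrite (pd_wexp _ _ b q0).2 pd_quad eqxx /wexp /quad /=.
by move: (_ ^+ p.+1) (_ ^+ p.+2) (p.+1%:R) (p%:R) => y1 y2 n1 n; ring.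
Qed.

(** The positive power p.+1 of the inverse squared distance is what dominates
    the lower-order terms in log_subharmonic_uc. *)
Lemma lap_wexp z0 M p w : 0 < dist2 z0 w ->
  lap (wexp z0 M p) w = 4 * M * p%:R * (dist2 z0 w)^-1 ^+ p.+1 * p%:R.
Proof.
move=> q0; rewrite /lap !pd2_wexp //.
have E : (dist2 z0 w)^-1 ^+ p.+2 *
    ((w.1 - z0.1) * (w.1 - z0.1) + (w.2 - z0.2) * (w.2 - z0.2)) =
    (dist2 z0 w)^-1 ^+ p.+1.
  by rewrite -dist2E exprS mulrAC mulVf ?mul1r // gt_eqF.
rewrite -E /= -[p.+1%:R]natr1 -natr1; move: (_^-1 ^+ _) (p%:R) => y n; rewrite /coord; ring.
Qed.

(** Second-order unique continuation: the hypothesis says that log u is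
    subharmonic up to terms of lower order. A maximum of u exp (M/|z|^(2p))
    over an annulus then lies on the outer circle, and M is arbitrary. *)
Lemma log_subharmonic_uc u z0 (r0 : R) : nsm setT 2 u -> (forall w, 0 <= u w) ->
  (forall rho : R, exists2 C : R, 0 <= C & forall w, csq 0 rho w ->
      pd false u w * pd false u w + pd true u w * pd true u w
      - C * u w * (`|pd false u w| + `|pd true u w|) - C * (u w * u w)
      <= u w * lap u w) ->
  0 < r0 -> (forall w, sq z0 r0 w -> u w = 0) -> forall w, u w = 0.
Proof.
move=> nu u0 hC r00 uz w1; apply/eqP; rewrite eq_le u0 andbT leNgt; apply/negP => uw.
have cu w : {for w, continuous u} by apply: nsm_continuous nu _.
have cq w : {for w, continuous (dist2 z0)} := differentiable_continuous (dist2_diff z0 w).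
pose s1 := (r0 / 2) * (r0 / 2); pose s2 := dist2 z0 w1 + 1.
have s10 : 0 < s1 by rewrite /s1; nra.
have q0 w : 0 <= dist2 z0 w by rewrite dist2E addr_ge0 // -expr2 sqr_ge0.
have s21 : 1 <= s2 by rewrite /s2 lerDr.
have s20 : 0 < s2 by apply: lt_le_trans s21.
have us1 w : dist2 z0 w <= s1 -> u w = 0.
  move=> qs; apply: uz; move: qs; rewrite dist2E /s1.
  have A (x y : R) : x * x + y * y <= r0 / 2 * (r0 / 2) -> `|x| < r0.
    by move=> H; rewrite ltr_norml; apply/andP; split; nra.
  by move=> H; split; [exact: A H|apply: A; rewrite addrC; exact: H].
pose K := [set w | s1 <= dist2 z0 w] `&` [set w | dist2 z0 w <= s2].
pose O := [set w | s1 < dist2 z0 w] `&` [set w | dist2 z0 w < s2].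
have Kbox w : K w -> forall b, `|coord b w - coord b z0| <= s2.
  move=> [_ /= qs] b; move: qs; rewrite dist2E ler_norml.
  have A (x y : R) : x * x + y * y <= s2 -> - s2 <= x <= s2.
    by move=> H; apply/andP; split; nra.
  by case: b => H; [apply: A; rewrite addrC; exact: H|exact: A H].
have cK : compact K.
  apply: (subclosed_compact _ (csq_compact (z := z0) (r := s2))).
    apply: closedI.
      by apply: (@closed_comp _ _ (dist2 z0) [set x | s1 <= x]) => [x _|];
        [exact: cq|exact: closed_ge].
    by apply: (@closed_comp _ _ (dist2 z0) [set x | x <= s2]) => [x _|];
      [exact: cq|exact: closed_le].
  by move=> w Kw; apply/coord_csq; exact: Kbox.
have oO : open O.
  apply: openI.
    by apply: (@open_comp _ _ (dist2 z0) [set x | s1 < x]) => [x _|];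
      [exact: cq|exact: open_gt].
  by apply: (@open_comp _ _ (dist2 z0) [set x | x < s2]) => [x _|];
    [exact: cq|exact: open_lt].
have Kw1 : K w1.
  split; last by rewrite /= lerDl.
  by rewrite /= leNgt; apply/negP => /ltW /us1 E; rewrite E ltxx in uw.
have [C C0 HC] := hC (`|z0| + s2).
have KC w : K w -> csq 0 (`|z0| + s2) w.
  move=> Kw; apply/coord_csq => c; rewrite (_ : coord c 0 = 0) ?subr0; last by case: (c).
  rewrite -[coord c w](subrK (coord c z0)) addrC; apply: le_trans (ler_normD _ _) _.
  by apply: lerD; [exact: coord_le|exact: Kbox].
have [m [m0 um]] := compact_bound cK (fun w _ => cu w).
pose p0 := (Num.truncn (C * s2 + 1)).+1.
have p0C : C * s2 + 1 < p0%:R by apply: truncnS_gt.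
have p01 : 1 <= p0%:R :> R by rewrite ler1n.
have s2p k : 0 < s2^-1 ^+ k by rewrite exprn_gt0 // invr_gt0.
have [d d0 Hd] : exists2 d : R, 0 < d & (dist2 z0 w1)^-1 ^+ p0 = s2^-1 ^+ p0 + d.
  exists ((dist2 z0 w1)^-1 ^+ p0 - s2^-1 ^+ p0); last by ring.
  have qw : 0 < dist2 z0 w1 by apply: lt_le_trans Kw1.1.
  rewrite subr_gt0 ltrXn2r ?invr_ge0 // ?ltW // ltf_pV2 ?posrE //.
  by rewrite /s2 ltrDl.
pose M := (C + 1) / s2^-1 ^+ p0.+1 + m / (u w1 * d) + 1.
have M1 : (C + 1) / s2^-1 ^+ p0.+1 <= M.
  rewrite /M -addrA lerDl addr_ge0 // divr_ge0 // mulr_ge0 // ltW //.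
have M2 : m < M * (u w1 * d).
  rewrite -ltr_pdivrMr ?mulr_gt0 // /M; apply: ltr_pwDr => //.
  by rewrite lerDr divr_ge0 // ?ltW //; lra.
have Mp : 0 < M.
  apply: lt_le_trans M1; rewrite divr_gt0 //; lra.
pose chi := wexp z0 M p0; pose psi w := u w * expR (chi w).
have qO w : O w -> 0 < dist2 z0 w by move=> [/(lt_trans s10)].
have qK w : K w -> 0 < dist2 z0 w by move=> [/(lt_le_trans s10)].
have dchi w : 0 < dist2 z0 w -> differentiable chi w.
  by move=> qw; exact: (pd_wexp M p0 false qw).1.
have dexp w : 0 < dist2 z0 w -> differentiable (fun x => expR (chi x)) w /\
    forall b, pd b (fun x => expR (chi x)) w = expR (chi w) * pd b chi w.
  by move=> qw; exact: (pd_comp (dchi w qw) (is_derive_expR _)).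
have du w : differentiable u w by apply: nsm_diff nu _.
have dpu b w : differentiable (pd b u) w by apply: nsm_diff (nsm_pd b nu) _.
have nchi : nsm O 2 chi by apply: nsm_wexp.
have dpchi b w : O w -> differentiable (pd b chi) w by apply: nsm_diff (nsm_pd b nchi).
have pdpsi b w : 0 < dist2 z0 w ->
    pd b psi w = expR (chi w) * (pd b u w + u w * pd b chi w).
  by move=> qw; have [de E] := dexp w qw; rewrite pdM // E; ring.
have nexp k : nsm O k (fun x => expR (chi x)).
  have nchi' l : nsm O l chi by apply: nsm_wexp.
  elim: k => [//|k IH]; split=> [w Ow|b]; first exact: (dexp w (qO w Ow)).1.
  apply: (nsm_eq (f := fun x => expR (chi x) * pd b chi x) oO) => [w Ow|].
    by rewrite (dexp w (qO w Ow)).2.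
  exact: (nsmM oO IH (nsm_pd b (nchi' k.+1))).
have npsi : nsm O 2 psi by exact: (nsmM oO (nsm_sub (@subsetT _ O) nu) (nexp 2%N)).
have OK : O `<=` K by move=> w [/ltW A /ltW B].
have [v [Kv Bv vmax]] : exists v, [/\ K v, ~ O v & forall w, K w -> psi w <= psi v].
  apply: (@max_principle R K (~` O) psi (ex_intro _ w1 Kw1) cK) => [w Kw|w Kw nnO wmax].
  - apply: differentiable_continuous.
    exact: (differentiableM (du w) (dexp w (qK w Kw)).1).
  have Ow : O w by apply: contrapT.
  have qw := qO w Ow.
  exists O; split=> // crit.
  have psiw : 0 < psi w.
    by apply: lt_le_trans (wmax w1 Kw1); rewrite mulr_gt0 // expR_gt0.
  have uwp : 0 < u w by move: psiw; rewrite pmulr_lgt0 // expR_gt0.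
  have cr b : pd b u w = - (u w * pd b chi w).
    have := crit b; rewrite pdpsi // => /eqP; rewrite mulf_eq0 gt_eqF ?expR_gt0 //=.
    by rewrite addr_eq0 => /eqP.
  have pd2 b : pd b (pd b psi) w = expR (chi w) *
      (pd b (pd b u) w - u w * (pd b chi w * pd b chi w) + u w * pd b (pd b chi) w).
    have -> : pd b (pd b psi) w =
        pd b (fun x => expR (chi x) * (pd b u x + u x * pd b chi x)) w.
      apply: near_pd; apply: filterS (open_nbhs_nbhs (conj oO Ow)) => x Ox.
      exact/pdpsi/qO.
    have [de E] := dexp w qw.
    have dm : differentiable (fun x => u x * pd b chi x) w.
      exact: (differentiableM (du w) (dpchi b w Ow)).
    have ds : differentiable (fun x => pd b u x + u x * pd b chi x) w :=
      differentiableD (dpu b w) dm.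
    rewrite (pdM b de ds) E (pdD b (dpu b w) dm) (pdM b (du w) (dpchi b w Ow)) cr.
    by move: (expR _) (u w) (pd b chi w) (pd b (pd b u) w) (pd b (pd b chi) w)
      => x1 x2 x3 x4 x5; ring.
  have -> : lap psi w = expR (chi w) * (lap u w - u w * (pd false chi w * pd false chi w
      + pd true chi w * pd true chi w) + u w * lap chi w).
    rewrite /lap !pd2; move: (expR _) (u w) (pd false (pd false u) w)
      (pd true (pd true u) w) (pd false (pd false chi) w) (pd true (pd true chi) w)
      (pd false chi w) (pd true chi w) => x1 x2 x3 x4 x5 x6 x7 x8; ring.
  rewrite mulr_gt0 ?expR_gt0 // -(pmulr_rgt0 _ uwp).
  have := HC w (KC w Kw); rewrite !cr !normrN !normrM (gtr0_norm uwp).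
  rewrite lap_wexp // /chi.
  have bx b : `|pd b (wexp z0 M p0) w| <= 2 * M * p0%:R * (dist2 z0 w)^-1 ^+ p0.+1 * s2.
    have c0 : 0 <= 2 * M * p0%:R by rewrite mulr_ge0 // mulr_ge0 // ltW.
    have y0 : 0 <= (dist2 z0 w)^-1 ^+ p0.+1 by rewrite exprn_ge0 // invr_ge0.
    rewrite (pd_wexp M p0 b qw).2 normrM normrN (ger0_norm c0) normrM (ger0_norm y0).
    by rewrite mulrA; apply: ler_wpM2l; [exact: mulr_ge0|exact: Kbox].
  have By : (C + 1) <= M * (dist2 z0 w)^-1 ^+ p0.+1.
    rewrite -ler_pdivrMr; last by rewrite exprn_gt0 // invr_gt0.
    apply: le_trans M1; apply: ler_wpM2l; first by lra.
    rewrite lef_pV2 ?posrE ?exprn_gt0 ?invr_gt0 //.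
    have yi : s2^-1 <= (dist2 z0 w)^-1 by rewrite lef_pV2 ?posrE //; exact: ltW Ow.2.
    by apply: lerXn2r => //; rewrite nnegrE invr_ge0 // ltW.
  move: (bx false) (bx true) By.
  move: (pd false _ w) (pd true _ w) (lap u w) ((dist2 z0 w)^-1 ^+ p0.+1) => X Y L Q bX bY By.
  move: p0C p01; move: (p0%:R) bX bY => P bX bY PC P1 H.
  have U0 : 0 < u w * u w by rewrite mulr_gt0.
  have main : 0 < u w * u w * (4 * M * P * Q * P - C * (`|X| + `|Y|) - C).
    rewrite mulr_gt0 //.
    have S : `|X| + `|Y| <= 4 * M * P * Q * s2 by lra.
    have CS : C * (`|X| + `|Y|) <= C * (4 * M * P * Q * s2) by apply: ler_wpM2l.
    have C1 : 0 <= C + 1 by rewrite addr_ge0.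
    have MQ : 0 <= M * Q by apply: le_trans By.
    have T : C + 1 <= P * (M * Q) by apply: le_trans By _; exact: ler_peMl.
    have PC1 : 1 <= P - C * s2 by rewrite lerBrDl; exact: ltW.
    have TT : (C + 1) * 1 <= P * (M * Q) * (P - C * s2) by apply: ler_pM.
    have EE : 4 * M * P * Q * P - C * (4 * M * P * Q * s2) = 4 * (P * (M * Q) * (P - C * s2)).
      by ring.
    lra.
  apply: lt_le_trans main _.
  rewrite -subr_ge0; move: H; rewrite -subr_ge0; set E1 := (X in 0 <= X) => E10.
  rewrite (_ : _ - _ = E1) // /E1; ring.
have [vs1|vs1] := leP (dist2 z0 v) s1.
  have := vmax w1 Kw1; rewrite /psi (us1 v vs1) mul0r leNgt => /negP; apply.
  by rewrite mulr_gt0 // expR_gt0.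
have vs2 : dist2 z0 v = s2.
  apply/eqP; rewrite eq_le Kv.2 leNgt /=; apply/negP => lt; exact: Bv.
have := vmax w1 Kw1; rewrite /psi /chi /wexp vs2 Hd mulrDr expRD mulrA mulrAC.
apply/negP; rewrite -ltNge ltr_pM2r ?expR_gt0 //.
apply: le_lt_trans (ler_norm _) _; apply: le_lt_trans (um v Kv) _.
apply: (lt_le_trans M2); rewrite mulrCA ler_pM2l //.
by apply: le_trans (expR_ge1Dx _); lra.
Qed.

End UniqueContinuation.

(** * The Poincare lemma in the plane *)

Section Primitive.
Variable R : realType.
Local Notation mu := (@lebesgue_measure R).
Implicit Types (f F : R -> R).

Lemma mean_value_le F (dF : R -> R) (C x y : R) :
  (forall s, x <= s <= y -> is_derive s (1 : R) F (dF s)) ->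
  (forall s, x <= s <= y -> `|dF s| <= C) -> x <= y -> `|F y - F x| <= C * (y - x).
Proof.
move=> HF HC xy; have [||s] := @MVT_segment R F dF x y xy.
- by move=> s; rewrite in_itv /= => /andP[sx sy]; apply: HF; rewrite !ltW.
- apply: derivable_within_continuous => s; rewrite in_itv /= => sxy.
  by have [] := HF s sxy.
rewrite in_itv /= => sxy ->; rewrite normrM (ger0_norm (x := y - x)) ?subr_ge0 //.
by apply: ler_wpM2r; [rewrite subr_ge0|exact: HC].
Qed.

Lemma mean_value_le0 F (dF : R -> R) (C x : R) :
  (forall s, is_derive s (1 : R) F (dF s)) ->
  (forall s, `|s| <= `|x| -> `|dF s| <= C) -> `|F x - F 0| <= C * `|x|.
Proof.
move=> HF HC; have [x0|x0] := leP 0 x.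
  rewrite (ger0_norm x0) -[X in C * X]subr0; apply: (mean_value_le (dF := dF)) => // s /andP[s0 sx].
  by apply: HC; rewrite !ger0_norm.
rewrite distrC (ltr0_norm x0) -[X in C * X]sub0r; apply: (mean_value_le (dF := dF)) => //; last exact: ltW.
by move=> s /andP[s0 sx]; apply: HC; rewrite (ltr0_norm x0) ler0_norm ?lerN2.
Qed.

Let G a f (x : R) : R := (\int[mu]_(t in `[a, x]) f t)%R.

Let GP f (a x : R) : continuous f -> a < x -> is_derive x (1 : R) (G a f) (f x).
Proof.
move=> cf ax; have xu : x < x + 1 by rewrite ltrDl.
have fi : mu.-integrable `[a, x + 1] (EFin \o f).
  apply: continuous_compact_integrable; first exact: segment_compact.
  exact: continuous_subspaceT.
have [dG] := continuous_FTC1_closed xu fi ax (cf x).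
by rewrite derive1E => E; split.
Qed.

Definition prim f (x : R) : R := G (- (`|x| + 1)) f x - G (- (`|x| + 1)) f 0.

Let prim_base f (a x : R) : continuous f -> a < x -> a < 0 ->
  prim f x = G a f x - G a f 0.
Proof.
move=> cf ax a0; rewrite /prim; set b := - (`|x| + 1).
have b0 : b < 0 by rewrite oppr_lt0 ltr_wpDl.
have bx : b < x by have := ler_norm (- x); rewrite normrN /b => ?; lra.
pose c := Num.max a b.
pose D t := G b f t - G a f t.
have dD t : c < t -> is_derive t (1 : R) D 0.
  rewrite gt_max => /andP[at_ bt]; rewrite -(subrr (f t)).
  exact: (is_deriveB (GP cf bt) (GP cf at_)).
have eqD s t : c < s -> s <= t -> D t = D s.
  move=> cs st; apply/subr0_eq/eqP; rewrite -normr_le0 -(mul0r (t - s)).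
  apply: (mean_value_le (dF := fun=> 0)) => // u /andP[su _]; last by rewrite normr0.
  by apply: dD; apply: lt_le_trans su.
have c0 : c < 0 by rewrite gt_max a0.
have cx : c < x by rewrite gt_max ax.
suff : D x = D 0 by rewrite /D => ?; lra.
by case: (leP 0 x) => [x0|/ltW x0]; [apply: eqD|apply/esym/eqD].
Qed.

Lemma prim_derive f (x : R) : continuous f -> is_derive x (1 : R) (prim f) (f x).
Proof.
move=> cf; pose a := - (`|x| + 2).
have a0 : a < 0 by rewrite oppr_lt0 ltr_wpDl.
have ax : a + 1 < x by have := ler_norm (- x); rewrite normrN /a => ?; lra.
have ax' : a < x by lra.
apply: (@near_eq_is_derive _ _ _ (fun y => G a f y - G a f 0)).
  apply: (filterS _ (open_nbhs_nbhs (conj (@open_gt R a) ax'))) => y ay.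
  exact/esym/prim_base.
rewrite -[f x]subr0; apply: is_deriveB; exact: GP.
Qed.

Lemma prim0 f : prim f 0 = 0.
Proof. by rewrite /prim subrr. Qed.

End Primitive.

Section Poincare.
Variable R : realType.
Implicit Types (f g a c : plane R -> R) (z w h : plane R).

Lemma differentiable_of_partials f a c :
  (forall x y : R, is_derive x (1 : R) (fun s => f (s, y)) (a (x, y))) ->
  (forall x y : R, is_derive y (1 : R) (fun s => f (x, s)) (c (x, y))) ->
  continuous a -> continuous c ->
  forall z, differentiable f z /\ pd false f z = a z /\ pd true f z = c z.
Proof.
move=> fa fc ca cc [x y].
have [|df dp] := @differentiable_eps R f (x, y) (a (x, y)) (c (x, y)); last first.
  by split=> //; rewrite !dp.
move=> e e0; have e2 : 0 < e / 2 by lra.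
have near_c (k : plane R -> R) : continuous k -> exists2 r : R, 0 < r &
    forall w, sq (x, y) r w -> `|k w - k (x, y)| <= e / 2.
  move=> ck; have /cvgrPdist_le /(_ _ e2) := ck (x, y).
  move=> /nbhs_sqP [r r0 H]; exists r => // w /H; by rewrite distrC.
have [r1 r10 H1] := near_c a ca; have [r2 r20 H2] := near_c c cc.
apply/nbhs_sqP; exists (Num.min r1 r2); first by rewrite lt_min r10.
move=> [h1 h2] [] /=; rewrite !subr0 !lt_min => /andP[ha hb] /andP[ka kb].
have mv (k dk : R -> R) (u v m : R) : (forall s, is_derive s (1 : R) k (dk s)) ->
    (forall s, `|s - u| <= `|v| -> `|dk s - m| <= e / 2) ->
    `|k (v + u) - k u - m * v| <= e / 2 * `|v|.
  move=> Hk Hm; pose F s := k (s + u) - k u - m * s.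
  have -> : k (v + u) - k u - m * v = F v - F 0.
    by rewrite /F add0r; ring.
  apply: (mean_value_le0 (dF := fun s => dk (s + u) - m)) => [s|s sv].
    have dks : is_derive s (1 : R) (fun s => k (s + u)) (dk (s + u)).
      have [d1 <-] := Hk (s + u).
      have E : (fun t : R => t^-1 *: (k (t *: 1 + s + u) - k (s + u))) =
               (fun t : R => t^-1 *: (k (t *: 1 + (s + u)) - k (s + u))).
        by apply/funext => t; rewrite addrA.
      by split; rewrite /derivable /derive E.
    have d0 : is_derive s (1 : R) (fun=> k u) 0 by exact: is_derive_cst.
    have dm : is_derive s (1 : R) (fun s : R => m * s) m.
      rewrite -[X in is_derive _ _ _ X]mulr1; exact: (is_deriveZ m (is_derive_id s (1 : R))).
    have := is_deriveB (is_deriveB dks d0) dm; rewrite subr0; exact.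
  by apply: Hm; rewrite addrK.
have A : `|f (h1 + x, h2 + y) - f (x, h2 + y) - a (x, y) * h1| <= e / 2 * `|h1|.
  apply: (mv (fun s => f (s, h2 + y)) (fun s => a (s, h2 + y))) => // s sv.
  by apply: H1; split=> /=; rewrite ?addrK //; exact: le_lt_trans sv ha.
have B : `|f (x, h2 + y) - f (x, y) - c (x, y) * h2| <= e / 2 * `|h2|.
  apply: (mv (fun s => f (x, s)) (fun s => c (x, s))) => // s sv.
  by apply: H2; split=> /=; rewrite ?subrr ?normr0 //; exact: le_lt_trans sv kb.
have := norm_fst_le ((h1, h2) : plane R); have := norm_snd_le ((h1, h2) : plane R).
rewrite -[((h1, h2) : plane R) + (x, y)]/(h1 + x, h2 + y) /linform /=.
move: (`|(h1, h2)|) A B; move: (f _) (f _) (f _) (a _) (c _) => p q r s t n A B Hb Ha.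
rewrite (_ : _ - _ = (r - q - s * h1) + (q - p - t * h2)); last by ring.
apply: le_trans (ler_normD _ _) _; apply: le_trans (lerD A B) _.
rewrite (_ : e * n = e / 2 * n + e / 2 * n); last by field.
by apply: lerD; (apply: ler_wpM2l; [exact: ltW|]).
Qed.

(** The primitive is an integral along two segments parallel to the axes;
    closedness serves to differentiate under the integral sign. *)
Lemma poincare a c : nsm setT 3 a -> nsm setT 3 c ->
  (forall z, pd true a z = pd false c z) ->
  exists2 f, (forall z, differentiable f z) &
    forall z, pd false f z = a z /\ pd true f z = c z.
Proof.
move=> na nc clos.
have slice k b : nsm setT 1 k -> forall x y : R,
    is_derive x (1 : R) (fun s => k (if b then (y, s) else (s, y)))
      (pd b k (if b then (y, x) else (x, y))).
  move=> nk x y; have dk : differentiable k (if b then (y, x) else (x, y)).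
    exact: nsm_diff nk _.
  have Ez (s : R) : (if b then (y, s) else (s, y)) = s *: axis R b + (if b then (y, 0) else (0, y)).
    by case: (b); congr (_, _); rewrite /= /GRing.scale /=; ring.
  rewrite pdE Ez; under eq_fun do rewrite Ez.
  by apply: is_derive_line; rewrite -Ez; exact: diff_derivable.
have cts (k : plane R -> R) : nsm setT 1 k -> continuous k.
  by move=> nk z; exact: nsm_continuous nk _.
have slice_c k : nsm setT 1 k -> (forall y, continuous (fun s : R => k (s, y))) /\
    (forall x, continuous (fun s : R => k (x, s))).
  move=> nk; split=> y s; apply: differentiable_continuous; apply/derivable1_diffP.
    by have [] := slice k false nk s y.
  by have [] := slice k true nk s y.
have na1 : nsm setT 1 a by exact: nsm_le na.
have nc1 : nsm setT 1 c by exact: nsm_le nc.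
have [P [dP P0]] : exists P : (R -> R) -> R -> R,
    (forall k x, continuous k -> is_derive x (1 : R) (P k) (k x)) /\
    forall k, P k 0 = 0.
  by exists (@prim R); split=> [k x ck|k]; [exact: prim_derive|exact: prim0].
pose g := P (fun s => c (0, s)).
pose A (x y : R) := P (fun s => a (s, y)) x.
pose f (z : plane R) := A z.1 z.2 + g z.2.
have Ax x y : is_derive x (1 : R) (fun s => A s y) (a (x, y)).
  by apply: (dP (fun s => a (s, y))); exact: (slice_c a na1).1.
have gy y : is_derive y (1 : R) g (c (0, y)).
  by apply: (dP (fun s => c (0, s))); exact: (slice_c c nc1).2.
have fx x y : is_derive x (1 : R) (fun s => f (s, y)) (a (x, y)).
  rewrite -[a _]addr0.
  exact: (is_deriveD (Ax x y) (is_derive_cst (g y) x (1 : R))).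
have fy x y : is_derive y (1 : R) (fun s => f (x, s)) (c (x, y)).
  suff Ay : is_derive y (1 : R) (A x) (c (x, y) - c (0, y)).
    by rewrite -[c (x, y)](subrK (c (0, y))); exact: (is_deriveD Ay (gy y)).
  (* Bound on the second derivative of a on a box around the segment. *)
  pose r := `|x| + `|y| + 1.
  have [C [C0 HC]] := compact_bound (f := pd true (pd true a))
    (csq_compact (z := (0 : plane R)) (r := r)) (fun w _ => cts _ (nsm_pd true (nsm_pd true na)) w).
  have key (h : R) : `|h| <= 1 ->
      `|A x (y + h) - A x y - h * (c (x, y) - c (0, y))| <= C * (`|h| * `|h|) * `|x|.
    move=> h1; pose F s := A s (y + h) - A s y - h * (c (s, y) - c (0, y)).
    have F0 : F 0 = 0 by rewrite /F /A !P0 !subrr mulr0 subrr.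
    have -> : A x (y + h) - A x y - h * (c (x, y) - c (0, y)) = F x - F 0.
      by rewrite F0 subr0.
    have dF (s : R) : is_derive s (1 : R) F
        (a (s, y + h) - a (s, y) - h * (pd false c (s, y) - 0)).
      exact: (is_deriveB (is_deriveB (Ax s (y + h)) (Ax s y))
        (is_deriveZ h (is_deriveB (slice c false nc1 s y)
          (is_derive_cst (c (0, y)) s (1 : R))))).
    apply: mean_value_le0 dF _ => s sx; rewrite subr0 -clos.
    have dy (k : plane R -> R) (t : R) : nsm setT 1 k -> is_derive t (1 : R) (fun v => k (s, v)) (pd true k (s, t)).
      by move=> nk; exact: (slice k true nk t s).
    have mono (k dk : R -> R) (m D : R) : (forall t, is_derive t (1 : R) k (dk t)) ->
        (forall t, `|t - y| <= `|h| -> `|dk t - m| <= D) -> `|k (y + h) - k y - h * m| <= D * `|h|.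
      move=> Hk Hm; pose K t := k t - m * t.
      have dK (t : R) : is_derive t (1 : R) K (dk t - m).
        rewrite -[m in _ - m]mulr1.
        exact: (is_deriveB (Hk t) (is_deriveZ m (is_derive_id t (1 : R)))).
      have -> : k (y + h) - k y - h * m = K (y + h) - K y by rewrite /K; ring.
      have [h0|h0] := leP 0 h.
        rewrite (ger0_norm h0) [X in D * X](_ : h = y + h - y); last by ring.
        apply: (mean_value_le (dF := fun t => dk t - m)) => //.
          move=> t /andP[ty th]; apply: Hm; rewrite !ger0_norm ?subr_ge0 //; lra.
        by rewrite lerDl.
      rewrite distrC (ltr0_norm h0) [X in D * X](_ : - h = y - (y + h)); last by ring.
      apply: (mean_value_le (dF := fun t => dk t - m)) => //.
        move=> t /andP[ty th]; apply: Hm; rewrite (ltr0_norm h0) ler0_norm ?subr_le0 //; lra.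
      by rewrite gerDl ltW.
    rewrite mulrA; apply: (mono (fun t => a (s, t)) (fun t => pd true a (s, t)) _ (C * `|h|)).
      by move=> t; exact: (slice a true na1 t s).
    move=> t ty; have dpa (u : R) := slice (pd true a) true (nsm_le (leqnSn 1) (nsm_pd true na)) u s.
    have box (u : R) : `|u - y| <= `|h| -> `|pd true (pd true a) (s, u)| <= C.
      move=> uy; apply: HC; split=> /=; rewrite subr0 /r.
        by apply: le_trans sx _; have := normr_ge0 y; lra.
      rewrite -[u](subrK y); apply: le_trans (ler_normD _ _) _.
      by have := normr_ge0 x; lra.
    have [yt|yt] := leP y t.
      apply: (@le_trans _ _ (C * (t - y))); last first.
        by apply: ler_wpM2l => //; apply: le_trans (ler_norm _) ty.
      apply: (mean_value_le (dF := fun u => pd true (pd true a) (s, u))) => // u /andP[uy ut].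
      by apply: box; apply: le_trans ty; rewrite !ger0_norm ?subr_ge0 //; lra.
    rewrite distrC; apply: (@le_trans _ _ (C * (y - t))); last first.
      by apply: ler_wpM2l => //; apply: le_trans (ler_norm _) _; rewrite distrC.
    apply: (mean_value_le (dF := fun u => pd true (pd true a) (s, u))) => //; last exact: ltW.
    move=> u /andP[uy ut].
    by apply: box; apply: le_trans ty; rewrite !ler0_norm ?subr_le0 //; lra.
  have lim : (fun h : R => h^-1 *: (A x (h *: 1 + y) - A x y)) @ 0^' --> c (x, y) - c (0, y).
    apply/cvgrPdist_le => e e0; pose k := C * `|x| + 1.
    have k0 : 0 < k by rewrite ltr_wpDl // mulr_ge0.
    near=> h; have h0 : h != 0 by near: h; exact: nbhs_dnbhs_neq.
    have h1 : `|h| < Num.min 1 (e / k).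
      near: h; apply: dnbhs0_lt; by rewrite lt_min ltr01 divr_gt0.
    move: h1; rewrite lt_min => /andP[/ltW h1 he].
    have := key h h1; rewrite [h *: 1 + y]addrC (_ : h *: 1 = h); last first.
      by rewrite /GRing.scale /= mulr1.
    move: (A x (y + h)) (A x y) (c (x, y) - c (0, y)) => p q m H.
    have hp : 0 < `|h| by rewrite normr_gt0.
    rewrite distrC -(ler_pM2l hp) -normrM mulrBr /GRing.scale /= mulVKf //.
    apply: le_trans H _; rewrite mulrAC mulrA [C * `|x| * _ * _]mulrC; apply: ler_wpM2l => //.
    move: he; rewrite ltr_pdivlMr // /k => he; apply: ltW; apply: le_lt_trans he.
    by rewrite [_ * `|h|]mulrC; apply: ler_wpM2l => //; rewrite lerDl.
  by split; [apply/cvg_ex; exists (c (x, y) - c (0, y))|apply/cvg_lim].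
have Q := differentiable_of_partials fx fy (cts a na1) (cts c nc1).
by exists f => z; have [? ?] := Q z.
Unshelve. all: by end_near.
Qed.

End Poincare.

(** * Wirtinger calculus for complex functions *)

Section ComplexCalculus.
Variable R : realType.
Local Notation C := R[i].
Local Notation Re := complex.Re.
Local Notation Im := complex.Im.
Implicit Types (f g : plane R -> C) (z w : plane R) (D : set (plane R)).

Lemma complex_eq (x y : C) : Re x = Re y -> Im x = Im y -> x = y.
Proof. by case: x y => [a b] [c d] /= -> ->. Qed.

Lemma ReD (x y : C) : Re (x + y) = Re x + Re y. Proof. by case: x y => [a b] []. Qed.
Lemma ImD (x y : C) : Im (x + y) = Im x + Im y. Proof. by case: x y => [a b] []. Qed.
Lemma ReN (x : C) : Re (- x) = - Re x. Proof. by case: x. Qed.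
Lemma ImN (x : C) : Im (- x) = - Im x. Proof. by case: x. Qed.
Lemma ReM (x y : C) : Re (x * y) = Re x * Re y - Im x * Im y.
Proof. by case: x y => [a b] []. Qed.
Lemma ImM (x y : C) : Im (x * y) = Re x * Im y + Im x * Re y.
Proof. by case: x y => [a b] [c d] /=; rewrite addrC. Qed.
Lemma conjE (x : C) : Num.conj x = Re x +i* - Im x.
Proof. by case: x. Qed.
Lemma ReJ (x : C) : Re (Num.conj x) = Re x. Proof. by rewrite conjE. Qed.
Lemma ImJ (x : C) : Im (Num.conj x) = - Im x. Proof. by rewrite conjE. Qed.
Lemma ReV (x : C) : Re x^-1 = Re x / (Re x * Re x + Im x * Im x).
Proof. by case: x => a b; rewrite -!expr2. Qed.
Lemma ImV (x : C) : Im x^-1 = - Im x / (Re x * Re x + Im x * Im x).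
Proof. by case: x => a b; rewrite -!expr2 mulNr. Qed.
Lemma normsq_neq0 (x : C) : x != 0 -> Re x * Re x + Im x * Im x != 0.
Proof.
move=> x0; rewrite -!expr2; apply: contraNneq x0 => /eqP.
by rewrite paddr_eq0 ?sqr_ge0 // !sqrf_eq0 => /andP[/eqP ? /eqP ?]; apply/eqP/complex_eq.
Qed.

Definition cdiff f z := differentiable (fun x => Re (f x)) z /\
                        differentiable (fun x => Im (f x)) z.

Definition csm D k f := nsm D k (fun x => Re (f x)) /\ nsm D k (fun x => Im (f x)).

Definition cpd b f z : C :=
  pd b (fun x => Re (f x)) z +i* pd b (fun x => Im (f x)) z.

Lemma csm_cdiff D k f z : csm D k.+1 f -> D z -> cdiff f z.
Proof. by move=> [n1 n2] Dz; split; [exact: nsm_diff n1 Dz|exact: nsm_diff n2 Dz]. Qed.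

Lemma csm_sub D D' k f : D' `<=` D -> csm D k f -> csm D' k f.
Proof. by move=> s [n1 n2]; split; apply: nsm_sub s _. Qed.

Lemma csm_le D j k f : (j <= k)%N -> csm D k f -> csm D j f.
Proof. by move=> s [n1 n2]; split; apply: nsm_le s _. Qed.

Lemma csm_eq D k f g : open D -> (forall z, D z -> f z = g z) -> csm D k f -> csm D k g.
Proof.
by move=> oD fg [n1 n2]; split; [apply: nsm_eq n1|apply: nsm_eq n2] => // z /fg ->.
Qed.

Lemma csm_cst D k (c : C) : csm D k (fun=> c).
Proof. by split; exact: nsm_cst. Qed.

Lemma csmD D k f g : open D -> csm D k f -> csm D k g -> csm D k (fun x => f x + g x).
Proof.
move=> oD [f1 f2] [g1 g2]; split.
  by under eq_fun do rewrite ReD; exact: nsmD.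
by under eq_fun do rewrite ImD; exact: nsmD.
Qed.

Lemma csmN D k f : open D -> csm D k f -> csm D k (fun x => - f x).
Proof.
move=> oD [f1 f2]; split.
  by under eq_fun do rewrite ReN; exact: nsmN.
by under eq_fun do rewrite ImN; exact: nsmN.
Qed.

Lemma csmM D k f g : open D -> csm D k f -> csm D k g -> csm D k (fun x => f x * g x).
Proof.
move=> oD [f1 f2] [g1 g2]; split.
  by under eq_fun do rewrite ReM; exact: (nsmB oD (nsmM oD f1 g1) (nsmM oD f2 g2)).
by under eq_fun do rewrite ImM; exact: (nsmD oD (nsmM oD f1 g2) (nsmM oD f2 g1)).
Qed.

Lemma csmJ D k f : open D -> csm D k f -> csm D k (fun x => Num.conj (f x)).
Proof.
move=> oD [f1 f2]; split.
  by under eq_fun do rewrite ReJ.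
by under eq_fun do rewrite ImJ; exact: nsmN.
Qed.

Lemma csmV D k f : open D -> (forall z, D z -> f z != 0) -> csm D k f ->
  csm D k (fun x => (f x)^-1).
Proof.
move=> oD f0 [f1 f2].
have nv : nsm D k (fun x => (Re (f x) * Re (f x) + Im (f x) * Im (f x))^-1).
  apply: (nsmV oD) => [z /f0 /normsq_neq0 //|].
  exact: (nsmD oD (nsmM oD f1 f1) (nsmM oD f2 f2)).
split; first by under eq_fun do rewrite ReV; exact: (nsmM oD f1 nv).
by under eq_fun do rewrite ImV; exact: (nsmM oD (nsmN oD f2) nv).
Qed.

Lemma csm_sum D k (I : Type) (r : seq I) (P : pred I) (F : I -> plane R -> C) : open D ->
  (forall i, csm D k (F i)) -> csm D k (fun x => \sum_(i <- r | P i) F i x).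
Proof.
move=> oD nF; elim: r => [|i r IH].
  by under eq_fun do rewrite big_nil; exact: csm_cst.
under eq_fun do rewrite big_cons.
by case: (P i) => //; apply: csmD.
Qed.

Lemma csm_prod D k (I : Type) (r : seq I) (P : pred I) (F : I -> plane R -> C) : open D ->
  (forall i, csm D k (F i)) -> csm D k (fun x => \prod_(i <- r | P i) F i x).
Proof.
move=> oD nF; elim: r => [|i r IH].
  by under eq_fun do rewrite big_nil; exact: csm_cst.
under eq_fun do rewrite big_cons.
by case: (P i) => //; apply: csmM.
Qed.

Lemma cdiffD f g z : cdiff f z -> cdiff g z -> cdiff (fun x => f x + g x) z.
Proof.
move=> [f1 f2] [g1 g2]; split.
  by under eq_fun do rewrite ReD; exact: differentiableD.
by under eq_fun do rewrite ImD; exact: differentiableD.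
Qed.

Lemma cdiffM f g z : cdiff f z -> cdiff g z -> cdiff (fun x => f x * g x) z.
Proof.
move=> [f1 f2] [g1 g2]; split.
  by under eq_fun do rewrite ReM;
    exact: (differentiableB (differentiableM f1 g1) (differentiableM f2 g2)).
by under eq_fun do rewrite ImM;
  exact: (differentiableD (differentiableM f1 g2) (differentiableM f2 g1)).
Qed.

Lemma cdiffJ f z : cdiff f z -> cdiff (fun x => Num.conj (f x)) z.
Proof.
move=> [f1 f2]; split; first by under eq_fun do rewrite ReJ.
by under eq_fun do rewrite ImJ; exact: differentiableN.
Qed.

Lemma cdiff_cst (c : C) z : cdiff (fun=> c) z.
Proof. by split; exact: differentiable_cst. Qed.

Lemma cpdD b f g z : cdiff f z -> cdiff g z ->
  cpd b (fun x => f x + g x) z = cpd b f z + cpd b g z.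
Proof.
move=> [f1 f2] [g1 g2]; apply: complex_eq; rewrite ?ReD ?ImD /cpd /=.
  by under eq_fun do rewrite ReD; exact: pdD.
by under eq_fun do rewrite ImD; exact: pdD.
Qed.

Lemma cpdM b f g z : cdiff f z -> cdiff g z ->
  cpd b (fun x => f x * g x) z = cpd b f z * g z + f z * cpd b g z.
Proof.
move=> [f1 f2] [g1 g2]; apply: complex_eq; rewrite ?ReD ?ImD ?ReM ?ImM /cpd /=.
  under eq_fun do rewrite ReM.
  rewrite (pdD b (differentiableM f1 g1) (differentiableN (differentiableM f2 g2))).
  rewrite (pdN b (differentiableM f2 g2)) (pdM b f1 g1) (pdM b f2 g2).
  by move: (pd b _ z) (pd b _ z) (pd b _ z) (pd b _ z) => p1 p2 p3 p4; ring.
under eq_fun do rewrite ImM.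
rewrite (pdD b (differentiableM f1 g2) (differentiableM f2 g1)).
rewrite (pdM b f1 g2) (pdM b f2 g1).
by move: (pd b _ z) (pd b _ z) (pd b _ z) (pd b _ z) => p1 p2 p3 p4; ring.
Qed.

Lemma cpdJ b f z : cdiff f z -> cpd b (fun x => Num.conj (f x)) z = Num.conj (cpd b f z).
Proof.
move=> [f1 f2]; apply: complex_eq; rewrite ?ReJ ?ImJ /cpd /=.
  by under eq_fun do rewrite ReJ.
by under eq_fun do rewrite ImJ; rewrite pdN.
Qed.

Lemma cpd_cst b (c : C) z : cpd b (fun=> c) z = 0.
Proof. by rewrite /cpd !pd_cst. Qed.

Lemma near_cpd b f g z : (\forall x \near z, f x = g x) -> cpd b f z = cpd b g z.
Proof.
by move=> fg; congr (_ +i* _); apply: near_pd; apply: filterS fg => x ->.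
Qed.

Lemma csm_cpd D k b f : csm D k.+1 f -> csm D k (cpd b f).
Proof. by move=> [f1 f2]; split; exact: nsm_pd. Qed.

Lemma cpdC D b f z : open D -> D z -> csm D 2 f ->
  cpd b (cpd (~~ b) f) z = cpd (~~ b) (cpd b f) z.
Proof.
by move=> oD Dz [f1 f2]; congr (_ +i* _); apply: (pdC b oD Dz).
Qed.

(** The coefficient of the second partial derivative in wirtinger s. *)
Definition wc (s : bool) : C := - ((-1) ^+ s * 'i).

Lemma wcJ s : Num.conj (wc s) = wc (~~ s).
Proof.
have J : Num.conj ('i : C) = - 'i by apply: complex_eq; rewrite ?ReJ ?ImJ /= ?oppr0.
rewrite /wc rmorphN rmorphM rmorph_sign /= J.
by case: s; rewrite /= ?expr0 ?expr1 ?mul1r ?mulN1r ?opprK.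
Qed.

Lemma wc_sqr s : wc s * wc s = -1.
Proof.
by rewrite /wc mulrNN mulrACA -!expr2 sqr_i -exprM mulnC exprM sqrrN expr1n expr1n mul1r.
Qed.

Lemma wc_neg s : wc (~~ s) = - wc s.
Proof. by rewrite /wc; case: s; rewrite /= ?expr0 ?expr1 mulN1r ?opprK mul1r. Qed.

Lemma wirtingerE s f z : wirtinger s f z = 2^-1 * (cpd false f z + wc s * cpd true f z).
Proof. by rewrite /wirtinger /cderive /cpd /wc mulNr !pdE. Qed.

Lemma wirtD s f g z : cdiff f z -> cdiff g z ->
  wirtinger s (fun x => f x + g x) z = wirtinger s f z + wirtinger s g z.
Proof.
move=> df dg; rewrite !wirtingerE !(cpdD _ df dg).
by move: (cpd _ _ _) (cpd _ _ _) (cpd _ _ _) (cpd _ _ _) => a b c d; ring.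
Qed.

Lemma wirtM s f g z : cdiff f z -> cdiff g z ->
  wirtinger s (fun x => f x * g x) z = wirtinger s f z * g z + f z * wirtinger s g z.
Proof.
move=> df dg; rewrite !wirtingerE !(cpdM _ df dg).
by move: (cpd _ _ _) (cpd _ _ _) (cpd _ _ _) (cpd _ _ _) => a b c d; ring.
Qed.

Lemma wirt_cst s (c : C) z : wirtinger s (fun=> c) z = 0.
Proof. by rewrite wirtingerE !cpd_cst mulr0 addr0 mulr0. Qed.

Lemma wirtN s f z : cdiff f z -> wirtinger s (fun x => - f x) z = - wirtinger s f z.
Proof.
move=> df; under eq_fun do rewrite -mulN1r.
by rewrite (wirtM s (cdiff_cst _ _) df) wirt_cst mul0r add0r mulN1r.
Qed.

Lemma wirtJ s f z : cdiff f z ->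
  wirtinger s (fun x => Num.conj (f x)) z = Num.conj (wirtinger (~~ s) f z).
Proof.
move=> df; rewrite !wirtingerE !(cpdJ _ df) rmorphM rmorphD rmorphM /= wcJ negbK.
by rewrite fmorphV rmorph_nat.
Qed.

Lemma near_wirt s f g z : (\forall x \near z, f x = g x) -> wirtinger s f z = wirtinger s g z.
Proof. by move=> fg; rewrite !wirtingerE !(near_cpd _ fg). Qed.

Lemma csm_wirt D k s f : open D -> csm D k.+1 f -> csm D k (wirtinger s f).
Proof.
move=> oD nf; have -> : wirtinger s f = fun z => 2^-1 * (cpd false f z + wc s * cpd true f z).
  by apply/funext => z; exact: wirtingerE.
have n1 := csm_cpd false nf; have n2 := csm_cpd true nf.
exact: (csmM oD (csm_cst D k _) (csmD oD n1 (csmM oD (csm_cst D k _) n2))).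
Qed.

Lemma wirt_wirt D s t f z : open D -> D z -> csm D 2 f ->
  wirtinger s (wirtinger t f) z = 4^-1 * (cpd false (cpd false f) z
   + (wc s + wc t) * cpd false (cpd true f) z + wc s * wc t * cpd true (cpd true f) z).
Proof.
move=> oD Dz nf.
have d b : cdiff (cpd b f) z by exact: csm_cdiff (csm_cpd b nf) Dz.
have dc (c : C) : cdiff (fun=> c) z by exact: cdiff_cst.
have dt := cdiffM (dc (wc t)) (d true).
have E b : cpd b (wirtinger t f) z =
    2^-1 * (cpd b (cpd false f) z + wc t * cpd b (cpd true f) z).
  have -> : wirtinger t f = fun z => 2^-1 * (cpd false f z + wc t * cpd true f z).
    by apply/funext => x; exact: wirtingerE.
  rewrite (cpdM b (dc _) (cdiffD (d false) dt)) cpd_cst mul0r add0r.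
  by rewrite (cpdD b (d false) dt) (cpdM b (dc _) (d true)) cpd_cst mul0r add0r.
rewrite wirtingerE !E (cpdC true oD Dz nf) /=.
have -> : (4^-1 : C) = 2^-1 * 2^-1 by rewrite -invfM -natrM.
by move: (cpd _ _ _) (cpd _ _ _) (cpd _ _ _) => p q r; ring.
Qed.

Lemma wirtC D s t f z : open D -> D z -> csm D 2 f ->
  wirtinger s (wirtinger t f) z = wirtinger t (wirtinger s f) z.
Proof.
by move=> oD Dz nf; rewrite !(wirt_wirt _ _ oD Dz nf) [wc t + _]addrC [wc t * _]mulrC.
Qed.

Lemma wirt_sum s (I : Type) (r : seq I) (F : I -> plane R -> C) z :
  (forall i, cdiff (F i) z) -> cdiff (fun x => \sum_(i <- r) F i x) z /\
  wirtinger s (fun x => \sum_(i <- r) F i x) z = \sum_(i <- r) wirtinger s (F i) z.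
Proof.
move=> dF; elim: r => [|i r [d E]].
  under eq_fun do rewrite big_nil; rewrite big_nil wirt_cst.
  by split=> //; exact: cdiff_cst.
under eq_fun do rewrite big_cons; rewrite big_cons -E.
by split; [exact: cdiffD|exact: wirtD].
Qed.

Lemma cpd_wirt f z : cpd false f z = wirtinger false f z + wirtinger true f z /\
  cpd true f z = wc true * (wirtinger false f z - wirtinger true f z).
Proof.
rewrite !wirtingerE.
have h : (2^-1 + 2^-1 : C) = 1 by have := splitr (1 : C); rewrite mul1r => <-.
have w2 : wc true * wc true = -1 := wc_sqr true.
have -> : wc false = - wc true :> C by rewrite -wc_neg.
move: (cpd false f z) (cpd true f z) (wc true) w2 => p q i i2; split.
  by transitivity ((2^-1 + 2^-1) * p); [rewrite h mul1r|ring].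
transitivity (- (i * i) * ((2^-1 + 2^-1) * q)); last by ring.
by rewrite h i2 opprK !mul1r.
Qed.

Lemma cgradient0_sq f z r : (forall w, sq z r w -> cdiff f w) ->
  (forall s w, sq z r w -> wirtinger s f w = 0) ->
  forall v w, sq z r v -> sq z r w -> f v = f w.
Proof.
move=> df wf v w Sv Sw.
have c0 b x : sq z r x -> cpd b f x = 0.
  move=> Sx; have [E1 E2] := cpd_wirt f x.
  by case: b; rewrite ?E1 ?E2 !wf // ?subrr ?mulr0 ?addr0.
apply: complex_eq.
  apply: (@gradient0_sq R (fun x => Re (f x)) z r) => // [x Sx|b x Sx].
    by case: (df x Sx).
  by have := congr1 (@complex.Re R) (c0 b x Sx).
apply: (@gradient0_sq R (fun x => Im (f x)) z r) => // [x Sx|b x Sx].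
  by case: (df x Sx).
by have := congr1 (@complex.Im R) (c0 b x Sx).
Qed.

Lemma cgradient0 f : (forall w, cdiff f w) -> (forall s w, wirtinger s f w = 0) ->
  forall v w, f v = f w.
Proof.
move=> df wf v w.
apply: (@cgradient0_sq f w (`|v - w| + 1)) => //; last first.
  by apply: sq_center; rewrite ltr_wpDl.
apply: (@sq_csq _ w `|v - w|); first by rewrite ltrDl.
by split; [exact: (norm_fst_le (v - w))|exact: (norm_snd_le (v - w))].
Qed.

(** The Laplacian is four times the composite of the two Wirtinger operators. *)
Lemma hol_lap D s f z : open D -> csm D 2 f -> (forall w, D w -> wirtinger s f w = 0) ->
  D z -> lap (fun x => Re (f x)) z = 0 /\ lap (fun x => Im (f x)) z = 0.
Proof.
move=> oD nf wf Dz.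
have E : cpd false (cpd false f) z + cpd true (cpd true f) z = 0.
  have := wirt_wirt (~~ s) s oD Dz nf.
  rewrite (near_wirt (~~ s) (g := fun=> 0)); last first.
    by apply: filterS (open_nbhs_nbhs (conj oD Dz)) => x; exact: wf.
  rewrite wirt_cst wc_neg addNr mul0r addr0 mulNr wc_sqr opprK mul1r.
  by move/esym/eqP; rewrite mulf_eq0 invr_eq0 pnatr_eq0 /= => /eqP.
split; [have := congr1 (@complex.Re R) E|have := congr1 (@complex.Im R) E]; by rewrite ?ReD ?ImD.
Qed.

Lemma hol_smooth D s f k : open D -> csm D 2 f -> (forall w, D w -> wirtinger s f w = 0) ->
  csm D k f.
Proof.
move=> oD nf wf; have [n1 n2] := nf.
by split; apply: (harmonic_nsm k oD) => // w Dw; have [] := hol_lap oD nf wf Dw.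
Qed.

(** Real and imaginary part are harmonic and vanish at infinity. *)
Lemma hol_Liouville s f : csm setT 2 f -> (forall w, wirtinger s f w = 0) ->
  (forall e : R, 0 < e -> exists r : R, forall w, ~ sq 0 r w ->
     `|Re (f w)| <= e /\ `|Im (f w)| <= e) -> forall w, f w = 0.
Proof.
move=> nf wf inf w; have [n1 n2] := nf.
have L x := hol_lap openT nf (fun w _ => wf w) (I : setT x).
apply: complex_eq => /=.
  apply: (harmonic_Liouville n1) => [x|e e0]; first by case: (L x).
  by have [r H] := inf e e0; exists r => v /H [].
apply: (harmonic_Liouville n2) => [x|e e0]; first by case: (L x).
by have [r H] := inf e e0; exists r => v /H [].
Qed.

(** With a false and a true as the two Wirtinger components, equality of the
    mixed derivatives is closedness of the form. *)
Lemma cpoincare (a : bool -> plane R -> C) : (forall s, csm setT 3 (a s)) ->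
  (forall z, wirtinger true (a false) z = wirtinger false (a true) z) ->
  exists2 f, (forall z, cdiff f z) & forall s z, wirtinger s f z = a s z.
Proof.
move=> na clos.
pose p z := a false z + a true z; pose q z := wc true * (a false z - a true z).
have oT : open [set: plane R] := openT.
have np : csm setT 3 p by exact: csmD.
have nq : csm setT 3 q.
  exact: (csmM oT (csm_cst _ _ _) (csmD oT (na false) (csmN oT (na true)))).
have d s z : cdiff (a s) z by exact: csm_cdiff (na s) _.
have dN s z : cdiff (fun x => - a s x) z.
  by apply: (csm_cdiff (csmN oT (na s))).
have cl z : cpd true p z = cpd false q z.
  have dd : cdiff (fun x => a false x - a true x) z by exact: cdiffD.
  rewrite (cpd_wirt p z).2 (cpd_wirt q z).1 /p /q.
  rewrite !(wirtD _ (d false z) (d true z)) !(wirtM _ (cdiff_cst _ _) dd) !wirt_cst.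
  rewrite !(wirtD _ (d false z) (dN true z)) !(wirtN _ (d true z)) clos.
  by move: (wirtinger _ _ _) (wirtinger _ _ _) (wirtinger _ _ _) (wc _) => x y t i; ring.
have [f1 df1 E1] := poincare np.1 nq.1 (fun z => congr1 (@complex.Re R) (cl z)).
have [f2 df2 E2] := poincare np.2 nq.2 (fun z => congr1 (@complex.Im R) (cl z)).
exists (fun z => f1 z +i* f2 z) => [z|s z]; first by split; [exact: df1|exact: df2].
have [A1 B1] := E1 z; have [A2 B2] := E2 z.
have -> : wirtinger s (fun z => f1 z +i* f2 z) z = 2^-1 * (p z + wc s * q z).
  rewrite wirtingerE; congr (_ * (_ + _ * _)); apply: complex_eq => //=.
rewrite /p /q; have w2 := wc_sqr true.
have h : (2^-1 + 2^-1 : C) = 1 by have := splitr (1 : C); rewrite mul1r => <-.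
have wF : wc false = - wc true :> C by rewrite -wc_neg.
case: s; rewrite ?wF.
  transitivity (2^-1 * (a false z + a true z + (wc true * wc true) * (a false z - a true z))).
    by ring.
  rewrite w2; transitivity ((2^-1 + 2^-1) * a true z); [ring|by rewrite h mul1r].
transitivity (2^-1 * (a false z + a true z - (wc true * wc true) * (a false z - a true z))).
  by ring.
rewrite w2; transitivity ((2^-1 + 2^-1) * a false z); [ring|by rewrite h mul1r].
Qed.

End ComplexCalculus.

HB.lock Definition mpart (R : realType) (m n : nat) (s : bool)
  (X : plane R -> 'M[R[i]]_(m, n)) (z : plane R) : 'M[R[i]]_(m, n) :=
  \matrix_(i, j) wirtinger s (fun x => X x i j) z.

(** * Wirtinger calculus for matrix functions *)

Section MatrixCalculus.
Variable R : realType.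
Local Notation C := R[i].
Implicit Types (z w : plane R) (D : set (plane R)).

Lemma mpartE m n s (X : plane R -> 'M[C]_(m, n)) z i j :
  mpart s X z i j = wirtinger s (fun x => X x i j) z.
Proof. by rewrite mpart.unlock mxE. Qed.

Lemma mpart_mx n s (X : plane R -> 'M[C]_n) : mxpartial s X = mpart s X.
Proof. by apply/funext => z; rewrite mpart.unlock. Qed.

Definition msm m n D k (X : plane R -> 'M[C]_(m, n)) :=
  forall i j, csm D k (fun x => X x i j).

Definition mdiff m n (X : plane R -> 'M[C]_(m, n)) z :=
  forall i j, cdiff (fun x => X x i j) z.

Lemma adjE m n (X : 'M[C]_(m, n)) i j : (X^t*) i j = Num.conj (X j i).
Proof. by rewrite !mxE. Qed.

Lemma adjM m n p (X : 'M[C]_(m, n)) (Y : 'M[C]_(n, p)) : (X *m Y)^t* = Y^t* *m X^t*.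
Proof. by rewrite trmx_mul map_mxM. Qed.

Lemma adjD m n (X Y : 'M[C]_(m, n)) : (X + Y)^t* = X^t* + Y^t*.
Proof. by rewrite linearD /= map_mxD. Qed.

Lemma adjN m n (X : 'M[C]_(m, n)) : (- X)^t* = - X^t*.
Proof. by rewrite linearN /= map_mxN. Qed.

Lemma adjB m n (X Y : 'M[C]_(m, n)) : (X - Y)^t* = X^t* - Y^t*.
Proof. by rewrite adjD adjN. Qed.

Lemma adjK m n (X : 'M[C]_(m, n)) : (X^t*)^t* = X.
Proof. by apply/matrixP => i j; rewrite !adjE conjCK. Qed.

Lemma adj1 n : (1%:M : 'M[C]_n)^t* = 1%:M.
Proof. by rewrite trmx1 map_mx1. Qed.

Lemma adj0 m n : (0 : 'M[C]_(m, n))^t* = 0.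
Proof. by rewrite trmx0 map_mx0. Qed.

Lemma adjZ m n (c : C) (X : 'M[C]_(m, n)) : (c *: X)^t* = Num.conj c *: X^t*.
Proof. by apply/matrixP => i j; rewrite !mxE rmorphM. Qed.

Lemma tr_adj n (X : 'M[C]_n) : \tr (X^t*) = Num.conj (\tr X).
Proof. by rewrite /mxtrace rmorph_sum; apply: eq_bigr => i _; rewrite adjE. Qed.

Section Rules.
Variables (m n p : nat).
Implicit Types X Y : plane R -> 'M[C]_(m, n).

Lemma msm_mdiff D k X z : msm D k.+1 X -> D z -> mdiff X z.
Proof. by move=> nX Dz i j; exact: csm_cdiff (nX i j) Dz. Qed.

Lemma msm_sub D D' k X : D' `<=` D -> msm D k X -> msm D' k X.
Proof. by move=> s nX i j; apply: csm_sub s _. Qed.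

Lemma msm_le D l k X : (l <= k)%N -> msm D k X -> msm D l X.
Proof. by move=> s nX i j; apply: csm_le s _. Qed.

Lemma msm_eq D k X Y : open D -> (forall z, D z -> X z = Y z) -> msm D k X -> msm D k Y.
Proof. by move=> oD XY nX i j; apply: csm_eq (nX i j) => // z Dz; rewrite XY. Qed.

Lemma msm_cst D k (M : 'M[C]_(m, n)) : msm D k (fun=> M).
Proof. by move=> i j; exact: csm_cst. Qed.

Lemma msmD D k X Y : open D -> msm D k X -> msm D k Y -> msm D k (fun x => X x + Y x).
Proof.
by move=> oD nX nY i j; under eq_fun do rewrite mxE; exact: csmD.
Qed.

Lemma msmN D k X : open D -> msm D k X -> msm D k (fun x => - X x).
Proof. by move=> oD nX i j; under eq_fun do rewrite mxE; exact: csmN. Qed.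

Lemma msmB D k X Y : open D -> msm D k X -> msm D k Y -> msm D k (fun x => X x - Y x).
Proof. by move=> oD nX nY; exact: (msmD oD nX (msmN oD nY)). Qed.

Lemma msmZ D k (c : plane R -> C) X : open D -> csm D k c -> msm D k X ->
  msm D k (fun x => c x *: X x).
Proof. by move=> oD nc nX i j; under eq_fun do rewrite mxE; exact: csmM. Qed.

Lemma msmM D k X (Y : plane R -> 'M[C]_(n, p)) : open D -> msm D k X -> msm D k Y ->
  msm D k (fun x => X x *m Y x).
Proof.
move=> oD nX nY i j; under eq_fun do rewrite mxE.
by apply: csm_sum => // l; exact: csmM.
Qed.

Lemma msmJ D k X : open D -> msm D k X -> msm D k (fun x => (X x)^t*).
Proof. by move=> oD nX i j; under eq_fun do rewrite adjE; exact: csmJ. Qed.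

Lemma msm_mpart D k s X : open D -> msm D k.+1 X -> msm D k (mpart s X).
Proof. by move=> oD nX i j; under eq_fun do rewrite mpartE; exact: csm_wirt. Qed.

Lemma mdiffD X Y z : mdiff X z -> mdiff Y z -> mdiff (fun x => X x + Y x) z.
Proof. by move=> dX dY i j; under eq_fun do rewrite mxE; exact: cdiffD. Qed.

Lemma mdiff_cst (M : 'M[C]_(m, n)) z : mdiff (fun=> M) z.
Proof. by move=> i j; exact: cdiff_cst. Qed.

Lemma mpart_cst s (M : 'M[C]_(m, n)) z : mpart s (fun=> M) z = 0.
Proof. by apply/matrixP => i j; rewrite mpartE wirt_cst mxE. Qed.

Lemma mpartD s X Y z : mdiff X z -> mdiff Y z ->
  mpart s (fun x => X x + Y x) z = mpart s X z + mpart s Y z.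
Proof.
move=> dX dY; apply/matrixP => i j; rewrite mpartE [RHS]mxE !mpartE -wirtD //.
by under eq_fun do rewrite mxE.
Qed.

Lemma mpartN s X z : mdiff X z -> mpart s (fun x => - X x) z = - mpart s X z.
Proof.
move=> dX; apply/matrixP => i j; rewrite mpartE [RHS]mxE !mpartE -wirtN //.
by under eq_fun do rewrite mxE.
Qed.

Lemma mdiffN X z : mdiff X z -> mdiff (fun x => - X x) z.
Proof.
move=> dX i j; under eq_fun do rewrite mxE -mulN1r.
by apply: cdiffM => //; exact: cdiff_cst.
Qed.

Lemma mpartB s X Y z : mdiff X z -> mdiff Y z ->
  mpart s (fun x => X x - Y x) z = mpart s X z - mpart s Y z.
Proof. by move=> dX dY; rewrite (mpartD s dX (mdiffN dY)) mpartN. Qed.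

Lemma mpartZ s (c : plane R -> C) X z : cdiff c z -> mdiff X z ->
  mpart s (fun x => c x *: X x) z = wirtinger s c z *: X z + c z *: mpart s X z.
Proof.
move=> dc dX; apply/matrixP => i j; rewrite mpartE !mxE mpartE -wirtM //.
by under eq_fun do rewrite mxE.
Qed.

Lemma mdiffM X (Y : plane R -> 'M[C]_(n, p)) z : mdiff X z -> mdiff Y z ->
  mdiff (fun x => X x *m Y x) z.
Proof.
move=> dX dY i j; under eq_fun do rewrite mxE.
by apply: (wirt_sum false _ _).1 => l; exact: cdiffM.
Qed.

Lemma mpartM s X (Y : plane R -> 'M[C]_(n, p)) z : mdiff X z -> mdiff Y z ->
  mpart s (fun x => X x *m Y x) z = mpart s X z *m Y z + X z *m mpart s Y z.
Proof.
move=> dX dY; apply/matrixP => i j; rewrite mpartE !mxE.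
under eq_fun do rewrite mxE.
have d l : cdiff (fun x => X x i l * Y x l j) z by exact: cdiffM.
rewrite (wirt_sum s _ d).2 -big_split /=; apply: eq_bigr => l _.
by rewrite (wirtM s (dX i l) (dY l j)) !mpartE.
Qed.

Lemma mdiffJ X z : mdiff X z -> mdiff (fun x => (X x)^t*) z.
Proof. by move=> dX i j; under eq_fun do rewrite adjE; exact: cdiffJ. Qed.

Lemma mpartJ s X z : mdiff X z ->
  mpart s (fun x => (X x)^t*) z = (mpart (~~ s) X z)^t*.
Proof.
move=> dX; apply/matrixP => i j; rewrite adjE !mpartE.
by under eq_fun do rewrite adjE; rewrite wirtJ.
Qed.

Lemma near_mpart s X Y z : (\forall x \near z, X x = Y x) -> mpart s X z = mpart s Y z.
Proof.
move=> XY; apply/matrixP => i j; rewrite !mpartE; apply: near_wirt.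
by apply: filterS XY => x ->.
Qed.

Lemma mpartC D s t X z : open D -> D z -> msm D 2 X ->
  mpart s (mpart t X) z = mpart t (mpart s X) z.
Proof.
move=> oD Dz nX; apply/matrixP => i j; rewrite !mpartE.
under eq_fun do rewrite mpartE; under [in RHS]eq_fun do rewrite mpartE.
exact: wirtC oD Dz (nX i j).
Qed.

Lemma mgradient0_sq X z r : (forall w, sq z r w -> mdiff X w) ->
  (forall s w, sq z r w -> mpart s X w = 0) ->
  forall v w, sq z r v -> sq z r w -> X v = X w.
Proof.
move=> dX pX v w Sv Sw; apply/matrixP => i j.
apply: (@cgradient0_sq R (fun x => X x i j) z r) => // [x Sx|s x Sx]; first exact: dX.
by rewrite -mpartE pX // mxE.
Qed.

Lemma mgradient0 X : (forall w, mdiff X w) -> (forall s w, mpart s X w = 0) ->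
  forall v w, X v = X w.
Proof.
move=> dX pX v w; apply/matrixP => i j.
apply: (@cgradient0 R (fun x => X x i j)) => // [x|s x]; first exact: dX.
by rewrite -mpartE pX // mxE.
Qed.

End Rules.

Section Square.
Variable n : nat.
Implicit Types X Y : plane R -> 'M[C]_n.

Lemma csm_tr D k X : open D -> msm D k X -> csm D k (fun x => \tr (X x)).
Proof. by move=> oD nX; rewrite /mxtrace; apply: csm_sum. Qed.

Lemma wirt_tr s X z : mdiff X z -> wirtinger s (fun x => \tr (X x)) z = \tr (mpart s X z).
Proof.
move=> dX; rewrite /mxtrace (wirt_sum s (F := fun i x => X x i i) _ (fun i => dX i i)).2.
by apply: eq_bigr => i _; rewrite mpartE.
Qed.

Lemma csm_det D k X : open D -> msm D k X -> csm D k (fun x => \det (X x)).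
Proof.
move=> oD nX; rewrite /determinant; apply: csm_sum => // s.
by apply: csmM => //; [exact: csm_cst|exact: csm_prod].
Qed.

Lemma msm_invmx D k X : open D -> (forall z, D z -> X z \in unitmx) -> msm D k X ->
  msm D k (fun x => invmx (X x)).
Proof.
move=> oD uX nX; apply: (@msm_eq _ _ _ _ (fun x => (\det (X x))^-1 *: \adj (X x))) => //.
  by move=> z Dz; rewrite /invmx uX.
apply: msmZ => //.
  by apply: (csmV oD) => [z /uX|]; [rewrite unitmxE unitfE|exact: csm_det].
move=> i j; under eq_fun do rewrite mxE; rewrite /cofactor.
apply: csmM => //; first exact: csm_cst.
move: n X nX {uX} i j => [|n'] X nX i j; first by case: i.
pose Y x := row' j (col' i (X x)).
have nY a b : csm D k (fun x => Y x a b).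
  by rewrite /Y; under eq_fun do rewrite !mxE; exact: nX.
rewrite /determinant; apply: csm_sum => // s.
by apply: csmM => //; [exact: csm_cst|apply: csm_prod => // a; exact: nY].
Qed.

End Square.

End MatrixCalculus.

(** * Unique continuation for first-order systems *)

Section VectorUC.
Variable R : realType.
Local Notation C := R[i].
Local Notation Re := complex.Re.
Local Notation Im := complex.Im.
Local Notation normc := (@ComplexField.Normc.normc R).
Implicit Types (z w : plane R) (D : set (plane R)).

Lemma normc_sq (x : C) : normc x * normc x = Re x * Re x + Im x * Im x.
Proof.
by case: x => a b; rewrite /= -expr2 sqr_sqrtr ?addr_ge0 ?sqr_ge0 // !expr2.
Qed.

Lemma normc_ge0 (x : C) : 0 <= normc x.
Proof. by case: x => a b; exact: sqrtr_ge0. Qed.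

Lemma normcJ (x : C) : normc (Num.conj x) = normc x.
Proof. by case: x => a b; rewrite /= sqrrN. Qed.

Lemma normc_Re (x : C) : `|Re x| <= normc x.
Proof.
by case: x => a b /=; rewrite -sqrtr_sqr ler_sqrt ?addr_ge0 ?sqr_ge0 // lerDl sqr_ge0.
Qed.

Lemma normc_Im (x : C) : `|Im x| <= normc x.
Proof.
by case: x => a b /=; rewrite -sqrtr_sqr ler_sqrt ?addr_ge0 ?sqr_ge0 // lerDr sqr_ge0.
Qed.

Lemma normcD (x y : C) : normc (x + y) <= normc x + normc y.
Proof. exact: le_normcD. Qed.

Lemma normc_le (x : C) : normc x <= `|Re x| + `|Im x|.
Proof.
case: x => a b /=; rewrite -[leRHS]ger0_norm ?addr_ge0 // -sqrtr_sqr ler_sqrt ?sqr_ge0 //.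
rewrite -(real_normK (num_real a)) -(real_normK (num_real b)).
by have := normr_ge0 a; have := normr_ge0 b; move: (`|a|) (`|b|) => x y x0 y0; nra.
Qed.

Lemma norm2_le (a b c : R) : 0 <= c -> 4 * (c * c) = a * a + b * b -> 2 * c <= `|a| + `|b|.
Proof.
move=> c0; rewrite -!expr2 -(real_normK (num_real a)) -(real_normK (num_real b)).
by have := normr_ge0 a; have := normr_ge0 b; move: (`|a|) (`|b|) => x y x0 y0; nra.
Qed.

Lemma normc_sum (I : Type) (r : seq I) (F : I -> C) (c : R) : (forall i, normc (F i) <= c) ->
  normc (\sum_(i <- r) F i) <= (size r)%:R * c.
Proof.
move=> Fc; elim: r => [|i r IH]; first by rewrite big_nil mul0r ComplexField.Normc.normc0.
rewrite big_cons /= -natr1 mulrDl mul1r addrC; apply: le_trans (normcD _ _) _.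
by apply: lerD.
Qed.

Lemma Re_sum (I : Type) (r : seq I) (F : I -> C) : Re (\sum_(i <- r) F i) = \sum_(i <- r) Re (F i).
Proof. by elim: r => [|i r IH]; rewrite ?big_nil // !big_cons ReD IH. Qed.

Lemma Re_mulJ (x : C) : Re (x * Num.conj x) = normc x * normc x.
Proof. by rewrite ReM ReJ ImJ normc_sq mulrN opprK. Qed.

Lemma conjMJ (x y : C) : Num.conj (x * Num.conj y) = Num.conj x * y.
Proof. by rewrite rmorphM /= conjCK. Qed.

Lemma mulJE (x : C) : x * Num.conj x = (normc x * normc x)%:C.
Proof.
apply: complex_eq; first by rewrite Re_mulJ.
by rewrite ImM ReJ ImJ /= mulrN mulrC addNr.
Qed.

(** Cauchy-Schwarz, from the positivity of the norm of u S - (w, S) w. *)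
Lemma cauchy_schwarz (I : finType) (w S : I -> C) :
  normc (\sum_i w i * Num.conj (S i)) * normc (\sum_i w i * Num.conj (S i)) <=
  (\sum_i normc (w i) * normc (w i)) * \sum_i normc (S i) * normc (S i).
Proof.
set t := \sum_i w i * _; set u := \sum_i normc (w i) * _; set v := \sum_i normc (S i) * normc (S i).
have nn (x : C) : 0 <= normc x * normc x by rewrite mulr_ge0 // normc_ge0.
have u0 : 0 <= u by apply: sumr_ge0.
have uE : u%:C = \sum_i w i * Num.conj (w i).
  by rewrite /u raddf_sum; apply: eq_bigr => i _; rewrite mulJE.
have vE : v%:C = \sum_i S i * Num.conj (S i).
  by rewrite /v raddf_sum; apply: eq_bigr => i _; rewrite mulJE.
have tE : Num.conj t = \sum_i S i * Num.conj (w i).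
  by rewrite /t rmorph_sum; apply: eq_bigr => i _; rewrite rmorphM /= conjCK mulrC.
have [u00|un0] := eqVneq u 0.
  have w0 i : w i = 0.
    apply: ComplexField.Normc.eq0_normc; apply/eqP; rewrite -sqrf_eq0 expr2.
    by have /psumr_eq0P /(_ i isT) -> := u00.
  rewrite u00 mul0r /t big1 ?ComplexField.Normc.normc0 ?mulr0 // => i _.
  by rewrite w0 mul0r.
have up : 0 < u by rewrite lt_neqAle eq_sym un0.
have tD : t = \sum_i w i * Num.conj (S i) by [].
clearbody t u v.
pose y i := u%:C * S i - Num.conj t * w i.
have y0 : 0 <= \sum_i normc (y i) * normc (y i) by apply: sumr_ge0.
have yE : (\sum_i normc (y i) * normc (y i))%:C =
    u%:C * (u%:C * v%:C - t * Num.conj t).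
  rewrite raddf_sum; transitivity (\sum_i y i * Num.conj (y i)).
    by apply: eq_bigr => i _; rewrite mulJE.
  have -> : \sum_i y i * Num.conj (y i) =
     u%:C * u%:C * (\sum_i S i * Num.conj (S i)) - u%:C * t * (\sum_i S i * Num.conj (w i))
     - u%:C * Num.conj t * (\sum_i w i * Num.conj (S i))
     + t * Num.conj t * (\sum_i w i * Num.conj (w i)).
    rewrite !mulr_sumr -!sumrB -big_split /=; apply: eq_bigr => i _.
    have cu : Num.conj u%:C = u%:C by apply: complex_eq; rewrite ?ReJ ?ImJ /= ?oppr0.
    rewrite /y rmorphB !rmorphM /= conjCK cu.
    by move: (u%:C) (Num.conj (S i)) (Num.conj (w i)) (Num.conj t) => a b c d; ring.
  rewrite -vE -tE -uE -tD; move: (u%:C) (Num.conj t) => a b; ring.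
have ReMr (x : R) (c : C) : Re (x%:C * c) = x * Re c by rewrite ReM /= mul0r subr0.
have := congr1 (@complex.Re R) yE; rewrite ReMr ReD ReN Re_mulJ ReMr => E.
by move: y0; rewrite [X in 0 <= X]E pmulr_rge0 // subr_ge0.
Qed.

Lemma csm_bound D k (f : plane R -> C) K : compact K -> K `<=` D -> csm D k.+1 f ->
  exists c : R, 0 <= c /\ forall z, K z -> normc (f z) <= c.
Proof.
move=> cK KD [n1 n2].
have [c1 [c10 H1]] := compact_bound cK (fun z Kz => nsm_continuous n1 (KD z Kz)).
have [c2 [c20 H2]] := compact_bound cK (fun z Kz => nsm_continuous n2 (KD z Kz)).
exists (c1 + c2); split=> [|z Kz]; first exact: addr_ge0.
by apply: le_trans (normc_le _) _; apply: lerD; [exact: H1|exact: H2].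
Qed.

Lemma uniform_bound (J : finType) D k (f : J -> plane R -> C) K : compact K -> K `<=` D ->
  (forall j, csm D k.+1 (f j)) ->
  exists c : R, 0 <= c /\ forall j z, K z -> normc (f j z) <= c.
Proof.
move=> cK KD nf.
have [c Hc] : exists c : J -> R, forall j, 0 <= c j /\ forall z, K z -> normc (f j z) <= c j.
  exists (fun j => projT1 (cid (csm_bound cK KD (nf j)))) => j.
  exact: (projT2 (cid (csm_bound cK KD (nf j)))).
exists (\sum_j c j); split=> [|j z Kz]; first by apply: sumr_ge0 => j _; case: (Hc j).
apply: le_trans ((Hc j).2 z Kz) _; rewrite (bigD1 j) //= lerDl.
by apply: sumr_ge0 => l _; case: (Hc l).
Qed.

Lemma uc_arith (c5 C3 C4 v x1 x2 x3 x4 x5 x6 x7 x8 x9 x10 : R) : 0 <= c5 -> 0 <= C3 + 2 * C4 ->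
  0 <= v -> x1 <= c5 * v -> x2 <= C4 * v -> x8 <= C3 * v -> x3 * x3 <= v * x7 -> x4 <= x3 + x1 ->
  2 * x4 <= x9 + x10 -> 0 <= x6 -> - x2 <= x5 -> 0 <= x1 -> 0 <= x4 -> 0 <= x3 ->
  4 * (x4 * x4) - (4 * c5 + 4 * (C3 + 2 * C4)) * v * (x9 + x10)
    - (4 * c5 + 4 * (C3 + 2 * C4)) * (v * v) <= v * (4 * (x6 + x7 - x8 + 2 * x5)).
Proof.
move=> c50 C20 v0 h1 h2 h3 h4 h5 h6 h7 h8 h9 h10 h11.
have k1 : x4 * x1 <= (x9 + x10) / 2 * (c5 * v) by apply: ler_pM => //; lra.
have k2 : x4 * x4 <= v * x7 + (x9 + x10) * (c5 * v).
  have [x14|/ltW x41] := lerP x1 x4; last first.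
    have := ler_wpM2l h10 x41; have : 0 <= x3 * x3 by apply: mulr_ge0.
    have : 0 <= (x9 + x10) * (c5 * v) by apply: mulr_ge0; [lra|apply: mulr_ge0].
    lra.
  have : (x4 - x1) * (x4 - x1) <= x3 * x3 by apply: ler_pM; lra.
  have : 0 <= x1 * x1 by apply: mulr_ge0.
  have -> : (x4 - x1) * (x4 - x1) = x4 * x4 - 2 * (x4 * x1) + x1 * x1 by ring.
  lra.
have k3 : v * x8 <= v * (C3 * v) by apply: ler_wpM2l.
have k4 : v * (- x5) <= v * (C4 * v) by apply: ler_wpM2l => //; lra.
have k5 : 0 <= v * x6 by apply: mulr_ge0.
have k6 : 0 <= (C3 + 2 * C4) * v * (x9 + x10) by apply: mulr_ge0; [apply: mulr_ge0|lra].
have k7 : 0 <= c5 * (v * v) by rewrite !mulr_ge0.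
nra.
Qed.

(** Unique continuation for first-order systems: |w|^2 satisfies the
    hypothesis of log_subharmonic_uc, because with S the Chern derivative of w
    the mixed second derivative of |w|^2 is |S|^2 and its first derivative is
    (w, S), up to terms bounded by |w|^2. *)
Lemma system_uc (I : finType) (s : bool) (w : I -> plane R -> C)
    (A B : I -> I -> plane R -> C) z0 (r0 : R) :
  (forall i, csm setT 2 (w i)) ->
  (forall i j, csm setT 2 (A i j)) -> (forall i j, csm setT 2 (B i j)) ->
  (forall i z, wirtinger s (w i) z =
     \sum_j (A i j z * w j z + B i j z * Num.conj (w j z))) ->
  0 < r0 -> (forall i z, sq z0 r0 z -> w i z = 0) -> forall i z, w i z = 0.
Proof.
move=> nw nA nB ew r00 w0.
have oT : open [set: plane R] := openT.
pose N := normc.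
have N0 x : 0 <= N x := normc_ge0 x.
have NM x y : N (x * y) = N x * N y := ComplexField.Normc.normcM x y.
pose u z := \sum_i N (w i z) * N (w i z).
pose U z : C := \sum_i w i z * Num.conj (w i z).
have nU : csm setT 2 U.
  by apply: csm_sum => // i; apply: csmM => //; exact: csmJ.
have UE z : U z = (u z)%:C.
  by rewrite /u raddf_sum; apply: eq_bigr => i _; rewrite mulJE.
have nu : nsm setT 2 u.
  have -> : u = fun z => Re (U z) by apply/funext => z; rewrite UE.
  exact: nU.1.
have u0 z : 0 <= u z by apply: sumr_ge0 => i _; apply: mulr_ge0.
suff uz z : u z = 0.
  move=> i z; apply: ComplexField.Normc.eq0_normc; apply/eqP; rewrite -sqrf_eq0 expr2.
  have /psumr_eq0P /(_ i isT) -> // := uz z.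
  by move=> j _; apply: mulr_ge0.
move: z; apply: (log_subharmonic_uc (z0 := z0) (r0 := r0)) => //; last first.
  by move=> z Sz; rewrite /u big1 // => i _; rewrite w0 // /N ComplexField.Normc.normc0 mul0r.
move=> rho.
have cK := csq_compact (z := (0 : plane R)) (r := rho).
have KT : csq 0 rho `<=` [set: plane R] by [].
have [c1 [c10 H1]] := uniform_bound cK KT (f := fun ij : I * I => A ij.1 ij.2) (fun ij => nA _ _).
have [c2 [c20 H2]] := uniform_bound cK KT (f := fun ij : I * I => B ij.1 ij.2) (fun ij => nB _ _).
have [c3 [c30 H3]] := uniform_bound cK KT
  (f := fun ij : I * I => wirtinger (~~ s) (A ij.1 ij.2)) (fun ij => csm_wirt (~~ s) oT (nA _ _)).
have [c4 [c40 H4]] := uniform_bound cK KT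
  (f := fun ij : I * I => wirtinger (~~ s) (B ij.1 ij.2)) (fun ij => csm_wirt (~~ s) oT (nB _ _)).
pose K := c1 + c2 + c3 + c4; pose n : R := #|I|%:R.
have K0 : 0 <= K by rewrite !addr_ge0.
have n0 : 0 <= n by [].
have bA i j z : csq 0 rho z -> N (A i j z) <= K.
  by move=> Kz; apply: le_trans (H1 (i, j) z Kz) _; rewrite /K; lra.
have bB i j z : csq 0 rho z -> N (B i j z) <= K.
  by move=> Kz; apply: le_trans (H2 (i, j) z Kz) _; rewrite /K; lra.
have bdA i j z : csq 0 rho z -> N (wirtinger (~~ s) (A i j) z) <= K.
  by move=> Kz; apply: le_trans (H3 (i, j) z Kz) _; rewrite /K; lra.
have bdB i j z : csq 0 rho z -> N (wirtinger (~~ s) (B i j) z) <= K.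
  by move=> Kz; apply: le_trans (H4 (i, j) z Kz) _; rewrite /K; lra.
clearbody K.
pose C1 := n * (n * K); pose C2 := n * (n * (n * (K * K))) + 2 * (n * (n * (K + K + K * (n * (K + K))))).
have C10 : 0 <= C1 by rewrite /C1 !mulr_ge0.
have C20 : 0 <= C2 by rewrite /C2 addr_ge0 // ?mulr_ge0 // ?addr_ge0 // ?mulr_ge0 // ?mulr_ge0 // ?addr_ge0.
exists (4 * C1 + 4 * C2); first by rewrite addr_ge0 // mulr_ge0.
move=> z Kz.
have ww i j : N (w i z) * N (w j z) <= u z.
  have le_u l : N (w l z) * N (w l z) <= u z.
    rewrite /u (bigD1 l) //= lerDl; apply: sumr_ge0 => q _; exact: mulr_ge0.
  have := le_u i; have := le_u j; have := N0 (w i z); have := N0 (w j z).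
  move: (N (w i z)) (N (w j z)) (u z) => a b c; nra.
have sumI (F : I -> C) (c : R) : (forall i, N (F i) <= c) -> N (\sum_i F i) <= n * c.
  by move=> Fc; have := normc_sum (enum I) Fc; rewrite big_enum /n cardE.
have sumR (F : I -> R) (c : R) : (forall i, F i <= c) -> \sum_i F i <= n * c.
  move=> Fc; apply: le_trans (ler_sum _ (fun i _ => Fc i)) _.
  by rewrite sumr_const mulr_natl.
pose p i := wirtinger s (w i); pose sg i := wirtinger (~~ s) (w i).
have dw i x : cdiff (w i) x by exact: csm_cdiff (nw i) _.
have dA i j x : cdiff (A i j) x by exact: csm_cdiff (nA i j) _.
have dB i j x : cdiff (B i j) x by exact: csm_cdiff (nB i j) _.
have dp i x : cdiff (p i) x by exact: csm_cdiff (csm_wirt s oT (nw i)) _.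
have dsg i x : cdiff (sg i) x by exact: csm_cdiff (csm_wirt (~~ s) oT (nw i)) _.
pose q i := wirtinger (~~ s) (p i) z.
have qE i : wirtinger s (sg i) z = q i by exact: (wirtC s (~~ s) oT (Logic.I : setT z) (nw i)).
pose a j := \sum_i Num.conj (A i j z) * w i z.
pose S j := sg j z + a j.
pose r := \sum_i \sum_j (B i j z * Num.conj (w j z)) * Num.conj (w i z).
pose E := \sum_i \sum_j (wirtinger (~~ s) (A i j) z * w j z
   + wirtinger (~~ s) (B i j) z * Num.conj (w j z) + B i j z * Num.conj (p j z)) * Num.conj (w i z).
have dsU x : wirtinger s U x = \sum_i (p i x * Num.conj (w i x) + w i x * Num.conj (sg i x)).
  rewrite (wirt_sum s (F := fun i y => w i y * Num.conj (w i y)) _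
    (fun i => cdiffM (dw i x) (cdiffJ (dw i x)))).2.
  by apply: eq_bigr => i _; rewrite (wirtM s (dw i x) (cdiffJ (dw i x))) wirtJ.
have pE i x : p i x = \sum_j (A i j x * w j x + B i j x * Num.conj (w j x)) by exact: ew.
have adj (c : I -> C) : \sum_i (\sum_j A i j z * c j) * Num.conj (w i z)
     = \sum_j c j * Num.conj (a j).
  under eq_bigr do rewrite mulr_suml.
  rewrite exchange_big; apply: eq_bigr => j _; rewrite /a rmorph_sum mulr_sumr.
  apply: eq_bigr => i _; rewrite rmorphM /= conjCK.
  by move: (A i j z) (c j) (Num.conj _) => x1 x2 x3; ring.
have d1 : wirtinger s U z = \sum_i w i z * Num.conj (S i) + r.
  rewrite dsU big_split /= [X in X + _ = _](_ : _ = \sum_j w j z * Num.conj (a j) + r).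
    rewrite addrAC -big_split /=; congr (_ + _); apply: eq_bigr => i _.
    by rewrite /S rmorphD mulrDr addrC.
  rewrite -adj -big_split /=; apply: eq_bigr => i _.
  rewrite pE big_split /= mulrDl; congr (_ + _).
  by rewrite mulr_suml.
have qE2 i : q i = \sum_j A i j z * sg j z + \sum_j (wirtinger (~~ s) (A i j) z * w j z
   + wirtinger (~~ s) (B i j) z * Num.conj (w j z) + B i j z * Num.conj (p j z)).
  have -> : q i = wirtinger (~~ s) (fun x => \sum_j (A i j x * w j x + B i j x * Num.conj (w j x))) z.
    exact: (congr1 (fun g => wirtinger (~~ s) g z) (funext (pE i))).
  have dd j : cdiff (fun x => A i j x * w j x + B i j x * Num.conj (w j x)) z.
    exact: (cdiffD (cdiffM (dA i j z) (dw j z)) (cdiffM (dB i j z) (cdiffJ (dw j z)))).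
  rewrite (wirt_sum _ _ dd).2 -big_split /=; apply: eq_bigr => j _.
  rewrite (wirtD _ (cdiffM (dA i j z) (dw j z)) (cdiffM (dB i j z) (cdiffJ (dw j z)))).
  rewrite (wirtM _ (dA i j z) (dw j z)) (wirtM _ (dB i j z) (cdiffJ (dw j z))) (wirtJ _ (dw j z)).
  rewrite negbK -/(p j z) -/(sg j z).
  move: (wirtinger _ _ _) (wirtinger _ _ _) (p j z) (sg j z) => x1 x2 x3 x4.
  move: (A i j z) (B i j z) (w j z) (Num.conj _) (Num.conj _) => x5 x6 x7 x8 x9; ring.
have d2 : wirtinger (~~ s) (wirtinger s U) z =
   \sum_i (p i z * Num.conj (p i z) + sg i z * Num.conj (sg i z)
     + (q i * Num.conj (w i z) + Num.conj (q i * Num.conj (w i z)))).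
  have -> : wirtinger s U = fun x => \sum_i (p i x * Num.conj (w i x) + w i x * Num.conj (sg i x)).
    by apply/funext => x; exact: dsU.
  have dd i : cdiff (fun x => p i x * Num.conj (w i x) + w i x * Num.conj (sg i x)) z.
    exact: (cdiffD (cdiffM (dp i z) (cdiffJ (dw i z))) (cdiffM (dw i z) (cdiffJ (dsg i z)))).
  rewrite (wirt_sum _ _ dd).2; apply: eq_bigr => i _.
  rewrite (wirtD _ (cdiffM (dp i z) (cdiffJ (dw i z))) (cdiffM (dw i z) (cdiffJ (dsg i z)))).
  rewrite (wirtM _ (dp i z) (cdiffJ (dw i z))) (wirtM _ (dw i z) (cdiffJ (dsg i z))).
  rewrite (wirtJ _ (dw i z)) (wirtJ _ (dsg i z)) negbK -/(p i z) -/(sg i z) -/(q i) qE.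
  have -> : Num.conj (q i * Num.conj (w i z)) = Num.conj (q i) * w i z.
    exact: conjMJ.
  move: (q i) (Num.conj _) (p i z) (sg i z) (w i z) => x1 x2 x3 x4 x5.
  move: (Num.conj _) (Num.conj _) (Num.conj _) => x6 x7 x8; ring.
have d3 : \sum_i q i * Num.conj (w i z) = \sum_j sg j z * Num.conj (a j) + E.
  rewrite -adj -big_split /=; apply: eq_bigr => i _; rewrite qE2 mulrDl; congr (_ + _).
  by rewrite mulr_suml.
have d4 : Re (wirtinger (~~ s) (wirtinger s U) z) =
   \sum_i N (p i z) * N (p i z) + \sum_i N (S i) * N (S i)
   - \sum_i N (a i) * N (a i) + 2 * Re E.
  have -> : Re E = \sum_i Re (q i * Num.conj (w i z)) - \sum_j Re (sg j z * Num.conj (a j)).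
    by rewrite -!Re_sum d3 ReD addrC addKr.
  rewrite d2 Re_sum mulrBr !mulr_sumr addrA -!sumrN -!big_split /=; apply: eq_bigr => i _.
  rewrite !ReD (ReJ (_ * _)) !Re_mulJ -[normc (p i z)]/(N (p i z)).
  have -> : N (S i) * N (S i) = N (sg i z) * N (sg i z) + N (a i) * N (a i)
      + 2 * Re (sg i z * Num.conj (a i)).
    rewrite /N /S !normc_sq !ReD !ImD ReM ReJ ImJ.
    by move: (Re (sg i z)) (Im (sg i z)) (Re (a i)) (Im (a i)) => x1 x2 x3 x4; ring.
  rewrite -/N; move: (N (p i z)) (N (sg i z)) (N (a i)) (Re _) (Re _) => x1 x2 x3 x4 x5; ring.
have Ure x : Re (U x) = u x by rewrite UE.
have Uim x : Im (U x) = 0 by rewrite UE.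
have d5 : 4 * Re (wirtinger (~~ s) (wirtinger s U) z) = lap u z.
  rewrite (wirt_wirt _ _ oT Logic.I nU) wc_neg addNr mul0r addr0 mulNr wc_sqr opprK mul1r.
  have -> : (4^-1 : C) = (4^-1 : R)%:C by rewrite fmorphV rmorph_nat.
  rewrite ReM /= mul0r subr0 /lap.
  have -> : (fun x => Re (U x)) = u by apply/funext.
  move: (pd _ _ z) (pd _ _ z) => x1 x2; lra.
have d6 : 4 * (N (wirtinger s U z) * N (wirtinger s U z)) =
   pd false u z * pd false u z + pd true u z * pd true u z.
  rewrite /N normc_sq wirtingerE /cpd.
  have -> : (fun x => Re (U x)) = u by apply/funext.
  have -> : (fun x => Im (U x)) = fun=> 0 by apply/funext.
  rewrite !pd_cst.
  have -> : (2^-1 : C) = (2^-1 : R)%:C by rewrite fmorphV rmorph_nat.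
  have wr : Re (wc R s) = 0 by rewrite /wc; case: (s); rewrite /= ?expr0 ?expr1 /=; lra.
  have wi : Im (wc R s) * Im (wc R s) = 1.
    by have := congr1 (@complex.Re R) (wc_sqr R s); rewrite ReM wr mul0r sub0r /= => /oppr_inj.
  rewrite !(ReM, ImM, ReD, ImD) wr /=; move: (pd _ _ z) (pd _ _ z) (Im (wc R s)) wi => x1 x2 x3 h.
  rewrite !(mul0r, mulr0, addr0, subr0, add0r).
  transitivity (x2 * x2 + (x3 * x3) * (x1 * x1)); first by field.
  by rewrite h mul1r.
have NJ x : N (Num.conj x) = N x := normcJ x.
have br : N r <= C1 * u z.
  rewrite /C1 -2!mulrA; apply: (sumI) => i; apply: (sumI) => j.
  rewrite !NM !NJ -mulrA; apply: ler_pM => //; first exact: mulr_ge0.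
  exact: bB.
have ba j : N (a j) * N (a j) <= n * (n * (K * K * u z)).
  rewrite -NM /a mulr_suml; apply: (sumI) => i; rewrite mulr_sumr; apply: (sumI) => k.
  rewrite !NM !NJ mulrACA; apply: ler_pM => //; do ?exact: mulr_ge0.
  by apply: ler_pM => //; exact: bA.
have bp i j : N (p j z) * N (w i z) <= n * ((K + K) * u z).
  rewrite -NM pE mulr_suml; apply: (sumI) => k; rewrite mulrDl.
  apply: le_trans (normcD _ _) _; rewrite -/N !NM !NJ [leRHS]mulrDl -!mulrA.
  by apply: lerD; apply: ler_pM => //; do ?exact: mulr_ge0; [exact: bA|exact: bB].
have Nw c x i j : N x <= c -> N (x * w j z * Num.conj (w i z)) <= c * u z.
  by move=> xc; rewrite NM (NM x) NJ -mulrA; apply: ler_pM => //; exact: mulr_ge0.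
have Nw' c x i j : N x <= c -> N (x * Num.conj (w j z) * Num.conj (w i z)) <= c * u z.
  by move=> xc; rewrite NM (NM x) !NJ -mulrA; apply: ler_pM => //; exact: mulr_ge0.
have bE : N E <= n * (n * ((K + K + K * (n * (K + K))) * u z)).
  apply: (sumI) => i; apply: (sumI) => j; rewrite 2!mulrDl [X in _ <= X]mulrDl.
  rewrite [X in _ <= X + _]mulrDl.
  apply: le_trans (normcD _ _) _; apply: lerD.
    apply: le_trans (normcD _ _) _; apply: lerD.
      by apply: (Nw); exact: bdA.
    by apply: (Nw'); exact: bdB.
  rewrite -/N NM (NM (B i j z)) !NJ -!mulrA; apply: ler_pM => //; do ?exact: mulr_ge0; first exact: bB.
have bS : \sum_i N (a i) * N (a i) <= n * (n * (n * (K * K * u z))) by apply: (sumR).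
have cs := cauchy_schwarz (fun i => w i z) S.
rewrite -/(u z) in cs.
have := N0 (\sum_i w i z * Num.conj (S i)); have := N0 (wirtinger s U z).
have tri : N (wirtinger s U z) <= N (\sum_i w i z * Num.conj (S i)) + N r.
  by rewrite d1; exact: normcD.
have grad : 2 * N (wirtinger s U z) <= `|pd false u z| + `|pd true u z|.
  exact: norm2_le (N0 _) d6.
have sp : 0 <= \sum_i N (p i z) * N (p i z) by apply: sumr_ge0 => i _; apply: mulr_ge0.
have bRe : - N E <= Re E by have := normc_Re E; rewrite ler_norml => /andP[].
rewrite -d6 -d5 d4; move: (u0 z) br bE bS cs tri grad sp bRe (N0 r).
rewrite -[normc (\sum_i _)]/(N (\sum_i w i z * Num.conj (S i))).
rewrite -[X in _ <= _ * X]/(\sum_i N (S i) * N (S i)).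
have -> : n * (n * (n * (K * K * u z))) = n * (n * (n * (K * K))) * u z by ring.
have -> : n * (n * ((K + K + K * (n * (K + K))) * u z)) = n * (n * (K + K + K * (n * (K + K)))) * u z by ring.
move=> v0 h1 h2 h3 h4 h5 h6 h7 h8 h9 h10 h11.
exact: (uc_arith C10 C20 v0 h1 h2 h3 h4 h5 h6 h7 h8 h9 h10 h11).
Qed.
End VectorUC.

(** * Division of holomorphic functions by the local coordinate *)

Section Division.
Variable R : realType.
Local Notation C := R[i].
Local Notation Re := complex.Re.
Local Notation Im := complex.Im.
Local Notation normc := (@ComplexField.Normc.normc R).
Implicit Types (z w : plane R) (D : set (plane R)).

Lemma nsm_local D k (f : plane R -> R) :
  (forall z, D z -> exists O, [/\ open O, O z & nsm O k f]) -> nsm D k f.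
Proof.
elim: k f => //= k IH f H; split=> [z /H [U [_ Uz [df _]]]|b]; first exact: df.
by apply: IH => z /H [U [oU Uz [_ nf]]]; exists U; split.
Qed.

Lemma csm_local D k (f : plane R -> C) :
  (forall z, D z -> exists O, [/\ open O, O z & csm O k f]) -> csm D k f.
Proof.
move=> H; split; apply: nsm_local => z /H [U [oU Uz [n1 n2]]]; by exists U.
Qed.

Definition dist1 z0 w : R := `|w.1 - z0.1| + `|w.2 - z0.2|.

Lemma dist1_ge0 z0 w : 0 <= dist1 z0 w. Proof. exact: addr_ge0. Qed.

Lemma differentiable_quadratic (f : plane R -> R) z0 (r c : R) : 0 < r -> 0 <= c ->
  (forall w, sq z0 r w -> `|f w| <= c * dist1 z0 w ^+ 2) ->
  differentiable f z0 /\ forall b, pd b f z0 = 0.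
Proof.
move=> r0 c0 H.
have f0 : f z0 = 0.
  have := H z0 (sq_center z0 r0); rewrite /dist1 !subrr normr0 addr0 expr0n mulr0.
  by rewrite normr_le0 => /eqP.
have [e|df pf] := @differentiable_eps R f z0 0 0; last by split=> // -[]; rewrite pf.
move=> e0; have c4 : 0 < 4 * c + 1 by lra.
pose t := Num.min r (e / (4 * c + 1)).
have t0 : 0 < t by rewrite lt_min r0 divr_gt0.
apply/nbhs_sqP; exists t => // h [h1 h2]; rewrite f0 subr0 /linform !mul0r addr0 subr0.
rewrite subr0 in h1; rewrite subr0 in h2.
have n1 := norm_fst_le h; have n2 := norm_snd_le h.
have tr : t <= r by rewrite ge_min lexx.
have te : t <= e / (4 * c + 1) by rewrite ge_min lexx orbT.
have E1 : (h + z0).1 - z0.1 = h.1 by rewrite /=; ring.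
have E2 : (h + z0).2 - z0.2 = h.2 by rewrite /=; ring.
have Sh : sq z0 r (h + z0) by split; rewrite ?E1 ?E2; apply: lt_le_trans tr.
apply: le_trans (H _ Sh) _; rewrite /dist1 E1 E2.
have nh : `|h| <= t by rewrite norm_plane_le !ltW.
have h0 := normr_ge0 h; move: n1 n2 (normr_ge0 h.1) (normr_ge0 h.2).
move: `|h.1| `|h.2| `|h| h0 nh => a b n n0 nt an bn a0 b0.
have n2 : (a + b) ^+ 2 <= (n + n) ^+ 2 by rewrite lerXn2r ?nnegrE ?addr_ge0 // lerD.
have en : (4 * c + 1) * n <= e by rewrite mulrC -ler_pdivlMr //; apply: le_trans nt te.
apply: le_trans (ler_wpM2l c0 n2) _; rewrite expr2.
have -> : c * ((n + n) * (n + n)) = 4 * c * n * n by ring.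
apply: ler_wpM2r => //; lra.
Qed.

(** Used for quotients by the local coordinate: after a Taylor polynomial is
    subtracted, the quotient and its gradient vanish to second order, which is
    enough to keep two derivatives across the point. *)
Lemma removable_quadratic D (f : plane R -> R) z0 (r c : R) : open D -> 0 < r -> 0 <= c ->
  (forall w, sq z0 r w -> `|f w| <= c * dist1 z0 w ^+ 2) ->
  (forall b w, sq z0 r w -> w != z0 -> `|pd b f w| <= c * dist1 z0 w ^+ 2) ->
  nsm (D `&` [set w | w != z0]) 2 f -> nsm D 2 f.
Proof.
move=> oD r0 c0 H0 H1 [df pf].
have [d0 p0] := differentiable_quadratic r0 c0 H0.
have dd z : D z -> differentiable f z.
  by move=> Dz; have [->|nz] := eqVneq z z0 => //; apply: df.
split=> // b; split=> // z Dz; have [->|nz] := eqVneq z z0; last exact: ((pf b).1 z (conj Dz nz)).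
apply: (differentiable_quadratic r0 c0 (f := pd b f) _).1 => w Sw.
have [->|nw] := eqVneq w z0; last exact: H1.
by rewrite p0 normr0 mulr_ge0 // exprn_ge0 // dist1_ge0.
Qed.

(** Vanishing to order k, as a bound and not through derivatives: this is the
    form in which a remainder can be divided by the coordinate. *)
Definition vanishes k (f : plane R -> C) z0 : Prop := exists r c : R,
  [/\ 0 < r, 0 <= c & forall w, sq z0 r w -> normc (f w) <= c * dist1 z0 w ^+ k].

Variables (s : bool) (z0 : plane R).

(** The local coordinate centred at z0 that d_s annihilates. *)
Definition zeta z : C := (z.1 - z0.1)%:C + wc R s * (z.2 - z0.2)%:C.

Lemma wc_Re : Re (wc R s) = 0.
Proof. by rewrite /wc; case: (s); rewrite /= ?expr0 ?expr1 /=; lra. Qed.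

Lemma wc_Im : Im (wc R s) * Im (wc R s) = 1.
Proof.
by have := congr1 (@complex.Re R) (wc_sqr R s); rewrite ReM wc_Re mul0r sub0r /= => /oppr_inj.
Qed.

Lemma zeta_normc w : normc (zeta w) * normc (zeta w) =
  (w.1 - z0.1) * (w.1 - z0.1) + (w.2 - z0.2) * (w.2 - z0.2).
Proof.
rewrite normc_sq /zeta ReD ImD ReM ImM wc_Re /=; move: (w.1 - z0.1) (w.2 - z0.2) wc_Im => a b.
move: (Im _) => c h; transitivity (a * a + (c * c) * (b * b)); first by ring.
by rewrite h mul1r.
Qed.

Lemma zeta_le w : normc (zeta w) <= dist1 z0 w /\ dist1 z0 w <= 2 * normc (zeta w).
Proof.
have n0 := normc_ge0 (zeta w); have E := zeta_normc w; move: E.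
rewrite -!expr2 -(real_normK (num_real (w.1 - _))) -(real_normK (num_real (w.2 - _))) /dist1.
move: (normr_ge0 (w.1 - z0.1)) (normr_ge0 (w.2 - z0.2)).
move: `|w.1 - _| `|w.2 - _| (normc _) n0 => a b n n0 a0 b0 E.
have ab : 0 <= a * b by apply: mulr_ge0.
have sq0 : 0 <= (a - b) ^+ 2 := sqr_ge0 _.
have b2 : 0 <= b ^+ 2 := sqr_ge0 _.
have a2 : 0 <= a ^+ 2 := sqr_ge0 _.
split; rewrite -ler_sqr ?nnegrE ?addr_ge0 ?mulr_ge0 // ?exprMn E sqrrD; first lra.
by move: sq0; rewrite sqrrB; lra.
Qed.

Lemma zeta_eq0 w : (zeta w == 0) = (w == z0).
Proof.
apply/eqP/eqP => [E|->]; last by rewrite /zeta !subrr mulr0 addr0.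
have := (zeta_le w).2; rewrite E ComplexField.Normc.normc0 mulr0 /dist1 => h.
have := normr_ge0 (w.1 - z0.1); have := normr_ge0 (w.2 - z0.2) => h1 h2.
have e1 : `|w.1 - z0.1| == 0 by rewrite eq_le h2 andbT; lra.
have e2 : `|w.2 - z0.2| == 0 by rewrite eq_le h1 andbT; lra.
by rewrite normr_eq0 subr_eq0 in e1; rewrite normr_eq0 subr_eq0 in e2; apply/eqP/andP.
Qed.

Lemma csm_zeta D k : open D -> csm D k zeta.
Proof.
move=> oD; have nc b : csm D k (fun w => (coord b w - coord b z0)%:C).
  split=> /=; last exact: nsm_cst.
  exact: (nsmB oD (nsm_coord k b oD) (nsm_cst D k (coord b z0))).
by apply: (csmD oD (nc false)); apply: (csmM oD (csm_cst D k (wc R s)) (nc true)).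
Qed.

Lemma wirt_zeta t w : wirtinger t zeta w = (t != s)%:R.
Proof.
have d1 b : cpd b zeta w = if b then wc R s else 1.
  have dc c : cdiff (fun w => (coord c w - coord c z0)%:C) w.
    split=> /=; last exact: differentiable_cst.
    by apply: differentiableB => //; [exact: (coord_diff c w).1].
  have pc c : cpd b (fun w => (coord c w - coord c z0)%:C) w = (b == c)%:R.
    rewrite /cpd pd_cst /= (pdD b (coord_diff c w).1 (differentiable_cst (- coord c z0) w)) pd_cst (coord_diff c w).2 addr0.
    by case: b c => [] [].
  rewrite (cpdD b (dc false) (cdiffM (cdiff_cst _ _) (dc true))).
  rewrite (cpdM b (cdiff_cst _ _) (dc true)) cpd_cst mul0r add0r !pc.
  by case: (b); rewrite /= ?mulr0 ?mulr1 ?addr0 ?add0r.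
rewrite wirtingerE !d1; have [->|ts] := eqVneq t s.
  by rewrite wc_sqr subrr mulr0.
have -> : t = ~~ s by case: (t) (s) ts => [] [].
by rewrite wc_neg mulNr wc_sqr opprK -[1 + 1]/(2%:R) mulVf ?pnatr_eq0.
Qed.

Lemma normcN (x : C) : normc (- x) = normc x.
Proof. by case: x => a b; rewrite /= !sqrrN. Qed.

Lemma normc_wc t : normc (wc R t) = 1.
Proof.
apply/eqP; have : normc (wc R t) * normc (wc R t) = 1.
  rewrite -ComplexField.Normc.normcM wc_sqr normcN.
  by rewrite /= expr1n expr0n addr0 sqrtr1.
by move/eqP; rewrite -expr2 sqrf_eq1 => /orP[//|/eqP h]; have := normc_ge0 (wc R t); rewrite h ler0N1.
Qed.

Lemma normc_cpd b f v : wirtinger s f v = 0 -> normc (cpd b f v) = normc (wirtinger (~~ s) f v).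
Proof.
have [E1 E2] := cpd_wirt f v; case: b; last first.
  by rewrite E1; case: (s) => ->; rewrite ?addr0 ?add0r.
rewrite E2 (ComplexField.Normc.normcM (wc R true)) normc_wc mul1r.
by case: (s) => ->; rewrite ?subr0 ?sub0r ?normcN.
Qed.

Definition hol D (f : plane R -> C) : Prop :=
  csm D 2 f /\ forall w, D w -> wirtinger s f w = 0.

Lemma hol_csm D k f : open D -> hol D f -> csm D k f.
Proof. by move=> oD [nf wf]; exact: hol_smooth oD nf wf. Qed.

Lemma hol_zeta D : open D -> hol D zeta.
Proof. by move=> oD; split=> [|w _]; [exact: csm_zeta|rewrite wirt_zeta eqxx]. Qed.

Lemma hol_cst D (c : C) : hol D (fun=> c).
Proof. by split=> [|w _]; [exact: csm_cst|exact: wirt_cst]. Qed.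

Lemma holD D f g : open D -> hol D f -> hol D g -> hol D (fun x => f x + g x).
Proof.
move=> oD [nf wf] [ng wg]; split=> [|w Dw]; first exact: csmD.
by rewrite (wirtD s (csm_cdiff nf Dw) (csm_cdiff ng Dw)) wf // wg // addr0.
Qed.

Lemma holM D f g : open D -> hol D f -> hol D g -> hol D (fun x => f x * g x).
Proof.
move=> oD [nf wf] [ng wg]; split=> [|w Dw]; first exact: csmM.
by rewrite (wirtM s (csm_cdiff nf Dw) (csm_cdiff ng Dw)) wf // wg // mul0r mulr0 addr0.
Qed.

Lemma hol_wirt D t f : open D -> hol D f -> hol D (wirtinger t f).
Proof.
move=> oD hf; split; first exact: (csm_wirt t oD (hol_csm 3 oD hf)).
move=> w Dw; rewrite (wirtC s t oD Dw hf.1) (near_wirt t (g := fun=> 0)) ?wirt_cst //.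
by apply: filterS (open_nbhs_nbhs (conj oD Dw)) => x; exact: hf.2.
Qed.

Lemma vanishes_cont D f : open D -> D z0 -> csm D 1 f -> vanishes 0 f z0.
Proof.
move=> oD Dz nf; have [r r0 rD] := open_sqP oD Dz.
have r2 : r / 2 < r by lra.
have [c [c0 H]] := csm_bound (@csq_compact R z0 (r / 2))
  (fun w Kw => rD w (sq_csq r2 Kw)) nf.
exists (r / 2), c; split=> // [|w Sw]; first by rewrite divr_gt0.
by rewrite expr0 mulr1; apply: H; exact: csq_sq.
Qed.

(** The derivative of a holomorphic function controls its gradient, so
    integration from the centre gains one order. *)
Lemma vanishes_int D f k : open D -> D z0 -> hol D f -> f z0 = 0 ->
  vanishes k (wirtinger (~~ s) f) z0 -> vanishes k.+1 f z0.
Proof.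
move=> oD Dz hf f0 [r1 [c [r10 c0 H]]]; have [r2 r20 rD] := open_sqP oD Dz.
pose r := Num.min r1 r2; have r0 : 0 < r by rewrite lt_min r10.
have s1 : sq z0 r `<=` sq z0 r1 by apply: sq_sub; rewrite ge_min lexx.
have s2 : sq z0 r `<=` D by move=> w Sw; apply: rD; move: w Sw; apply: sq_sub; rewrite ge_min lexx orbT.
exists (r / 2), (2 * (c * 4 ^+ k)); split=> [||w Sw]; first by rewrite divr_gt0.
  by rewrite !mulr_ge0 // exprn_ge0.
have [->|nw] := eqVneq w z0.
  by rewrite f0 ComplexField.Normc.normc0 mulr_ge0 ?exprn_ge0 ?dist1_ge0 // !mulr_ge0 // exprn_ge0.
have dw : 0 < dist1 z0 w.
  rewrite lt_neqAle dist1_ge0 andbT eq_sym; apply: contraNneq nw => d0.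
  have := (zeta_le w).1; rewrite d0 => h; rewrite -zeta_eq0; apply/eqP.
  by apply: ComplexField.Normc.eq0_normc; apply/eqP; rewrite eq_le h normc_ge0.
pose q := Num.min r (dist1 z0 w * 2).
have q0 : 0 < q by rewrite lt_min r0 mulr_gt0.
have sq1 : sq z0 q `<=` sq z0 r by apply: sq_sub; rewrite ge_min lexx.
have wq : sq z0 q w.
  have [w1 w2] := Sw; split; rewrite lt_min; apply/andP; split; try lra.
    by move: dw; rewrite /dist1; have := normr_ge0 (w.1 - z0.1); have := normr_ge0 (w.2 - z0.2); lra.
  by move: dw; rewrite /dist1; have := normr_ge0 (w.1 - z0.1); have := normr_ge0 (w.2 - z0.2); lra.
have bnd b v : sq z0 q v -> normc (cpd b f v) <= c * 4 ^+ k * dist1 z0 w ^+ k.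
  move=> Sv; have Dv := s2 v (sq1 v Sv).
  have -> : normc (cpd b f v) = normc (wirtinger (~~ s) f v).
    exact: normc_cpd (hf.2 v Dv).
  apply: le_trans (H v (s1 v (sq1 v Sv))) _; rewrite -mulrA -exprMn; apply: ler_wpM2l => //.
  rewrite lerXn2r ?nnegrE ?mulr_ge0 ?dist1_ge0 //.
  have [v1 v2] := Sv; have qd : q <= dist1 z0 w * 2 by rewrite ge_min lexx orbT.
  by rewrite {1}/dist1; lra.
have cf v : sq z0 q v -> cdiff f v by move=> Sv; exact: csm_cdiff hf.1 (s2 v (sq1 v Sv)).
have zq := sq_center z0 q0.
have L1 := lipschitz_sq (fun v Sv => (cf v Sv).1)
   (fun b v Sv => le_trans (normc_Re (cpd b f v)) (bnd b v Sv)) wq zq.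
have L2 := lipschitz_sq (fun v Sv => (cf v Sv).2)
   (fun b v Sv => le_trans (normc_Im (cpd b f v)) (bnd b v Sv)) wq zq.
move: L1 L2; rewrite f0 /= !subr0 -/(dist1 z0 w) => L1 L2.
apply: le_trans (normc_le _) _; rewrite exprSr.
have -> : 2 * (c * 4 ^+ k) * (dist1 z0 w ^+ k * dist1 z0 w) =
  c * 4 ^+ k * dist1 z0 w ^+ k * dist1 z0 w + c * 4 ^+ k * dist1 z0 w ^+ k * dist1 z0 w by ring.
exact: lerD.
Qed.

Lemma vanishes_eq D k f g : open D -> D z0 -> (forall w, D w -> f w = g w) ->
  vanishes k f z0 -> vanishes k g z0.
Proof.
move=> oD Dz fg [r1 [c [r10 c0 H]]]; have [r2 r20 rD] := open_sqP oD Dz.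
exists (Num.min r1 r2), c; split=> // [|w Sw]; first by rewrite lt_min r10.
have Dw : D w by apply: rD; move: w Sw; apply: sq_sub; rewrite ge_min lexx orbT.
rewrite -(fg w Dw); apply: H; move: w Sw {Dw}; apply: sq_sub; by rewrite ge_min lexx.
Qed.

Definition monomial k z : C := k`!%:R^-1 * zeta z ^+ k.

Lemma hol_zetaX D k : open D -> hol D (fun z => zeta z ^+ k).
Proof.
move=> oD; elim: k => [|k IH]; first exact: hol_cst.
by under eq_fun do rewrite exprS; apply: (holM oD (hol_zeta oD) IH).
Qed.

Lemma hol_monomial D k : open D -> hol D (monomial k).
Proof. by move=> oD; apply: (holM oD (hol_cst D _) (hol_zetaX k oD)). Qed.

Lemma wirt_zetaX k w : wirtinger (~~ s) (fun z => zeta z ^+ k.+1) w = k.+1%:R * zeta w ^+ k.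
Proof.
have dz := csm_cdiff (hol_zeta openT).1 (Logic.I : setT w).
have dX j := csm_cdiff (hol_zetaX j openT).1 (Logic.I : setT w).
elim: k => [|k IH].
  by rewrite wirt_zeta mul1r expr0; case: (s).
have -> : (fun z => zeta z ^+ k.+2) = fun z => zeta z * zeta z ^+ k.+1.
  by apply/funext => z; rewrite exprS.
rewrite (wirtM _ dz (dX k.+1)) IH wirt_zeta; have -> : ~~ s != s by case: (s).
rewrite mul1r mulrCA -exprS -[X in X + _]mul1r -mulrDl; congr (_ * _).
Qed.

Lemma wirt_monomial k w : wirtinger (~~ s) (monomial k.+1) w = monomial k w.
Proof.
have dX := csm_cdiff (hol_zetaX k.+1 openT).1 (Logic.I : setT w).
rewrite /monomial (wirtM _ (cdiff_cst _ _) dX) wirt_cst mul0r add0r wirt_zetaX mulrA.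
congr (_ * _); by rewrite factS natrM invfM mulrAC mulVf ?mul1r // pnatr_eq0.
Qed.

Let W (f : plane R -> C) := wirtinger (~~ s) f.

Definition taylor k f z : C := \sum_(i < k) iter i W f z0 * monomial i z.

Lemma hol_sum D k (F : nat -> plane R -> C) : open D -> (forall i, hol D (F i)) ->
  hol D (fun z => \sum_(i < k) F i z).
Proof.
move=> oD hF; elim: k => [|k IH].
  by under eq_fun do rewrite big_ord0; exact: hol_cst.
by under eq_fun do rewrite big_ord_recr /=; exact: holD.
Qed.

Lemma hol_taylor D k f : open D -> hol D (taylor k f).
Proof.
move=> oD; apply: (@hol_sum D k (fun i z => iter i W f z0 * monomial i z)) => // i.
by apply: (holM oD (hol_cst D _)); exact: hol_monomial.
Qed.

Lemma wirt_taylor k f w : W (taylor k.+1 f) w = taylor k (W f) w.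
Proof.
have dm i : cdiff (fun z => iter i W f z0 * monomial i z) w.
  exact: (cdiffM (cdiff_cst _ _) (csm_cdiff (hol_monomial i openT).1 (Logic.I : setT w))).
rewrite /W /taylor.
rewrite (wirt_sum _ (F := fun i : 'I_k.+1 => fun z => iter i W f z0 * monomial i z) _ (fun i => dm i)).2.
transitivity (\sum_(i < k.+1) iter i W f z0 * wirtinger (~~ s) (monomial i) w).
  apply: eq_bigr => i _; rewrite (wirtM (~~ s) (cdiff_cst (iter i W f z0) w)
    (csm_cdiff (hol_monomial i openT).1 (Logic.I : setT w))).
  by rewrite wirt_cst mul0r add0r.
have m0 : wirtinger (~~ s) (monomial 0) w = 0.
  have -> : monomial 0 = fun=> 1.
    by apply/funext => z; rewrite /monomial expr0 mulr1 fact0 invr1.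
  exact: wirt_cst.
rewrite big_ord_recl [X in X + _](_ : _ = 0) ?add0r; last by rewrite m0 mulr0.
apply: eq_bigr => i _; rewrite lift0 wirt_monomial; congr (_ * _).
by rewrite iterSr.
Qed.

Lemma taylor_center k f : taylor k.+1 f z0 = f z0.
Proof.
rewrite /taylor big_ord_recl /= /monomial expr0 mulr1 fact0 invr1 mulr1 big1 ?addr0 // => i _.
rewrite /= (_ : zeta z0 = 0) ?expr0n /= ?mulr0 //.
by apply/eqP; rewrite zeta_eq0.
Qed.

(** Induction on k, applied to the derivative of f: differentiation sends
    Taylor polynomials to Taylor polynomials, and vanishes_int integrates
    back. *)
Lemma vanishes_taylor D k f : open D -> D z0 -> hol D f ->
  vanishes k (fun z => f z - taylor k f z) z0.
Proof.
move=> oD Dz; elim: k f => [|k IH] f hf.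
  apply: (vanishes_cont oD Dz); apply: (csmD oD (hol_csm 1 oD hf)).
  exact: (csmN oD (hol_csm 1 oD (hol_taylor 0 f oD))).
have hT : hol D (fun z => - taylor k.+1 f z).
  split; first exact: (csmN oD (hol_taylor _ _ oD).1).
  move=> w Dw; rewrite (wirtN _ (csm_cdiff (hol_taylor k.+1 f oD).1 Dw)).
  by rewrite (hol_taylor k.+1 f oD).2 // oppr0.
apply: (vanishes_int oD Dz); first exact: (holD oD hf hT).
  by rewrite taylor_center subrr.
apply: (vanishes_eq oD Dz) (IH (W f) (hol_wirt (~~ s) oD hf)) => w Dw.
rewrite (wirtD _ (csm_cdiff hf.1 Dw) (csm_cdiff hT.1 Dw)).
by rewrite (wirtN _ (csm_cdiff (hol_taylor k.+1 f oD).1 Dw)); congr (_ - _); rewrite -wirt_taylor.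
Qed.

(** The Taylor polynomial is divisible term by term, and the remainder divided
    by the coordinate extends by removable_quadratic. *)
Lemma hol_div D f : open D -> D z0 -> hol D f -> f z0 = 0 ->
  exists2 g, hol D g & forall w, D w -> f w = zeta w * g w.
Proof.
move=> oD Dz hf f0; pose T := taylor 4 f; pose Q w := f w - T w.
have hT : hol D T := hol_taylor 4 f oD.
have hN : hol D (fun z => - T z).
  split; first exact: (csmN oD hT.1).
  by move=> w Dw; rewrite (wirtN _ (csm_cdiff hT.1 Dw)) hT.2 // oppr0.
have hQ : hol D Q := holD oD hf hN.
have vQ : vanishes 4 Q z0 := vanishes_taylor 4 oD Dz hf.
have vW : vanishes 3 (W Q) z0.
  apply: (vanishes_eq oD Dz) (vanishes_taylor 3 oD Dz (hol_wirt (~~ s) oD hf)) => w Dw.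
  rewrite /W (wirtD _ (csm_cdiff hf.1 Dw) (csm_cdiff hN.1 Dw)).
  by rewrite (wirtN _ (csm_cdiff hT.1 Dw)); congr (_ - _); rewrite -wirt_taylor.
have [r1 [c1 [r10 c10 H1]]] := vQ; have [r2 [c2 [r20 c20 H2]]] := vW.
have [r3 r30 rD] := open_sqP oD Dz.
pose r := Num.min (Num.min r1 r2) (Num.min r3 (2^-1)).
have r0 : 0 < r by rewrite !lt_min r10 r20 r30 invr_gt0 ltr0n.
have s1 : sq z0 r `<=` sq z0 r1 by apply: sq_sub; rewrite !ge_min lexx.
have s2 : sq z0 r `<=` sq z0 r2 by apply: sq_sub; rewrite !ge_min lexx orbT.
have s3 : sq z0 r `<=` D by move=> w Sw; apply: rD; move: w Sw; apply: sq_sub; rewrite !ge_min lexx !orbT.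
have s4 w : sq z0 r w -> dist1 z0 w <= 1.
  have : r <= 2^-1 by rewrite !ge_min lexx !orbT.
  by move=> rr [w1 w2]; rewrite /dist1; lra.
pose D' := D `&` [set w | w != z0].
have oD' : open D'.
  apply: openI => //; rewrite (_ : [set w | w != z0] = ~` [set z0]).
    by apply: closed_openC; apply: accessible_closed_set1; apply: hausdorff_accessible; exact: norm_hausdorff.
  by apply/seteqP; split=> w /= /eqP.
have sD : D' `<=` D by move=> w [].
pose q w := Q w * (zeta w)^-1.
have nz w : D' w -> zeta w != 0 by move=> [_ nw]; rewrite zeta_eq0.
have nq : csm D' 2 q.
  apply: (csmM oD' (csm_sub sD hQ.1)); apply: (csmV oD' nz).
  exact: (csm_zeta 2 oD').
have dz w := csm_cdiff (csm_zeta 1 openT) (Logic.I : setT w).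
have qz w : D' w -> Q w = q w * zeta w by move=> /nz zw; rewrite /q mulfVK.
have Wq t w : D' w -> wirtinger t Q w = wirtinger t q w * zeta w + q w * (t != s)%:R.
  move=> Dw; rewrite -(wirt_zeta t w) -(wirtM t (csm_cdiff nq Dw) (dz w)).
  by apply: near_wirt; apply: filterS (open_nbhs_nbhs (conj oD' Dw)) => x /qz.
have hq w : D' w -> wirtinger s q w = 0.
  move=> Dw; have := Wq s w Dw; rewrite hQ.2 ?eqxx ?mulr0 ?addr0; last exact: sD.
  by move/esym/eqP; rewrite mulf_eq0 (negPf (nz w Dw)) orbF => /eqP.
pose c := 2 * (c2 + 2 * c1).
have c0 : 0 <= c by rewrite /c; lra.
have dV w : w != z0 -> normc (zeta w)^-1 <= 2 * (dist1 z0 w)^-1 /\ 0 < dist1 z0 w.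
  move=> nw; have [zl zu] := zeta_le w.
  have zp : 0 < normc (zeta w).
    rewrite lt_neqAle normc_ge0 andbT eq_sym; apply: contraNneq nw => E.
    by rewrite -zeta_eq0; apply/eqP; exact: ComplexField.Normc.eq0_normc.
  have dp : 0 < dist1 z0 w by apply: lt_le_trans zp zl.
  split=> //; rewrite ComplexField.Normc.normcV -[2]invrK -invfM lef_pV2 ?posrE ?mulr_gt0 //; lra.
have b0 w : sq z0 r w -> w != z0 -> normc (q w) <= 2 * c1 * dist1 z0 w ^+ 3.
  move=> Sw nw; have [h1 h2] := dV w nw.
  have -> : 2 * c1 * dist1 z0 w ^+ 3 = (c1 * dist1 z0 w ^+ 4) * (2 * (dist1 z0 w)^-1).
    by rewrite (exprSr _ 3); move: (dist1 _ _) h2 => d d0; field; rewrite gt_eqF.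
  rewrite ComplexField.Normc.normcM; apply: ler_pM => //; try exact: normc_ge0.
  by apply: H1; exact: s1.
have b1 w : sq z0 r w -> w != z0 -> normc (W q w) <= c * dist1 z0 w ^+ 2.
  move=> Sw nw; have [h1 h2] := dV w nw; have Dw : D' w by split=> //; exact: s3.
  have -> : W q w = (W Q w - q w) * (zeta w)^-1.
    have ts : ~~ s != s by case: (s).
    by rewrite /W (Wq _ _ Dw) ts mulr1 addrK mulfK // nz.
  have -> : c * dist1 z0 w ^+ 2 = ((c2 + 2 * c1) * dist1 z0 w ^+ 3) * (2 * (dist1 z0 w)^-1).
    by rewrite (exprSr _ 2) /c; move: (dist1 _ _) h2 => d d0; field; rewrite gt_eqF.
  rewrite ComplexField.Normc.normcM; apply: ler_pM => //; try exact: normc_ge0.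
  apply: le_trans (normcD _ _) _; rewrite normcN mulrDl; apply: lerD; last exact: b0.
  by apply: H2; exact: s2.
have q00 : q z0 = 0.
  by rewrite /q (_ : zeta z0 = 0) ?invr0 ?mulr0 //; apply/eqP; rewrite zeta_eq0.
have B0 w : sq z0 r w -> normc (q w) <= c * dist1 z0 w ^+ 2.
  move=> Sw; have d0 := dist1_ge0 z0 w; have [->|nw] := eqVneq w z0.
    by rewrite q00 ComplexField.Normc.normc0 mulr_ge0 // exprn_ge0 // dist1_ge0.
  apply: le_trans (b0 w Sw nw) _; rewrite (exprSr _ 2) mulrA.
  have t0 : 0 <= dist1 z0 w ^+ 2 by rewrite exprn_ge0.
  apply: le_trans (_ : 2 * c1 * dist1 z0 w ^+ 2 <= _).
    by apply: ler_piMr (s4 w Sw); rewrite !mulr_ge0.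
  by apply: ler_wpM2r => //; rewrite /c; lra.
have B1 b w : sq z0 r w -> w != z0 -> normc (cpd b q w) <= c * dist1 z0 w ^+ 2.
  move=> Sw nw; have Dw : D' w by split=> //; exact: s3.
  by rewrite (normc_cpd b (hq w Dw)); exact: b1.
have nqD : csm D 2 q.
  split.
    apply: (removable_quadratic oD r0 c0 _ _ nq.1) => [w Sw|b w Sw nw].
      exact: le_trans (normc_Re _) (B0 w Sw).
    exact: le_trans (normc_Re _) (B1 b w Sw nw).
  apply: (removable_quadratic oD r0 c0 _ _ nq.2) => [w Sw|b w Sw nw].
    exact: le_trans (normc_Im _) (B0 w Sw).
  exact: le_trans (normc_Im _) (B1 b w Sw nw).
have hqD : hol D q.
  split=> // w Dw; have [->|nw] := eqVneq w z0; last by apply: hq.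
  have d1 := (differentiable_quadratic r0 c0 (fun w Sw => le_trans (normc_Re (q w)) (B0 w Sw))).2.
  have d2 := (differentiable_quadratic r0 c0 (fun w Sw => le_trans (normc_Im (q w)) (B0 w Sw))).2.
  by rewrite wirtingerE /cpd !d1 !d2 mulr0 addr0 mulr0.
pose m i w := iter i.+1 W f z0 * ((i.+1)`!%:R^-1 * zeta w ^+ i).
exists (fun w => \sum_(i < 3) m i w + q w).
  have hm i : hol D (m i) := holM oD (hol_cst D _) (holM oD (hol_cst D _) (hol_zetaX i oD)).
  exact: (holD oD (@hol_sum D 3 m oD hm) hqD).
move=> w Dw; have [->|nw] := eqVneq w z0.
  by rewrite f0 (_ : zeta z0 = 0) ?mul0r //; apply/eqP; rewrite zeta_eq0.
rewrite mulrDr [zeta w * q w]mulrC -qz; last by split.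
rewrite mulr_sumr; have E : T w = \sum_(i < 3) zeta w * m i w.
  rewrite /T /taylor big_ord_recl /= f0 mul0r add0r; apply: eq_bigr => i _.
  rewrite /m /monomial /= /bump /= add1n exprS.
  by rewrite [RHS]mulrCA; congr (_ * _); rewrite [RHS]mulrCA.
by rewrite -E /Q addrC subrK.
Qed.

End Division.

(** * Zeros of holomorphic matrix functions *)

Section Order.
Variable R : realType.
Local Notation C := R[i].
Local Notation Re := complex.Re.
Local Notation Im := complex.Im.
Local Notation normc := (@ComplexField.Normc.normc R).
Implicit Types (z w : plane R) (D : set (plane R)).

(** The maximum principle for the real and the imaginary parts separately,
    whence the factor two. *)
Lemma hol_max s D (f : plane R -> C) z0 (r M : R) : open D -> csq z0 r `<=` D -> hol s D f ->
  (forall w, csq z0 r w -> ~ sq z0 r w -> normc (f w) <= M) ->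
  forall w, csq z0 r w -> normc (f w) <= M + M.
Proof.
move=> oD rD hf fM w Kw; have [n1 n2] := hf.1.
have oS : open (sq z0 r) := @sq_open R z0 r.
have sD : sq z0 r `<=` D by move=> v Sv; apply: rD; exact: csq_sq.
have main (u : plane R -> R) : nsm D 2 u -> (forall v, D v -> lap u v = 0) ->
    (forall v, `|u v| <= normc (f v)) -> `|u w| <= M.
  move=> nu lu uf; have cu v : csq z0 r v -> {for v, continuous u}.
    by move=> /rD Dv; exact: nsm_continuous nu Dv.
  have nuN := nsmN oD nu.
  rewrite ler_norml; apply/andP; split.
    rewrite lerNl.
    apply: (subharmonic_le (u := fun x => - u x) (csq_compact (z := z0) (r := r)) oS (@csq_sq _ _ _) (fun _ h => h) _ _ _ _ Kw) => [v Kv||v Sv|v Kv nS].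
    - by have := nsm_continuous nuN (rD v Kv).
    - exact: nsm_sub sD nuN.
    - by rewrite (lapN oS Sv (nsm_sub sD nu)) lu ?oppr0 //; exact: sD.
    - apply: le_trans (fM v Kv nS); apply: le_trans (uf v); rewrite -normrN; exact: ler_norm.
  apply: (subharmonic_le (u := u) (csq_compact (z := z0) (r := r)) oS (@csq_sq _ _ _) (fun _ h => h) _ _ _ _ Kw) => [v Kv||v Sv|v Kv nS].
  - exact: cu.
  - exact: nsm_sub sD nu.
  - by rewrite lu //; exact: sD.
  - by apply: le_trans (fM v Kv nS); apply: le_trans (uf v); exact: ler_norm.
have L v : D v -> _ := fun Dv => hol_lap oD hf.1 hf.2 Dv.
apply: le_trans (normc_le _) _; apply: lerD.
  apply: (main (fun x => Re (f x))) => // [v Dv|v]; [exact: (L v Dv).1|exact: normc_Re].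
apply: (main (fun x => Im (f x))) => // [v Dv|v]; [exact: (L v Dv).2|exact: normc_Im].
Qed.

(** By hol_max on a fixed square, the quotient of f by the k-th power of the
    coordinate is bounded by a constant times r^-k; letting k grow forces f to
    vanish on a smaller square. *)
Lemma hol_flat s D (f : plane R -> C) z0 : open D -> D z0 -> hol s D f ->
  (forall k, exists2 g, hol s D g & forall w, D w -> f w = zeta s z0 w ^+ k * g w) ->
  exists2 r : R, 0 < r & forall w, sq z0 r w -> f w = 0.
Proof.
move=> oD Dz hf H; have [r r0 rD] := open_sqP oD Dz.
have rq : csq z0 (r / 2) `<=` D.
  by move=> w Kw; apply: rD; move: w Kw; apply: sq_csq; lra.
have [M [M0 fM]] := csm_bound (@csq_compact R z0 (r / 2)) rq hf.1.
exists (r / 8); first by rewrite divr_gt0.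
move=> w Sw; apply: ComplexField.Normc.eq0_normc; apply/eqP.
have Kw : csq z0 (r / 2) w by case: Sw => w1 w2; split; lra.
have bd k : normc (f w) <= 2^-1 ^+ k * (M + M).
  have [g hg fg] := H k.
  have zr v : csq z0 (r / 2) v -> ~ sq z0 (r / 2) v -> r / 2 <= normc (zeta s z0 v).
    move=> [v1 v2] nS; rewrite leNgt; apply/negP => lt; apply: nS.
    have E := zeta_normc s z0 v; rewrite -!expr2 in E.
    have n0 := normc_ge0 (zeta s z0 v).
    have a0 := sqr_ge0 (v.1 - z0.1); have b0 := sqr_ge0 (v.2 - z0.2).
    have le1 : `|v.1 - z0.1| <= normc (zeta s z0 v).
      by rewrite -ler_sqr ?nnegrE // E real_normK ?num_real // lerDl.
    have le2 : `|v.2 - z0.2| <= normc (zeta s z0 v).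
      by rewrite -ler_sqr ?nnegrE // E real_normK ?num_real // lerDr.
    by split; [apply: le_lt_trans le1 lt|apply: le_lt_trans le2 lt].
  have r2 : 0 < r / 2 by rewrite divr_gt0.
  have gM v : csq z0 (r / 2) v -> ~ sq z0 (r / 2) v -> normc (g v) <= M / (r / 2) ^+ k.
    move=> Kv nS; have z1 := zr v Kv nS.
    have zp : 0 < normc (zeta s z0 v) ^+ k by rewrite exprn_gt0 //; apply: lt_le_trans z1.
    rewrite ler_pdivlMr ?exprn_gt0 //.
    apply: le_trans (_ : normc (g v) * normc (zeta s z0 v) ^+ k <= _).
      by apply: ler_wpM2l; rewrite ?normc_ge0 // lerXn2r ?nnegrE ?normc_ge0 // ltW.
    have nX : normc (zeta s z0 v) ^+ k = normc (zeta s z0 v ^+ k).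
      elim: (k) => [|j IH]; first by rewrite !expr0 /= expr1n expr0n addr0 sqrtr1.
      by rewrite !exprS IH ComplexField.Normc.normcM.
    rewrite nX mulrC -ComplexField.Normc.normcM -fg; last exact: rq.
    exact: fM.
  have gw := hol_max oD rq hg gM Kw.
  rewrite (fg w (rq w Kw)) ComplexField.Normc.normcM.
  have nX : normc (zeta s z0 w ^+ k) = normc (zeta s z0 w) ^+ k.
    elim: (k) => [|j IH]; first by rewrite !expr0 /= expr1n expr0n addr0 sqrtr1.
    by rewrite !exprS -IH ComplexField.Normc.normcM.
  have zw : normc (zeta s z0 w) <= r / 4.
    by apply: le_trans (zeta_le s z0 w).1 _; case: Sw => w1 w2; rewrite /dist1; lra.
  have -> : 2^-1 ^+ k * (M + M) = (r / 4) ^+ k * (M / (r / 2) ^+ k + M / (r / 2) ^+ k).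
    have -> : r / 4 = 2^-1 * (r / 2) by field.
    rewrite exprMn -mulrDl [(M + M) / _]mulrC !mulrA mulfK //.
    by rewrite gt_eqF // exprn_gt0.
  rewrite nX; apply: ler_pM; rewrite ?exprn_ge0 ?normc_ge0 //.
  by rewrite lerXn2r ?nnegrE ?normc_ge0 // divr_ge0 // ltW.
have N0 := normc_ge0 (f w); rewrite eq_le N0 andbT leNgt; apply/negP => Np.
have [k Hk] : exists k : nat, (M + M) / normc (f w) < k%:R.
  exists (Num.bound ((M + M) / normc (f w))); apply: archi_boundP; rewrite divr_ge0 ?addr_ge0 //.
have k2 : (k%:R : R) <= 2 ^+ k by rewrite -natrX ler_nat ltnW // ltn_expl.
have := bd k; rewrite exprVn mulrC ler_pdivlMr ?exprn_gt0 // leNgt => /negP; apply.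
by rewrite -ltr_pdivrMl // mulrC; apply: lt_le_trans Hk k2.
Qed.

Definition mhol s D m n (X : plane R -> 'M[C]_(m, n)) : Prop :=
  forall i j, hol s D (fun z => X z i j).

(** Division is repeated as long as the quotient vanishes at z0; it terminates
    because a matrix that is divisible by every power of the coordinate
    vanishes near z0 by hol_flat. *)
Lemma hol_factor s D m n (X : plane R -> 'M[C]_(m, n)) z0 : open D -> D z0 -> mhol s D X ->
  ~ (exists2 r : R, 0 < r & forall w, sq z0 r w -> X w = 0) ->
  exists k Y, [/\ mhol s D Y, forall w, D w -> X w = zeta s z0 w ^+ k *: Y w & Y z0 != 0].
Proof.
move=> oD Dz hX nX; apply: contrapT => H; apply: nX.
have div k : exists2 Y, mhol s D Y & forall w, D w -> X w = zeta s z0 w ^+ k *: Y w.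
  elim: k => [|k [Y hY XY]]; first by exists X => // w _; rewrite expr0 scale1r.
  have Y0 : Y z0 = 0.
    by apply/eqP/negPn/negP => Y0; apply: H; exists k, Y.
  have dv i j : exists2 g, hol s D g & forall w, D w -> Y w i j = zeta s z0 w * g w.
    by apply: hol_div => //; rewrite Y0 mxE.
  pose g i j := projT1 (cid2 (dv i j)).
  have hg i j : hol s D (g i j) by rewrite /g; case: cid2.
  have Yg i j w : D w -> Y w i j = zeta s z0 w * g i j w by rewrite /g; case: cid2 => ? ? h /h.
  exists (fun w => \matrix_(i, j) g i j w).
    by move=> i j; under eq_fun do rewrite mxE.
  move=> w Dw; rewrite XY // exprSr -scalerA; congr (_ *: _).
  by apply/matrixP => i j; rewrite !mxE Yg.
have fl i j : exists2 r : R, 0 < r & forall w, sq z0 r w -> X w i j = 0.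
  apply: (hol_flat oD Dz (hX i j)) => k; have [Y hY XY] := div k.
  by exists (fun z => Y z i j) => // w /XY ->; rewrite mxE.
pose r i j := projT1 (cid2 (fl i j)).
have r0 i j : 0 < r i j by rewrite /r; case: cid2.
have Xr i j w : sq z0 (r i j) w -> X w i j = 0 by rewrite /r; case: cid2 => ? ? h /h.
pose q := \big[Num.min/1]_(ij : 'I_m * 'I_n) r ij.1 ij.2.
exists q => [|w Sw].
  by apply: (big_ind (fun x : R => 0 < x)) => // x y x0 y0; rewrite lt_min x0.
apply/matrixP => i j; rewrite mxE; apply: Xr.
move: w Sw; apply: sq_sub; rewrite /q.
by rewrite (bigD1 (i, j)) //= ge_min lexx.
Qed.

End Order.

(** * Rank-one projectors *)

Section RankOne.
Variables (R : realType) (n : nat).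
Local Notation C := R[i].
Local Notation normc := (@ComplexField.Normc.normc R).
Implicit Types (P Q M X Y : 'M[C]_n).

Lemma idem_trace P : P *m P = P -> \tr P = (\rank P)%:R.
Proof.
move=> PP; have E := mulmx_base P.
have BC : row_base P *m col_base P = 1%:M.
  apply: (row_full_inj (col_base_full P)); apply: (row_free_inj (row_base_free P)).
  by rewrite mulmx1 mulmxA -[_ *m _ *m row_base P]mulmxA E PP.
by rewrite -{1}E mxtrace_mulC BC mxtrace1.
Qed.

Lemma rank1_rank P : rank1_projector P -> \rank P = 1%N.
Proof.
by move=> [PP _ tP]; move: tP; rewrite idem_trace // => /eqP; rewrite pnatr_eq1 => /eqP.
Qed.

Lemma rank1_outer P : \rank P = 1%N -> exists (c : 'cV[C]_n) (r : 'rV[C]_n), P = c *m r.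
Proof.
move=> r1; move: (col_base P) (row_base P) (mulmx_base P); rewrite r1 => c r <-.
by exists c, r.
Qed.

(** The source of all the scalar coefficients below: P M P is a multiple of
    P. *)
Lemma rank1_sandwich P M : rank1_projector P -> P *m M *m P = \tr (P *m M) *: P.
Proof.
move=> /rank1_rank/rank1_outer[c [r ->]].
rewrite -!mulmxA (mxtrace_mulC c) [r *m (M *m (c *m r))]mulmxA [r *m M *m _]mulmxA.
rewrite [r *m M *m c]mx11_scalar mxtrace_scalar mulr1n mul_scalar_mx.
by rewrite scalemxAr.
Qed.

Lemma tr_normsq m p (X : 'M[C]_(m, p)) :
  \tr (X *m X^t*) = (\sum_i \sum_j normc (X i j) * normc (X i j))%:C.
Proof.
rewrite /mxtrace raddf_sum; apply: eq_bigr => i _; rewrite mxE raddf_sum.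
by apply: eq_bigr => j _; rewrite adjE mulJE.
Qed.

Lemma tr_normsq_eq0 m p (X : 'M[C]_(m, p)) : \tr (X *m X^t*) = 0 -> X = 0.
Proof.
rewrite tr_normsq => /(congr1 (@complex.Re R)) /= E; apply/matrixP => i j; rewrite mxE.
have nn k l : 0 <= normc (X k l) * normc (X k l) by rewrite mulr_ge0 // normc_ge0.
have /psumr_eq0P /(_ i isT) E1 := E; have {}E1 := E1 (fun k _ => sumr_ge0 _ (fun l _ => nn k l)).
have /psumr_eq0P /(_ j isT) E2 := E1; have {}E2 := E2 (fun l _ => nn i l).
by apply: ComplexField.Normc.eq0_normc; apply/eqP; rewrite -sqrf_eq0 expr2 E2.
Qed.

Lemma col_normsq_eq0 (u : 'cV[C]_n) : (u^t* *m u) 0 0 = 0 -> u = 0.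
Proof.
move=> E; have h : \tr (u^t* *m (u^t*)^t*) = 0 by rewrite adjK [_ *m _]mx11_scalar mxtrace_scalar E mul0rn.
by rewrite -[u]adjK (tr_normsq_eq0 h) adj0.
Qed.

(** A rank-one operator is determined by its value on one vector outside its
    kernel. *)
Lemma rank1_kill m P (Y : 'M[C]_(m, n)) (e : 'cV[C]_n) : rank1_projector P ->
  P *m e != 0 -> Y *m P *m e = 0 -> Y *m P = 0.
Proof.
move=> rP Pe Ye; have [PP PJ _] := rP.
have S := rank1_sandwich (e *m (P *m e)^t*) rP.
have tn : \tr (P *m (e *m (P *m e)^t*)) != 0.
  apply: contra_neq Pe => E; apply: tr_normsq_eq0; rewrite -E mulmxA.
  by [].
apply: (scalerI tn); rewrite scaler0 scalemxAr -S !mulmxA Ye.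
by rewrite !mul0mx.
Qed.

Lemma rank1_neq0 P : rank1_projector P -> P != 0.
Proof. by move=> [_ _ t]; apply: contra_eq_neq t => ->; rewrite mxtrace0 eq_sym oner_neq0. Qed.

End RankOne.

(** * Unique continuation for matrix systems *)

Section MatrixUC.
Variables (R : realType).
Local Notation C := R[i].
Implicit Types (z : plane R).

Section Lin.
Variables (I : finType) (w : I -> plane R -> C).

(** Conjugates are included because adjoints occur in the matrix systems. *)
Definition lin (f : plane R -> C) : Prop := exists A B : I -> plane R -> C,
  [/\ forall i, csm setT 2 (A i), forall i, csm setT 2 (B i) &
    forall z, f z = \sum_i (A i z * w i z + B i z * Num.conj (w i z))].

Lemma lin_id i : lin (w i).
Proof.
exists (fun j _ => (j == i)%:R), (fun _ _ => 0); split=> [j|j|z]; try exact: csm_cst.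
rewrite (bigD1 i) //= eqxx mul1r mul0r addr0 big1 ?addr0 // => j /negPf ->.
by rewrite !mul0r addr0.
Qed.

Lemma linD f g : lin f -> lin g -> lin (fun z => f z + g z).
Proof.
move=> [A [B [nA nB E]]] [A' [B' [nA' nB' E']]].
exists (fun i z => A i z + A' i z), (fun i z => B i z + B' i z).
split=> [i|i|z]; [exact: (csmD openT)|exact: (csmD openT)|].
rewrite E E' -big_split /=; apply: eq_bigr => i _.
move: (A i z) (B i z) (A' i z) (B' i z) (w i z) (Num.conj _) => a b c d x y; ring.
Qed.

Lemma linM c f : csm setT 2 c -> lin f -> lin (fun z => c z * f z).
Proof.
move=> nc [A [B [nA nB E]]].
exists (fun i z => c z * A i z), (fun i z => c z * B i z).
split=> [i|i|z]; [exact: (csmM openT)|exact: (csmM openT)|].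
rewrite E mulr_sumr; apply: eq_bigr => i _.
move: (A i z) (B i z) (c z) (w i z) (Num.conj _) => a b d x y; ring.
Qed.

Lemma lin0 : lin (fun=> 0).
Proof.
exists (fun _ _ => 0), (fun _ _ => 0); split=> [i|i|z]; try exact: csm_cst.
by rewrite big1 // => i _; rewrite !mul0r addr0.
Qed.

Lemma linJ f : lin f -> lin (fun z => Num.conj (f z)).
Proof.
move=> [A [B [nA nB E]]].
exists (fun i z => Num.conj (B i z)), (fun i z => Num.conj (A i z)).
split=> [i|i|z]; [exact: (csmJ openT)|exact: (csmJ openT)|].
rewrite E rmorph_sum; apply: eq_bigr => i _.
by rewrite rmorphD !rmorphM /= conjCK addrC.
Qed.

Lemma lin_sum (J : Type) (r : seq J) (F : J -> plane R -> C) : (forall j, lin (F j)) ->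
  lin (fun z => \sum_(j <- r) F j z).
Proof.
move=> hF; elim: r => [|j r IH].
  by under eq_fun do rewrite big_nil; exact: lin0.
by under eq_fun do rewrite big_cons; exact: linD.
Qed.

Definition mlin m n (X : plane R -> 'M[C]_(m, n)) : Prop := forall i j, lin (fun z => X z i j).

Lemma mlinD m n (X Y : plane R -> 'M[C]_(m, n)) : mlin X -> mlin Y -> mlin (fun z => X z + Y z).
Proof. by move=> hX hY i j; under eq_fun do rewrite mxE; exact: linD. Qed.

Lemma mlinN m n (X : plane R -> 'M[C]_(m, n)) : mlin X -> mlin (fun z => - X z).
Proof.
move=> hX i j; under eq_fun do rewrite mxE -mulN1r.
exact: (linM (csm_cst _ _ _) (hX i j)).
Qed.

Lemma mlinJ m n (X : plane R -> 'M[C]_(m, n)) : mlin X -> mlin (fun z => (X z)^t*).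
Proof. by move=> hX i j; under eq_fun do rewrite adjE; exact: linJ. Qed.

Lemma mlinMl m n p (A : plane R -> 'M[C]_(m, n)) (X : plane R -> 'M[C]_(n, p)) :
  msm setT 2 A -> mlin X -> mlin (fun z => A z *m X z).
Proof.
move=> nA hX i j; under eq_fun do rewrite mxE.
by apply: lin_sum => k; exact: (linM (nA i k) (hX k j)).
Qed.

Lemma mlinMr m n p (A : plane R -> 'M[C]_(n, p)) (X : plane R -> 'M[C]_(m, n)) :
  msm setT 2 A -> mlin X -> mlin (fun z => X z *m A z).
Proof.
move=> nA hX i j; under eq_fun do rewrite mxE.
by apply: lin_sum => k; under eq_fun do rewrite mulrC; exact: (linM (nA k j) (hX i k)).
Qed.

Lemma mlin_eq m n (X Y : plane R -> 'M[C]_(m, n)) : (forall z, X z = Y z) -> mlin Y -> mlin X.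
Proof. by move=> XY; rewrite (_ : X = Y) //; apply/funext. Qed.

End Lin.

Definition entries n (X : bool -> plane R -> 'M[C]_n) (i : bool * ('I_n * 'I_n)) z : C :=
  X i.1 z i.2.1 i.2.2.

Lemma mlin_entries n (X : bool -> plane R -> 'M[C]_n) b : mlin (entries X) (X b).
Proof. by move=> i j; exact: (lin_id (entries X) (b, (i, j))). Qed.

(** system_uc for two matrix functions whose derivatives in one direction are
    linear, with conjugates allowed, in the entries of both. *)
Lemma matrix_uc s n (X : bool -> plane R -> 'M[C]_n) z0 (r0 : R) :
  (forall b, msm setT 2 (X b)) -> (forall b, mlin (entries X) (mpart s (X b))) ->
  0 < r0 -> (forall b z, sq z0 r0 z -> X b z = 0) -> forall b z, X b z = 0.
Proof.
move=> nX lX r00 X0 b z; apply/matrixP => i j; rewrite mxE.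
have lX' i' : lin (entries X) (wirtinger s (entries X i')).
  case: i' => c [k l]; have := lX c k l; congr (lin _ _).
  by apply/funext => x; rewrite mpartE.
pose A i' := projT1 (cid (lX' i')); pose B i' := projT1 (cid (projT2 (cid (lX' i')))).
have AB i' := projT2 (cid (projT2 (cid (lX' i')))).
apply: (@system_uc R _ s (entries X) A B z0 r0 _ _ _ _ _ _ (b, (i, j)) z) => //.
- by case=> c [k l]; exact: nX.
- by move=> i'; have [h _ _] := AB i'.
- by move=> i'; have [_ h _] := AB i'.
- by move=> i'; have [_ _ h] := AB i'.
- by case=> c [k l] x Sx; rewrite /entries X0 ?mxE.
Qed.

End MatrixUC.

(** * Smoothness of holomorphic projectors *)

Section Projectors.
Variables (R : realType).
Local Notation C := R[i].
Implicit Types (z : plane R) (D : set (plane R)).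

Lemma csm_neq0_near D (f : plane R -> C) z0 : open D -> D z0 -> csm D 1 f -> f z0 != 0 ->
  exists O, [/\ open O, O z0, O `<=` D & forall z, O z -> f z != 0].
Proof.
move=> oD Dz [n1 n2] f0.
have main (g : plane R -> R) : nsm D 1 g -> g z0 != 0 -> (forall z, g z != 0 -> f z != 0) ->
   exists O, [/\ open O, O z0, O `<=` D & forall z, O z -> f z != 0].
  move=> ng g0 gf; have cg := nsm_continuous ng Dz.
  have ne : nbhs (g z0) [set x : R | x != 0].
    apply: open_nbhs_nbhs; split; last exact: g0.
    have -> : [set x : R | x != 0] = ~` [set (0 : R)] by apply/seteqP; split=> x /= /eqP.
    by apply: closed_openC; apply: accessible_closed_set1; apply: hausdorff_accessible;
      exact: Rhausdorff.
  have nb : nbhs z0 [set z | g z != 0] by exact: (cg _ ne).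
  have [r1 r10 H1] := (nbhs_sqP _ _).1 nb; have [r2 r20 H2] := open_sqP oD Dz.
  exists (sq z0 (Num.min r1 r2)); split=> [|||z Sz]; first exact: (@sq_open R).
  - by apply: sq_center; rewrite lt_min r10.
  - by move=> z Sz; apply: H2; move: z Sz; apply: sq_sub; rewrite ge_min lexx orbT.
  - by apply: gf; apply: H1; move: z Sz; apply: sq_sub; rewrite ge_min lexx.
have [e1|e1] := eqVneq (complex.Re (f z0)) 0; last first.
  by apply: (main _ n1 e1) => z; apply: contra_neq => ->.
have [e2|e2] := eqVneq (complex.Im (f z0)) 0; last first.
  by apply: (main _ n2 e2) => z; apply: contra_neq => ->.
by move: f0; rewrite (complex_eq (x := f z0) (y := 0)) ?eqxx.
Qed.

Lemma unit_near n D (X : plane R -> 'M[C]_n) z0 : open D -> D z0 -> msm D 1 X ->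
  X z0 \in unitmx -> exists O, [/\ open O, O z0, O `<=` D & forall z, O z -> X z \in unitmx].
Proof.
move=> oD Dz nX; rewrite unitmxE unitfE => /(csm_neq0_near oD Dz (csm_det oD nX))[U [? ? ? H]].
by exists U; split=> // z /H; rewrite unitmxE unitfE.
Qed.

Variable n : nat.
Implicit Types (Q P M : plane R -> 'M[C]_n).

Lemma msm_local D k Q :
  (forall z, D z -> exists O, [/\ open O, O z & msm O k Q]) -> msm D k Q.
Proof. by move=> H i j; apply: csm_local => z /H [U [oU Uz nX]]; exists U; split. Qed.

Lemma near_open D (A : plane R -> Prop) z : open D -> D z -> (forall w, D w -> A w) ->
  \forall x \near z, A x.
Proof. by move=> oD Dz H; apply: filterS (open_nbhs_nbhs (conj oD Dz)) => x /H. Qed.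

(** The oblique projection with the image of Q and the kernel of Q z0. *)
Lemma oblique_projector s D Q z0 : open D -> D z0 -> msm D 2 Q ->
  (forall z, D z -> Q z *m Q z = Q z) -> (forall z, D z -> mpart s Q z *m Q z = 0) ->
  exists O M, [/\ open O, O z0, O `<=` D, mhol s O M &
    forall z, O z -> [/\ Q z *m M z = M z, M z *m Q z = Q z,
      Q z0 *m M z = Q z0 & M z *m Q z0 = M z]].
Proof.
move=> oD Dz nQ QQ dQ; pose Q0 := Q z0; have Q00 : Q0 *m Q0 = Q0 by exact: QQ.
pose X z := Q0 *m Q z + (1%:M - Q0) *m (1%:M - Q z).
have nX : msm D 2 X.
  apply: (msmD oD (msmM oD (msm_cst D 2 Q0) nQ)).
  exact: (msmM oD (msm_cst D 2 (1%:M - Q0)) (msmB oD (msm_cst D 2 1%:M) nQ)).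
have X0 : X z0 = 1%:M.
  by rewrite /X -/Q0 Q00 mulmxBr mulmx1 mulmxBl mul1mx Q00 subrr subr0 addrC subrK.
have [|U [oO Oz OD uX]] := unit_near oD Dz (msm_le (isT : 1 <= 2)%N nX); first by rewrite X0 unitmx1.
have Q0X z : D z -> Q0 *m X z = Q0 *m Q z.
  move=> Dz'; rewrite /X mulmxDr !mulmxA Q00 (_ : Q0 *m (1%:M - Q0) = 0); last first.
    by rewrite mulmxBr mulmx1 Q00 subrr.
  by rewrite mul0mx addr0.
have XQ z : D z -> X z *m Q z = Q0 *m Q z.
  move=> Dz'; rewrite /X mulmxDl -!mulmxA QQ // (_ : (1%:M - Q z) *m Q z = 0); last first.
    by rewrite mulmxBl mul1mx QQ // subrr.
  by rewrite mulmx0 addr0.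
pose M z := Q z *m invmx (X z).
have nM : msm U 2 M.
  apply: (msmM oO (msm_sub OD nQ)); apply: (msm_invmx oO uX); exact: msm_sub OD nX.
have ME z : U z -> M z = invmx (X z) *m Q0.
  move=> Oz'; apply: (row_free_inj (A := X z)); first by rewrite row_free_unit uX.
  rewrite /M mulmxKV ?uX // -mulmxA (Q0X z (OD _ Oz')) -(XQ z (OD _ Oz')).
  by rewrite mulmxA mulVmx ?uX // mul1mx.
have alg z : U z -> [/\ Q z *m M z = M z, M z *m Q z = Q z, Q0 *m M z = Q0 & M z *m Q0 = M z].
  move=> Oz'; have Dz' := OD _ Oz'; split.
  - by rewrite /M mulmxA QQ.
  - by rewrite ME // -mulmxA -XQ // mulmxA mulVmx ?uX // mul1mx.
  - by rewrite /M mulmxA -Q0X // -mulmxA mulmxV ?uX // mulmx1.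
  - by rewrite ME // -mulmxA Q00.
exists U, M; split=> //.
have dM z : U z -> mpart s M z = 0.
  move=> Oz'; have Dz' := OD _ Oz'; have [QM MQ QM0 MQ0] := alg z Oz'.
  have mM := msm_mdiff nM Oz'; have mQ := msm_mdiff nQ Dz'.
  have E1 : mpart s M z = Q z *m mpart s M z.
    rewrite -{1}[LHS](near_mpart s (X := fun x => Q x *m M x)); last first.
      by apply: (near_open oO Oz') => x Ox; have [] := alg x Ox.
    by rewrite (mpartM s mQ mM) -{1}QM mulmxA dQ // mul0mx add0r.
  have E2 : Q0 *m mpart s M z = 0.
    have := near_mpart s (X := fun x => Q0 *m M x) (Y := fun=> Q0) (z := z).
    rewrite mpart_cst (mpartM s (mdiff_cst _ _) mM) mpart_cst mul0mx add0r; apply.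
    by apply: (near_open oO Oz') => x Ox; have [] := alg x Ox.
  have E3 : X z *m mpart s M z = 0 by rewrite E1 mulmxA XQ // -mulmxA -E1.
  by rewrite -[LHS](mulKmx (uX z Oz')) E3 mulmx0.
move=> i j; split; first exact: nM.
by move=> w Ow; rewrite -mpartE dM // mxE.
Qed.

Lemma mhol_msm s D k Q : open D -> mhol s D Q -> msm D k Q.
Proof. by move=> oD hQ i j; exact: hol_csm oD (hQ i j). Qed.

(** A projector with d_s Q Q = 0 is smooth although it has only two
    derivatives to begin with: the oblique projection M is holomorphic, hence
    smooth, and Q is recovered as M (M + M^* - 1)^-1. *)
Lemma smooth_projector s D Q k : open D -> msm D 2 Q ->
  (forall z, D z -> Q z *m Q z = Q z) -> (forall z, D z -> (Q z)^t* = Q z) ->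
  (forall z, D z -> mpart s Q z *m Q z = 0) -> msm D k Q.
Proof.
move=> oD nQ QQ QJ dQ; apply: msm_local => z0 Dz.
have [U [M [oO Oz OD hM alg]]] := oblique_projector oD Dz nQ QQ dQ.
pose Y z := M z + (M z)^t* - 1%:M.
have nM l : msm U l M := mhol_msm l oO hM.
have nY l : msm U l Y.
  exact: (msmB oO (msmD oO (nM l) (msmJ oO (nM l))) (msm_cst U l 1%:M)).
have QY z : U z -> Q z *m Y z = M z.
  move=> Oz'; have [QM MQ _ _] := alg z Oz'.
  have QMJ : Q z *m (M z)^t* = Q z.
    by rewrite -{1}(QJ z (OD _ Oz')) -adjM MQ QJ //; exact: OD.
  by rewrite /Y mulmxBr mulmxDr mulmx1 QM QMJ addrK.
have M0 : M z0 = Q z0.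
  by have [QM MQ QM0 MQ0] := alg z0 Oz; rewrite -MQ0 MQ.
have uY : Y z0 \in unitmx.
  have E : Y z0 *m Y z0 = 1%:M.
    rewrite /Y M0 QJ // !mulmxBr !mulmxBl !mulmx1 !mul1mx mulmxDr mulmxDl !QQ //.
    by rewrite addrK opprB addrCA subrr addr0.
  by case: (mulmx1_unit E).
have [U1 [oO1 Oz1 OO uY1]] := unit_near oO Oz (nY 1%N) uY.
exists U1; split=> //.
apply: (msm_eq oO1 (X := fun z => M z *m invmx (Y z))).
  by move=> z Oz'; rewrite -(QY z (OO _ Oz')) mulmxK // uY1.
apply: (msmM oO1 (msm_sub OO (nM k))); apply: (msm_invmx oO1 uY1); exact: msm_sub OO (nY k).
Qed.

End Projectors.

(** * Potentials of a rank-one projector *)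

Section Pairs.
Variables (R : realType) (n : nat).
Local Notation C := R[i].
Implicit Types (z : plane R) (D : set (plane R)) (T P : plane R -> 'M[C]_n).

Lemma eq_mpart s m p (X Y : plane R -> 'M[C]_(m, p)) z : (forall w, X w = Y w) ->
  mpart s X z = mpart s Y z.
Proof. by move=> XY; rewrite (_ : X = Y) //; apply/funext. Qed.

(** The image of P is one step of a flag: it is orthogonal to that of T, and
    by the last field Q = T and Q = T + P both satisfy d_s Q Q = 0, which says
    that their images are holomorphic subbundles (antiholomorphic ones for the
    other sign). The matrix function B = d_s P P is the second fundamental
    form that links P to T. This is the object that a harmonic map of the
    sphere produces, and it is stable under the ladder. *)
Record potential s T P (k : nat) : Prop := Potential {
  pot_T : msm setT k T;
  pot_P : msm setT k P;
  pot_rank1 : forall z, rank1_projector (P z);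
  pot_idem : forall z, T z *m T z = T z;
  pot_adj : forall z, (T z)^t* = T z;
  pot_TP : forall z, T z *m P z = 0;
  pot_d : forall z, mpart s T z = - (mpart s P z *m P z) }.

Lemma proj_d t P z : mdiff P z -> (forall w, P w *m P w = P w) ->
  mpart t P z *m P z + P z *m mpart t P z = mpart t P z.
Proof.
by move=> dP PP; rewrite -(mpartM t dP dP); congr (mpart _ _ _); apply/funext => w; rewrite PP.
Qed.

Lemma proj_dd t P z : mdiff P z -> (forall w, P w *m P w = P w) ->
  P z *m mpart t P z *m P z = 0.
Proof.
move=> dP PP; have E := proj_d t dP PP.
have := congr1 (fun X => P z *m X *m P z) E.
rewrite /= mulmxDr mulmxDl !mulmxA PP -[P z *m mpart t P z *m P z *m P z]mulmxA PP => h.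
by apply: (addrI (P z *m mpart t P z *m P z)); rewrite addr0.
Qed.

Lemma adj_d t P z : mdiff P z -> (forall w, (P w)^t* = P w) ->
  (mpart t P z)^t* = mpart (~~ t) P z.
Proof.
move=> dP PJ; rewrite -[t in LHS]negbK -(mpartJ (~~ t) dP).
by congr (mpart _ _ _); apply/funext => w; rewrite PJ.
Qed.

Section Identities.
Variables (s : bool) (T P : plane R -> 'M[C]_n).
Hypothesis pot : potential s T P 2.
Implicit Types w : plane R.

Let dT z : mdiff T z. Proof. exact: msm_mdiff (pot_T pot) Logic.I. Qed.
Let dP z : mdiff P z. Proof. exact: msm_mdiff (pot_P pot) Logic.I. Qed.
Let PP z : P z *m P z = P z. Proof. by have [] := pot_rank1 pot z. Qed.
Let PJ z : (P z)^t* = P z. Proof. by have [] := pot_rank1 pot z. Qed.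
Local Notation B z := (mpart s P z *m P z).

Lemma pot_PT z : P z *m T z = 0.
Proof. by rewrite -(PJ z) -(pot_adj pot z) -adjM (pot_TP pot) adj0. Qed.

Lemma pot_dTT z : mpart s T z *m T z = 0.
Proof. by rewrite (pot_d pot) mulNmx -mulmxA pot_PT mulmx0 oppr0. Qed.

Lemma pot_TB z : T z *m B z = B z.
Proof.
have := proj_d s (dT z) (pot_idem pot).
by rewrite pot_dTT add0r (pot_d pot) mulmxN => /oppr_inj.
Qed.

Lemma pot_dPT z : mpart s P z *m T z = 0.
Proof.
have E : mpart s P z *m T z + P z *m mpart s T z = 0.
  rewrite -(mpartM s (dP z) (dT z)) (@eq_mpart s _ _ _ (fun=> 0)) ?mpart_cst // => w.
  exact: pot_PT.
by move: E; rewrite (pot_d pot) mulmxN mulmxA (proj_dd s (dP z) PP) subr0.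
Qed.

Lemma pot_PB z : P z *m B z = 0.
Proof. by rewrite mulmxA (proj_dd s (dP z) PP). Qed.

Lemma pot_dJ z : (mpart s P z)^t* = mpart (~~ s) P z.
Proof. exact: adj_d. Qed.

Lemma pot_BJ z : (B z)^t* = P z *m mpart (~~ s) P z.
Proof. by rewrite adjM pot_dJ PJ. Qed.

Lemma pot_d' z : mpart (~~ s) T z = - (P z *m mpart (~~ s) P z).
Proof. by rewrite -(adj_d s (dT z) (pot_adj pot)) (pot_d pot) adjN pot_BJ. Qed.

Lemma pot_TdP z : T z *m mpart s P z = B z.
Proof.
by rewrite -{1}(proj_d s (dP z) PP) mulmxDr pot_TB mulmxA (pot_TP pot) mul0mx addr0.
Qed.

(** Covariant holomorphy of the second fundamental form. It makes the zeros of
    B isolated and B subject to unique continuation. *)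
Lemma pot_dB z : mpart (~~ s) (fun x => B x) z =
  B z *m mpart (~~ s) P z - mpart (~~ s) P z *m B z.
Proof.
have ddP t : mdiff (mpart t P) z.
  exact: msm_mdiff (msm_mpart t openT (pot_P pot)) Logic.I.
pose L := mpart s (mpart (~~ s) P) z.
have LE : mpart (~~ s) (mpart s P) z = L by exact: mpartC openT Logic.I (pot_P pot).
have dB : mpart (~~ s) (fun x => B x) z = L *m P z + mpart s P z *m mpart (~~ s) P z.
  by rewrite (mpartM _ (ddP s) (dP z)) LE.
have EL : P z *m L = L *m P z.
  have h : mpart s (mpart (~~ s) T) z = mpart (~~ s) (mpart s T) z.
    exact: mpartC openT Logic.I (pot_T pot).
  have h1 : mpart s (mpart (~~ s) T) z = - (mpart s P z *m mpart (~~ s) P z + P z *m L).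
    have -> : mpart (~~ s) T = fun x => - (P x *m mpart (~~ s) P x) by apply/funext => x; exact: pot_d'.
    by rewrite (mpartN s (mdiffM (dP z) (ddP _))) (mpartM s (dP z) (ddP _)).
  have h2 : mpart (~~ s) (mpart s T) z = - (L *m P z + mpart s P z *m mpart (~~ s) P z).
    have -> : mpart s T = fun x => - B x by apply/funext => x; exact: (pot_d pot).
    by rewrite (mpartN _ (mdiffM (ddP s) (dP z))) dB.
  by move: h; rewrite h1 h2 => /oppr_inj; rewrite addrC => /addIr.
have mB : mdiff (fun x => B x) z by exact: mdiffM (ddP s) (dP z).
have E : mpart (~~ s) (fun x => B x) z =
    mpart (~~ s) T z *m B z + T z *m mpart (~~ s) (fun x => B x) z.
  rewrite -(mpartM _ (dT z) mB); congr (mpart _ _ _); apply/funext => x.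
  by rewrite pot_TB.
rewrite E pot_d' dB mulmxDr -EL !mulmxA (pot_TP pot) mul0mx add0r pot_TdP !mulNmx addrC.
congr (_ - _); rewrite -[in RHS](proj_d (~~ s) (dP z) PP) !mulmxDl.
have -> : mpart (~~ s) P z *m P z *m mpart s P z *m P z = 0.
  by rewrite -!mulmxA pot_PB mulmx0.
by rewrite add0r.
Qed.

End Identities.

Lemma pot_le s T P k l : (l <= k)%N -> potential s T P k -> potential s T P l.
Proof.
by move=> lk [*]; split=> //; exact: msm_le lk _.
Qed.

(** The orthogonal complement of T + P plays for the opposite direction the
    role of T, which gives the second ladder from the first. *)
Lemma pot_dual s T P k : potential s T P k.+2 -> potential (~~ s) (fun z => 1%:M - T z - P z) P k.+2.
Proof.
move=> pot; have pot2 := pot_le (isT : 2 <= k.+2)%N pot.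
have PP z : P z *m P z = P z by have [] := pot_rank1 pot z.
have PJ z : (P z)^t* = P z by have [] := pot_rank1 pot z.
have TP := pot_TP pot; have PT := pot_PT pot2; have TT := pot_idem pot.
have E z : (1%:M - T z - P z) *m P z = 0.
  by rewrite !mulmxBl mul1mx TP PP subr0 subrr.
have E' z : (1%:M - T z - P z) *m T z = 0.
  by rewrite !mulmxBl mul1mx TT PT subr0 subrr.
split=> //.
- exact: (msmB openT (msmB openT (msm_cst _ _ _) (pot_T pot)) (pot_P pot)).
- exact: (pot_P pot).
- exact: (pot_rank1 pot).
- by move=> z; rewrite [LHS]mulmxBr mulmxBr mulmx1 E E' !subr0.
- by move=> z; rewrite !adjB adj1 PJ (pot_adj pot).
move=> z; have dT : mdiff T z := msm_mdiff (pot_T pot2) Logic.I.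
have dP : mdiff P z := msm_mdiff (pot_P pot2) Logic.I.
have d1 : mdiff (fun x => 1%:M - T x) z.
  exact: (msm_mdiff (msmB openT (msm_cst _ _ 1%:M) (pot_T pot2)) Logic.I).
rewrite (mpartB _ d1 dP) (mpartB _ (mdiff_cst _ _) dT) mpart_cst sub0r (pot_d' pot2) opprK.
by rewrite -{2}(proj_d (~~ s) dP PP) opprD addrCA subrr addr0.
Qed.

(** Both T and T + P are holomorphic projectors, hence smooth. *)
Lemma pot_smooth s T P k : potential s T P 2 -> potential s T P k.
Proof.
move=> pot; have PP z : P z *m P z = P z by have [] := pot_rank1 pot z.
have PJ z : (P z)^t* = P z by have [] := pot_rank1 pot z.
have TP := pot_TP pot; have PT := pot_PT pot; have TT := pot_idem pot.
have dT z : mdiff T z := msm_mdiff (pot_T pot) Logic.I.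
have dP z : mdiff P z := msm_mdiff (pot_P pot) Logic.I.
have nT : msm setT k T.
  by apply: (smooth_projector (s := s) k openT (pot_T pot)) => z _ //;
    [exact: (pot_adj pot)|exact: (pot_dTT pot)].
have nS : msm setT k (fun z => T z + P z).
  apply: (smooth_projector (s := s) k openT (msmD openT (pot_T pot) (pot_P pot))) => z _.
  - by rewrite mulmxDl !mulmxDr TT TP PT PP addr0 add0r.
  - by rewrite adjD PJ (pot_adj pot).
  - rewrite (mpartD s (dT z) (dP z)) (pot_d pot) -{2}(proj_d s (dP z) PP) addKr.
    by rewrite mulmxDr (proj_dd s (dP z) PP) addr0 -mulmxA (pot_dPT pot) mulmx0.
case: pot => *; split=> //.
apply: (msm_eq openT (X := fun z => T z + P z - T z)) (msmB openT nS nT) => z _.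
by rewrite addrC addKr.
Qed.

(** By pot_dB, B solves a linear system in the direction -s, to which matrix_uc
    applies. *)
Lemma pot_uc s T P z0 (r0 : R) : potential s T P 2 -> 0 < r0 ->
  (forall z, sq z0 r0 z -> mpart s P z *m P z = 0) -> forall z, mpart s P z *m P z = 0.
Proof.
move=> pot r00 B0 z; have nP k := pot_P (pot_smooth k pot).
pose X (b : bool) x := mpart s P x *m P x.
apply: (matrix_uc (s := ~~ s) (X := X) (z0 := z0) _ _ r00 _ true) => [b|b|b w Sw].
- exact: (msmM openT (msm_mpart s openT (nP 3%N)) (nP 2%N)).
- apply: (mlin_eq (fun z => pot_dB pot z)).
  apply: mlinD; first exact: (mlinMr (msm_mpart (~~ s) openT (nP 3%N)) (mlin_entries X b)).
  apply: mlinN; exact: (mlinMl (msm_mpart (~~ s) openT (nP 3%N)) (mlin_entries X b)).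
- exact: B0.
Qed.

End Pairs.

(** * The raising and lowering operators near a zero of the denominator *)

Section Ladder.
Variables (R : realType) (n : nat).
Local Notation C := R[i].
Implicit Types (z : plane R) (D : set (plane R)) (T P : plane R -> 'M[C]_n).

Lemma csm_punctured D (f : plane R -> C) z0 : open D -> D z0 -> csm D 1 f ->
  (forall z, D z -> z != z0 -> f z = 0) -> f z0 = 0.
Proof.
move=> oD Dz nf H; apply/eqP/negPn/negP => /(csm_neq0_near oD Dz nf)[U [oU Uz UD fU]].
have [r r0 rU] := open_sqP oU Uz.
have Sz : sq z0 r (z0.1 + r / 2, z0.2).
  split; rewrite /= ?subrr ?normr0 //; rewrite addrAC subrr add0r ger0_norm; lra.
have /eqP := fU _ (rU _ Sz); apply; apply: H; first by apply: UD; exact: rU.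
by apply/eqP => /(congr1 fst) /= /eqP; rewrite -subr_eq0 addrAC subrr add0r; apply/negP; lra.
Qed.

Lemma msm_punctured D m p (X Y : plane R -> 'M[C]_(m, p)) z0 : open D -> D z0 -> msm D 1 X ->
  msm D 1 Y -> (forall z, D z -> z != z0 -> X z = Y z) -> X z0 = Y z0.
Proof.
move=> oD Dz nX nY H; apply/subr0_eq/matrixP => i j; rewrite [RHS]mxE.
apply: (csm_punctured (f := fun z => (X z - Y z) i j) oD Dz (msmB oD nX nY i j)) => z Dz' nz.
by rewrite H // subrr mxE.
Qed.

Lemma ladder_numE s T P z : potential s T P 2 ->
  ladder_num s P z = (mpart s P z *m P z) *m (mpart s P z *m P z)^t*.
Proof.
move=> pot; rewrite (pot_BJ pot) /ladder_num !mpart_mx mulmxA -[_ *m P z *m P z]mulmxA.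
by have [-> _ _] := pot_rank1 pot z.
Qed.

Lemma ladder0 s T P : potential s T P 2 -> (forall z, mpart s P z *m P z = 0) ->
  forall z, ladder s P z = 0.
Proof.
move=> pot B0 z; rewrite /ladder; case: asboolP => // -[] x.
by rewrite (ladder_numE x pot) B0 mul0mx.
Qed.

(** The oblique projection M on the image of T is holomorphic, hence so is its
    derivative, and up to multiplication by smooth projectors that derivative
    is the adjoint of B. So hol_factor, applied to it, extracts a power of the
    coordinate; G does not vanish because the factor at z0 is compatible with
    the projections. *)
Lemma pot_factor s T P z0 : potential s T P 2 -> ~ (forall z, mpart s P z *m P z = 0) ->
  exists O h G, [/\ open O, O z0, forall k, msm O k G,
    forall z, O z -> G z != 0 /\ (z != z0 -> h z != 0) &
    forall z, O z -> mpart s P z *m P z = h z *: G z].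
Proof.
move=> pot nB; have nT k := pot_T (pot_smooth k pot).
have [U [M [oU Uz _ hM alg]]] := oblique_projector openT (Logic.I : setT z0)
  (pot_T pot) (fun z _ => pot_idem pot z) (fun z _ => pot_dTT pot z).
pose E := mpart (~~ s) M.
have hE : mhol s U E.
  move=> i j; rewrite /E (_ : (fun z => _) = wirtinger (~~ s) (fun z => M z i j)).
    exact: hol_wirt oU (hM i j).
  by apply/funext => z; rewrite mpartE.
have nM k : msm U k M := mhol_msm k oU hM.
have BE z : U z -> (mpart s P z *m P z)^t* = - ((1%:M - T z) *m E z *m T z).
  move=> Uz'; have [TM MT _ _] := alg z Uz'.
  have mM := msm_mdiff (nM 1%N) Uz'; have mT : mdiff T z := msm_mdiff (pot_T pot) Logic.I.
  have h : E z *m T z + M z *m mpart (~~ s) T z = mpart (~~ s) T z.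
    rewrite -(mpartM _ mM mT); apply: near_mpart.
    by apply: (near_open oU Uz') => x Ux; have [] := alg x Ux.
  have h2 : (1%:M - T z) *m (E z *m T z) = (1%:M - T z) *m mpart (~~ s) T z.
    rewrite -h mulmxDr (_ : (1%:M - T z) *m (M z *m _) = 0) ?addr0 //.
    by rewrite mulmxA mulmxBl mul1mx TM subrr mul0mx.
  rewrite -mulmxA h2 mulmxBl mul1mx (pot_d' pot) mulmxN mulmxA (pot_TP pot) mul0mx oppr0.
  by rewrite subr0 opprK (pot_BJ pot).
have [|k [Y [hY EY Y0]]] := hol_factor oU Uz hE.
  move=> [r r0 E0]; have [r' r'0 rU] := open_sqP oU Uz; apply: nB.
  apply: (pot_uc (z0 := z0) (r0 := Num.min r r') pot); first by rewrite lt_min r0.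
  move=> z Sz; have Uz' : U z by apply: rU; move: z Sz; apply: sq_sub; rewrite ge_min lexx orbT.
  have Ez : E z = 0 by apply: E0; move: z Sz {Uz'}; apply: sq_sub; rewrite ge_min lexx.
  by rewrite -[LHS]adjK BE // Ez mulmx0 mul0mx oppr0 adj0.
pose b z := - ((1%:M - T z) *m Y z *m T z); pose G z := (b z)^t*.
have nY l : msm U l Y := mhol_msm l oU hY.
have nG l : msm U l G.
  have nT' : msm U l T := msm_sub (@subsetT _ U) (nT l).
  have n1 := msmB oU (msm_cst U l (1%:M : 'M[C]_n)) nT'.
  exact: (msmJ oU (msmN oU (msmM oU (msmM oU n1 (nY l)) nT'))).
have T0M z : U z -> T z0 *m E z = 0.
  move=> Uz'; have mM := msm_mdiff (nM 1%N) Uz'.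
  have : mpart (~~ s) (fun x => T z0 *m M x) z = 0.
    rewrite (near_mpart _ (Y := fun=> T z0)) ?mpart_cst //.
    by apply: (near_open oU Uz') => x Ux; have [] := alg x Ux.
  by rewrite (mpartM _ (mdiff_cst _ _) mM) mpart_cst mul0mx add0r.
have MT0 z : U z -> E z *m T z0 = E z.
  move=> Uz'; have mM := msm_mdiff (nM 1%N) Uz'.
  have : mpart (~~ s) (fun x => M x *m T z0) z = E z.
    by apply: near_mpart; apply: (near_open oU Uz') => x Ux; have [] := alg x Ux.
  by rewrite (mpartM _ mM (mdiff_cst _ _)) mpart_cst mulmx0 addr0.
have zk z : z != z0 -> zeta s z0 z ^+ k != 0.
  by move=> nz; rewrite expf_neq0 // zeta_eq0.
have T0Y : T z0 *m Y z0 = 0.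
  apply: (msm_punctured oU Uz (X := fun z => T z0 *m Y z) (Y := fun=> 0)).
  - exact: (msmM oU (msm_cst _ _ _) (nY 1%N)).
  - exact: msm_cst.
  move=> z Uz' /zk zn; apply: (scalerI zn).
  by rewrite scalemxAr -EY // T0M // scaler0.
have YT0 : Y z0 *m T z0 = Y z0.
  apply: (msm_punctured oU Uz (X := fun z => Y z *m T z0) (Y := Y)).
  - exact: (msmM oU (nY 1%N) (msm_cst _ _ _)).
  - exact: nY.
  move=> z Uz' /zk zn; apply: (scalerI zn).
  by rewrite scalemxAl -EY // MT0.
have G0 : G z0 != 0.
  apply: contra_neq Y0 => h; have : b z0 = 0 by rewrite -[b z0]adjK -/(G z0) h adj0.
  by rewrite /b -mulmxA YT0 mulmxBl mul1mx T0Y subr0 => /eqP; rewrite oppr_eq0 => /eqP.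
have nt := csm_tr oU (msmM oU (nG 1%N) (msmJ oU (nG 1%N))).
have t0 : \tr (G z0 *m (G z0)^t*) != 0 by apply: contra_neq G0; exact: tr_normsq_eq0.
have [V [oV Vz VU Vn]] := csm_neq0_near oU Uz nt t0.
exists V, (fun z => Num.conj (zeta s z0 z ^+ k)), G; split; first exact: oV.
- exact: Vz.
- by move=> l; exact: msm_sub VU (nG l).
- move=> z Vz'; split; last by move=> /zk zn; rewrite conjC_eq0.
  by apply: contra_neq (Vn z Vz') => ->; rewrite mul0mx mxtrace0.
- move=> z /VU Uz'; rewrite -[LHS]adjK BE // EY //.
  by rewrite -scalemxAr -scalemxAl -scalerN adjZ.
Qed.

(** The clim in the definition of ladder computes a continuous extension. *)
Lemma clim_punctured D (f g : plane R -> C) (A : set (plane R)) z0 : open D -> D z0 ->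
  csm D 1 f -> (forall z, D z -> A z -> g z = f z) ->
  (forall z, D z -> z != z0 -> A z) -> clim (within A (nbhs z0)) g = f z0.
Proof.
move=> oD Dz nf gf DA.
have PF : ProperFilter (within A (nbhs z0)).
  apply: Build_ProperFilter_ex => B /= nB; have [r1 r10 H] := (nbhs_sqP _ _).1 nB.
  have [r2 r20 rD] := open_sqP oD Dz; pose r := Num.min r1 r2.
  have r0 : 0 < r by rewrite lt_min r10.
  pose w : plane R := (z0.1 + r / 2, z0.2).
  have Sz : sq z0 r w.
    split; rewrite /= ?subrr ?normr0 //; rewrite addrAC subrr add0r ger0_norm; lra.
  exists w; apply: H; first by move: w Sz; apply: sq_sub; rewrite ge_min lexx.
  apply: DA; first by apply: rD; move: w Sz; apply: sq_sub; rewrite ge_min lexx orbT.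
  by apply/eqP => /(congr1 fst) /= /eqP; rewrite -subr_eq0 addrAC subrr add0r; apply/negP; lra.
have main (p q : plane R -> R) : nsm D 1 p -> (forall z, D z -> A z -> q z = p z) ->
    lim (q x @[x --> within A (nbhs z0)]) = p z0.
  move=> np qp; apply: cvg_lim; first exact: Rhausdorff.
  move=> V /(nsm_continuous np Dz) nV; change (nbhs z0 (fun x => A x -> V (q x))).
  have nV' : nbhs z0 (fun x => V (p x)) by exact: nV.
  have [r1 r10 H1] := (nbhs_sqP _ _).1 nV'; have [r2 r20 rD] := open_sqP oD Dz.
  apply: (nbhs_sqP _ _).2; exists (Num.min r1 r2) => [|x Sx Ax]; first by rewrite lt_min r10.
  have Dx : D x by apply: rD; move: x Sx {Ax}; apply: sq_sub; rewrite ge_min lexx orbT.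
  rewrite qp //; apply: H1; move: x Sx {Ax Dx}; apply: sq_sub; by rewrite ge_min lexx.
apply: complex_eq; rewrite /clim /=.
  by apply: (main (fun x => complex.Re (f x))); [exact: nf.1|move=> z Dz' Az; rewrite gf].
by apply: (main (fun x => complex.Im (f x))); [exact: nf.2|move=> z Dz' Az; rewrite gf].
Qed.

Lemma tr_scale_normalize (c : C) (X : 'M[C]_n) : c != 0 ->
  (\tr (c *: X))^-1 *: (c *: X) = (\tr X)^-1 *: X.
Proof.
move=> c0; rewrite mxtraceZ invfM scalerA mulrC mulrA mulrV ?unitfE //.
by rewrite mul1r.
Qed.

Lemma ladder_generic s P z : ~ (forall x, ladder_num s P x = 0) ->
  \tr (ladder_num s P z) != 0 -> ladder s P z = ladder_quot s P z.
Proof.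
move=> nz tz; rewrite /ladder; case: (asboolP (forall x, ladder_num s P x = 0)) => [/nz []|_].
by apply: ifT.
Qed.

Lemma ladder_singular s P z : ~ (forall x, ladder_num s P x = 0) ->
  \tr (ladder_num s P z) = 0 -> ladder s P z = \matrix_(i, j)
    clim (within [set x | \tr (ladder_num s P x) != 0] (nbhs z))
         (fun x => ladder_quot s P x i j).
Proof.
move=> nz tz; rewrite /ladder; case: (asboolP (forall x, ladder_num s P x = 0)) => [/nz []|_].
by apply: ifF; rewrite tz eqxx.
Qed.

(** The normalized product of G with its adjoint does not see the scalar
    factor, so that the value prescribed as a limit is the value of a smooth
    function. *)
Lemma ladder_local s T P z0 : potential s T P 2 -> ~ (forall z, mpart s P z *m P z = 0) ->
  exists O G, [/\ open O, O z0, forall k, msm O k G,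
    forall z, O z -> \tr (G z *m (G z)^t*) != 0 /\
      ladder s P z = (\tr (G z *m (G z)^t*))^-1 *: (G z *m (G z)^t*) &
    forall z, O z -> (z != z0 -> mpart s P z *m P z != 0) /\
      (mpart s P z *m P z != 0 -> exists2 c, c != 0 & G z = c *: (mpart s P z *m P z))].
Proof.
move=> pot nB; have [U [h [G [oU Uz nG Gh BG]]]] := pot_factor z0 pot nB.
have trG z : U z -> \tr (G z *m (G z)^t*) != 0.
  by move=> /Gh[G0 _]; apply: contra_neq G0; exact: tr_normsq_eq0.
have numE z : U z -> ladder_num s P z = (h z * Num.conj (h z)) *: (G z *m (G z)^t*).
  move=> Uz'; rewrite (ladder_numE z pot) BG // adjZ -scalemxAr -scalemxAl scalerA.
  by rewrite mulrC.
have trE z : U z -> (\tr (ladder_num s P z) != 0) = (h z != 0).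
  move=> Uz'; rewrite numE // mxtraceZ !mulf_eq0 conjC_eq0 (negPf (trG z Uz')).
  by rewrite orbF orbb.
have quotE z : U z -> h z != 0 ->
    ladder_quot s P z = (\tr (G z *m (G z)^t*))^-1 *: (G z *m (G z)^t*).
  move=> Uz' hz; rewrite /ladder_quot numE // tr_scale_normalize //.
  by rewrite mulf_neq0 // conjC_eq0.
have nz : ~ (forall x, ladder_num s P x = 0).
  move=> H; apply: nB => z; apply: tr_normsq_eq0.
  by rewrite -(ladder_numE z pot) H mxtrace0.
exists U, G; split=> // [z Uz'|z Uz']; last first.
  have [G0 hz] := Gh z Uz'; rewrite (BG z Uz'); split=> [/hz hz'|].
    by rewrite scaler_eq0 negb_or hz'.
  rewrite scaler_eq0 negb_or => /andP[hz' _].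
  by exists (h z)^-1; rewrite ?invr_eq0 // scalerA mulVf // scale1r.
split; first exact: trG.
have tE := trE z Uz'; have [h0|hz] := eqVneq (h z) 0; last first.
  by rewrite (ladder_generic nz) ?tE //; exact: quotE.
rewrite (ladder_singular nz); last by apply/eqP; move: tE; rewrite h0 eqxx => /negbFE.
have zz : z = z0.
  by apply/eqP/negPn/negP => zn; have := (Gh z Uz').2 zn; rewrite h0 eqxx.
rewrite zz; apply/matrixP => i j; rewrite [LHS]mxE.
pose F x := (\tr (G x *m (G x)^t*))^-1 *: (G x *m (G x)^t*).
have nF : msm U 1 F.
  have nGG := msmM oU (nG 1%N) (msmJ oU (nG 1%N)).
  exact: (msmZ oU (csmV oU trG (csm_tr oU nGG)) nGG).
apply: (clim_punctured (f := fun x => F x i j) oU Uz (nF i j)) => x Ux /=.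
  by rewrite (trE x Ux) => hx; rewrite (quotE x Ux hx).
by rewrite (trE x Ux); exact: (Gh x Ux).2.
Qed.

End Ladder.

(** * The ladder of a potential *)

Section LadderStep.
Variables (R : realType) (n : nat).
Local Notation C := R[i].
Implicit Types (z : plane R) (D : set (plane R)) (T P : plane R -> 'M[C]_n).

Section Step.
Variables (s : bool) (T P : plane R -> 'M[C]_n).
Hypothesis pot : potential s T P 2.
Hypothesis nB : ~ (forall z, mpart s P z *m P z = 0).
Local Notation B z := (mpart s P z *m P z).
Local Notation P' := (ladder s P).

Let t z := \tr (B z *m (B z)^t*).

Let PP z : P z *m P z = P z. Proof. by have [] := pot_rank1 pot z. Qed.
Let PJ z : (P z)^t* = P z. Proof. by have [] := pot_rank1 pot z. Qed.
Let dP z : mdiff P z. Proof. exact: msm_mdiff (pot_P pot) Logic.I. Qed.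

Let nP k : msm setT k P. Proof. exact: pot_P (pot_smooth k pot). Qed.
Let nT k : msm setT k T. Proof. exact: pot_T (pot_smooth k pot). Qed.
Let nB' k : msm setT k (fun z => B z).
Proof. exact: (msmM openT (msm_mpart s openT (nP k.+1)) (nP k)). Qed.

Let nP' k : msm setT k P'.
Proof.
apply: msm_local => z0 _; have [U [G [oU Uz nG GP _]]] := ladder_local z0 pot nB.
exists U; split=> //; apply: (msm_eq oU (fun z Uz' => esym (GP z Uz').2)).
have nGG := msmM oU (nG k) (msmJ oU (nG k)).
exact: (msmZ oU (csmV oU (fun z Uz' => (GP z Uz').1) (csm_tr oU nGG)) nGG).
Qed.

Let t0 z : B z != 0 -> t z != 0.
Proof. by apply: contra_neq; exact: tr_normsq_eq0. Qed.

Let P'E z : B z != 0 -> P' z = (t z)^-1 *: (B z *m (B z)^t*).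
Proof.
move=> Bz; have [U [G [oU Uz nG GP GB]]] := ladder_local z pot nB.
have [_ ->] := GP z Uz; have [c c0 ->] := (GB z Uz).2 Bz.
by rewrite adjZ -scalemxAr -scalemxAl scalerA tr_scale_normalize // mulf_neq0 // conjC_eq0.
Qed.

(* The zeros of the second fundamental form are isolated. *)
Let ext m p (X Y : plane R -> 'M[C]_(m, p)) : msm setT 1 X -> msm setT 1 Y ->
  (forall z, B z != 0 -> X z = Y z) -> forall z, X z = Y z.
Proof.
move=> nX nY H z0; have [U [G [oU Uz nG _ GB]]] := ladder_local z0 pot nB.
have sU := @subsetT _ U.
apply: (msm_punctured oU Uz (msm_sub sU nX) (msm_sub sU nY)) => z Uz' zn.
by apply: H; exact: (GB z Uz').1.
Qed.

Let BB z : (B z)^t* *m B z = t z *: P z.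
Proof.
have [rP] : rank1_projector (P z) by exact: (pot_rank1 pot z).
move=> _ _; have S := rank1_sandwich ((mpart s P z)^t* *m mpart s P z) (pot_rank1 pot z).
rewrite adjM PJ; transitivity (P z *m ((mpart s P z)^t* *m mpart s P z) *m P z).
  by rewrite !mulmxA.
rewrite S /t adjM PJ; congr (_ *: _).
by rewrite mulmxA mxtrace_mulC -[B z *m _]mulmxA [P z *m (P z *m _)]mulmxA PP.
Qed.

Let BP z : B z *m P z = B z. Proof. by rewrite -mulmxA PP. Qed.
Let BJP z : (B z)^t* *m P z = 0. Proof. by rewrite -{2}(PJ z) -adjM (pot_PB pot) adj0. Qed.

Let nadj m p k (X : plane R -> 'M[C]_(m, p)) : msm setT k X -> msm setT k (fun z => (X z)^t*).
Proof. exact: msmJ openT. Qed.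

Let P'P' z : P' z *m P' z = P' z.
Proof.
move: z; apply: ext => [||z Bz]; [exact: (msmM openT (nP' 1) (nP' 1))|exact: nP'|].
rewrite (P'E Bz) -scalemxAl -scalemxAr; congr (_ *: _).
rewrite mulmxA -[B z *m _ *m B z]mulmxA BB -scalemxAr -scalemxAl BP scalerA.
by rewrite mulVf ?t0 // scale1r.
Qed.

Let tJ z : Num.conj (t z) = t z.
Proof. by rewrite /t -tr_adj (adjM (B z)) adjK. Qed.

Let P'J z : (P' z)^t* = P' z.
Proof.
move: z; apply: ext => [||z Bz]; [exact: (nadj (nP' 1))|exact: nP'|].
rewrite (P'E Bz) adjZ (adjM (B z)) adjK fmorphV; congr (_^-1 *: _).
exact: tJ.
Qed.

Let trP' z : \tr (P' z) = 1.
Proof.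
have nc : csm setT 1 (fun z => \tr (P' z) - 1).
  exact: (csmD openT (csm_tr openT (nP' 1)) (csm_cst _ _ _)).
have [U [G [oU Uz nG _ GB]]] := ladder_local z pot nB.
apply/subr0_eq; apply: (csm_punctured (f := fun x => \tr (P' x) - 1) oU Uz) => [|w Uw wz].
  exact: csm_sub (@subsetT _ U) nc.
have Bw := (GB w Uw).1 wz.
by rewrite (P'E Bw) mxtraceZ mulVf ?subrr // t0.
Qed.

Let TP' z : T z *m P' z = P' z.
Proof.
move: z; apply: ext => [||z Bz]; [exact: (msmM openT (nT 1) (nP' 1))|exact: nP'|].
by rewrite (P'E Bz) -scalemxAr mulmxA (pot_TB pot).
Qed.

Let P'B z : P' z *m B z = B z.
Proof.
move: z; apply: ext => [||z Bz]; [exact: (msmM openT (nP' 1) (nB' 1))|exact: nB'|].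
by rewrite (P'E Bz) -scalemxAl -mulmxA BB -scalemxAr BP scalerA mulVf ?t0 // scale1r.
Qed.

Let PP' z : P z *m P' z = 0.
Proof.
by rewrite -TP' mulmxA (pot_PT pot) mul0mx.
Qed.

Let P'dP' z : P' z *m mpart s P' z = - B z.
Proof.
have nd k : msm setT k (mpart s P') := msm_mpart s openT (nP' k.+1).
move: z; apply: ext => [||z Bz].
- exact: (msmM openT (nP' 1) (nd 1)).
- exact: (msmN openT (nB' 1)).
have mB : mdiff (fun x => B x) z := msm_mdiff (nB' 1) Logic.I.
have mP' : mdiff P' z := msm_mdiff (nP' 1) Logic.I.
have BJP' x : (B x)^t* *m P' x = (B x)^t* by rewrite -(P'J x) -adjM P'B.
have E1 : mpart s (fun x => (B x)^t*) z *m P' z + (B z)^t* *m mpart s P' z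
    = mpart s (fun x => (B x)^t*) z.
  by rewrite -(mpartM s (mdiffJ mB) mP'); apply: eq_mpart.
have E2 : mpart s (fun x => (B x)^t*) z =
    mpart s P z *m (B z)^t* - (B z)^t* *m mpart s P z.
  by rewrite (mpartJ s mB) (pot_dB pot) adjB (adjM (B z))
    (adjM (mpart (~~ s) P z)) (adj_d _ (dP z) PJ) negbK.
have E3 : (B z)^t* *m mpart s P z = t z *: P z.
  by rewrite -{2}(proj_d s (dP z) PP) mulmxDr BB mulmxA BJP mul0mx addr0.
have E4 : (B z)^t* *m mpart s P' z = - (t z *: P z).
  move: E1; rewrite E2 mulmxBl -mulmxA BJP' E3 -scalemxAl PP' scaler0 subr0.
  by move/addrI.
rewrite (P'E Bz) -scalemxAl -mulmxA E4 mulmxN -scalemxAr BP scalerN scalerA mulVf ?t0 //.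
by rewrite scale1r.
Qed.

(** One step of the ladder splits off from T the line spanned by the image of
    B. The identity P_1 d_s P_1 = - B says that the remaining part T - P_1 is
    again a potential, of P_1. *)
Lemma ladder_potential : potential s (fun z => T z - P' z) P' 2.
Proof.
have P'T z : P' z *m T z = P' z by rewrite -{1}(P'J z) -(pot_adj pot) -adjM TP' P'J.
have dT z : mdiff T z := msm_mdiff (nT 1) Logic.I.
have dP' z : mdiff P' z := msm_mdiff (nP' 1) Logic.I.
split.
- exact: (msmB openT (nT 2) (nP' 2)).
- exact: nP'.
- by move=> z; split; [exact: P'P'|exact: P'J|exact: trP'].
- by move=> z; rewrite mulmxBl !mulmxBr (pot_idem pot) TP' P'T P'P' subrr subr0.
- by move=> z; rewrite adjB (pot_adj pot) P'J.
- by move=> z; rewrite mulmxBl TP' P'P' subrr.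
move=> z; rewrite (mpartB s (dT z) (dP' z)) (pot_d pot) -P'dP'.
by rewrite -{2}(proj_d s (dP' z) P'P') opprD addrCA subrr addr0.
Qed.

End Step.

Definition partial_sum s T P k z : 'M[C]_n := T z - \sum_(1 <= j < k.+1) iter j (ladder s) P z.

(** The trace of T is a nonnegative integer that drops by one at each step, so
    some B vanishes after finitely many steps. *)
Lemma ladder_chain s T P : potential s T P 2 -> exists r,
  [/\ forall k, (k <= r)%N -> potential s (partial_sum s T P k) (iter k (ladder s) P) 2,
      forall k, (k < r)%N -> ~ (forall z, mpart s (iter k (ladder s) P) z *m iter k (ladder s) P z = 0) &
      forall z, mpart s (iter r (ladder s) P) z *m iter r (ladder s) P z = 0].
Proof.
pose z0 : plane R := 0.
have [m] : exists m, (\rank (T z0) <= m)%N by exists (\rank (T z0)).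
have T0 T' P' : partial_sum s T' P' 0 = T'.
  by apply/funext => z; rewrite /partial_sum big_geq // subr0.
elim: m T P => [|m IH] T P rT pot.
  have [B0|nB] := pselect (forall z, mpart s P z *m P z = 0).
    by exists 0%N; split=> // -[|//] _; rewrite T0.
  have pot' := ladder_potential pot nB; have := idem_trace (pot_idem pot z0).
  have := idem_trace (pot_idem pot' z0); have [_ _ t1] := pot_rank1 pot' z0.
  rewrite mxtraceD linearN /= t1 => E1 E2; move: E1; rewrite E2.
  move: rT; rewrite leqn0 => /eqP ->; rewrite sub0r => /eqP.
  by rewrite eq_sym -subr_eq0 opprK natr1 pnatr_eq0.
have [B0|nB] := pselect (forall z, mpart s P z *m P z = 0).
  by exists 0%N; split=> // -[|//] _; rewrite T0.
have pot' := ladder_potential pot nB.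
have [|r [H1 H2 H3]] := IH _ _ _ pot'.
  have := idem_trace (pot_idem pot z0).
  have := idem_trace (pot_idem pot' z0); have [_ _ t1] := pot_rank1 pot' z0.
  rewrite mxtraceD linearN /= t1 => E1 E2; move: E1; rewrite E2 => /eqP.
  by rewrite subr_eq natr1 eqr_nat => /eqP h; move: rT; rewrite h ltnS.
exists r.+1; split=> [[|k] kr|[|k] kr|].
- by rewrite T0.
- have := H1 k kr; rewrite -iterSr; congr (potential _ _ _ _).
  apply/funext => z; rewrite /partial_sum -addrA -opprD; congr (_ - _).
  rewrite [RHS]big_nat_recl //; congr (_ + _).
  by apply: eq_bigr => i _; rewrite -iterSr.
- exact: nB.
- by rewrite iterSr; exact: H2.
- by rewrite iterSr; exact: H3.
Qed.

Lemma ladder_zero s k : iter k (ladder s) (fun=> (0 : 'M[C]_n)) = fun=> 0.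
Proof.
elim: k => // k IH; rewrite iterS IH; apply/funext => z.
rewrite /ladder; case: (asboolP (forall x, ladder_num s (fun=> (0 : 'M[C]_n)) x = 0)) => // -[] x.
by rewrite /ladder_num mulmx0 mul0mx.
Qed.

End LadderStep.

(** * Bases from a triangular family of projections *)

Section TriangularBasis.
Variables (R : realType) (n : nat).
Local Notation C := R[i].
Local Notation V := 'cV[C]_n.

Lemma rank1_line (p : 'M[C]_n) (w v : V) : rank1_projector p -> p *m w != 0 ->
  exists c, p *m v = c *: (p *m w).
Proof.
move=> /rank1_rank/rank1_outer[x [r ->]]; rewrite -!mulmxA => xw.
have a0 : (r *m w) 0 0 != 0.
  by apply: contra_neq xw => h; rewrite [r *m w]mx11_scalar h mul_mx_scalar scale0r.
exists ((r *m v) 0 0 / (r *m w) 0 0).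
have E (c : 'M[C]_1) : x *m c = c 0 0 *: x by rewrite {1}[c]mx11_scalar mul_mx_scalar.
by rewrite !E scalerA mulfVK.
Qed.

Variables (a b : nat) (p : nat -> 'M[C]_n) (y : nat -> V) (W : {vspace V}).
Hypothesis prank : forall k, (a <= k < a + b)%N -> rank1_projector (p k).
Hypothesis yp : forall k, (a <= k)%N -> y k = \sum_(a <= j < a + b) p j *m y k.
Hypothesis Wy : forall v, v \in W <-> exists k, v \in <<mkseq (fun k => y (a + k)) k>>%VS.

Let mem k : (k \in iota a b) = (a <= k < a + b)%N.
Proof. by rewrite mem_iota. Qed.

Lemma span_le (u : nat -> V) : (forall k, (a <= k < a + b)%N -> u k != 0 /\ exists v, u k = p k *m v) ->
  (W <= <<[seq u k | k <- iota a b]>>)%VS.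
Proof.
move=> hu; apply/subvP => v /Wy[k]; move: v; apply/subvP.
apply/span_subvP => v /mapP[j _ ->]; rewrite yp ?leq_addr //.
rewrite big_seq; apply: memv_suml => i; rewrite mem_index_iota => ai.
have [u0 [x ux]] := hu i ai; rewrite ux in u0.
have [c ->] := rank1_line (y (a + j)) (prank ai) u0.
by rewrite -ux; apply: memvZ; apply: memv_span; apply/mapP; exists i => //; rewrite mem.
Qed.

Lemma dim_span_le : (\dim W <= b)%N.
Proof.
have H k : exists v : V, (a <= k < a + b)%N -> p k *m v != 0.
  have [ak|//] := boolP (a <= k < a + b)%N; last by exists 0.
  apply: contrapT => nv; have := rank1_neq0 (prank ak); apply/negP/negPn/eqP.
  apply/matrixP => i j; rewrite [RHS]mxE.
  have : p k *m delta_mx j (0 : 'I_1) = 0.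
    by apply: contrapT => /eqP x; apply: nv; exists (delta_mx j 0) => _.
  by rewrite -colE => /matrixP /(_ i 0); rewrite !mxE.
pose v k := projT1 (cid (H k)).
have hv k : (a <= k < a + b)%N -> p k *m v k != 0 by rewrite /v; case: cid.
have := @span_le (fun k => p k *m v k) (fun k ak => conj (hv k ak) (ex_intro _ (v k) erefl)).
move/dimvS => h; apply: leq_trans h _; apply: leq_trans (dim_span _) _.
by rewrite size_map size_iota.
Qed.

Hypothesis py : forall j k, (a <= k < j)%N -> (j < a + b)%N -> p j *m y k = 0.
Hypothesis ny : forall k, (a <= k < a + b)%N -> p k *m y k != 0.

Let Y m := [seq y (a + k) | k <- rev (iota 0 m)].

Let freeY m : (m <= b)%N -> free (Y m).
Proof.
elim: m => [|m IH] mb; first by rewrite /Y nil_free.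
have E : iota 0 m.+1 = iota 0 m ++ [:: m] by rewrite -[m.+1]addn1 iotaD add0n.
rewrite /Y E rev_cat /= free_cons IH ?andbT; last exact: ltnW.
have am : (a <= a + m < a + b)%N by rewrite leq_addr ltn_add2l.
apply: contra (ny am) => H; apply/eqP.
pose f := linfun (mulmx (p (a + m)) : V -> V).
suff : (<<Y m>> <= lker f)%VS by move/subvP/(_ _ H); rewrite memv_ker lfunE => /eqP.
apply/span_subvP => v /mapP[k]; rewrite mem_rev mem_iota add0n /= => km ->.
by rewrite memv_ker lfunE /= py // ?ltn_add2l ?leq_addr //.
Qed.

Lemma dim_span_eq : \dim W = b.
Proof.
apply/eqP; rewrite eqn_leq dim_span_le /=.
have sY : size (Y b) = b by rewrite size_map size_rev size_iota.
rewrite -{1}sY -(eqP (freeY (leqnn b))); apply: dimvS; apply/span_subvP => v.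
move=> /mapP[k]; rewrite mem_rev mem_iota add0n /= => kb ->; apply/Wy.
exists k.+1; apply: memv_span; apply/mapP; exists k => //.
by rewrite mem_iota add0n ltnS leqnn.
Qed.

(** With respect to the orthogonal lines the vectors y are triangular with
    nonzero diagonal, so both families span the same space. *)
Lemma triangular_basis : images_basis W p (iota a b).
Proof.
split=> [k|u hu]; first by rewrite mem => /prank/rank1_rank.
rewrite basisEdim size_map size_iota dim_span_eq leqnn andbT.
by apply: span_le => k; rewrite -mem => /hu.
Qed.

Lemma triangular_projects k : (a <= k < a + b)%N -> projects_into (p k) W.
Proof.
move=> ak v; have [_ H] := triangular_basis.
have hb : basis_of W [seq p k *m y k | k <- iota a b].
  by apply: H => j; rewrite mem => aj; split; [exact: ny|exists (y j)].
rewrite -(span_basis hb); have [c ->] := rank1_line v (prank ak) (ny ak).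
by apply: memvZ; apply: memv_span; apply/mapP; exists k => //; rewrite mem.
Qed.

End TriangularBasis.

(** * Density of the points where P e does not vanish *)

Section Density.
Variables (R : realType) (n : nat).
Local Notation C := R[i].
Implicit Types (z : plane R) (T P : plane R -> 'M[C]_n) (K : 'M[C]_n).

Let uc1 s T P K z0 (r : R) : potential s T P 2 -> 0 < r ->
  (forall z, sq z0 r z -> P z *m K = 0 /\ T z *m K = K) -> forall z, P z *m K = 0.
Proof.
move=> pot r0 H z; have nP k := pot_P (pot_smooth k pot).
have nT k := pot_T (pot_smooth k pot).
have PP w : P w *m P w = P w by have [] := pot_rank1 pot w.
pose X (b : bool) w := if b then P w *m K else (1%:M - T w) *m K.
have n1 := msmB openT (msm_cst setT 2 (1%:M : 'M[C]_n)) (nT 2%N).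
have nX b : msm setT 2 (X b).
  case: b; [exact: (msmM openT (nP 2%N) (msm_cst _ _ K))|exact: (msmM openT n1 (msm_cst _ _ K))].
have dP w : mdiff P w := msm_mdiff (nP 1%N) Logic.I.
have dT w : mdiff T w := msm_mdiff (nT 1%N) Logic.I.
have ndP := msm_mpart s openT (nP 3%N).
apply: (matrix_uc (s := s) (X := X) (z0 := z0) nX _ r0 _ true) => [b|b w Sw]; last first.
  have [h1 h2] := H w Sw; case: b; rewrite /X //.
  by rewrite mulmxBl mul1mx h2 subrr.
case: b.
- apply: (@mlin_eq _ _ _ _ _ _ (fun w => mpart s P w *m X true w + P w *m mpart s P w *m X false w)).
    move=> w; rewrite /X (mpartM _ (dP w) (mdiff_cst _ _)) mpart_cst mulmx0 addr0.
    rewrite -{1}(proj_d s (dP w) PP) mulmxDl -!mulmxA; congr (_ + _).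
    by rewrite !mulmxA mulmxBr mulmx1 -[P w *m _ *m T w]mulmxA (pot_dPT pot) mulmx0 subr0.
  apply: mlinD; first exact: (mlinMl ndP (mlin_entries X true)).
  exact: (mlinMl (msmM openT (nP 2%N) ndP) (mlin_entries X false)).
- apply: (@mlin_eq _ _ _ _ _ _ (fun w => mpart s P w *m X true w)).
    move=> w; rewrite /X (mpartM _ (msm_mdiff n1 Logic.I) (mdiff_cst _ _)) mpart_cst mulmx0 addr0.
    by rewrite (mpartB _ (mdiff_cst _ _) (dT w)) mpart_cst sub0r (pot_d pot) opprK mulmxA.
  exact: (mlinMl ndP (mlin_entries X true)).
Qed.

(** A constant vector killed by P on an open set splits into its components in
    the image of T and orthogonal to it. Both are constant near the point,
    because the derivatives of T K only involve P K; each of them satisfies a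
    linear system, for the potential and for its dual respectively, and unique
    continuation applies. *)
Lemma pot_kill s T P K z0 (r : R) : potential s T P 2 -> 0 < r ->
  (forall z, sq z0 r z -> P z *m K = 0) -> forall z, P z *m K = 0.
Proof.
move=> pot r0 H.
have dP w : mdiff P w := msm_mdiff (pot_P pot) Logic.I.
have dT w : mdiff T w := msm_mdiff (pot_T pot) Logic.I.
have dPK t w : sq z0 r w -> mpart t P w *m K = 0.
  move=> Sw; have : mpart t (fun x => P x *m K) w = 0.
    rewrite (near_mpart t (Y := fun=> 0)) ?mpart_cst //.
    by apply: (near_open (@sq_open R z0 r) Sw) => x /H.
  by rewrite (mpartM _ (dP w) (mdiff_cst _ _)) mpart_cst mulmx0 addr0.
have TK : forall v w, sq z0 r v -> sq z0 r w -> T v *m K = T w *m K.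
  apply: (mgradient0_sq (X := fun x => T x *m K)) => [w Sw|t w Sw].
    exact: mdiffM (dT w) (mdiff_cst _ _).
  rewrite (mpartM _ (dT w) (mdiff_cst _ _)) mpart_cst mulmx0 addr0.
  have [->|ts] := eqVneq t s; first by rewrite (pot_d pot) mulNmx -mulmxA H // mulmx0 oppr0.
  have -> : t = ~~ s by case: (t) (s) ts => [] [].
  by rewrite (pot_d' pot) mulNmx -mulmxA dPK // mulmx0 oppr0.
have z0S := sq_center z0 r0; pose K1 := T z0 *m K.
have PT := pot_PT pot; have TT := pot_idem pot.
have e1 z : sq z0 r z -> T z *m K = K1 by move=> Sz; exact: TK.
have p1 : forall z, P z *m K1 = 0.
  apply: (@uc1 _ _ P K1 z0 r pot r0) => z Sz; rewrite -(e1 z Sz) !mulmxA PT mul0mx; split=> //.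
  by rewrite TT.
(* The complement is handled by the same lemma, for the dual potential. *)
have p2 : forall z, P z *m (K - K1) = 0.
  apply: (@uc1 _ _ P (K - K1) z0 r (pot_dual pot) r0) => z Sz; rewrite mulmxBr (H z Sz) p1 subrr; split=> //.
  rewrite !mulmxBl !mul1mx !mulmxBr (H z Sz) p1 (e1 z Sz) -{1 3}(e1 z Sz) !mulmxA TT (e1 z Sz).
  by rewrite !subrr !subr0.
by move=> z; rewrite -[K](subrK K1) mulmxDr p1 p2 addr0.
Qed.

End Density.

(** * Covariant derivatives and the ladder *)

Section Direction.
Variables (R : realType) (n : nat) (s : bool).
Local Notation C := R[i].
Variables (T P : plane R -> 'M[C]_n) (e : 'cV[C]_n) (r : nat).
Local Notation Pk k := (iter k (ladder s) P).
Local Notation Tk k := (partial_sum s T P k).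
Local Notation B k z := (mpart s (Pk k) z *m Pk k z).
Hypothesis pot : forall k, (k <= r)%N -> potential s (Tk k) (Pk k) 2.
Hypothesis Br : forall z, B r z = 0.
Implicit Types z : plane R.

Let T0 : Tk 0 = T.
Proof. by apply/funext => z; rewrite /partial_sum big_geq // subr0. Qed.

Let TkS k z : Tk k.+1 z = Tk k z - Pk k.+1 z.
Proof. by rewrite /partial_sum big_nat_recr //= opprD addrA. Qed.

Let PkPk k z : (k <= r)%N -> Pk k z *m Pk k z = Pk k z.
Proof. by move=> kr; have [] := pot_rank1 (pot kr) z. Qed.
Let PkJ k z : (k <= r)%N -> (Pk k z)^t* = Pk k z.
Proof. by move=> kr; have [] := pot_rank1 (pot kr) z. Qed.
Let dPk k z : (k <= r)%N -> mdiff (Pk k) z.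
Proof. by move=> kr; exact: msm_mdiff (pot_P (pot kr)) Logic.I. Qed.
Let dTk k z : (k <= r)%N -> mdiff (Tk k) z.
Proof. by move=> kr; exact: msm_mdiff (pot_T (pot kr)) Logic.I. Qed.

Let TkP k z : (k < r)%N -> Tk k z *m Pk k.+1 z = Pk k.+1 z.
Proof.
move=> kr; have := pot_TP (pot kr) z; rewrite TkS mulmxBl PkPk //.
exact: subr0_eq.
Qed.

Let TkTk j k z : (j <= k)%N -> (k <= r)%N -> Tk j z *m Tk k z = Tk k z.
Proof.
elim: k => [|k IH]; first by rewrite leqn0 => /eqP -> kr; exact: (pot_idem (pot kr)).
rewrite leq_eqVlt => /orP[/eqP ->|jk] kr; first exact: (pot_idem (pot kr)).
by rewrite TkS mulmxBr IH // 1?ltnW // -{1}(TkP z kr) mulmxA IH // 1?ltnW // TkP.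
Qed.

Let PkTk j k z : (j <= k)%N -> (k <= r)%N -> Pk j z *m Tk k z = 0.
Proof.
move=> jk kr; rewrite -(TkTk z jk kr) mulmxA (pot_PT (pot (leq_trans jk kr))).
exact: mul0mx.
Qed.

Let TkPk j k z : (j <= k)%N -> (k <= r)%N -> Tk k z *m Pk j z = 0.
Proof.
move=> jk kr; rewrite -(PkJ z (leq_trans jk kr)) -(pot_adj (pot kr)) -adjM PkTk //.
exact: adj0.
Qed.

Let orth j k z : (j < k)%N -> (k <= r)%N -> Pk j z *m Pk k z = 0.
Proof.
case: k => // k jk kr; rewrite -(TkP z kr) mulmxA PkTk ?mul0mx //; exact: ltnW.
Qed.

Let orth' j k z : (j < k)%N -> (k <= r)%N -> Pk k z *m Pk j z = 0.
Proof.
move=> jk kr; rewrite -(PkJ z kr) -(PkJ z (ltnW (leq_trans jk kr))) -adjM orth //.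
exact: adj0.
Qed.

Let TkdP k j z : (j < k)%N -> (k <= r)%N -> (forall w, B k w *m Pk j w = 0) ->
  Tk k z *m mpart s (Pk j) z = 0.
Proof.
move=> jk kr BP; have jr : (j <= r)%N := ltnW (leq_trans jk kr).
have : mpart s (fun x => Tk k x *m Pk j x) z = 0.
  by rewrite (eq_mpart s z (fun w => TkPk w (ltnW jk) kr)) mpart_cst.
rewrite (mpartM s (dTk z kr) (dPk z jr)) (pot_d (pot kr)) mulNmx BP oppr0 add0r.
by [].
Qed.

Let PB k z : (k < r)%N -> Pk k.+1 z *m B k z = B k z.
Proof.
move=> kr; have := pot_TB (pot (ltnW kr)) z.
have -> : Tk k z = Tk k.+1 z + Pk k.+1 z by rewrite TkS subrK.
rewrite mulmxDl mulmxA TkdP // ?mul0mx ?add0r // => w.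
by rewrite -mulmxA orth' // mulmx0.
Qed.

Let S k z := P z + T z - Tk k z.

Let SE k z : S k z = \sum_(0 <= j < k.+1) Pk j z.
Proof.
by rewrite /S /partial_sum opprB addrACA subrr addr0 [RHS]big_ltn.
Qed.

Let dS k z : (k <= r)%N -> mpart s (S k) z = P z *m mpart s P z + B k z.
Proof.
move=> kr; have p0 := pot (leq0n r); have dP := dPk z (leq0n r); have dT := dTk z (leq0n r).
rewrite T0 in p0 dT.
rewrite (mpartB s (mdiffD dP dT) (dTk z kr)) (mpartD s dP dT) (pot_d p0) (pot_d (pot kr)) opprK.
congr (_ + _); rewrite -{1}(proj_d s dP (fun w => PkPk w (leq0n r))) /= addrAC subrr add0r.
by [].
Qed.

Let SS j k z : (j <= k)%N -> (k <= r)%N -> S k z *m S j z = S j z.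
Proof.
move=> jk kr; have jr := leq_trans jk kr; rewrite (SE j z) mulmx_sumr big_nat [RHS]big_nat.
apply: eq_bigr => i /=; rewrite ltnS => ij; have ik := leq_trans ij jk.
rewrite /S mulmxBl TkPk // subr0 mulmxDl.
case: i ij ik => [|i] ij ik.
  by rewrite (PkPk z (leq0n r)) -T0 TkPk // addr0.
rewrite -[P z]/(Pk 0 z) orth ?(leq_trans ik) // add0r -{1}T0.
have ir : (i < r)%N by exact: leq_trans ik kr.
by rewrite -(TkP z ir) mulmxA TkTk // ltnW.
Qed.

Let D := nonvanishing P e.
Let oD : open D.
Proof.
rewrite openE => z Dz; have nP : msm setT 1 P := msm_le (isT : 1 <= 2)%N (pot_P (pot (leq0n r))).
have nPe := msmM openT nP (msm_cst setT 1 e).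
have nt := csm_tr openT (msmM openT nPe (msmJ openT nPe)).
have t0 : \tr (P z *m e *m (P z *m e)^t*) != 0 by apply: contra_neq Dz; exact: tr_normsq_eq0.
have [U [oU Uz _ H]] := csm_neq0_near openT (Logic.I : setT z) nt t0.
rewrite /interior; apply: filterS (open_nbhs_nbhs (conj oU Uz)) => x /H; apply: contra_neq => ->.
by rewrite mul0mx mxtrace0.
Qed.

Let nP k : msm D k P.
Proof.
have p0 := pot (leq0n r).
exact: msm_sub (@subsetT _ D) (pot_P (pot_smooth k p0)).
Qed.

Let lam := bracket P e P (mxpartial s P).

Let ePe z : D z -> (e^t* *m P z *m e) 0 0 != 0.
Proof.
rewrite /D /nonvanishing /=; apply: contra_neq => h; apply: col_normsq_eq0.
by rewrite adjM (PkJ z (leq0n r)) -mulmxA [P z *m (P z *m e)]mulmxA (PkPk z (leq0n r)) mulmxA.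
Qed.

Let nlam k : csm D k lam.
Proof.
have ne := msm_cst D k e; have neJ := msmJ oD ne.
have ndP := msm_mpart s oD (nP k.+1).
apply: (csmM oD (f := fun z => (e^t* *m (P z)^t* *m mxpartial s P z *m e) 0 0)).
  rewrite mpart_mx; exact: (msmM oD (msmM oD (msmM oD neJ (msmJ oD (nP k))) ndP) ne 0 0).
apply: (csmV oD ePe); exact: (msmM oD (msmM oD neJ (nP k)) ne 0 0).
Qed.

Let Yk k := iter k (covder s P e) P.

Let nY k l : msm D l (Yk k).
Proof.
elim: k l => [|k IH] l; first exact: nP.
rewrite /Yk iterS -/(Yk k) /covder mpart_mx.
exact: (msmB oD (msm_mpart s oD (IH l.+1)) (msmZ oD (nlam l) (IH l))).
Qed.

Let y k z := Yk k z *m e.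

Let my k z : D z -> mdiff (y k) z.
Proof. by move=> Dz; exact: (mdiffM (msm_mdiff (nY k 1) Dz) (mdiff_cst _ _)). Qed.

Let yS k z : D z -> y k.+1 z = mpart s (y k) z - lam z *: y k z.
Proof.
move=> Dz; rewrite /y (mpartM s (msm_mdiff (nY k 1) Dz) (mdiff_cst _ _)) mpart_cst mulmx0 addr0.
by rewrite scalemxAl -mulmxBl /Yk iterS /covder mpart_mx.
Qed.

(* A projector field whose derivative stays in its image on y k. *)
Let stable (X : plane R -> 'M[C]_n) k : (forall z, mdiff X z) ->
  (forall z, D z -> X z *m y k z = y k z) ->
  (forall z, D z -> X z *m X z = X z) ->
  (forall z, D z -> X z *m (mpart s X z *m y k z) = mpart s X z *m y k z) ->
  forall z, D z -> X z *m y k.+1 z = y k.+1 z.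
Proof.
move=> dX Xy XX dXy z Dz.
have E : mpart s (y k) z = mpart s X z *m y k z + X z *m mpart s (y k) z.
  rewrite -(mpartM s (dX z) (my k Dz)); apply: near_mpart.
  by apply: (near_open oD Dz) => x Dx; rewrite Xy.
have E2 : X z *m mpart s (y k) z = mpart s (y k) z.
  by rewrite {1}E mulmxDr dXy // mulmxA XX // -E.
by rewrite yS // mulmxBr -scalemxAr Xy // E2.
Qed.

Let dSk k z : (k <= r)%N -> mdiff (S k) z.
Proof.
move=> kr; have dT := dTk z (leq0n r); rewrite T0 in dT.
exact: (mdiffD (mdiffD (dPk z (leq0n r)) dT) (mdiffN (dTk z kr))).
Qed.

Let SP k z : (k <= r)%N -> S k z *m P z = P z.
Proof.
move=> kr; rewrite /S mulmxBl mulmxDl (PkPk z (leq0n r)) -[P z]/(Pk 0 z) TkPk // -{1}T0.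
by rewrite TkPk // addr0 subr0.
Qed.

Let y0 z : y 0 z = P z *m e. Proof. by []. Qed.

(** The image of P_0 + ... + P_r is stable under covariant differentiation in
    direction s, since B vanishes at level r. *)
Lemma y_span0 k z : D z -> y k z = \sum_(0 <= j < 0 + r.+1) Pk j z *m y k z.
Proof.
move=> Dz; rewrite -mulmx_suml -SE; symmetry.
elim: k z Dz => [|k IH] z Dz; first by rewrite y0 mulmxA SP.
apply: (stable (X := S r)) => // [w|w Dw|w Dw]; first exact: dSk.
  exact: SS.
by rewrite dS // Br addr0 !mulmxA SP.
Qed.

Let E' z := T z - Tk r z.

Let E'E z : E' z = \sum_(1 <= j < 1 + r) Pk j z.
Proof. by rewrite /E' /partial_sum opprB addrC subrK add1n. Qed.

Let PE' z : P z *m E' z = 0.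
Proof. by rewrite mulmxBr -[P z]/(Pk 0 z) PkTk // -{1}T0 PkTk // subrr. Qed.

(** The first covariant derivative is B e, which has no component along P;
    afterwards the argument is that of y_span0, for the sum from 1 to r. *)
Lemma y_span1 k z : (1 <= k)%N -> D z -> y k z = \sum_(1 <= j < 1 + r) Pk j z *m y k z.
Proof.
move=> k1 Dz; rewrite -mulmx_suml -E'E; symmetry.
have p0 : potential s T P 2 by rewrite -T0; exact: (pot (leq0n r)).
have dP w : mdiff P w := dPk w (leq0n r).
have TrT w : Tk r w *m T w = Tk r w.
  rewrite -(pot_adj (pot (leqnn r))) -(pot_adj p0) -adjM -{1}T0 TkTk //.
have TTr w : T w *m Tk r w = Tk r w by rewrite -{1}T0 TkTk.
case: k k1 => // k _; elim: k z Dz => [|k IH] z Dz; last first.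
  apply: (stable (X := E')) => // [w|w Dw|w Dw].
  - have dT := dTk w (leq0n r); rewrite T0 in dT.
    exact: (mdiffD dT (mdiffN (dTk w (leqnn r)))).
  - by rewrite /E' mulmxBl (mulmxBr (T w)) (mulmxBr (Tk r w)) (pot_idem p0 w) (TTr w) (TrT w)
      (pot_idem (pot (leqnn r)) w) subrr subr0.
  - have dT := dTk w (leq0n r); rewrite T0 in dT.
    rewrite (mpartB s dT (dTk w (leqnn r))) (pot_d p0) (pot_d (pot (leqnn r))) Br oppr0 subr0.
    by rewrite mulNmx -mulmxA -(IH w Dw) [P w *m _]mulmxA PE' mul0mx mulmx0 oppr0 mulmx0.
have y1 : y 1 z = B 0 z *m e.
  rewrite yS // y0 (mpartM s (dP z) (mdiff_cst _ _)) mpart_cst mulmx0 addr0.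
  rewrite -{1}(proj_d s (dP z) (fun w => PkPk w (leq0n r))) mulmxDl -addrA.
  rewrite [X in _ + X](_ : _ = 0) ?addr0 //; apply/eqP; rewrite subr_eq0; apply/eqP.
  have sw : P z *m (e *m e^t*) *m P z = \tr (P z *m (e *m e^t*)) *: P z :=
    rank1_sandwich (e *m e^t*) (pot_rank1 p0 z).
  have tE : \tr (P z *m (e *m e^t*)) = (e^t* *m P z *m e) 0 0.
    by rewrite mulmxA mxtrace_mulC mulmxA trace_mx11.
  apply: (scalerI (ePe Dz)); rewrite -tE scalerA.
  have -> : \tr (P z *m (e *m e^t*)) *: (P z *m mpart s P z *m e) =
     P z *m (e *m e^t*) *m P z *m mpart s P z *m e by rewrite !scalemxAl -sw.
  rewrite /lam /bracket -tE mulrC divfK; last by rewrite tE ePe.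
  rewrite (PkJ z (leq0n r)) mpart_mx -!mulmxA.
  rewrite [e^t* *m _]mx11_scalar mul_mx_scalar -scalemxAr.
  by congr (_ *: _); rewrite !mxE.
have TrdP : Tk r z *m B 0 z = 0.
  have [r0|rp] := posnP r; first by have := Br z; rewrite r0 => ->; rewrite mulmx0.
  by rewrite mulmxA TkdP ?mul0mx // => w; rewrite Br mul0mx.
by rewrite y1 mulmxA mulmxBl TrdP subr0 (pot_TB p0).
Qed.

(** One derivative raises the level by at most one. *)
Lemma y_partial k z : (k <= r)%N -> D z -> S k z *m y k z = y k z.
Proof.
elim: k z => [|k IH] z kr Dz; first by rewrite y0 mulmxA SP.
have k1 := ltnW kr.
have E : mpart s (y k) z = mpart s (S k) z *m y k z + S k z *m mpart s (y k) z.
  rewrite -(mpartM s (dSk z k1) (my k Dz)); apply: near_mpart.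
  by apply: (near_open oD Dz) => x Dx; rewrite IH.
have SB : S k.+1 z *m B k z = B k z.
  rewrite -(PB z kr) mulmxA; congr (_ *m _).
  have -> : Pk k.+1 z = S k.+1 z - S k z.
    have -> : S k.+1 z = S k z + Pk k.+1 z by rewrite !SE [LHS]big_nat_recr.
    by rewrite addrC addKr.
  by rewrite mulmxBr !SS.
have E2 : S k.+1 z *m mpart s (y k) z = mpart s (y k) z.
  rewrite {1}E mulmxDr [in LHS]mulmxA dS // mulmxDr SB !mulmxA SP // SS // -mulmxA.
  by rewrite {2}E dS // !mulmxA.
rewrite (yS k Dz) mulmxBr E2 -scalemxAr -{1}(IH z k1 Dz) mulmxA (SS z (leqnSn k) kr).
by rewrite (IH z k1 Dz).
Qed.

Lemma y_below j k z : (k < j)%N -> (j <= r)%N -> D z -> Pk j z *m y k z = 0.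
Proof.
move=> kj jr Dz; rewrite -y_partial //; last exact: ltnW (leq_trans kj jr).
rewrite SE mulmxA mulmx_sumr big_nat big1 ?mul0mx // => i /=; rewrite ltnS => ik.
by rewrite orth' //; exact: leq_ltn_trans ik kj.
Qed.

(** Modulo the lower levels, y k.+1 is B k applied to y k, and B k z is
    injective on the line of P_k z when it is nonzero. *)
Lemma y_diag k z : (forall j, (j < r)%N -> B j z != 0) -> D z -> (k <= r)%N ->
  Pk k z *m y k z != 0.
Proof.
move=> Bz Dz; elim: k => [|k IH] kr; first by rewrite y0 mulmxA (PkPk z (leq0n r)).
have k1 := ltnW kr.
have E : mpart s (y k) z = mpart s (S k) z *m y k z + S k z *m mpart s (y k) z.
  rewrite -(mpartM s (dSk z k1) (my k Dz)); apply: near_mpart.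
  by apply: (near_open oD Dz) => x Dx; rewrite y_partial.
have PS : Pk k.+1 z *m S k z = 0.
  by rewrite SE mulmx_sumr big_nat big1 // => i /andP[_ ik]; exact: orth'.
have -> : Pk k.+1 z *m y k.+1 z = B k z *m y k z.
  rewrite (yS k Dz) mulmxBr -scalemxAr (y_below (leqnn _) kr Dz) scaler0 subr0 E mulmxDr !mulmxA PS.
  rewrite mul0mx addr0.
  by rewrite dS // mulmxDr mulmxA -[P z]/(Pk 0 z) orth' // mul0mx add0r PB.
apply: contra_neq (Bz k kr) => h.
exact: (rank1_kill (pot_rank1 (pot k1) z) (IH k1) h).
Qed.

End Direction.

(** * The coordinate at infinity *)

Section Inversion.
Variable R : realType.
Local Notation C := R[i].
Local Notation Re := complex.Re.
Local Notation Im := complex.Im.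
Local Notation normc := (@ComplexField.Normc.normc R).
Implicit Types (z w : plane R) (f : plane R -> C).

Lemma diff_plane (f : plane R -> R) z (a c : R) : differentiable f z ->
  'd f z ((a, c) : plane R) = 'D_((1, 0) : plane R) f z * a + 'D_((0, 1) : plane R) f z * c.
Proof.
move=> df; have -> : ((a, c) : plane R) = a *: ((1, 0) : plane R) + c *: ((0, 1) : plane R).
  by congr (_, _); rewrite /= /GRing.scale /=; ring.
rewrite linearD !linearZ (deriveE _ df) (deriveE _ df) /GRing.scale /=.
by congr (_ + _); rewrite mulrC.
Qed.

Lemma pd_chain (f g1 g2 : plane R -> R) w : differentiable f (g1 w, g2 w) ->
  differentiable g1 w -> differentiable g2 w ->
  differentiable (fun x => f (g1 x, g2 x)) w /\
  forall b, pd b (fun x => f (g1 x, g2 x)) w =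
    pd false f (g1 w, g2 w) * pd b g1 w + pd true f (g1 w, g2 w) * pd b g2 w.
Proof.
move=> df d1 d2; set z := (g1 w, g2 w) in df *.
pose g x : plane R := (g1 x, g2 x).
have dg : differentiable g w by exact: differentiable_pair.
have dfg : differentiable (f \o g) w by exact: differentiable_comp.
split=> // b; rewrite !pdE (deriveE _ dfg) (diff_comp dg df) /=.
have -> : 'd g w (axis R b) = ('d g1 w (axis R b), 'd g2 w (axis R b)) :> plane R.
  by rewrite /g diff_pair.
rewrite (deriveE (axis R b) d1) (deriveE (axis R b) d2).
exact: (diff_plane ('d g1 w (axis R b)) ('d g2 w (axis R b)) df).
Qed.

Definition cplx w : C := zeta true 0 w.

Lemma cplxE w : cplx w = w.1 +i* w.2.
Proof.
rewrite /cplx /zeta /wc expr1 mulN1r opprK; apply: complex_eq; rewrite ?ReD ?ImD ?ReM ?ImM /=; ring.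
Qed.

Definition inv w : plane R := (Re (cplx w)^-1, Im (cplx w)^-1).

Lemma cplx_inv w : cplx (inv w) = (cplx w)^-1.
Proof. by rewrite cplxE /inv; case: (_^-1). Qed.

Lemma cplx_inj z w : cplx z = cplx w -> z = w.
Proof. by rewrite !cplxE; case: z w => [a b] [c d] /= [-> ->]. Qed.

Lemma invK w : inv (inv w) = w.
Proof. by apply: cplx_inj; rewrite !cplx_inv invrK. Qed.

Lemma cplx_eq0 w : (cplx w == 0) = (w == 0).
Proof. by rewrite /cplx zeta_eq0. Qed.

Definition punctured : set (plane R) := [set w | w != 0].

Lemma open_punctured : open punctured.
Proof.
rewrite (_ : punctured = ~` [set 0]); last by apply/seteqP; split=> w /= /eqP.
apply: closed_openC; apply: accessible_closed_set1; apply: hausdorff_accessible.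
exact: norm_hausdorff.
Qed.

Definition cplxs (s : bool) w : C := if s then Num.conj (cplx w) else cplx w.

Lemma csm_cplxs D k s : open D -> csm D k (cplxs s).
Proof.
by move=> oD; case: s; [exact: (csmJ oD (csm_zeta true 0 k oD))|exact: csm_zeta].
Qed.

Let G w := (cplx w)^-1.

Let nG k : csm punctured k G.
Proof.
apply: (csmV open_punctured) (csm_zeta true 0 k open_punctured) => w.
by rewrite /punctured /= -cplx_eq0.
Qed.

Let cpdG b w : punctured w -> cpd b G w = (if b then wc R true else 1) * - (G w * G w).
Proof.
move=> pw; have w0 : cplx w != 0 by rewrite cplx_eq0.
have dG := csm_cdiff (nG 1) pw.
have dc : cdiff cplx w by exact: csm_cdiff (csm_zeta true 0 1 openT) (Logic.I : setT w).
have cc : cpd b cplx w = if b then wc R true else 1.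
  have [E1 E2] := cpd_wirt cplx w; rewrite /cplx !wirt_zeta /= in E1 E2.
  by case: b; rewrite ?E1 ?E2 ?subr0 ?mulr1 ?addr0.
have : cpd b (fun x => G x * cplx x) w = 0.
  rewrite (near_cpd b (g := fun=> 1)) ?cpd_cst //.
  apply: filterS (open_nbhs_nbhs (conj open_punctured pw)) => x px.
  by rewrite /G mulVf // cplx_eq0.
rewrite (cpdM b dG dc) cc => /eqP; rewrite addr_eq0 => /eqP h.
apply: (mulIf w0); rewrite h mulrN mulNr; congr (- _).
by rewrite -2!mulrA /G mulVf // mulr1 mulrC.
Qed.

Lemma wirt_inv s f w : w != 0 -> cdiff f (inv w) ->
  cdiff (fun x => f (inv x)) w /\
  wirtinger s f (inv w) = - (cplxs s w * cplxs s w) * wirtinger s (fun x => f (inv x)) w.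
Proof.
move=> w0 [f1 f2]; have pw : punctured w by [].
have [g1 g2] := csm_cdiff (nG 1) pw.
have [d1 p1] := pd_chain f1 g1 g2; have [d2 p2] := pd_chain f2 g1 g2.
split=> //; have [a aE] : exists a, a = - (G w * G w) by exists (- (G w * G w)).
have a1 : pd false (fun x => Re (G x)) w = Re a.
  by transitivity (Re (cpd false G w)); [|rewrite (cpdG false pw) mul1r aE].
have a2 : pd false (fun x => Im (G x)) w = Im a.
  by transitivity (Im (cpd false G w)); [|rewrite (cpdG false pw) mul1r aE].
have wt : wc R true = 'i by rewrite /wc expr1 mulN1r opprK.
have e : cpd true G w = 'i * a by rewrite (cpdG true pw) wt aE.
have Ri : Re ('i : C) = 0 by [].
have Ii : Im ('i : C) = 1 by [].
have a3 : pd true (fun x => Re (G x)) w = - Im a.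
  by transitivity (Re (cpd true G w)); [|rewrite e ReM Ri Ii mul0r mul1r sub0r].
have a4 : pd true (fun x => Im (G x)) w = Re a.
  by transitivity (Im (cpd true G w)); [|rewrite e ImM Ri Ii mul0r mul1r add0r].
have E : wirtinger s (fun x => f (inv x)) w =
    (if s then Num.conj a else a) * wirtinger s f (inv w).
  rewrite !wirtingerE /cpd !p1 !p2 a1 a2 a3 a4 -/(inv w).
  move: (pd _ _ _) (pd _ _ _) (pd _ _ _) (pd _ _ _) => x1 x2 x3 x4.
  have iE : wc R s = if s then 'i else - 'i.
    by rewrite /wc; case: (s); rewrite ?expr0 ?expr1 ?mulN1r ?opprK ?mul1r.
  rewrite mulrCA; congr (_ * _); rewrite iE; case: (s); apply: complex_eq;
    rewrite ?ReD ?ImD ?ReM ?ImM ?ReN ?ImN ?ReJ ?ImJ ?ReD ?ImD ?ReM ?ImM ?ReN ?ImN /=;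
    move: (Re a) (Im a) => b1 b2; ring.
have Gc : G w * cplx w = 1 by rewrite /G mulVf // cplx_eq0.
have h : - (cplx w * cplx w) * - (G w * G w) = 1.
  by rewrite mulrNN mulrACA [cplx w * _]mulrC Gc mulr1.
rewrite E mulrA [_ * (if s then _ else _)](_ : _ = 1) ?mul1r // /cplxs aE.
case: (s) => //; rewrite -(rmorph1 (Num.conj : C -> C)) -h.
by rewrite (rmorphM (Num.conj : C -> C)) (rmorphN _ (cplx w * _)) (rmorphM _ (cplx w)).
Qed.

(** The chain rule for the inversion; the factor w^2 vanishes at infinity, and
    this is the source of the decay used for the Liouville argument. *)
Lemma mpart_inv s m p (X : plane R -> 'M[C]_(m, p)) w : w != 0 -> mdiff X (inv w) ->
  mpart s X (inv w) = - (cplxs s w * cplxs s w) *: mpart s (fun x => X (inv x)) w.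
Proof.
move=> w0 dX; apply/matrixP => i j; rewrite mxE !mpartE.
by have [_ ->] := wirt_inv s w0 (dX i j).
Qed.

Lemma inv_small (d : R) w : 0 < d -> ~ sq 0 d^-1 w -> csq 0 d (inv w) /\ w != 0.
Proof.
move=> d0 nS; have w0 : w != 0.
  by apply/eqP => w0; apply: nS; rewrite w0; apply: sq_center; rewrite invr_gt0.
split=> //; have E := zeta_normc true 0 w; rewrite -!expr2 !subr0 in E.
have n0 := normc_ge0 (cplx w).
have a0 := sqr_ge0 w.1; have b0 := sqr_ge0 w.2.
have l1 : `|w.1| <= normc (cplx w).
  by rewrite -ler_sqr ?nnegrE // E real_normK ?num_real // lerDl.
have l2 : `|w.2| <= normc (cplx w).
  by rewrite -ler_sqr ?nnegrE // E real_normK ?num_real // lerDr.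
have big : d^-1 <= normc (cplx w).
  rewrite leNgt; apply/negP => h; apply: nS; split; rewrite subr0;
    [exact: le_lt_trans l1 h|exact: le_lt_trans l2 h].
have small : normc (cplx w)^-1 <= d.
  rewrite ComplexField.Normc.normcV -[d]invrK lef_pV2 // posrE ?invr_gt0 //.
  by apply: lt_le_trans big; rewrite invr_gt0.
by split; rewrite subr0; [apply: le_trans (normc_Re _) small|apply: le_trans (normc_Im _) small].
Qed.

End Inversion.

(** * Isotropy of harmonic maps of the sphere *)

Section Towers.
Variables (R : realType) (n : nat).
Local Notation C := R[i].
Local Notation Re := complex.Re.
Local Notation Im := complex.Im.
Implicit Types (z w : plane R).

(** Where P e is nonzero, X_(k+1) e is the derivative of X_k e up to a
    multiple of X_k e. Multiplication by P at each step thus replaces the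
    choice of e, and the tower is defined everywhere. *)
Fixpoint tower (s : bool) (P : plane R -> 'M[C]_n) (k : nat) : plane R -> 'M[C]_n :=
  if k is l.+1 then fun z => mpart s (tower s P l) z *m P z else P.

(** The same tower written in the coordinate at infinity. *)
Fixpoint tower_infty (s : bool) (Q : plane R -> 'M[C]_n) (k : nat) : plane R -> 'M[C]_n :=
  if k is l.+1 then
    fun w => (- (cplxs s w * cplxs s w) *: mpart s (tower_infty s Q l) w) *m Q w
  else Q.

Lemma mpart_sum s (F : nat -> plane R -> 'M[C]_n) (H : nat -> 'M[C]_n) k z :
  (forall i : 'I_k, mdiff (F i) z /\ mpart s (F i) z = H i) ->
  mdiff (fun x => \sum_(i < k) F i x) z /\ mpart s (fun x => \sum_(i < k) F i x) z = \sum_(i < k) H i.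
Proof.
elim: k => [|k IH] hF.
  rewrite big_ord0 (_ : (fun x => _) = fun=> 0); last by apply/funext => x; rewrite big_ord0.
  by split; [exact: mdiff_cst|exact: mpart_cst].
have [d1 e1] := IH (fun i => hF (widen_ord (leqnSn k) i)); have [d2 e2] := hF ord_max.
rewrite (_ : (fun x => _) = fun x => \sum_(i < k) F i x + F k x); last first.
  by apply/funext => x; rewrite big_ord_recr.
by split; [exact: mdiffD|rewrite (mpartD s d1 d2) e1 e2 big_ord_recr].
Qed.

Variables (P Q : plane R -> 'M[C]_n) (K : nat).
Hypothesis nP : msm setT K P.
Hypothesis rP : forall z, rank1_projector (P z).
Hypothesis EL : forall z, P z *m mpart true (mpart false P) z = mpart true (mpart false P) z *m P z.
Hypothesis K4 : (4 <= K)%N.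
Hypothesis nQ : msm setT K Q.
Hypothesis PQ : forall w, w != 0 -> Q w = P (inv w).

Local Notation X s k := (tower s P k).

Let PP z : P z *m P z = P z. Proof. by have [] := rP z. Qed.
Let PJ z : (P z)^t* = P z. Proof. by have [] := rP z. Qed.

Lemma tower_msm s k l : (k + l <= K)%N -> msm setT l (X s k).
Proof.
elim: k l => [|k IH] l kl; first by apply: msm_le nP.
have nX : msm setT l.+1 (X s k) by apply: IH; rewrite addnS -addSn.
apply: (msmM openT (msm_mpart s openT nX)); apply: msm_le nP.
by apply: leq_trans kl; rewrite leq_addl.
Qed.

Let dX s k z : (k < K)%N -> mdiff (X s k) z.
Proof.
by move=> kK; apply: (@msm_mdiff _ _ _ setT 0); rewrite ?addn1 //; apply: tower_msm; rewrite addn1.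
Qed.

Let dP z : mdiff P z.
Proof. by apply: (@msm_mdiff _ _ _ setT 3); first exact: msm_le nP. Qed.

Let ddP t z : mdiff (mpart t P) z.
Proof.
by apply: (@msm_mdiff _ _ _ setT 2) => //; apply: (msm_mpart t openT); exact: msm_le nP.
Qed.

Lemma tower_P s k z : X s k z *m P z = X s k z.
Proof. by case: k => [|k] /=; rewrite ?PP // -mulmxA PP. Qed.

Let L s z := mpart (~~ s) (mpart s P) z.

Let LE s z : P z *m L s z = L s z *m P z.
Proof.
have C z' : mpart false (mpart true P) z' = mpart true (mpart false P) z'.
  by apply: (mpartC _ _ openT (Logic.I : setT z')); exact: msm_le (ltnW (ltnW K4)) nP.
by rewrite /L; case: s => /=; rewrite ?C EL.
Qed.

Let gam s z : C := \tr (P z *m L s z) + (\tr (P z *m (mpart s P z *m mpart (~~ s) P z)))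
   + \tr (P z *m (mpart s P z *m mpart (~~ s) P z)).

Let dX_split s t k z : (k < K)%N ->
  mpart t (X s k) z = mpart t (X s k) z *m P z + X s k z *m mpart t P z.
Proof.
move=> kK; rewrite -(mpartM t (dX s z kK) (dP z)); congr (mpart _ _ _).
by apply/funext => w; rewrite tower_P.
Qed.

Let PLP s z : P z *m L s z *m P z = \tr (P z *m L s z) *: P z.
Proof. exact: rank1_sandwich. Qed.

Let dPdPP s z : (mpart s P z *m mpart (~~ s) P z) *m P z =
  \tr (P z *m (mpart s P z *m mpart (~~ s) P z)) *: P z.
Proof.
rewrite -(rank1_sandwich _ (rP z)) -{1}(proj_d s (dP z) PP) !mulmxDl !mulmxA.
rewrite -[mpart s P z *m P z *m _ *m _]mulmxA -[mpart s P z *m P z *m _]mulmxA.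
by rewrite [P z *m (mpart (~~ s) P z *m P z)]mulmxA (proj_dd (~~ s) (dP z) PP) mulmx0 add0r.
Qed.

Let aux1 s z (A D : 'M[C]_n) : A *m P z = A -> D = D *m P z + A *m mpart s P z ->
  D *m mpart (~~ s) P z *m P z = \tr (P z *m (mpart s P z *m mpart (~~ s) P z)) *: A.
Proof.
move=> AP ->; rewrite !mulmxDl -!mulmxA.
rewrite [P z *m (mpart (~~ s) P z *m P z)]mulmxA (proj_dd (~~ s) (dP z) PP) mulmx0 add0r.
by rewrite [mpart s P z *m (_ *m _)]mulmxA -{1}AP -mulmxA [P z *m _]mulmxA (rank1_sandwich _ (rP z)) -scalemxAr AP.
Qed.

Let aux2 s z (A : 'M[C]_n) : A *m P z = A -> A *m L s z *m P z = \tr (P z *m L s z) *: A.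
Proof.
by move=> AP; rewrite -{1}AP -!mulmxA [P z *m (L s z *m _)]mulmxA PLP -scalemxAr AP.
Qed.

(** d_{-s} lowers the tower in direction s, up to the covariant term X dP; the
    harmonic map equation enters at the bottom. *)
Lemma tower_lower s k : (0 < k)%N -> (k < K)%N -> exists c : nat -> plane R -> C,
  (forall i, csm setT (K - k.+1) (c i)) /\
  forall z, mpart (~~ s) (X s k) z *m P z = \sum_(i < k) c i z *: X s i z.
Proof.
have nPl l : (l <= K)%N -> msm setT l P by move=> h; exact: msm_le h nP.
have ntr l : (l.+2 <= K)%N -> csm setT l (fun z => \tr (P z *m L s z)).
  move=> lK; apply: (csm_tr openT); apply: (msmM openT (nPl _ (ltnW (ltnW lK)))).
  exact: (msm_mpart _ openT (msm_mpart s openT (nPl _ lK))).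
have ntr2 l : (l.+1 <= K)%N ->
    csm setT l (fun z => \tr (P z *m (mpart s P z *m mpart (~~ s) P z))).
  move=> lK; apply: (csm_tr openT); apply: (msmM openT (nPl _ (ltnW lK))).
  exact: (msmM openT (msm_mpart s openT (nPl _ lK)) (msm_mpart (~~ s) openT (nPl _ lK))).
case: k => // k _; elim: k => [|k IH] kK.
  exists (fun _ z => \tr (P z *m L s z) + \tr (P z *m (mpart s P z *m mpart (~~ s) P z))).
  split=> [i|z].
    apply: (csmD openT); first by apply: ntr; lia.
    by apply: ntr2; lia.
  rewrite big_ord1 /= (mpartM _ (ddP s z) (dP z)) mulmxDl -mulmxA PP dPdPP -/(L s z).
  by rewrite -{1}(PP z) mulmxA -LE PLP scalerDl.
have [c [nc Ec]] := IH (ltnW kK); have k1K := ltnW kK.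
have Kk : (K - k.+2 = (K - k.+3).+1)%N by lia.
pose c' i z := (if (i < k.+1)%N then wirtinger s (c i) z else gam s z) +
  (if i is j.+1 then c j z else 0).
have ngam l : (l.+2 <= K)%N -> csm setT l (gam s).
  by move=> lK; apply: (csmD openT (csmD openT (ntr l lK) (ntr2 l (ltnW lK))) (ntr2 l (ltnW lK))).
exists c'; split=> [i|z].
  apply: (csmD openT (f := fun z => if (i < k.+1)%N then wirtinger s (c i) z else gam s z)).
    case: (i < k.+1)%N; first by apply: (csm_wirt s openT); rewrite -Kk; exact: nc.
    by apply: ngam; lia.
  case: i => [|i]; first exact: csm_cst.
  by apply: csm_le (nc i); rewrite Kk leqnSn.
have dc i : cdiff (c i) z.
  by apply: (@csm_cdiff _ setT (K - k.+3)) => //; rewrite -Kk.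
have dXi (i : nat) : (i < k.+1)%N -> mdiff (X s i) z by move=> ik; apply: dX; lia.
have E0 x : mpart (~~ s) (X s k.+1) x =
    \sum_(i < k.+1) c i x *: X s i x + X s k.+1 x *m mpart (~~ s) P x.
  by rewrite dX_split // Ec.
have nX2 : msm setT 2 (X s k.+1) by apply: tower_msm; lia.
have E1 : mpart (~~ s) (mpart s (X s k.+1)) z = \sum_(i < k.+1)
    (wirtinger s (c i) z *: X s i z + c i z *: mpart s (X s i) z)
    + (mpart s (X s k.+1) z *m mpart (~~ s) P z + X s k.+1 z *m L s z).
  rewrite (mpartC _ _ openT (Logic.I : setT z) nX2).
  rewrite (_ : mpart (~~ s) (X s k.+1) = fun x => \sum_(i < k.+1) c i x *: X s i x
      + X s k.+1 x *m mpart (~~ s) P x); last by apply/funext => x; exact: E0.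
  have dS : mdiff (fun x => \sum_(i < k.+1) c i x *: X s i x) z /\
      mpart s (fun x => \sum_(i < k.+1) c i x *: X s i x) z = \sum_(i < k.+1)
      (wirtinger s (c i) z *: X s i z + c i z *: mpart s (X s i) z).
    apply: (@mpart_sum s (fun i x => c i x *: X s i x)
      (fun i => wirtinger s (c i) z *: X s i z + c i z *: mpart s (X s i) z)) => i; split; last by rewrite mpartZ // ; exact: dXi.
    by move=> a b; under eq_fun do rewrite mxE; apply: cdiffM => //; exact: dXi.
  have dX1 : mdiff (X s k.+1) z by apply: dX.
  rewrite (mpartD s dS.1 (mdiffM dX1 (ddP _ z))) dS.2 (mpartM s dX1 (ddP _ z)).
  congr (_ + (_ + _ *m _)).
  by rewrite /L; apply: (mpartC _ _ openT (Logic.I : setT z)); exact: msm_le (ltnW (ltnW K4)) nP.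
have dX1P : mpart s (X s k.+1) z *m mpart (~~ s) P z *m P z =
    \tr (P z *m (mpart s P z *m mpart (~~ s) P z)) *: X s k.+1 z.
  exact: (aux1 (tower_P s k.+1 z) (dX_split s s z k1K)).
have XLP : X s k.+1 z *m L s z *m P z = \tr (P z *m L s z) *: X s k.+1 z.
  exact: (aux2 s (tower_P s k.+1 z)).
have dX1 : mdiff (mpart s (X s k.+1)) z.
  by apply: (@msm_mdiff _ _ _ setT 0) => //; exact: (msm_mpart s openT nX2).
have -> : mpart (~~ s) (X s k.+2) z *m P z =
    mpart (~~ s) (mpart s (X s k.+1)) z *m P z + mpart s (X s k.+1) z *m mpart (~~ s) P z *m P z.
  by rewrite /= (mpartM _ dX1 (dP z)) mulmxDl -mulmxA PP.
rewrite E1 !mulmxDl XLP dX1P mulmx_suml [RHS]big_ord_recr.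
transitivity (\sum_(i < k.+1) wirtinger s (c i) z *: X s i z +
   \sum_(i < k.+1) c i z *: X s i.+1 z + gam s z *: X s k.+1 z).
  rewrite -addrA; congr (_ + _).
    rewrite -big_split; apply: eq_bigr => i _.
    by rewrite mulmxDl -!scalemxAl tower_P.
  by rewrite /gam; move: (X s k.+1 z) (\tr _) (\tr _) => Y a b; rewrite -!scalerDl [b + a]addrC.
have -> : c' k.+1 z = gam s z + c k z by rewrite /c' ltnn.
have -> : \sum_(i < k.+1) c' i z *: X s i z = \sum_(i < k.+1) wirtinger s (c i) z *: X s i z
    + \sum_(i < k.+1) (if i : nat is j.+1 then c j z else 0) *: X s i z.
  by rewrite -big_split /=; apply: eq_bigr => i _; rewrite /c' ltn_ord scalerDl.
have -> : \sum_(i < k.+1) c i z *: X s i.+1 z =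
    \sum_(i < k.+1) (if i : nat is j.+1 then c j z else 0) *: X s i z + c k z *: X s k.+1 z.
  by rewrite big_ord_recr /= [Z in _ = Z + _]big_ord_recl /= scale0r add0r.
have fin (A B D E : 'M[C]_n) : A + (B + D) + E = A + B + (E + D).
  by rewrite [E + D]addrC !addrA.
by apply: etrans (fin _ _ _ _) _; rewrite -scalerDl.
Qed.

Let q s j k z : C := \tr ((X (~~ s) j z)^t* *m X s k z).

Let nq s j k l : (j + l <= K)%N -> (k + l <= K)%N -> csm setT l (q s j k).
Proof.
move=> jl kl; exact: (csm_tr openT (msmM openT (msmJ openT (tower_msm (~~ s) jl)) (tower_msm s kl))).
Qed.

Let PXJ s j z : P z *m (X s j z)^t* = (X s j z)^t*.
Proof. by rewrite -{1}(PJ z) -adjM tower_P. Qed.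

Let dq s t j k z : (j < K)%N -> (k < K)%N -> wirtinger t (q s j k) z =
  \tr ((mpart (~~ t) (X (~~ s) j) z *m P z)^t* *m X s k z)
  + \tr ((X (~~ s) j z)^t* *m (mpart t (X s k) z *m P z)).
Proof.
move=> jK kK; have d1 := dX (~~ s) z jK; have d2 := dX s z kK.
rewrite /q wirt_tr; last exact: mdiffM (mdiffJ d1) d2.
rewrite (mpartM t (mdiffJ d1) d2) (mpartJ t d1) mxtraceD.
have e1 : \tr ((mpart (~~ t) (X (~~ s) j) z)^t* *m X s k z) =
    \tr ((mpart (~~ t) (X (~~ s) j) z *m P z)^t* *m X s k z).
  rewrite (adjM (mpart (~~ t) _ z)) PJ -mulmxA [RHS]mxtrace_mulC -mulmxA tower_P.
  by [].
have e2 : \tr ((X (~~ s) j z)^t* *m mpart t (X s k) z) =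
    \tr ((X (~~ s) j z)^t* *m (mpart t (X s k) z *m P z)).
  by rewrite [in RHS]mulmxA [RHS]mxtrace_mulC mulmxA PXJ.
by rewrite e1 e2.
Qed.

Let q_decay s j k : (0 < k)%N -> (j < K)%N -> (k < K)%N -> forall d : R, 0 < d ->
  exists r : R, forall w, ~ sq 0 r w -> `|Re (q s j k w)| <= d /\ `|Im (q s j k w)| <= d.
Proof.
have nY t i l : (i + l <= K)%N -> msm setT l (tower_infty t Q i).
  elim: i l => [|i IH] l il; first by apply: msm_le nQ.
  have nT : msm setT l.+1 (tower_infty t Q i) by apply: IH; rewrite addnS -addSn.
  have nw : csm setT l (fun w => - (cplxs t w * cplxs t w)).
    exact: (csmN openT (csmM openT (csm_cplxs l t openT) (csm_cplxs l t openT))).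
  apply: (msmM openT (msmZ openT nw (msm_mpart t openT nT))); apply: msm_le nQ; lia.
have XY t i : (i < K)%N -> forall w, w != 0 -> X t i (inv w) = tower_infty t Q i w.
  elim: i => [|i IH] iK w w0; first by rewrite /= PQ.
  rewrite /= -(PQ w0); congr (_ *m _).
  rewrite (mpart_inv t w0 (dX t (inv w) (ltnW iK))); congr (_ *: _).
  apply: near_mpart; apply: (near_open (@open_punctured R) (D := @punctured R)) => // x x0.
  exact: IH (ltnW iK) x x0.
move=> k0 jK kK d d0; pose h w := \tr ((tower_infty (~~ s) Q j w)^t* *m tower_infty s Q k w).
have nh : csm setT 1 h.
  by apply: (csm_tr openT); apply: (msmM openT (msmJ openT _)); apply: nY; lia.
have h0 : h 0 = 0.
  rewrite /h; case: (k) k0 => // i _; rewrite /=.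
  have -> : cplxs s (0 : plane R) = 0.
    rewrite /cplxs; have /eqP -> : cplx (0 : plane R) == 0 by rewrite cplx_eq0.
    by case: (s); rewrite ?rmorph0.
  by rewrite mul0r oppr0 scale0r mul0mx mulmx0 mxtrace0.
have cont (g : plane R -> R) : nsm setT 1 g -> g 0 = 0 ->
    exists2 r : R, 0 < r & forall w, sq 0 r w -> `|g w| <= d.
  move=> ng g0; have cg := nsm_continuous ng (Logic.I : setT (0 : plane R)).
  have nb : nbhs (g 0) [set x : R | `|x| <= d].
    apply/nbhs_ballP; exists d => //= x; rewrite g0 /ball /= sub0r normrN; exact: ltW.
  have [r r0 H] := (nbhs_sqP _ _).1 (cg _ nb); by exists r.
have [r1 r10 H1] := cont _ nh.1 (congr1 (@complex.Re R) h0).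
have [r2 r20 H2] := cont _ nh.2 (congr1 (@complex.Im R) h0).
pose r := Num.min r1 r2 / 2.
have m0 : 0 < Num.min r1 r2 by rewrite lt_min r10.
have r0 : 0 < r by rewrite divr_gt0.
exists r^-1 => w nS; have [Si w0] := inv_small r0 nS.
have S1 : sq 0 r1 (inv w).
  apply: (sq_csq _ Si); apply: lt_le_trans (_ : Num.min r1 r2 <= _); last by rewrite ge_min lexx.
  by rewrite /r; lra.
have S2 : sq 0 r2 (inv w).
  apply: (sq_csq _ Si); apply: lt_le_trans (_ : Num.min r1 r2 <= _); last by rewrite ge_min lexx orbT.
  by rewrite /r; lra.
have i0 : inv w != 0 by rewrite -cplx_eq0 cplx_inv invr_eq0 cplx_eq0.
have -> : q s j k w = h (inv w).
  by rewrite /q /h -(XY (~~ s) j jK _ i0) -(XY s k kK _ i0) invK.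
by split; [exact: H1|exact: H2].
Qed.

(** Liouville: the pairings q of the two opposite towers are holomorphic by
    induction on the level and vanish at infinity. *)
Lemma tower_orthogonal s l : (0 < l)%N -> (l.+2 <= K)%N -> forall j k, (j + k = l)%N ->
  forall z, q s j k z = 0.
Proof.
case: l => // l _; elim/ltn_ind: l => l IH lK.
(* d_s q(j, k) = q(j+1, k) + q(j, k+1), and the left side is constant. *)
have shift j k z : (j + k = l)%N -> q s j.+1 k z = - q s j k.+1 z.
  move=> jk; have jK : (j < K)%N by lia.
  have kK : (k < K)%N by lia.
  have E : q s j.+1 k z + q s j k.+1 z = wirtinger s (q s j k) z.
    by rewrite (dq s s z jK kK) /q /=.
  have c0 : wirtinger s (q s j k) z = 0.
    have [c qc] : exists c, forall x, q s j k x = c.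
      have [l0|l0] := posnP l.
        have [-> ->] : j = 0%N /\ k = 0%N by lia.
        by exists 1 => x; rewrite /q /= PJ PP; have [_ _ ->] := rP x.
      by exists 0 => x; apply: (IH l.-1); lia.
    rewrite (_ : q s j k = fun=> c) ?wirt_cst //; exact/funext.
  by apply/eqP; rewrite -addr_eq0 E c0.
(* d_(-s) q(1, l) consists of pairings of lower level, by tower_lower. *)
have key z : q s 1 l z = 0.
  case: l IH lK shift => [|l] IH lK shift.
    rewrite (shift 0 0 z erefl) /q /= PJ mulmxA (proj_dd s (dP z) PP) mxtrace0 oppr0.
    by [].
  apply: (hol_Liouville (s := ~~ s)); last by apply: q_decay; lia.
    by apply: nq; lia.
  move=> w; rewrite dq; try lia.
  rewrite negbK; set a := \tr _; set b := \tr _.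
  have [c [_ Ec]] : exists c : nat -> plane R -> C, (forall i, csm setT (K - l.+2) (c i)) /\
    forall z, mpart (~~ s) (X s l.+1) z *m P z = \sum_(i < l.+1) c i z *: X s i z.
    by apply: tower_lower; lia.
  have [c2 [_ Ec2]] : exists c : nat -> plane R -> C, (forall i, csm setT (K - 2) (c i)) /\
    forall z, mpart (~~ ~~ s) (X (~~ s) 1) z *m P z = \sum_(i < 1) c i z *: X (~~ s) i z.
    by apply: tower_lower; lia.
  have -> : b = 0.
    rewrite /b Ec mulmx_sumr raddf_sum big1 // => i _.
    rewrite -[LHS]/(\tr ((X (~~ s) 1 w)^t* *m (c i w *: X s i w))) -scalemxAr mxtraceZ.
    have il := ltn_ord i.
    have -> : \tr ((X (~~ s) 1 w)^t* *m X s i w) = 0 by apply: (IH i _ _ 1%N i erefl w); lia.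
    exact: mulr0.
  have -> : a = 0.
    move: (Ec2 w); rewrite negbK big_ord1 /a => ->.
    rewrite adjZ -scalemxAl mxtraceZ.
    have -> : \tr ((X (~~ s) 0 w)^t* *m X s l.+1 w) = 0 by apply: (IH l _ _ 0%N l.+1 erefl w); lia.
    exact: mulr0.
  by rewrite addr0.
have all j z : (j <= l)%N -> q s j.+1 (l - j) z = 0.
  elim: j => [|j IHj] jl; first by rewrite subn0.
  by rewrite shift ?subnKC // subnSK // IHj ?oppr0 // ltnW.
move=> [|j] k jk z; last by rewrite (_ : k = l - j)%N; [apply: all; lia|lia].
have -> : k = l.+1 by lia.
by apply/eqP; rewrite -oppr_eq0 -shift // key.
Qed.

(** Isotropy: only finitely many levels are available, as many as P has
    derivatives, and they suffice because at most n of the vectors X_k e are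
    independent. *)
Lemma tower_PX s k z : (0 < k)%N -> (k.+2 <= K)%N -> P z *m X s k z = 0.
Proof.
move=> k0 kK; rewrite -(tower_P s k z) mulmxA rank1_sandwich //.
have := tower_orthogonal s k0 kK (add0n k) z; rewrite /q /= PJ => ->.
by rewrite scale0r.
Qed.

End Towers.

(** * Orthogonal projectors from Gram matrices *)

Section Gram.
Variables (R : realType) (n : nat).
Local Notation C := R[i].

Lemma gram_kernel m (G : 'M[C]_(n, m)) (x : 'cV[C]_m) : G^t* *m G *m x = 0 -> G *m x = 0.
Proof.
move=> E; apply: col_normsq_eq0; rewrite adjM -mulmxA [G^t* *m _]mulmxA E mulmx0 mxE.
by [].
Qed.

Lemma gram_le m (G : 'M[C]_(n, m)) : G^t* *m G \in unitmx -> (m <= n)%N.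
Proof.
move=> /mxrank_unit h; rewrite -[m]h; apply: leq_trans (mxrankM_maxr _ _) _.
exact: rank_leq_row.
Qed.

Lemma gram_extend m (G : 'M[C]_(n, m)) (v : 'cV[C]_n) : G^t* *m G \in unitmx ->
  (row_mx G v)^t* *m row_mx G v \notin unitmx -> exists x, v = G *m x.
Proof.
move=> uG; rewrite unitmxE unitfE negbK => /det0P[y y0 Ey].
have Ex : row_mx G v *m y^t* = 0.
  apply: gram_kernel; rewrite -(adj0 R 1) -Ey (adjM y) (adjM ((row_mx G v)^t*)) adjK.
  by [].
move: Ex; rewrite -[y^t*]vsubmxK mul_row_col; set a := usubmx _; set b := dsubmx _ => Ex.
have [b0|b0] := eqVneq (b 0 0) 0.
  have bb : b = 0 by rewrite [b]mx11_scalar b0 raddf0.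
  have a0 : a = 0.
    rewrite -[a](mulKmx uG) -mulmxA (_ : G *m a = 0) ?mulmx0 //.
    by move: Ex; rewrite bb mulmx0 addr0.
  case/negP: y0; apply/eqP; rewrite -[y]adjK -[y^t*]vsubmxK -/a -/b a0 bb.
  by rewrite col_mx0 adj0.
exists ((- (b 0 0)^-1) *: a); rewrite -scalemxAr.
have -> : G *m a = - (b 0 0 *: v).
  by apply/eqP; rewrite -addr_eq0 -mul_mx_scalar -mx11_scalar; apply/eqP.
by rewrite scalerN scaleNr opprK scalerA mulVf // scale1r.
Qed.

Definition cols m (u : nat -> 'cV[C]_n) : 'M[C]_(n, m) := \matrix_(i, j) u j.+1 i 0.

Lemma cols_col m u j : col j (cols m u) = u j.+1.
Proof. by apply/matrixP => i k; rewrite !mxE ord1. Qed.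

Lemma mpart_cols t m (u : nat -> plane R -> 'cV[C]_n) (j : 'I_m) z :
  col j (mpart t (fun x => cols m (fun k => u k x)) z) = mpart t (u j.+1) z.
Proof.
apply/matrixP => i k; rewrite [LHS]mxE mpartE mpartE ord1.
have -> : (fun x => cols m (fun k => u k x) i j) = fun x => u j.+1 x i 0.
  by apply/funext => x; rewrite mxE.
by [].
Qed.

Lemma cols_extend m u : row_mx (cols m u) (u m.+1) = cols (m + 1) u.
Proof.
apply/matrixP => i j; rewrite !mxE; case: splitP => k ->; first by rewrite mxE.
by rewrite !ord1 addn0.
Qed.

Lemma col_mul p m (A : 'M[C]_(p, n)) (G : 'M[C]_(n, m)) j : col j (A *m G) = A *m col j G.
Proof. by apply/matrixP => i k; rewrite !mxE; apply: eq_bigr => l _; rewrite mxE. Qed.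

Lemma eq_cols p m (A : 'M[C]_(p, n)) (B : 'M[C]_(p, n)) (G : 'M[C]_(n, m)) :
  (forall j, A *m col j G = B *m col j G) -> A *m G = B *m G.
Proof.
move=> H; apply/matrixP => i j; have := congr1 (fun M : 'cV_p => M i 0) (H j).
have e (M : 'M[C]_(p, m)) : M i j = col j M i 0 by rewrite mxE.
by rewrite -!col_mul (e (A *m G)) (e (B *m G)).
Qed.

(** The orthogonal projector on the column space of G. *)
Definition gram_proj m (G : 'M[C]_(n, m)) := G *m invmx (G^t* *m G) *m G^t*.

Lemma gram_projG m (G : 'M[C]_(n, m)) : G^t* *m G \in unitmx -> gram_proj G *m G = G.
Proof. by move=> uG; rewrite /gram_proj -!mulmxA mulVmx // mulmx1. Qed.

Lemma gram_proj_idem m (G : 'M[C]_(n, m)) : G^t* *m G \in unitmx ->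
  gram_proj G *m gram_proj G = gram_proj G.
Proof. by move=> uG; rewrite {2}/gram_proj !mulmxA gram_projG. Qed.

Lemma gram_proj_adj m (G : 'M[C]_(n, m)) : G^t* *m G \in unitmx -> (gram_proj G)^t* = gram_proj G.
Proof.
move=> uG; have h : (invmx (G^t* *m G))^t* = invmx (G^t* *m G).
  apply: (row_free_inj (A := G^t* *m G)); first by rewrite row_free_unit.
  have gJ : (G^t* *m G)^t* = G^t* *m G by rewrite adjM adjK.
  by rewrite mulVmx // -{2}gJ -adjM mulmxV // adj1.
by rewrite /gram_proj !adjM adjK h mulmxA.
Qed.

End Gram.

(** * The local potential *)

Section LocalPotential.
Variables (R : realType) (n : nat).
Local Notation C := R[i].
Implicit Types (z w : plane R).
Variables (P Q : plane R -> 'M[C]_n) (K : nat) (s : bool).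
Hypothesis nP : msm setT K P.
Hypothesis rP : forall z, rank1_projector (P z).
Hypothesis EL : forall z, P z *m mpart true (mpart false P) z = mpart true (mpart false P) z *m P z.
Hypothesis K4 : (4 <= K)%N.
Hypothesis Kn : (n.+2 <= K)%N.
Hypothesis nQ : msm setT K Q.
Hypothesis PQ : forall w, w != 0 -> Q w = P (inv w).
Local Notation X k := (tower s P k).

Let PP z : P z *m P z = P z. Proof. by have [] := rP z. Qed.
Let PJ z : (P z)^t* = P z. Proof. by have [] := rP z. Qed.
Let dP z : mdiff P z.
Proof. by apply: (@msm_mdiff _ _ _ setT 3); first exact: msm_le nP. Qed.

Let good a := exists z e0, P z *m e0 != 0 /\
  (cols a (fun k => X k z *m e0))^t* *m cols a (fun k => X k z *m e0) \in unitmx.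

Let PX k z : (0 < k)%N -> (k <= n)%N -> P z *m X k z = 0.
Proof. by move=> k0 kn; apply: (tower_PX nP rP EL K4 nQ PQ) => //; lia. Qed.

(** The columns X_1 e0, X_2 e0, ... span, at a point where the largest number
    a of them is independent, a space orthogonal to P by isotropy. It is
    stable under d_s because X_(a+1) e0 depends on the preceding ones by
    maximality, and d_(-s) maps it to itself up to P by tower_lower. These two
    facts give the derivatives of the orthogonal projector T on it. *)
Lemma local_potential : exists z0 r (T : plane R -> 'M[C]_n), [/\ 0 < r, msm (sq z0 r) 1 T &
  forall z, sq z0 r z -> [/\ T z *m T z = T z, (T z)^t* = T z, T z *m P z = 0,
    T z *m (mpart s P z *m P z) = mpart s P z *m P z &
    mpart s T z = - (mpart s P z *m P z)]].
Proof.
have ub a : `[< good a >] -> (a <= n)%N by move=> /asboolP[z [e0 [_ /gram_le]]].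
have ex : exists a, `[< good a >].
  exists 0%N; apply/asboolP; exists 0.
  have [e0 Pe] : exists e0 : 'cV[C]_n, P 0 *m e0 != 0.
    apply: contrapT => nv; have := rank1_neq0 (rP 0); apply/negP/negPn/eqP.
    apply/matrixP => i j; rewrite [RHS]mxE.
    have : P 0 *m delta_mx j (0 : 'I_1) = 0.
      by apply: contrapT => /eqP x; apply: nv; exists (delta_mx j 0).
    by rewrite -colE => /matrixP /(_ i 0); rewrite !mxE.
  by exists e0; split=> //; rewrite unitmxE det_mx00 unitr1.
(* The largest number of independent vectors X_1 e0, X_2 e0, and so on. *)
case: (ex_maxnP ex ub) => a /asboolP[z0 [e0 [Pe0 uG0]]] amax.
have an : (a <= n)%N := gram_le uG0.
pose u k z := X k z *m e0; pose G z := cols a (fun k => u k z).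
have nX k l : (k + l <= K)%N -> msm setT l (X k) := fun h => tower_msm nP s h.
have nu k l : (k + l <= K)%N -> msm setT l (u k).
  by move=> h; exact: (msmM openT (nX k l h) (msm_cst _ _ e0)).
have nG : msm setT 2 G.
  move=> i j; rewrite /G (_ : (fun z => _) = fun z => u j.+1 z i 0); last first.
    by apply/funext => z; rewrite mxE.
  by apply: nu; have := ltn_ord j; lia.
have nPe : msm setT 2 (fun z => P z *m e0).
  by apply: (msmM openT _ (msm_cst _ _ e0)); apply: msm_le nP; lia.
have nt : csm setT 1 (fun z => \tr (P z *m e0 *m (P z *m e0)^t*)).
  have nPe1 : msm setT 1 (fun z => P z *m e0) := msm_le (isT : 1 <= 2)%N nPe.
  exact: (csm_tr openT (msmM openT nPe1 (msmJ openT nPe1))).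
have t0 : \tr (P z0 *m e0 *m (P z0 *m e0)^t*) != 0 by apply: contra_neq Pe0; exact: tr_normsq_eq0.
have [V [oV Vz _ H1]] := csm_neq0_near openT (Logic.I : setT z0) nt t0.
have nGG : msm setT 2 (fun z => (G z)^t* *m G z) := msmM openT (msmJ openT nG) nG.
have nGG1 : msm V 1 (fun z => (G z)^t* *m G z).
  by apply: msm_sub (@subsetT _ V) _; exact: msm_le nGG.
have [U [oU Uz UV uG]] := unit_near oV Vz nGG1 uG0.
have Pe z : U z -> P z *m e0 != 0.
  by move=> /UV/H1; apply: contra_neq => ->; rewrite mul0mx mxtrace0.
pose T z := gram_proj (G z).
have nT : msm U 2 T.
  have nGU := msm_sub (@subsetT _ U) nG; have nGGU := msm_sub (@subsetT _ U) nGG.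
  exact: (msmM oU (msmM oU nGU (msm_invmx oU uG nGGU)) (msmJ oU nGU)).
have TG z : U z -> T z *m G z = G z by move=> /uG; exact: gram_projG.
have TT z : U z -> T z *m T z = T z by move=> /uG; exact: gram_proj_idem.
have TJ z : U z -> (T z)^t* = T z by move=> /uG; exact: gram_proj_adj.
have Tu k z : U z -> (0 < k)%N -> (k <= a.+1)%N -> T z *m u k z = u k z.
  move=> Uz' k0 ka; case: (ltnP k a.+1) => [ka'|ka'].
    case: k k0 {ka} ka' => // k _ ka'; have := congr1 (col (Ordinal (ka' : (k < a)%N))) (TG z Uz').
    by rewrite col_mul cols_col.
  have -> : k = a.+1 by lia.
  have [|x ->] := gram_extend (v := u a.+1 z) (uG z Uz'); last by rewrite mulmxA TG.
  apply/negP => h; have : good (a + 1)%N.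
    by exists z, e0; split; [exact: Pe|rewrite -cols_extend].
  by move/asboolP/amax; rewrite addn1 ltnn.
have TP z : U z -> T z *m P z = 0.
  move=> Uz'; have PG : P z *m G z = 0.
    rewrite -(mul0mx _ (G z)); apply: eq_cols => j; rewrite cols_col mul0mx /u mulmxA PX ?mul0mx //.
    by have := ltn_ord j; lia.
  have GP : (G z)^t* *m P z = 0 by rewrite -(PJ z) -adjM PG adj0.
  by rewrite /T /gram_proj -mulmxA GP mulmx0.
have PT z : U z -> P z *m T z = 0.
  by move=> Uz'; rewrite -(PJ z) -(TJ z Uz') -adjM TP // adj0.
have TB z : U z -> T z *m (mpart s P z *m P z) = mpart s P z *m P z.
  move=> Uz'; apply/esym/subr0_eq; rewrite -{1}[_ *m P z]mul1mx -mulmxBl mulmxA.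
  apply: (rank1_kill (e := e0) (rP z)); first exact: Pe.
  rewrite -!mulmxA mulmxBl mul1mx [mpart s P z *m _]mulmxA.
  by rewrite -[_ *m P z *m e0]/(u 1%N z) Tu // subrr.
have dTJ t z : U z -> (mpart t T z)^t* = mpart (~~ t) T z.
  move=> Uz'; rewrite -[t in LHS]negbK -(mpartJ (~~ t) (msm_mdiff nT Uz')).
  by apply: near_mpart; apply: (near_open oU Uz') => x Ux; exact: TJ.
(* The part of the space orthogonal to both P and the tower. *)
pose Rc z := 1%:M - P z - T z.
have RP z : U z -> Rc z *m P z = 0.
  by move=> Uz'; rewrite /Rc !mulmxBl mul1mx PP TP // subrr subr0.
have RT z : U z -> Rc z *m T z = 0.
  by move=> Uz'; rewrite /Rc !mulmxBl mul1mx TT // PT // subr0 subrr.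
have Ru k z : U z -> (0 < k)%N -> (k <= a.+1)%N -> Rc z *m u k z = 0.
  by move=> Uz' k0 ka; rewrite -(Tu k z Uz' k0 ka) mulmxA RT // mul0mx.
(* Up to a multiple of X_k e0, only the derivative of X_k along P matters. *)
have du t k z : U z -> (k < K)%N -> exists c,
    mpart t (u k) z = mpart t (X k) z *m P z *m e0 + c *: u k z.
  move=> Uz' kK; have nXk : msm setT 1 (X k) by apply: nX; lia.
  have dXk : mdiff (X k) z := msm_mdiff nXk Logic.I.
  have [c Ec] := rank1_line (mpart t P z *m e0) (rP z) (Pe z Uz').
  exists c; rewrite /u (mpartM t dXk (mdiff_cst _ _)) mpart_cst mulmx0 addr0.
  have E : mpart t (X k) z = mpart t (X k) z *m P z + X k z *m mpart t P z.
    by rewrite -(mpartM t dXk (dP z)); apply: eq_mpart => w; rewrite tower_P.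
  rewrite {1}E mulmxDl; congr (_ + _).
  by rewrite -{1}(tower_P rP s k z) -!mulmxA Ec -scalemxAr mulmxA tower_P.
have colG t (j : 'I_a) z : col j (mpart t G z) = mpart t (u j.+1) z.
  exact: mpart_cols.
have mT z : U z -> mdiff T z := fun Uz' => msm_mdiff nT Uz'.
have mG z : mdiff G z := msm_mdiff nG Logic.I.
have dTG t z : U z -> mpart t T z *m G z + T z *m mpart t G z = mpart t G z.
  move=> Uz'; rewrite -(mpartM t (mT z Uz') (mG z)); apply: near_mpart.
  by apply: (near_open oU Uz') => x Ux; exact: TG.
have facT z : T z = G z *m (invmx ((G z)^t* *m G z) *m (G z)^t*) by rewrite mulmxA.
have TdG z : U z -> T z *m mpart s G z = mpart s G z.
  move=> Uz'; rewrite -[RHS]mul1mx; apply: eq_cols => j; rewrite mul1mx colG.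
  have ja := ltn_ord j; have [|c ->] := du s j.+1 z Uz'; first by lia.
  by rewrite -[_ *m P z *m e0]/(u j.+2 z) mulmxDr -scalemxAr !Tu // ltnW.
have dTT z : U z -> mpart s T z *m T z = 0.
  move=> Uz'; rewrite facT mulmxA (_ : mpart s T z *m G z = 0) ?mul0mx //.
  by have := dTG s z Uz'; rewrite TdG // -{2}[mpart s G z]add0r => /addIr.
have RdG z : U z -> Rc z *m mpart (~~ s) G z = 0.
  move=> Uz'; rewrite -(mul0mx n (mpart (~~ s) G z)); apply: eq_cols => j; rewrite mul0mx colG.
  have ja := ltn_ord j; have [|c ->] := du (~~ s) j.+1 z Uz'; first by lia.
  rewrite mulmxDr -scalemxAr Ru // 1?ltnW // scaler0 addr0.
  have [||c' [_ ->]] := tower_lower nP rP EL K4 s (k := j.+1); [by []|by lia|].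
  rewrite mulmx_suml mulmx_sumr big1 // => i _; rewrite -scalemxAl -scalemxAr.
  rewrite (_ : Rc z *m _ = 0) ?scaler0 //.
  have ij := ltn_ord i; case: (posnP i) => [->|i0]; last by apply: Ru => //; lia.
  by rewrite /= mulmxA RP // mul0mx.
have RdTT z : U z -> Rc z *m mpart (~~ s) T z *m T z = 0.
  move=> Uz'; rewrite facT mulmxA -[Rc z *m _ *m G z]mulmxA.
  have -> : mpart (~~ s) T z *m G z = mpart (~~ s) G z - T z *m mpart (~~ s) G z.
    by rewrite -{1}(dTG (~~ s) z Uz') addrK.
  by rewrite mulmxBr [Rc z *m (T z *m _)]mulmxA RT // RdG // mul0mx subrr mul0mx.
have TdT z : U z -> T z *m mpart (~~ s) T z = 0.
  by move=> Uz'; rewrite -(dTJ s z Uz') -{1}(TJ z Uz') -adjM dTT // adj0.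
have d'TT z : U z -> mpart (~~ s) T z *m T z = mpart (~~ s) T z.
  move=> Uz'; have E : mpart (~~ s) T z *m T z + T z *m mpart (~~ s) T z = mpart (~~ s) T z.
    rewrite -(mpartM _ (mT z Uz') (mT z Uz')); apply: near_mpart.
    by apply: (near_open oU Uz') => x Ux; exact: TT.
  by rewrite -{2}E TdT // addr0.
have one z : 1%:M = P z + T z + Rc z.
  by rewrite [RHS]addrC /Rc [P z + T z]addrC addrA !subrK.
have d'T z : U z -> mpart (~~ s) T z = P z *m mpart (~~ s) T z.
  move=> Uz'; rewrite -{1}[mpart _ T z]mul1mx (one z) 2!mulmxDl TdT // addr0.
  have -> : Rc z *m mpart (~~ s) T z = 0 by rewrite -(d'TT z Uz') mulmxA RdTT.
  exact: addr0.
have d'PT z : U z -> mpart (~~ s) T z = - (mpart (~~ s) P z *m T z).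
  move=> Uz'; have : mpart (~~ s) P z *m T z + P z *m mpart (~~ s) T z = 0.
    rewrite -(mpartM _ (dP z) (mT z Uz')) (near_mpart _ (Y := fun=> 0)) ?mpart_cst //.
    by apply: (near_open oU Uz') => x Ux; exact: PT.
  by rewrite -d'T // addrC => /eqP; rewrite addr_eq0 => /eqP.
have Td'P z : U z -> T z *m mpart (~~ s) P z = 0.
  move=> Uz'; have : mpart (~~ s) T z *m P z + T z *m mpart (~~ s) P z = 0.
    rewrite -(mpartM _ (mT z Uz') (dP z)) (near_mpart _ (Y := fun=> 0)) ?mpart_cst //.
    by apply: (near_open oU Uz') => x Ux; exact: TP.
  by rewrite -(d'TT z Uz') -mulmxA TP // mulmx0 add0r.
have Pd'PR z : U z -> P z *m mpart (~~ s) P z *m Rc z = 0.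
  move=> Uz'; have RJ : (Rc z)^t* = Rc z by rewrite /Rc !adjB adj1 PJ TJ.
  rewrite -RJ -(PJ z) -(adj_d s (dP z) PJ) -2!adjM.
  rewrite (_ : Rc z *m _ = 0) ?adj0 //.
  by rewrite -TB // mulmxA RT // mul0mx.
have fin z : U z -> mpart (~~ s) T z = - (P z *m mpart (~~ s) P z).
  move=> Uz'; rewrite d'T // d'PT // mulmxN mulmxA; congr (- _).
  rewrite -[RHS]mulmx1 (one z) 2!mulmxDr Pd'PR // addr0 (proj_dd (~~ s) (dP z) PP).
  by rewrite add0r.
have [r r0 rU] := open_sqP oU Uz; exists z0, r, T; split=> //.
  by apply: msm_sub rU _; exact: msm_le nT.
move=> z /rU Uz'; split; [exact: TT|exact: TJ|exact: TP|exact: TB|].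
rewrite -[s]negbK -(dTJ (~~ s) z Uz') fin // adjN adjM PJ -(adj_d s (dP z) PJ) adjK.
by rewrite negbK.
Qed.

End LocalPotential.

(** * The global potential *)

Section GlobalPotential.
Variables (R : realType) (n : nat).
Local Notation C := R[i].
Implicit Types (z w : plane R).

Lemma csm_of_wirt k (f : plane R -> C) (a : bool -> plane R -> C) : (forall z, cdiff f z) ->
  (forall t z, wirtinger t f z = a t z) -> (forall t, csm setT k (a t)) -> csm setT k.+1 f.
Proof.
move=> df fa na.
have n0 b : csm setT k (cpd b f).
  case: b.
    rewrite (_ : cpd true f = fun z => wc R true * (a false z + - a true z)).
      exact: (csmM openT (csm_cst _ _ _) (csmD openT (na false) (csmN openT (na true)))).
    by apply/funext => z; rewrite (cpd_wirt f z).2 !fa.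
  rewrite (_ : cpd false f = fun z => a false z + a true z).
    exact: (csmD openT (na false) (na true)).
  by apply/funext => z; rewrite (cpd_wirt f z).1 !fa.
split; split=> [z _|b]; [exact: (df z).1|exact: (n0 b).1|exact: (df z).2|exact: (n0 b).2].
Qed.

Variables (P Q : plane R -> 'M[C]_n) (K : nat) (s : bool).
Hypothesis nP : msm setT K P.
Hypothesis rP : forall z, rank1_projector (P z).
Hypothesis EL : forall z, P z *m mpart true (mpart false P) z = mpart true (mpart false P) z *m P z.
Hypothesis K4 : (4 <= K)%N.
Hypothesis Kn : (n.+2 <= K)%N.
Hypothesis nQ : msm setT K Q.
Hypothesis PQ : forall w, w != 0 -> Q w = P (inv w).

Let PP z : P z *m P z = P z. Proof. by have [] := rP z. Qed.
Let PJ z : (P z)^t* = P z. Proof. by have [] := rP z. Qed.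
Let nP4 : msm setT 4 P. Proof. exact: msm_le nP. Qed.
Let dP z : mdiff P z. Proof. exact: (msm_mdiff nP4 Logic.I). Qed.
Let ndP t : msm setT 3 (mpart t P). Proof. exact: (msm_mpart t openT nP4). Qed.
Let ddP t z : mdiff (mpart t P) z. Proof. exact: (msm_mdiff (ndP t) Logic.I). Qed.

Local Notation B z := (mpart s P z *m P z).
Local Notation B' z := (P z *m mpart (~~ s) P z).

Let L z := mpart (~~ s) (mpart s P) z.

Let LE' : forall z, mpart s (mpart (~~ s) P) z = L z.
Proof.
by move=> z; apply: (mpartC _ _ openT (Logic.I : setT z)); exact: msm_le nP4.
Qed.

Let PL z : P z *m L z = L z *m P z.
Proof.
have C z' : mpart false (mpart true P) z' = mpart true (mpart false P) z'.
  by apply: (mpartC _ _ openT (Logic.I : setT z')); exact: msm_le nP4.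
by rewrite /L; case: (s) => /=; rewrite ?C EL.
Qed.

Let PB z : P z *m B z = 0.
Proof. by rewrite mulmxA (proj_dd s (dP z) PP). Qed.

Let BJ z : (B z)^t* = B' z.
Proof. by rewrite adjM (adj_d s (dP z) PJ) PJ. Qed.

Let dB z : mpart (~~ s) (fun x => B x) z = L z *m P z + mpart s P z *m mpart (~~ s) P z.
Proof. by rewrite (mpartM _ (ddP s z) (dP z)). Qed.

Let dB2 z : mpart (~~ s) (fun x => B x) z = B z *m mpart (~~ s) P z - mpart (~~ s) P z *m B z.
Proof.
have h : mpart (~~ s) (fun x => P x *m (mpart s P x *m P x)) z = 0.
  by rewrite (eq_mpart (~~ s) z PB) mpart_cst.
have mB : mdiff (fun x => B x) z := mdiffM (ddP s z) (dP z).
have DD : mpart s P z *m mpart (~~ s) P z =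
    B z *m mpart (~~ s) P z + P z *m (mpart s P z *m mpart (~~ s) P z).
  by rewrite -{1}(proj_d s (dP z) PP) mulmxDl -[P z *m _ *m _]mulmxA.
have PLP : P z *m (L z *m P z) = L z *m P z by rewrite mulmxA PL -mulmxA PP.
move: h; rewrite (mpartM _ (dP z) mB) dB mulmxDr PLP => h.
have -> : - (mpart (~~ s) P z *m B z) = L z *m P z + P z *m (mpart s P z *m mpart (~~ s) P z).
  by apply/eqP; rewrite eq_sym -subr_eq0 opprK addrC; apply/eqP.
by rewrite {1}DD addrCA.
Qed.

Let A t z := if t == s then - B z else - B' z.

Let nA t : msm setT 3 (A t).
Proof.
have nP3 : msm setT 3 P := msm_le (isT : 3 <= 4)%N nP4.
rewrite /A; case: (t == s); apply: (msmN openT).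
  exact: (msmM openT (ndP s) nP3).
exact: (msmM openT nP3 (ndP (~~ s))).
Qed.

Let AJ t z : (A (~~ t) z)^t* = A t z.
Proof.
rewrite /A; have -> : (~~ t == s) = ~~ (t == s) by case: (t) (s) => [] [].
case: (t == s) => /=; rewrite adjN; first by rewrite -BJ adjK.
by rewrite BJ.
Qed.

Let closed z : mpart true (A false) z = mpart false (A true) z.
Proof.
have mB : mdiff (fun x => B x) z := mdiffM (ddP s z) (dP z).
have mB' : mdiff (fun x => B' x) z := mdiffM (dP z) (ddP _ z).
have e : mpart (~~ s) (fun x => - B x) z = mpart s (fun x => - B' x) z.
  rewrite (mpartN _ mB) (mpartN _ mB') dB (mpartM _ (dP z) (ddP _ z)) LE' -PL.
  by rewrite addrC.
by move: e; rewrite /A; case: (s).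
Qed.

(** The local T is a primitive of the form with components -B and -B^t*, which
    is closed on the whole plane by the harmonic map equation; a global
    primitive that agrees with it at one point therefore extends it. The
    products T P and (1 - T) B satisfy a first-order linear system, hence
    vanish everywhere because they do near z0; from these two identities T T =
    T follows by differentiation. *)
Lemma global_potential : exists T, potential s T P 2.
Proof.
have [z0 [r [T1 [r0 nT1 H1]]]] := local_potential s nP rP EL K4 Kn nQ PQ.
have prim i j : exists2 f, (forall z, cdiff f z) & forall t z, wirtinger t f z = A t z i j.
  apply: cpoincare => [t|z]; first exact: nA.
  by have := congr1 (fun M : 'M[C]_n => M i j) (closed z); rewrite !mpartE.
pose F z : 'M[C]_n := \matrix_(i, j) projT1 (cid2 (prim i j)) z.
have dF z : mdiff F z.
  move=> i j; rewrite (_ : (fun x => _) = projT1 (cid2 (prim i j))).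
    by case: cid2.
  by apply/funext => x; rewrite mxE.
have F' t z : mpart t F z = A t z.
  apply/matrixP => i j; rewrite mpartE (_ : (fun x => _) = projT1 (cid2 (prim i j))).
    by case: cid2 => f ? /= ->.
  by apply/funext => x; rewrite mxE.
pose T z := F z + (T1 z0 - F z0).
have dT z : mdiff T z := mdiffD (dF z) (mdiff_cst _ z).
have T' t z : mpart t T z = A t z by rewrite (mpartD t (dF z) (mdiff_cst _ _)) mpart_cst addr0 F'.
have nT : msm setT 4 T.
  move=> i j; apply: (csm_of_wirt (a := fun t z => A t z i j)) => [z|t z|t].
  - exact: dT.
  - by rewrite -mpartE T'.
  - exact: nA.
have Tz0 : T z0 = T1 z0 by rewrite /T addrC subrK.
have z0S := sq_center z0 r0.
have T1' t z : sq z0 r z -> mpart t T1 z = A t z.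
  move=> Sz; have [_ _ _ _ d] := H1 z Sz; rewrite /A; case: eqP => [->|/eqP ts]; first exact: d.
  have -> : t = ~~ s by case: (t) (s) ts => [] [].
  have TJ : mpart (~~ s) (fun x => (T1 x)^t*) z = mpart (~~ s) T1 z.
    apply: near_mpart; apply: (near_open (@sq_open R z0 r) Sz) => x Sx.
    by have [] := H1 x Sx.
  by rewrite -TJ (mpartJ _ (msm_mdiff nT1 Sz)) negbK d adjN BJ.
have TT1 z : sq z0 r z -> T z = T1 z.
  move=> Sz; apply/subr0_eq.
  have := mgradient0_sq (X := fun x => T x - T1 x) (z := z0) (r := r).
  move=> /(_ _ _ z z0 Sz z0S) ->; first by rewrite Tz0 subrr.
    by move=> w Sw; exact: (mdiffD (dT w) (mdiffN (msm_mdiff nT1 Sw))).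
  by move=> t w Sw; rewrite (mpartB t (dT w) (msm_mdiff nT1 Sw)) T' T1' // subrr.
have [idem1 adj1 _ _ _] := H1 z0 z0S.
have TJ z : (T z)^t* = T z.
  apply/subr0_eq; rewrite (mgradient0 (X := fun x => (T x)^t* - T x) _ _ z z0) => [|w|t w].
  - by rewrite Tz0 adj1 subrr.
  - exact: (mdiffD (mdiffJ (dT w)) (mdiffN (dT w))).
  - by rewrite (mpartB t (mdiffJ (dT w)) (dT w)) (mpartJ t (dT w)) !T' AJ subrr.
have Ts z : mpart s T z = - B z by rewrite T' /A eqxx.
have Tns z : mpart (~~ s) T z = - B' z by rewrite T' /A; case: (s).
(* The two defects satisfy a linear system in the direction -s. *)
pose X (b : bool) z := if b then (T z *m P z)^t* else (1%:M - T z) *m B z.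
have nP2 : msm setT 2 P := msm_le (isT : 2 <= 4)%N nP4.
have ndP2 t : msm setT 2 (mpart t P) := msm_le (isT : 2 <= 3)%N (ndP t).
have nT2 : msm setT 2 T := msm_le (isT : 2 <= 4)%N nT.
have nB : msm setT 2 (fun z => B z) := msmM openT (ndP2 s) nP2.
have nX b : msm setT 2 (X b).
  case: b; first exact: (msmJ openT (msmM openT nT2 nP2)).
  exact: (msmM openT (msmB openT (msm_cst _ _ _) nT2) nB).
have X0 b z : X b z = 0.
  move: b z; apply: (matrix_uc (s := ~~ s) (z0 := z0) (r0 := r) nX) => // [b|b z Sz]; last first.
    have [_ _ TP TB _] := H1 z Sz; rewrite /X TT1 //; case: b; first by rewrite TP adj0.
    by rewrite mulmxBl mul1mx TB subrr.
  have m1T w : mdiff (fun x => 1%:M - T x) w := mdiffD (mdiff_cst _ _) (mdiffN (dT w)).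
  case: b.
  - apply: (@mlin_eq _ _ _ _ _ _ (fun z => - (X false z)^t* + mpart (~~ s) P z *m X true z)).
      move=> z; rewrite /X (mpartJ _ (mdiffM (dT z) (dP z))) negbK.
      have -> : mpart s (fun x => T x *m P x) z =
          - ((1%:M - T z) *m B z) + (T z *m P z) *m mpart s P z.
        rewrite (mpartM s (dT z) (dP z)) Ts -{2}(proj_d s (dP z) PP) mulmxDr mulNmx.
        rewrite -[B z *m P z]mulmxA PP mulmxBl mul1mx opprB addrA [T z *m (P z *m _)]mulmxA.
        by congr (_ + _); rewrite addrC.
      by rewrite adjD adjN (adjM (T z *m P z)) (adj_d s (dP z) PJ).
    apply: mlinD; first by apply: mlinN; apply: mlinJ; exact: (mlin_entries X false).
    exact: (mlinMl (ndP2 _) (mlin_entries X true)).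
  - apply: (@mlin_eq _ _ _ _ _ _ (fun z => X false z *m mpart (~~ s) P z +
        (X true z)^t* *m (mpart (~~ s) P z *m B z))).
      move=> z; rewrite /X adjK (mpartM _ (m1T z) (mdiffM (ddP s z) (dP z))).
      rewrite (mpartB _ (mdiff_cst _ _) (dT z)) mpart_cst sub0r Tns opprK dB2.
      have e : mpart (~~ s) P z *m B z = P z *m (mpart (~~ s) P z *m B z).
        rewrite -{1}(proj_d (~~ s) (dP z) PP) mulmxDl -[_ *m P z *m B z]mulmxA PB mulmx0 add0r.
        by rewrite -mulmxA.
      rewrite -[B' z *m B z]mulmxA -e mulmxBr -[T z *m P z *m _]mulmxA -e.
      rewrite [(1%:M - T z) *m (mpart _ _ _ *m B z)]mulmxBl mul1mx opprB addrCA.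
      by rewrite [mpart _ _ _ *m B z + _]addrC subrK; congr (_ + _); exact: mulmxA.
    apply: mlinD; first exact: (mlinMr (ndP2 _) (mlin_entries X false)).
    exact: (mlinMr (msmM openT (ndP2 _) nB) (mlinJ (mlin_entries X true))).
have TP z : T z *m P z = 0.
  by rewrite -[T z *m P z]adjK -[(T z *m P z)^t*]/(X true z) X0 adj0.
have TB z : T z *m B z = B z.
  by have /eqP := X0 false z; rewrite /X mulmxBl mul1mx subr_eq0 => /eqP.
have PT z : P z *m T z = 0 by rewrite -(PJ z) -(TJ z) -adjM TP adj0.
have BT z : B z *m T z = 0 by rewrite -mulmxA PT mulmx0.
(* T T - T has zero gradient by the two identities, and vanishes at z0. *)
have TT z : T z *m T z = T z.
  apply/subr0_eq; rewrite (mgradient0 (X := fun x => T x *m T x - T x) _ _ z z0) => [|w|t w].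
  - by rewrite Tz0 idem1 subrr.
  - exact: (mdiffD (mdiffM (dT w) (dT w)) (mdiffN (dT w))).
  rewrite (mpartB t (mdiffM (dT w) (dT w)) (dT w)) (mpartM t (dT w) (dT w)).
  have [->|ts] := eqVneq t s.
    by rewrite Ts mulNmx BT oppr0 add0r mulmxN TB subrr.
  have -> : t = ~~ s by case: (t) (s) ts => [] [].
  have B'T : B' w *m T w = B' w by rewrite -BJ -{1}(TJ w) -adjM TB.
  by rewrite Tns mulmxN mulmxA TP mul0mx oppr0 addr0 mulNmx B'T subrr.
by exists T; split.
Qed.

End GlobalPotential.

(** * Generic points *)

Section Generic.
Variables (R : realType) (n : nat).
Local Notation C := R[i].
Implicit Types (z w : plane R) (T P : plane R -> 'M[C]_n) (e : 'cV[C]_n).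

Lemma open_dense_finite (F : nat -> set (plane R)) r :
  (forall k, (k < r)%N -> open (F k) /\ dense (F k)) ->
  open [set z | forall k, (k < r)%N -> F k z] /\ dense [set z | forall k, (k < r)%N -> F k z].
Proof.
elim: r => [|r IH] H.
  rewrite (_ : [set z | _] = setT); last by apply/seteqP; split.
  by split=> [|O O0 _]; [exact: openT|rewrite setIT].
have [oI dI] := IH (fun k kr => H k (ltnW kr)).
have [oF dF] := H r (ltnSn r).
rewrite (_ : [set z | _] = [set z | forall k, (k < r)%N -> F k z] `&` F r).
  by split; [exact: openI|exact: denseI].
apply/seteqP; split=> z /= => [Hz|[Hz Fz] k].
  by split=> [k kr|]; apply: Hz => //; exact: ltnW.
by rewrite ltnS leq_eqVlt => /orP[/eqP->//|/Hz].
Qed.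

Lemma open_neq0 m p (X : plane R -> 'M[C]_(m, p)) : msm setT 1 X -> open [set z | X z != 0].
Proof.
move=> nX; rewrite openE => z /= Xz.
have nt := csm_tr openT (msmM openT nX (msmJ openT nX)).
have tz : \tr (X z *m (X z)^t*) != 0 by apply: contra_neq Xz; exact: tr_normsq_eq0.
have [D [oO Oz _ HO]] := csm_neq0_near openT Logic.I nt tz.
by apply: (near_open oO Oz) => w /HO; apply: contra_neq => ->; rewrite mul0mx mxtrace0.
Qed.

Lemma open_dense_neq0 m p (X : plane R -> 'M[C]_(m, p)) : msm setT 1 X ->
  (forall z0 r, 0 < r -> ~ (forall z, sq z0 r z -> X z = 0)) ->
  open [set z | X z != 0] /\ dense [set z | X z != 0].
Proof.
move=> nX H; split; first exact: open_neq0.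
move=> O [z Oz] oO; have [r r0 sO] := open_sqP oO Oz.
apply: contrapT => nE; apply: (H z r r0) => w Sw; apply/eqP; apply: contrapT => /negP Xw.
by apply: nE; exists w; split; [exact: sO|].
Qed.

(** The matrix e e^t* turns the vector e into the constant matrix that
    pot_kill asks for. *)
Lemma nonvanishing_generic s T P e : potential s T P 2 -> e^t* *m e = 1%:M ->
  (exists z, P z *m e != 0) -> open (nonvanishing P e) /\ dense (nonvanishing P e).
Proof.
move=> pot ee [z1 /eqP P1].
apply: (open_dense_neq0 (X := fun z => P z *m e)) => [|z0 r r0 H].
  exact: (msmM openT (msm_le (isT : 1 <= 2)%N (pot_P pot)) (msm_cst _ _ _)).
have /(pot_kill pot r0)/(_ z1) K : forall z, sq z0 r z -> P z *m (e *m e^t*) = 0.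
  by move=> z /H; rewrite mulmxA => ->; rewrite mul0mx.
by apply: P1; rewrite -[e in LHS]mulmx1 -ee [e *m _]mulmxA mulmxA K mul0mx.
Qed.

Lemma level_generic s T P : potential s T P 2 -> ~ (forall z, mpart s P z *m P z = 0) ->
  open [set z | mpart s P z *m P z != 0] /\ dense [set z | mpart s P z *m P z != 0].
Proof.
move=> pot nB; apply: (open_dense_neq0 (X := fun z => mpart s P z *m P z)) => [|z0 r r0 H].
  exact: (msmM openT (msm_mpart s openT (pot_P pot)) (msm_le (isT : 1 <= 2)%N (pot_P pot))).
by apply: nB; exact: (pot_uc pot r0 H).
Qed.

End Generic.

Lemma generic_dimE (F : fieldType) (V : vectType F) (T : Type) (D : set T) (W : T -> {vspace V}) b z :
  (forall x, D x -> (\dim (W x) <= b)%N) -> D z -> \dim (W z) = b -> generic_dim D W = b.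
Proof.
move=> H Dz Wz; apply/eqP; rewrite eqn_leq; apply/andP; split.
  by apply/bigmax_leqP => i /asboolP[x Dx <-]; exact: H.
have bd : (b < (\dim {:V}).+1)%N by rewrite ltnS -Wz dimvS // subvf.
apply: (leq_trans _ (leq_bigmax_cond (Ordinal bd) _)) => //=.
by apply/asboolP; exists z.
Qed.

(** * The spaces spanned by covariant derivatives *)

Section CovariantSpan.
Variables (R : realType) (n : nat) (s : bool).
Local Notation C := R[i].
Variables (T P : plane R -> 'M[C]_n) (e : 'cV[C]_n) (r : nat).
Local Notation Pk k := (iter k (ladder s) P).
Hypothesis pot : forall k, (k <= r)%N -> potential s (partial_sum s T P k) (Pk k) 2.
Hypothesis Br : forall z, mpart s (Pk r) z *m Pk r z = 0.

(** The last step has B = 0, and the ladder of the zero function is zero. *)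
Lemma ladder_stop k : (r < k)%N -> Pk k = fun=> 0.
Proof.
move=> rk; rewrite -(subnK rk) iterD iterS (_ : ladder s _ = fun=> 0) ?ladder_zero //.
by apply/funext => z; exact: (ladder0 (pot (leqnn r)) Br).
Qed.

Variables (a b : nat).
Hypothesis a1 : (a <= 1)%N.
Hypothesis ab : (a + b)%N = r.+1.
Local Notation W z := (span_seq (fun k => iter (a + k) (covder s P e) P z *m e)).

Let prank z k : (a <= k < a + b)%N -> rank1_projector (Pk k z).
Proof. by rewrite ab ltnS => /andP[_ /pot/pot_rank1/(_ z)]. Qed.

Let yp z k : nonvanishing P e z -> (a <= k)%N -> iter k (covder s P e) P z *m e =
  \sum_(a <= j < a + b) Pk j z *m (iter k (covder s P e) P z *m e).
Proof.
move=> Dz; rewrite ab; case: a a1 => [|[|//]] _ ak; first exact: (y_span0 pot Br).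
exact: (y_span1 pot Br).
Qed.

Lemma covspan_dim_le z : nonvanishing P e z -> (\dim (W z) <= b)%N.
Proof.
move=> Dz; apply: (dim_span_le (y := fun k => iter k (covder s P e) P z *m e) (prank z)).
  by move=> k; exact: yp.
exact: span_seqP.
Qed.

(** At such points the generic dimension is attained, so this is also what
    identifies the number of nonzero steps with the dimension. *)
Lemma covspan_basis z : nonvanishing P e z ->
  (forall k, (k < r)%N -> mpart s (Pk k) z *m Pk k z != 0) ->
  [/\ \dim (W z) = b, images_basis (W z) (fun k => Pk k z) (iota a b) &
      forall k, (a <= k)%N -> projects_into (Pk k z) (W z)].
Proof.
move=> Dz Bz; pose y k := iter k (covder s P e) P z *m e.
have pr : forall k, (a <= k < a + b)%N -> rank1_projector (Pk k z) := prank z.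
have yz k : (a <= k)%N -> y k = \sum_(a <= j < a + b) Pk j z *m y k by exact: yp.
have Wz v : v \in W z <-> exists k, v \in <<mkseq (fun k => y (a + k)%N) k>>%VS.
  exact: span_seqP.
have py j k : (a <= k < j)%N -> (j < a + b)%N -> Pk j z *m y k = 0.
  by rewrite ab ltnS => /andP[_ kj] jr; exact: (y_below pot).
have ny k : (a <= k < a + b)%N -> Pk k z *m y k != 0.
  by rewrite ab ltnS => /andP[_ kr]; exact: (y_diag pot).
split; [exact: (dim_span_eq pr yz Wz py ny)|exact: (triangular_basis pr yz Wz py ny)|].
move=> k ak; have [kr|rk] := leqP k r; last by move=> v; rewrite ladder_stop // mul0mx mem0v.
by apply: (triangular_projects pr yz Wz py ny); rewrite ak ab ltnS.
Qed.

End CovariantSpan.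

(** * Solutions on the sphere *)

Section Sphere.
Variables (R : realType) (N : nat).
Local Notation C := R[i].
Implicit Types (X : plane R -> 'M[C]_N) (w : plane R).

Lemma chart_inv w : w != 0 -> chart_infty w = Some (inv w).
Proof. by move=> /negbTE w0; rewrite /chart_infty w0 /inv cplxE. Qed.

Lemma mxndifferentiable_msm k X : mxndifferentiable k X -> msm setT k X.
Proof. by move=> H i j; have [/ndifferentiableE ? /ndifferentiableE ?] := H i j. Qed.

(** The regularity argument takes four derivatives. These are there when the
    size is at least two, and in size one the projector is constant. *)
Lemma rank1_smooth X : (forall z, rank1_projector (X z)) -> msm setT N.+2 X ->
  msm setT (maxn 4 N.+2) X.
Proof.
case: N X => [|[|k]] X rX nX; last by rewrite (maxn_idPr _).
  by have [_ _] := rX 0; rewrite /mxtrace big_ord0 => /esym/eqP; rewrite oner_eq0.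
rewrite (_ : X = fun=> 1%:M); first exact: msm_cst.
apply/funext => z; have [_ _] := rX z.
by rewrite [X z]mx11_scalar mxtrace_scalar mulr1n => ->.
Qed.

(** If the point is the one at infinity, continuity in the coordinate there
    provides a finite one. *)
Lemma finite_point (Phat : sphere R -> 'M[C]_N) (e : 'cV[C]_N) :
  msm setT 1 (fun w => Phat (chart_infty w)) -> (exists z, Phat z *m e != 0) ->
  exists z : plane R, Phat (Some z) *m e != 0.
Proof.
move=> nQ [[z|] Pz]; first by exists z.
have o := open_neq0 (msmM openT nQ (msm_cst _ _ e)).
have Q0 : [set w : plane R | Phat (chart_infty w) *m e != 0] 0 by rewrite /= /chart_infty eqxx.
have [r r0 sO] := open_sqP o Q0.
pose w : plane R := (r / 2, 0).
have w0 : w != 0 by apply/eqP => -[h]; move: r0; lra.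
have Sw : sq 0 r w by split; rewrite /= !subr0 ?normr0 ?gtr0_norm; lra.
by exists (inv w); have := sO w Sw; rewrite /= chart_inv.
Qed.

End Sphere.

(** * The theorem *)

Theorem lemma3 (R : realType) (N : nat) (Phat : sphere R -> 'M[R[i]]_N)
    (e : 'cV[R[i]]_N) (n m : nat)
    (P := fun z : plane R => Phat (Some z)) :
  (forall z : sphere R, rank1_projector (Phat z)) ->
  sphere_ndifferentiable N.+2 Phat ->
  euler_lagrange P ->
  (action P < +oo)%E ->
  e ^t* *m e = 1%:M ->
  (exists z : sphere R, Phat z *m e != 0) ->
  generic_dim (nonvanishing P e) (spaceH P e) = n.+1 ->
  generic_dim (nonvanishing P e) (spaceHperp P e) = m ->
  exists U : set (plane R),
    [/\ open U, dense U, U `<=` nonvanishing P e &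
      forall z, U z ->
        [/\ forall k, projects_into (iter k (ladder true) P z) (spaceH P e z),
            forall k, (1 <= k)%N ->
              projects_into (iter k (ladder false) P z) (spaceHperp P e z),
            images_basis (spaceH P e z) (fun k => iter k (ladder true) P z)
              (iota 0 n.+1) &
            images_basis (spaceHperp P e z) (fun k => iter k (ladder false) P z)
              (iota 1 m)]].
Proof.
move=> rP [/mxndifferentiable_msm nP /mxndifferentiable_msm nQ] EL _ ee Pe dimH dimHp.
have nP' : msm setT (maxn 4 N.+2) P := rank1_smooth (fun z => rP (Some z)) nP.
have nQ' : msm setT (maxn 4 N.+2) (fun w => Phat (chart_infty w)) := rank1_smooth (fun w => rP (chart_infty w)) nQ.
have PQ w : w != 0 -> Phat (chart_infty w) = P (inv w) by move=> w0; rewrite chart_inv.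
have EL' z : P z *m mpart true (mpart false P) z = mpart true (mpart false P) z *m P z.
  have := EL z; rewrite !mpart_mx (mpartC _ _ openT (Logic.I : setT z)); last exact: msm_le nP.
  by move/subr0_eq.
have [T pot] := global_potential true nP' (fun z => rP (Some z)) EL' (leq_maxl _ _) (leq_maxr _ _) nQ' PQ.
have [r1 [pot1 B1 E1]] := ladder_chain pot.
have [r2 [pot2 B2 E2]] := ladder_chain (pot_dual pot).
have [oD dD] := nonvanishing_generic pot ee (finite_point (msm_le (isT : 1 <= N.+2)%N nQ) Pe).
have [oU dU] := open_dense_finite (fun k kr => level_generic (pot1 k (ltnW kr)) (B1 k kr)).
have [oV dV] := open_dense_finite (fun k kr => level_generic (pot2 k (ltnW kr)) (B2 k kr)).
set U := [set z | forall k, (k < r1)%N -> _] in oU dU.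
set V := [set z | forall k, (k < r2)%N -> _] in oV dV.
pose G := nonvanishing P e `&` U `&` V.
have dG : dense G by apply: denseI; [exact: openI|exact: denseI|].
have H1 z (Gz : G z) := covspan_basis pot1 E1 (leq0n 1) (erefl : (0 + r1.+1)%N = r1.+1) Gz.1.1 Gz.1.2.
have H2 z (Gz : G z) := covspan_basis pot2 E2 (leqnn 1) (erefl : (1 + r2)%N = r2.+1) Gz.1.1 Gz.2.
have [z0 [_ G0]] := dG setT (ex_intro _ 0 Logic.I) openT.
have nr : n.+1 = r1.+1.
  have [d _ _] := H1 z0 G0; rewrite -dimH; apply: (generic_dimE _ G0.1.1 d) => z Dz.
  exact: (covspan_dim_le pot1 E1 (leq0n 1) (erefl : (0 + r1.+1)%N = r1.+1) Dz).
have mr : m = r2.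
  have [d _ _] := H2 z0 G0; rewrite -dimHp; apply: (generic_dimE _ G0.1.1 d) => z Dz.
  exact: (covspan_dim_le pot2 E2 (leqnn 1) (erefl : (1 + r2)%N = r2.+1) Dz).
exists G; split=> // [|z [[//]]|z Gz]; first exact: openI (openI oD oU) oV.
have [_ bH pH] := H1 z Gz; have [_ bHp pHp] := H2 z Gz.
by rewrite nr mr; split=> // k; exact: pH.
Qed.
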